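(* The tilting sheaves in the category $\mathrm{coh}\text{-}\mathbb{X}(p,q)$ are in natural bijection with the triangulations of $A_{p,q}$: the assignment $\Gamma\mapsto\bigoplus_{\gamma\in\Gamma}\phi(\gamma)$ is a bijection from the set of triangulations of $A_{p,q}$ to the set of (isomorphism classes of multiplicity-free) tilting sheaves.
   Context: Sheaves. Let $\mathbf{k}$ be an algebraically closed field and $1\le p\le q$ integers. $\mathbb{L}(p,q)$ is the abelian group on generators $\vec{x}_1,\vec{x}_2$ with relation $p\vec{x}_1=q\vec{x}_2=:\vec{c}$. $S=\mathbf{k}[x_1,x_2]$ is $\mathbb{L}(p,q)$-graded with $\deg x_i=\vec{x}_i$. $\mathrm{coh}\text{-}\mathbb{X}(p,q)$ is the quotient of the category of finitely generated $\mathbb{L}(p,q)$-graded $S$-modules by the Serre subcategory of finite dimensional modules; $\mathcal{O}$ is the image of $S$, and $\mathcal{O}(\vec{x})$ its grading shifts. The indecomposable vector bundles are the line bundles $\mathcal{O}(\vec{x})$; $S_{\infty,i}^{(j)}$ ($i\in\mathbb{Z}/p$), resp. $S_{0,i}^{(j)}$ ($i\in\mathbb{Z}/q$), is the uniserial torsion sheaf of length $j\ge1$ with top $S_{\infty,i}=\mathrm{coker}(x_1:\mathcal{O}((i-1)\vec{x}_1)\to\mathcal{O}(i\vec{x}_1))$, resp. $S_{0,i}=\mathrm{coker}(x_2:\mathcal{O}((i-1)\vec{x}_2)\to\mathcal{O}(i\vec{x}_2))$. A sheaf $T$ is tilting if $\mathrm{Ext}^1(T,T)=0$ and $\mathrm{Hom}(T,X)=0=\mathrm{Ext}^1(T,X)$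 implies $X=0$. Annulus. Let $\mathbb{U}=\mathbb{R}\times[0,1]$ and $\pi:\mathbb{U}\to A_{p,q}$ the quotient by $(x,y)\sim(x+1,y)$; $y=1$ covers the inner boundary $\partial$, $y=0$ the outer boundary $\partial'$; the marked points are the images of $(\tfrac{i}{p},1)$ and $(\tfrac{j}{q},0)$, $i,j\in\mathbb{Z}$. Let $[D^{i/p}_{j/q}]$ be the homotopy class of the image in $A_{p,q}$ of the oriented arc in $\mathbb{U}$ from $(\tfrac{j}{q},0)$ to $(\tfrac{i}{p},1)$ (bridging), and for $j-i\ge2$ let $[D^{i/p,j/p}]$, $[D_{i/q,j/q}]$ be those of the arcs from $(\tfrac{i}{p},1)$ to $(\tfrac{j}{p},1)$ and from $(\tfrac{i}{q},0)$ to $(\tfrac{j}{q},0)$ (peripheral), with interiors in the interior of $\mathbb{U}$. Such a class is an arc of $A_{p,q}$ if it has a representative without self-intersection in the interior of $A_{p,q}$. A triangulation of $A_{p,q}$ is a maximal collection of (homotopy classes of) arcs that do not intersect in the interior of $A_{p,q}$; its arcs are always taken with the orientations of $[D^{i/p}_{j/q}]$, $[D^{i/p,j/p}]$ and $[D_{i/q,j/q}]$, i.e. bridging arcs are oriented from the outer boundary to the inner boundary, and peripheral arcs are oriented so that their lifts to $\mathbb{U}$ go from the endpoint with smaller $x$-coordinate to the endpoint with larger $x$-coordinate. $\phi$ is defined by $[D^{i/p}_{j/q}]\mapsto\mathcal{O}(i\vec{x}_1-j\vec{x}_2)$, $[D^{(i-j-1)/p,\,i/p}]\mapsto S_{\infty,i}^{(j)}$,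 $[D_{-i/q,\,(j-i+1)/q}]\mapsto S_{0,i}^{(j)}$ ($j\geq 1$ in the last two). *)

(* Defs.v *)
From HB Require Import structures.
From mathcomp Require Import all_boot all_order all_algebra.
From mathcomp Require Import all_classical all_reals all_analysis.
From mathcomp Require mpoly.
(* mpoly's notations clash with those of mathcomp-analysis; only its structures
   are imported, and its constants are written qualified. *)
Import (canonicals, coercions) mpoly.
Import Order.TTheory GRing.Theory Num.Theory numFieldNormedType.Exports.

Set Implicit Arguments.
Unset Strict Implicit.
Unset Printing Implicit Defensive.

Local Open Scope classical_set_scope.
Local Open Scope ring_scope.
Local Open Scope quotient_scope.

(* L(p,q) = Z^2 / <(p, -q)>. *)
Definition Lrel (p q : nat) : {pred int * int} :=
  fun z => `[< exists n : int, z = (n * p%:Z, - (n * q%:Z)) >].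

Lemma Lrel_zmod_closed (p q : nat) : zmod_closed (Lrel p q).
Proof.
split=> [|x y /asboolP[n ->] /asboolP[m ->]]; apply/asboolP.
  by exists 0; rewrite !mul0r oppr0.
by exists (n - m); congr (_, _); rewrite /= mulrBl // opprB opprK addrC.
Qed.

HB.instance Definition _ (p q : nat) :=
  GRing.isZmodClosed.Build (int * int)%type (Lrel p q) (Lrel_zmod_closed p q).

Definition Lpq (p q : nat) : zmodType := Quotient.quot (Lrel p q).

(* The generators: vx 0 is x_1 and vx 1 is x_2. *)
Definition vx (p q : nat) (i : 'I_2) : Lpq p q :=
  \pi_(Quotient.quot (Lrel p q))
     (if i == ord0 then (1, 0) else (0, 1) : int * int).

Notation Spol k := (mpoly.mpoly 2 k).

Section Sheaves.
Variables (k : closedFieldType) (p q : nat).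
Local Notation S := (Spol k).
Local Notation L := (Lpq p q).
Local Notation vx := (@vx p q).

Definition mdegree (m : mpoly.multinom 2) : L := \sum_(i < 2) vx i *+ m i.

Definition Shom (x : L) : set S :=
  [set s | forall m, mpoly.mcoeff m s != 0 -> mdegree m = x].

Definition lcomb (M : lmodType S) (c : nat -> S) (e : seq M) : M :=
  \sum_(i < size e) c i *: e`_i.

(* Finitely generated L(p,q)-graded S-modules; ghom x is the homogeneous part
   of degree x. *)
Record grmod := GrMod {
  gcar :> lmodType S;
  ghom : L -> set gcar;
  ghom0 : forall x, ghom x 0;
  ghomB : forall x m m', ghom x m -> ghom x m' -> ghom x (m - m');
  ghomZ : forall x y s m, Shom y s -> ghom x m -> ghom (x + y) (s *: m);
  ghom_sum : forall m, exists (r : seq L) (f : L -> gcar),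
    [/\ uniq r, forall x, ghom x (f x) & m = \sum_(x <- r) f x];
  ghom_direct : forall (r : seq L) (f : L -> gcar),
    uniq r -> (forall x, ghom x (f x)) -> \sum_(x <- r) f x = 0 ->
    forall x, x \in r -> f x = 0;
  gfingen : exists e : seq gcar, forall m, exists c, m = lcomb c e
}.

Definition kspan (M : lmodType S) (e : seq M) : set M :=
  [set m | exists c : nat -> k, m = lcomb (fun i => mpoly.mpolyC 2 (c i)) e].

(* V has finite dimension over k. *)
Definition fdim (M : lmodType S) (V : set M) : Prop :=
  exists e : seq M, V `<=` kspan e.

(* M / V has finite dimension over k. *)
Definition cofdim (M : lmodType S) (V : set M) : Prop :=
  exists e : seq M, forall m, exists2 u, kspan e u & V (m - u).

Definition gsub (M : grmod) (V : set M) : Prop :=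
  [/\ V 0,
      forall a m m', V m -> V m' -> V (a *: m + m')
    & forall (r : seq L) (f : L -> M), uniq r -> (forall x, ghom x (f x)) ->
        V (\sum_(x <- r) f x) -> forall x, x \in r -> V (f x)].

Lemma lcomb_cons (M : lmodType S) c a (e : seq M) :
  lcomb c (a :: e) = c 0%N *: a + lcomb (fun i => c i.+1) e.
Proof. by rewrite /lcomb /= big_ord_recl. Qed.

Lemma lcomb_cat (M : lmodType S) c (e1 e2 : seq M) :
  lcomb c (e1 ++ e2) = lcomb c e1 + lcomb (fun i => c (size e1 + i)%N) e2.
Proof.
elim: e1 c => [|a e1 IH] c /=; first by rewrite /lcomb big_ord0 add0r.
by rewrite !lcomb_cons IH addrA.
Qed.

Lemma lcomb_cat_ex (M : lmodType S) c1 c2 (e1 e2 : seq M) :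
  lcomb c1 e1 + lcomb c2 e2 =
  lcomb (fun i => if (i < size e1)%N then c1 i else c2 (i - size e1)%N)
        (e1 ++ e2).
Proof.
rewrite lcomb_cat; congr (_ + _); apply: eq_bigr => i _.
  by rewrite ltn_ord.
by rewrite ltnNge leq_addr /= addKn.
Qed.

Lemma lcomb_map (M N : lmodType S) (h : M -> N) c (e : seq M) :
  linear h -> lcomb c (map h e) = h (lcomb c e).
Proof.
move=> hl; have h0 : h 0 = 0.
  by have := hl (-1) 0 0; rewrite scaler0 addr0 scaleN1r addNr.
elim: e c => [|a e IH] c /=; first by rewrite /lcomb !big_ord0 h0.
by rewrite !lcomb_cons IH hl.
Qed.

Lemma big_extend (V : zmodType) (r r' : seq L) (f : L -> V) :
  uniq r -> uniq r' -> {subset r <= r'} ->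
  \sum_(x <- r) f x = \sum_(x <- r') (if x \in r then f x else 0).
Proof.
move=> ur ur' sub; rewrite -big_mkcond -big_filter; apply: perm_big.
apply: uniq_perm => // [|x]; first exact: filter_uniq.
by rewrite mem_filter; case xr: (x \in r) => //=; rewrite sub.
Qed.

Lemma ghom_if (M : grmod) (r : seq L) (f : L -> M) :
  (forall x, ghom x (f x)) -> forall x, ghom x (if x \in r then f x else 0).
Proof. by move=> hf x; case: ifP => // _; exact: ghom0. Qed.

Lemma pair_sum (M N : lmodType S) (r : seq L) (f : L -> (M * N)%type) :
  \sum_(x <- r) f x = (\sum_(x <- r) (f x).1, \sum_(x <- r) (f x).2).
Proof.
elim: r => [|x r IH]; first by rewrite !big_nil.
by rewrite !big_cons IH.
Qed.

Section Dsum.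
Variables M N : grmod.
Let T : lmodType S := (M * N)%type.
Definition dsum_hom (x : L) : set T := [set u | ghom x u.1 /\ ghom x u.2].

Lemma dsum_sum (m : T) : exists (r : seq L) (f : L -> T),
  [/\ uniq r, forall x, dsum_hom x (f x) & m = \sum_(x <- r) f x].
Proof.
have [r [f [ur hf ef]]] := ghom_sum m.1.
have [r' [f' [ur' hf' ef']]] := ghom_sum m.2.
exists (undup (r ++ r')),
  (fun x => (if x \in r then f x else 0, if x \in r' then f' x else 0)).
split; first exact: undup_uniq.
  by move=> x; split; exact: ghom_if.
rewrite pair_sum /= -!big_extend ?undup_uniq //; first by case: m ef ef' => a b /= -> ->.
  by move=> x xr; rewrite mem_undup mem_cat xr orbT.
by move=> x xr; rewrite mem_undup mem_cat xr.
Qed.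

Lemma dsum_direct (r : seq L) (f : L -> T) :
  uniq r -> (forall x, dsum_hom x (f x)) -> \sum_(x <- r) f x = 0 ->
  forall x, x \in r -> f x = 0.
Proof.
move=> ur hf; rewrite pair_sum => -[e1 e2] x xr.
have a1 := ghom_direct ur (fun y => (hf y).1) e1 xr.
have a2 := ghom_direct ur (fun y => (hf y).2) e2 xr.
by case: (f x) a1 a2 => a b /= -> ->.
Qed.

Lemma dsum_fingen : exists e : seq T, forall m, exists c, m = lcomb c e.
Proof.
have [e1 h1] := gfingen M; have [e2 h2] := gfingen N.
exists (map (fun a => (a, 0)) e1 ++ map (fun b => (0, b)) e2) => -[a b].
have [c1 ea] := h1 a; have [c2 eb] := h2 b.
eexists; apply: etrans (lcomb_cat_ex c1 c2 _ _); rewrite !lcomb_map.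
- rewrite -ea -eb; congr (_, _); rewrite ?addr0 ?add0r //.
- by move=> s u v; apply/pair_equal_spec; split; rewrite /= ?scaler0 ?addr0.
- by move=> s u v; apply/pair_equal_spec; split; rewrite /= ?scaler0 ?addr0.
Qed.

Definition dsum : grmod.
Proof.
refine (@GrMod T dsum_hom _ _ _ dsum_sum dsum_direct dsum_fingen).
- by move=> x; split; exact: ghom0.
- by move=> x m m' [a b] [a' b']; split; exact: ghomB.
- by move=> x y s m hs [a b]; split; exact: ghomZ.
Defined.
End Dsum.

Definition gzero : grmod.
Proof.
refine (@GrMod ('rV[S]_0 : lmodType S) (fun=> setT) _ _ _ _ _ _) => //.
- by move=> m; exists [::], (fun=> 0); split=> //; rewrite thinmx0 big_nil.
- by move=> r f _ _ _ x _; rewrite thinmx0.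
- by exists [::] => m; exists (fun=> 0); rewrite thinmx0 [RHS]thinmx0.
Defined.

(* O(y) = S(y), with S(y)_x = S_(x + y). *)
Section LineBundle.
Variable y : L.
Let T : lmodType S := S^o.
Definition Ohom (x : L) : set T := Shom (x + y).

Lemma Shom0 x : Shom x 0.
Proof. by move=> m; rewrite mpoly.mcoeff0 eqxx. Qed.

Lemma ShomB x s t : Shom x s -> Shom x t -> Shom x (s - t).
Proof.
move=> hs ht m; rewrite mpoly.mcoeffB => h.
case: (eqVneq (mpoly.mcoeff m s) 0) => [e|]; last exact: hs.
by apply: ht; apply: contraNneq h => e'; rewrite e e' subrr.
Qed.

Lemma mdegreeD m1 m2 :
  mdegree (mpoly.mnm_add m1 m2) = mdegree m1 + mdegree m2.
Proof.
by rewrite /mdegree -big_split; apply: eq_bigr => i _; rewrite mpoly.mnmDE mulrnDr.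
Qed.

Lemma ShomM x x' s t : Shom x s -> Shom x' t -> Shom (x + x') (s * t).
Proof.
move=> hs ht m; rewrite -mpoly.mcoeff_msupp => /mpoly.msuppM_le /allpairsP.
case=> -[m1 m2] /= [h1 h2 ->]; rewrite mdegreeD.
by rewrite (hs m1) ?(ht m2) // -mpoly.mcoeff_msupp.
Qed.

Lemma Shom_comp s (x : L) :
  Shom x (\sum_(m <- mpoly.msupp s | mdegree m == x)
      mpoly.mcoeff m s *: mpoly.mpolyX k m).
Proof.
move=> m; rewrite raddf_sum /= => h; apply/eqP; apply: contraNT h => h.
rewrite big1 // => a /eqP ea; rewrite mpoly.mcoeffZ mpoly.mcoeffX.
by case: eqP => [eam|_]; rewrite ?mulr0 // -eam ea eqxx in h *.
Qed.

Lemma O_sum (m : T) : exists (r : seq L) (f : L -> T),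
  [/\ uniq r, forall x, Ohom x (f x) & m = \sum_(x <- r) f x].
Proof.
exists (undup [seq mdegree a - y | a <- mpoly.msupp m]).
exists (fun x => \sum_(a <- mpoly.msupp m | mdegree a == x + y)
      mpoly.mcoeff a m *: mpoly.mpolyX k a).
split; first exact: undup_uniq.
  by move=> x; exact: Shom_comp.
rewrite (exchange_big_dep xpredT) //= [LHS](mpoly.mpolyE m).
rewrite big_seq [RHS]big_seq; apply: eq_bigr => a ha.
rewrite (eq_bigl (fun x => x == mdegree a - y)); last first.
  by move=> x; rewrite [RHS]eq_sym subr_eq.
rewrite -big_filter (filter_pred1_uniq (undup_uniq _)) ?big_seq1 //.
by rewrite mem_undup; exact: (map_f (fun b => mdegree b - y)).
Qed.

Lemma O_direct (r : seq L) (f : L -> T) :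
  uniq r -> (forall x, Ohom x (f x)) -> \sum_(x <- r) f x = 0 ->
  forall x, x \in r -> f x = 0.
Proof.
move=> ur hf e x xr; apply/mpoly.mpolyP => m; rewrite mpoly.mcoeff0.
case: (eqVneq (mpoly.mcoeff m (f x)) 0) => // nz.
have := congr1 (mpoly.mcoeff m) e; rewrite mpoly.mcoeff0 raddf_sum /=.
rewrite (bigD1_seq x) //= big1 ?addr0 // => z zx.
apply/eqP; apply: contraNT zx => nz'.
by apply/eqP/(addIr y); rewrite -(hf x m nz) (hf z m nz').
Qed.

Definition O : grmod.
Proof.
refine (@GrMod T Ohom (fun x => @Shom0 _) (fun x => @ShomB _) _
          O_sum O_direct _).
- by move=> x z s m hs hm; rewrite /Ohom addrAC addrC; exact: ShomM.
- exists [:: 1] => m; exists (fun=> m).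
  by rewrite /lcomb big_ord1 /= /GRing.scale /= mulr1.
Defined.
End LineBundle.

(* Morphisms of the quotient category: Hom(M, N) is the colimit of
   Hom_S(M', N/N') over the graded submodules M' of M and N' of N with M/M' and
   N' finite dimensional.  A representative f : M' -> N/N' is given by its graph
   {(m, n) | m in M', n in f(m)} in M (+) N, from which M' and N' are recovered
   as {m | exists n, (m, n) in the graph} and {n | (0, n) in the graph}. *)
Definition is_qgraph (M N : grmod) (G : set (dsum M N)) : Prop :=
  [/\ gsub G,
      cofdim [set m : M | exists n, G (m, n)]
    & fdim [set n : N | G (0, n)]].

Record qhom (M N : grmod) := QHom {
  graph : set (dsum M N);
  graphP : is_qgraph graph
}.

(* Equality in the colimit: f and g induce the same map M'' -> N/N'' for some
   smaller M'' and larger N''; the last clause at m = 0 gives N' <= N''. *)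
Definition qeq (M N : grmod) (f g : qhom M N) : Prop :=
  exists (M'' : set M) (N'' : set N),
    [/\ gsub M'' /\ cofdim M'', gsub N'' /\ fdim N'',
        forall m, M'' m -> (exists n, graph f (m, n)) /\ (exists n, graph g (m, n))
      & forall m n1 n2, M'' m -> graph f (m, n1) -> graph g (m, n2) ->
          N'' (n1 - n2)].

Lemma kspan0 (M : lmodType S) (e : seq M) : kspan e 0.
Proof.
exists (fun=> 0); rewrite /lcomb big1 // => i _.
by rewrite mpoly.mpolyC0 scale0r.
Qed.

Lemma kspan_consP (M : lmodType S) a (e : seq M) m :
  kspan (a :: e) m <-> exists c w, kspan e w /\ m = mpoly.mpolyC 2 c *: a + w.
Proof.
split=> [[c ->]|[c [w [[d ->] ->]]]].
  exists (c 0%N), (lcomb (fun i => mpoly.mpolyC 2 (c i.+1)) e).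
  by rewrite lcomb_cons; split=> //; exists (fun i => c i.+1).
by exists (fun i => if i is j.+1 then d j else c); rewrite lcomb_cons.
Qed.

Lemma kspanP (M : lmodType S) (e : seq M) c m m' :
  kspan e m -> kspan e m' -> kspan e (mpoly.mpolyC 2 c *: m + m').
Proof.
elim: e m m' => [|a e IH] m m'.
  move=> [d ->] [d' ->]; rewrite /lcomb !big_ord0 scaler0 addr0.
  exact: kspan0.
move=> /kspan_consP[d [w [hw ->]]] /kspan_consP[d' [w' [hw' ->]]].
apply/kspan_consP; exists (c * d + d'), (mpoly.mpolyC 2 c *: w + w').
split; first exact: IH.
by rewrite scalerDr addrACA mpoly.mpolyCD scalerDl mpoly.mpolyCM scalerA.
Qed.

Lemma kspan_catl (M : lmodType S) (e1 e2 : seq M) u v :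
  kspan e1 u -> kspan e2 v -> kspan (e1 ++ e2) (u + v).
Proof.
elim: e1 u => [|a e1 IH] u; first by move=> [c ->]; rewrite /lcomb big_ord0 add0r.
move=> /kspan_consP[c [w [hw ->]]] hv; apply/kspan_consP.
by exists c, (w + v); split; [exact: IH|rewrite addrA].
Qed.

Lemma kspan_rel (M N : lmodType S) (T : set (M * N)%type) (e : seq M) :
  (forall c u v, T u -> T v -> T (mpoly.mpolyC 2 c *: u + v)) ->
  exists e' : seq N, forall m n, kspan e m -> T (m, n) ->
    exists n0, T (0, n0) /\ kspan e' (n - n0).
Proof.
move=> hT; elim: e => [|a e [e' IH]].
  exists [::] => m n [c ->]; rewrite /lcomb big_ord0 => h; exists n.
  by rewrite subrr; split=> //; exact: kspan0.
have [[c1 [w1 [n1 [nz hw1 T1]]]]|no] := pselect (exists c w n,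
    [/\ c != 0, kspan e w & T (mpoly.mpolyC 2 c *: a + w, n)]).
  exists (n1 :: e') => m n /kspan_consP[c [w [hw ->]]] h.
  pose d := - (c / c1).
  have h' : T (mpoly.mpolyC 2 d *: w1 + w, mpoly.mpolyC 2 d *: n1 + n).
    have := hT d _ _ T1 h; congr T; congr (_, _) => /=.
    rewrite scalerDr addrACA scalerA -mpoly.mpolyCM -scalerDl -mpoly.mpolyCD.
    by rewrite /d mulNr divfK // addNr mpoly.mpolyC0 scale0r add0r.
  have [n0 [Tn0 hn0]] := IH _ _ (kspanP d hw1 hw) h'.
  exists n0; split=> //; apply: (proj2 (kspan_consP _ _ _)).
  exists (- d), (mpoly.mpolyC 2 d *: n1 + n - n0); split=> //.
  by rewrite mpoly.mpolyCN scaleNr -addrA addKr.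
exists e' => m n /kspan_consP[c [w [hw ->]]] h.
have [c0|nz] := eqVneq c 0; last by case: no; exists c, w, n.
by apply: (IH w) => //; move: h; rewrite c0 mpoly.mpolyC0 scale0r add0r.
Qed.

(* f : M' -> N/N' followed by g : N'' -> P/P' is composed on the largest
   submodule of M' where this makes sense; on graphs this is the composition of
   relations. *)
Section Comp.
Variables (M N P : grmod) (g : qhom N P) (f : qhom M N).
Definition comp_graph : set (dsum M P) :=
  [set u | exists n, graph f (u.1, n) /\ graph g (n, u.2)].

Lemma comp_gsub : gsub comp_graph.
Proof.
have [[f0 fD fH] _ _] := graphP f; have [[g0 gD gH] _ _] := graphP g.
split; first by exists 0.
  move=> a u v [n [h1 h2]] [n' [h1' h2']]; exists (a *: n + n').
  by split; [exact: (fD a _ _ h1 h1')|exact: (gD a _ _ h2 h2')].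
move=> r h ur hh; rewrite pair_sum => -[n [h1 h2]] x xr.
have [r' [b [ur' hb en]]] := ghom_sum n; rewrite {n}en /= in h1 h2.
pose R := undup (r ++ r').
have uR : uniq R by exact: undup_uniq.
have sr : {subset r <= R} by move=> z zr; rewrite mem_undup mem_cat zr.
have sr' : {subset r' <= R} by move=> z zr; rewrite mem_undup mem_cat zr orbT.
pose b' z := if z \in r' then b z else 0.
pose h1' z := if z \in r then (h z).1 else 0.
pose h2' z := if z \in r then (h z).2 else 0.
have hb' z : ghom z (b' z) by exact: ghom_if.
have hh1 z : ghom z (h1' z).
  exact: (@ghom_if M r (fun t => (h t).1) (fun t => (hh t).1) z).
have hh2 z : ghom z (h2' z).
  exact: (@ghom_if P r (fun t => (h t).2) (fun t => (hh t).2) z).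
rewrite (big_extend _ ur uR sr) (big_extend b ur' uR sr') in h1.
rewrite (big_extend _ ur uR sr) (big_extend b ur' uR sr') in h2.
exists (b' x).
have := fH R (fun z => (h1' z, b' z)) uR (fun z => conj (hh1 z) (hb' z)).
rewrite pair_sum => /(_ h1 x (sr x xr)).
have := gH R (fun z => (b' z, h2' z)) uR (fun z => conj (hb' z) (hh2 z)).
rewrite pair_sum => /(_ h2 x (sr x xr)).
by rewrite /h1' /h2' xr.
Qed.

Lemma comp_cofdim : cofdim [set m : M | exists n, comp_graph (m, n)].
Proof.
have [[f0 fD _] [ef hf] _] := graphP f; have [[g0 gD _] [eg hg] _] := graphP g.
pose T : set (N * M)%type :=
  [set u | exists n, graph f (u.2, n) /\ exists t, graph g (n - u.1, t)].
have [|e' he'] := @kspan_rel _ _ T eg.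
  move=> c u v [n [h1 [t h2]]] [n' [h1' [t' h2']]].
  exists (mpoly.mpolyC 2 c *: n + n'); split; first exact: (fD _ _ _ h1 h1').
  exists (mpoly.mpolyC 2 c *: t + t').
  by have := gD (mpoly.mpolyC 2 c) _ _ h2 h2'; congr graph; congr (_, _);
    rewrite /= scalerBr addrACA -opprD.
exists (ef ++ e') => m; have [u hu [n hn]] := hf m.
have [w hw [t ht]] := hg n.
have [|m0 [[n0 [/= h1 [t0 h2]]] h3]] := he' w (m - u) hw.
  by exists n; split=> //; exists t.
exists (u + (m - u - m0)); first exact: kspan_catl.
exists t0, n0; rewrite subr0 in h2; split=> //=.
by rewrite addrA subrKC subKr.
Qed.

Lemma comp_fdim : fdim [set n : P | comp_graph (0, n)].
Proof.
have [[f0 fD _] _ [ef hf]] := graphP f; have [[g0 gD _] _ [eg hg]] := graphP g.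
pose T : set (N * P)%type := [set u | graph f (0, u.1) /\ graph g u].
have [|e' he'] := @kspan_rel _ _ T ef.
  move=> c u v [h1 h2] [h1' h2']; split; last exact: (gD _ _ _ h2 h2').
  by have := fD (mpoly.mpolyC 2 c) _ _ h1 h1'; congr graph; congr (_, _);
    rewrite /= scaler0 addr0.
exists (eg ++ e') => t [n [h1 h2]].
have [//|t0 [[_ h3] h4]] := he' n t (hf _ h1).
by rewrite -(subrKC t0 t); apply: kspan_catl => //; exact: hg.
Qed.

Definition qcomp : qhom M P :=
  @QHom M P comp_graph (And3 comp_gsub comp_cofdim comp_fdim).
End Comp.

(* The image in the quotient category of a homomorphism of graded modules. *)
Section Lin.
Variables (M N : grmod) (h : M -> N).
Hypotheses (h_lin : linear h) (h_hom : forall x m, ghom x m -> ghom x (h m)).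

Lemma lin_graphP : @is_qgraph M N [set u | u.2 = h u.1].
Proof.
have h0 : h 0 = 0.
  by have := h_lin (-1) 0 0; rewrite scaler0 addr0 scaleN1r addNr.
have hD : {morph h : u v / u + v}.
  by move=> u v; have := h_lin 1 u v; rewrite !scale1r.
have hN u : h (- u) = - h u.
  by have := h_lin (-1) u 0; rewrite !scaleN1r h0 !addr0.
split; first split.
- by rewrite /= h0.
- by move=> a u v /= -> ->; rewrite h_lin.
- move=> r f ur hf; rewrite pair_sum /= (big_morph h hD h0) => e x xr.
  apply/eqP; rewrite -subr_eq0; apply/eqP.
  apply: (ghom_direct (f := fun z => (f z).2 - h (f z).1) ur _ _ xr).
    by move=> z; have [a b] := hf z; apply: ghomB => //; exact: h_hom.
  by rewrite sumrB e subrr.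
- by exists [::] => m; exists 0; [exact: kspan0|exists (h (m - 0))].
- by exists [::] => n /= ->; rewrite h0; exact: kspan0.
Qed.

Definition qlin : qhom M N := QHom lin_graphP.
End Lin.

Definition qid (M : grmod) : qhom M M :=
  @qlin M M idfun (fun _ _ _ => erefl) (fun _ _ hm => hm).

Lemma zero_lin (M N : grmod) : linear (fun _ : M => 0 : N).
Proof. by move=> a u v; rewrite scaler0 addr0. Qed.

Definition qzero (M N : grmod) : qhom M N :=
  @qlin M N (fun=> 0) (@zero_lin M N) (fun x _ _ => ghom0 N x).

Definition qiso (M N : grmod) (f : qhom M N) : Prop :=
  exists g : qhom N M, qeq (qcomp g f) (qid M) /\ qeq (qcomp f g) (qid N).

Definition isomorphic (M N : grmod) : Prop := exists f : qhom M N, qiso f.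

Definition is_zero (M : grmod) : Prop := isomorphic M gzero.

Definition mono (M N : grmod) (f : qhom M N) : Prop :=
  forall Z (g h : qhom Z M), qeq (qcomp f g) (qcomp f h) -> qeq g h.

Definition epi (M N : grmod) (f : qhom M N) : Prop :=
  forall Z (g h : qhom N Z), qeq (qcomp g f) (qcomp h f) -> qeq g h.

Definition is_kernel (K M N : grmod) (i : qhom K M) (f : qhom M N) : Prop :=
  [/\ mono i, qeq (qcomp f i) (qzero K N)
    & forall Z (h : qhom Z M), qeq (qcomp f h) (qzero Z N) ->
        exists u : qhom Z K, qeq (qcomp i u) h].

Definition is_cokernel (M N C : grmod) (f : qhom M N) (c : qhom N C) : Prop :=
  [/\ epi c, qeq (qcomp c f) (qzero M C)
    & forall Z (h : qhom N Z), qeq (qcomp h f) (qzero M Z) ->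
        exists u : qhom C Z, qeq (qcomp u c) h].

Definition short_exact (A B C : grmod) (f : qhom A B) (g : qhom B C) : Prop :=
  is_kernel f g /\ is_cokernel f g.

Definition Hom_zero (A B : grmod) : Prop :=
  forall f : qhom A B, qeq f (qzero A B).

(* Ext^1(A, B) is the Yoneda Ext group of the extensions 0 -> B -> E -> A -> 0;
   it vanishes when all of them split. *)
Definition Ext1_zero (A B : grmod) : Prop :=
  forall E (f : qhom B E) (g : qhom E A), short_exact f g ->
    exists s : qhom A E, qeq (qcomp g s) (qid A).

Definition tilting (T : grmod) : Prop :=
  Ext1_zero T T /\
  forall X, Hom_zero T X -> Ext1_zero T X -> is_zero X.

Definition indecomposable (X : grmod) : Prop :=
  ~ is_zero X /\
  forall A B, isomorphic X (dsum A B) -> is_zero A \/ is_zero B.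

Definition dsum_seq (s : seq grmod) : grmod := \big[dsum/gzero]_(X <- s) X.

Definition multiplicity_free (T : grmod) : Prop :=
  exists s : seq grmod,
    [/\ forall i, (i < size s)%N -> indecomposable (nth gzero s i),
        forall i j, (i < j < size s)%N ->
          ~ isomorphic (nth gzero s i) (nth gzero s j)
      & isomorphic T (dsum_seq s)].

Definition simple_obj (X : grmod) : Prop :=
  ~ is_zero X /\
  forall U (u : qhom U X), mono u -> is_zero U \/ qiso u.

Fixpoint has_length (n : nat) (X : grmod) : Prop :=
  if n is n'.+1 then
    exists U V (f : qhom U X) (g : qhom X V),
      [/\ short_exact f g, simple_obj V & has_length n' U]
  else is_zero X.

Definition uniserial (X : grmod) : Prop :=
  forall U V (u : qhom U X) (v : qhom V X), mono u -> mono v ->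
    (exists w : qhom U V, qeq (qcomp v w) u) \/
    (exists w : qhom V U, qeq (qcomp u w) v).

(* Y = X / rad X: the kernel of t is the radical of X, that is, the
   intersection of the kernels of all morphisms from X to a simple object. *)
Definition is_top (X Y : grmod) : Prop :=
  exists t : qhom X Y, epi t /\
    forall Z (g : qhom Z X), qeq (qcomp t g) (qzero Z Y) <->
      forall W (h : qhom X W), simple_obj W -> qeq (qcomp h g) (qzero Z W).

Lemma mulX_lin (i : 'I_2) (y y' : L) :
  linear (fun s : O y => mpoly.mpolyX k (mpoly.mnm1 i) *: s : O y').
Proof. by move=> a u v; rewrite scalerDr !scalerA mulrC. Qed.

Lemma mulX_hom (i : 'I_2) (y : L) x (s : O (y - vx i)) :
  ghom x s -> @ghom (O y) x (mpoly.mpolyX k (mpoly.mnm1 i) *: s).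
Proof.
move=> hs; have hX : Shom (vx i) (mpoly.mpolyX k (mpoly.mnm1 i)).
  move=> m; rewrite mpoly.mcoeffX; case: (mpoly.mnm1 i =P m) => [<- _|_];
    last by rewrite eqxx.
  rewrite /mdegree (bigD1 i) //= mpoly.mnm1E eqxx mulr1n big1 ?addr0 // => j ji.
  by rewrite mpoly.mnm1E eq_sym (negbTE ji) mulr0n.
have := ShomM hX hs; rewrite /ghom /= /Ohom; congr Shom.
by rewrite addrC -addrA subrK.
Qed.

(* Multiplication by x_1 (i = 0) or x_2 (i = 1), from O(y - deg) to O(y). *)
Definition mulX (i : 'I_2) (y : L) : qhom (O (y - vx i)) (O y) :=
  qlin (@mulX_lin i _ _) (@mulX_hom i y).

(* With x = x_1 for b = 0 and x = x_2 for b = 1, X is the exceptional simple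
   sheaf coker(x : O((i - 1) deg x) -> O(i deg x)): S_(infinity, i) for b = 0
   and S_(0, i) for b = 1. *)
Definition is_exc_simple (b : 'I_2) (i : int) (X : grmod) : Prop :=
  exists c : qhom (O (vx b *~ i)) X, is_cokernel (mulX b (vx b *~ i)) c.

(* X is S_(infinity, i)^(j) (b = 0), or S_(0, i)^(j) (b = 1); having finite
   length, X is torsion. *)
Definition is_exc_uniserial (b : 'I_2) (i : int) (j : nat) (X : grmod) : Prop :=
  [/\ uniserial X, has_length j X
    & exists2 Y, is_exc_simple b i Y & is_top X Y].

End Sheaves.

Section Annulus.
Variable R : realType.

Local Notation I01 := (`[0, 1]%classic : set R).

(* U = R x [0, 1], with (x, y) ~ (x + 1, y) and its integer iterates. *)
Definition strip : Type := (R * set_type I01)%type.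

Definition same_point (u v : strip) : bool :=
  `[< exists n : int, v.1 = u.1 + n%:~R /\ v.2 = u.2 >].

Lemma same_point_equiv : equiv_class_of same_point.
Proof.
split=> [x|x y|y x z].
- by apply/asboolP; exists 0; rewrite addr0.
- apply/idP/idP => /asboolP[n [e1 e2]]; apply/asboolP; exists (- n);
    by rewrite e1 e2 mulrNz addrK.
- move=> /asboolP[n [e1 e2]] /asboolP[m [f1 f2]]; apply/asboolP; exists (n + m).
  by rewrite f1 f2 e1 e2 intrD addrA.
Qed.

Canonical same_point_eqv := EquivRelPack same_point_equiv.
Canonical same_point_enc := defaultEncModRel same_point.

Definition annulus := quotient_topology {eq_quot same_point}.

Definition cover : strip -> annulus := \pi_annulus.

Definition height (u : strip) : R := set_val u.2.

Definition annulus_interior : set annulus :=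
  cover @` [set u | 0 < height u < 1].

(* Arcs are parametrised by [0, 1]; the values elsewhere are irrelevant. *)

(* Arcs of the strip from (x0, y0) to (x1, y1). *)
Definition strip_arc (x0 y0 x1 y1 : R) (d : R -> strip) : Prop :=
  [/\ {within I01, continuous d},
      (d 0).1 = x0 /\ height (d 0) = y0,
      (d 1).1 = x1 /\ height (d 1) = y1
    & forall t, 0 < t < 1 -> 0 < height (d t) < 1].

Definition annulus_arc (c : R -> annulus) : Prop :=
  {within I01, continuous c} /\
  forall t, 0 < t < 1 -> annulus_interior (c t).

Definition homotopic (c c' : R -> annulus) : Prop :=
  exists H : R * R -> annulus,
    [/\ {within I01 `*` I01, continuous H},
        forall t, I01 t -> H (0, t) = c t /\ H (1, t) = c' t
      & forall s, I01 s -> H (s, 0) = c 0 /\ H (s, 1) = c 1].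

(* The homotopy class of the image in the annulus of the arcs of the strip from
   (x0, y0) to (x1, y1), given as the set of its representatives. *)
Definition arc_class (x0 y0 x1 y1 : R) : set (R -> annulus) :=
  [set c | annulus_arc c /\
     exists d, strip_arc x0 y0 x1 y1 d /\ homotopic (cover \o d) c].

Section Marked.
Variables p q : nat.

(* [D^(i/p)_(j/q)] *)
Definition bridging (i j : int) : set (R -> annulus) :=
  arc_class (j%:~R / q%:R) 0 (i%:~R / p%:R) 1.

(* [D^(i/p, j/p)] *)
Definition inner_peripheral (i j : int) : set (R -> annulus) :=
  arc_class (i%:~R / p%:R) 1 (j%:~R / p%:R) 1.

(* [D_(i/q, j/q)] *)
Definition outer_peripheral (i j : int) : set (R -> annulus) :=
  arc_class (i%:~R / q%:R) 0 (j%:~R / q%:R) 0.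

Definition has_simple_representative (C : set (R -> annulus)) : Prop :=
  exists c, C c /\ forall s t, 0 < s < 1 -> 0 < t < 1 -> c s = c t -> s = t.

Definition is_arc (C : set (R -> annulus)) : Prop :=
  [\/ exists i j, C = bridging i j,
      exists i j, 2 <= j - i /\ C = inner_peripheral i j
    | exists i j, 2 <= j - i /\ C = outer_peripheral i j] /\
  has_simple_representative C.

Definition disjoint_arcs (C C' : set (R -> annulus)) : Prop :=
  exists c c', [/\ C c, C' c' &
    forall s t, 0 < s < 1 -> 0 < t < 1 -> c s <> c' t].

Definition noncrossing (G : set (set (R -> annulus))) : Prop :=
  G `<=` is_arc /\
  forall C C', G C -> G C' -> C <> C' -> disjoint_arcs C C'.

Definition triangulation (G : set (set (R -> annulus))) : Prop :=
  noncrossing G /\ forall G', noncrossing G' -> G `<=` G' -> G' = G.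

(* The defining property of phi; its values are determined up to isomorphism. *)
Definition is_phi (k : closedFieldType)
    (phi : set (R -> annulus) -> grmod k p q) : Prop :=
  [/\ forall i j : int,
        isomorphic (phi (bridging i j))
                   (O k (vx p q 0 *~ i - vx p q 1 *~ j)),
      forall (i : int) (j : nat), (1 <= j)%N ->
        is_exc_uniserial 0 i j (phi (inner_peripheral (i - j%:Z - 1) i))
    & forall (i : int) (j : nat), (1 <= j)%N ->
        is_exc_uniserial 1 i j (phi (outer_peripheral (- i) (j%:Z - i + 1)))].

End Marked.
End Annulus.

(* The direct sum of phi(C), C in G, for G finite. *)
Definition phi_sum (R : realType) (k : closedFieldType) (p q : nat)
    (phi : set (R -> annulus R) -> grmod k p q)
    (G : set (set (R -> annulus R))) : grmod k p q :=
  dsum_seq [seq phi C | C <- finmap.enum_fset (fset_set G)].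

(* Main.v *)
(* Arcs are encoded by integers, up to translation by (p, -q): the bridging arc of
   O(m1 x_1 + m2 x_2) by the pair (m1, m2), and a peripheral arc by an interval
   (a, c) on one boundary component.

   A morphism of the quotient category is determined by its graph, and "up to
   finite dimension" means "after multiplication by large powers of both
   variables".  With this, Hom and Ext^1 between line bundles and the modules
   O(y) / f^l, f prime, are computed explicitly: Ext^1 vanishes in both directions
   iff the arcs do not cross.  Every nonzero sheaf has a line bundle or some
   O(y) / f^l as a direct summand (an element of maximal f-primary order, or else
   a minimal generator of a saturated submodule of a free module, splits off), and
   O(y) / f^l has self-extensions unless f is a variable and l is less than its
   weight; hence the rigid indecomposables are the images of the arcs.

   On the topological side two arcs which cross combinatorially always meet: the
   difference of their lifts would otherwise have a continuous angle on the unit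
   square, with contradictory boundary behaviour.  If they do not cross, straight
   lines and flat parabolas are disjoint representatives.

   Finally a noncrossing collection is maximal iff it contains a bridging arc,
   consecutive end points of bridging arcs are joined by a peripheral arc, and
   every peripheral arc is cut by a third point into two arcs or boundary edges.
   The same conditions say that no nonzero sheaf, or equivalently no line bundle,
   no exceptional uniserial sheaf and no sheaf at an ordinary point, is orthogonal
   to all the members of the collection. *)
From HB Require Import structures.
Require Import Defs.
From mathcomp Require Import all_boot all_order all_algebra.
From mathcomp Require Import all_classical all_reals all_analysis.
From mathcomp Require Import zify ring lra.
From mathcomp Require mpoly.
Import (canonicals, coercions) mpoly.
Import Order.TTheory GRing.Theory Num.Theory numFieldNormedType.Exports.
Set Implicit Arguments.
Unset Strict Implicit.
Unset Printing Implicit Defensive.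
Local Open Scope classical_set_scope.
Local Open Scope ring_scope.
Local Open Scope quotient_scope.

(** * Graded polynomials and graded submodules *)

Section Degrees.
Variables p q : nat.
Local Notation L := (Lpq p q).
Local Notation vx := (@vx p q).

(** [Ext1_zero] only says that extensions split, so explicit pullbacks and pushouts ([ExtLift],
    [ExtPush]) play the part of long exact sequences. Vanishing of Ext^1 from O comes from a Cech
    criterion for the two variables ([ExtO_zero]), vanishing from O(y) / f^l from the cokernel of
    f^l after a variable prime to f has been inverted ([ExtQ_zero]). Instead of comparing
    decompositions, the proof of injectivity uses that an arc compatible with all arcs of a maximal
    collection belongs to it; and generation needs only one direct summand of a test sheaf.
    Maximality and generation are compared through local conditions rather than by counting arcs.
    The side b = 1 is described in reversed coordinates, so that O(m1 x_1 + m2 x_2) ends at m1 and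
    m2 and both boundary components obey the same formulas; bridging arcs then cross when some
    product of differences of ends is positive. In the topology one tool serves twice: a continuous
    angle on the unit square lifts homotopies to the strip, and it also shows that crossing arcs
    meet. *)

Lemma vx_intE (a b : int) :
  vx 0 *~ a + vx 1 *~ b = \pi_(Quotient.quot (Lrel p q)) (a, b).
Proof.
pose f (z : int * int) : L := \pi_(Quotient.quot (Lrel p q)) z.
have fB x y : f (x - y) = f x - f y by rewrite /f !raddfB.
have fD x y : f (x + y) = f x + f y.
  have f0 : f 0 = 0 by rewrite -[0](subrr 0) fB subrr.
  have fN : f (- y) = - f y by have := fB 0 y; rewrite sub0r f0 sub0r.
  by rewrite -[f y]opprK -fN -fB opprK.
have fn (z : int * int) (n : nat) : f z *+ n = f (z.1 * n%:Z, z.2 * n%:Z).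
  elim: n => [|n IH].
    by rewrite mulr0n; have := fB 0 0; rewrite !subrr => <-; congr f; congr (_, _); rewrite mulr0.
  by rewrite mulrS IH -fD; congr f; congr (_, _) => /=; lia.
have fz (z : int * int) (n : int) : f z *~ n = f (z.1 * n, z.2 * n).
  case: n => n; rewrite ?NegzE.
    by rewrite -pmulrn fn.
  rewrite mulrNz -pmulrn fn -[- f _]add0r -(subrr (f 0)) -!fB; congr f.
  by congr (_, _) => /=; lia.
by rewrite /vx /= -!/(f _) !fz -fD; congr f; congr (_, _) => /=; lia.
Qed.

(** The kernel of Z^2 -> L(p,q) is spanned by (p, -q); comparisons of degrees become integer
    arithmetic through this equivalence. *)
Lemma vx_intP (a b a' b' : int) :
  vx 0 *~ a + vx 1 *~ b = vx 0 *~ a' + vx 1 *~ b' <->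
  exists n : int, a = a' + n * p%:Z /\ b = b' - n * q%:Z.
Proof.
rewrite !vx_intE; split.
  move=> /eqP; rewrite eqmodE /= Quotient.equivE => /asboolP[n] /= [e1 e2].
  by exists n; lia.
move=> [n [-> ->]]; apply/eqP; rewrite eqmodE /= Quotient.equivE.
by apply/asboolP; exists n; congr (_, _) => /=; lia.
Qed.

Lemma L_coords (x : L) : exists a b : int, x = vx 0 *~ a + vx 1 *~ b.
Proof.
by elim/quotW: x => -[a b]; exists a, b; rewrite vx_intE.
Qed.

Lemma vx_natP (a b a' b' : nat) :
  vx 0 *+ a + vx 1 *+ b = vx 0 *+ a' + vx 1 *+ b' <->
  exists n : int, a%:Z = a'%:Z + n * p%:Z /\ b%:Z = b'%:Z - n * q%:Z.
Proof. by rewrite -vx_intP. Qed.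

Definition other (b : 'I_2) : 'I_2 := if b == 0 then 1 else 0.
(** The weight of the exceptional point where the variable [b] vanishes: modulo multiples of the
    other generator, [vx b] has order [wt b]. *)
Definition wt (b : 'I_2) : nat := if b == 0 then p else q.

Lemma I2P (P : 'I_2 -> Prop) : P 0 -> P 1 -> forall b, P b.
Proof. by move=> P0 P1 [[|[|//]] h]; [move: P0|move: P1]; congr P; apply: val_inj. Qed.

Lemma vx_othP b (a c a' c' : int) :
  vx b *~ a + vx (other b) *~ c = vx b *~ a' + vx (other b) *~ c' <->
  exists n : int, a = a' + n * (wt b)%:Z /\ c = c' - n * (wt (other b))%:Z.
Proof.
elim/I2P: b; first exact: vx_intP.
rewrite addrC [X in _ = X]addrC; split.
  by move=> /vx_intP[n [e1 e2]]; exists (- n); rewrite /wt /=; lia.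
by move=> [n]; rewrite /wt /= => -[e1 e2]; apply/vx_intP; exists (- n); lia.
Qed.

Lemma L_coords_oth b (x : L) :
  exists a c : int, x = vx b *~ a + vx (other b) *~ c.
Proof.
have [a [c ->]] := L_coords x.
by elim/I2P: b; [exists a, c|exists c, a; rewrite addrC].
Qed.
End Degrees.

(** * Divisibility by the variables in k[x_1, x_2] *)

Section Poly.
Variables (k : closedFieldType).
Local Notation S := (Spol k).
Definition xx (b : 'I_2) : S := mpoly.mpolyX k (mpoly.mnm1 b).

Lemma mpolyX2 (m : mpoly.multinom 2) :
  mpoly.mpolyX k m = xx 0 ^+ m 0 * xx 1 ^+ m 1.
Proof.
rewrite mpoly.mpolyXE_id !big_ord_recl big_ord0 mulr1 /xx.
by congr (_ ^+ _ * _ ^+ _); first [congr mpoly.mpolyX; congr mpoly.mnm1|congr mpoly.fun_of_multinom]; apply: val_inj.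
Qed.

Lemma S_ind (P : S -> Prop) : P 0 -> (forall s t, P s -> P t -> P (s + t)) ->
  (forall c a b, P (c *: (xx 0 ^+ a * xx 1 ^+ b))) -> forall s, P s.
Proof.
move=> P0 PD Pm s; rewrite [s]mpoly.mpolyE.
by apply: big_ind => // m _; rewrite mpolyX2.
Qed.

Lemma xx_neq0 b : xx b != 0.
Proof. by apply/eqP => /(congr1 (mpoly.mcoeff (mpoly.mnm1 b)))/eqP; rewrite mpoly.mcoeffX mpoly.mcoeff0 eqxx oner_eq0. Qed.

Lemma xxn_neq0 b n : xx b ^+ n != 0.
Proof. by rewrite expf_neq0 ?xx_neq0. Qed.
(** Substitution of 0 for the variable [b], kept as an endomorphism of S. Its kernel is the ideal of
    [xx b], so primality of [xx b] follows from S being a domain. *)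
Definition kill (b : 'I_2) : S -> S :=
  mpoly.comp_mpoly [tuple if i == b then 0 else xx i | i < 2].

Lemma kill_xx b i : kill b (xx i) = if i == b then 0 else xx i.
Proof. rewrite /kill {1}/xx mpoly.comp_mpolyX (bigD1 i) //= big1 => [|j ji].
  by rewrite mulr1 tnth_mktuple mpoly.mnm1E eqxx expr1.
by rewrite mpoly.mnm1E eq_sym (negbTE ji) expr0.
Qed.

Lemma killP b s : kill b s = 0 <-> exists t, s = xx b * t.
Proof.
split=> [e|[t ->]]; last by rewrite /kill rmorphM /= -/(kill _ _) kill_xx eqxx mul0r.
suff [t et] : exists t, s - kill b s = xx b * t by exists t; rewrite -et e subr0.
elim/S_ind: s {e} => [|s t [u es] [v et]|c m n].
- by exists 0; rewrite /kill rmorph0 subrr mulr0.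
- exists (u + v); rewrite mulrDr -es -et /kill rmorphD /=; ring.
- rewrite /kill linearZ /= rmorphM !rmorphXn /= -!/(kill _ _) !kill_xx.
  elim/I2P: b => /=.
    case: m => [|m]; first by exists 0; rewrite !expr0 subrr mulr0.
    by exists (c *: (xx 0 ^+ m * xx 1 ^+ n)); rewrite [0 ^+ _]exprS !mul0r scaler0 subr0 exprS -mulrA -scalerAr.
  case: n => [|n]; first by exists 0; rewrite !expr0 subrr mulr0.
  by exists (c *: (xx 0 ^+ m * xx 1 ^+ n)); rewrite [0 ^+ _]exprS mul0r mulr0 scaler0 subr0 exprS mulrCA -scalerAr.
Qed.

Lemma xx_dvdM b (s t u : S) : s * t = xx b * u ->
  (exists v, s = xx b * v) \/ (exists v, t = xx b * v).
Proof.
move=> e; have : kill b (s * t) = 0 by apply/killP; exists u.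
rewrite /kill rmorphM /= -!/(kill _ _) => /eqP; rewrite mulf_eq0.
by case/orP=> /eqP /killP; [left|right].
Qed.

Lemma xx_dvdXM b N (s t u : S) : (forall v, s <> xx b * v) ->
  s * t = xx b ^+ N * u -> exists v, t = xx b ^+ N * v.
Proof.
move=> hs; elim: N t u => [|N IH] t u e; first by exists t; rewrite expr0 mul1r.
have [|[v ev]|[v ev]] := @xx_dvdM b s t (xx b ^+ N * u).
- by rewrite e exprS mulrA.
- by case: (hs v).
rewrite ev mulrCA exprS -mulrA in e.
have [w ew] := IH _ _ (mulfI (xx_neq0 b) e).
by exists w; rewrite ev ew exprS mulrA.
Qed.

Lemma xx_ndvdX b (s : S) l : (forall v, s <> xx b * v) ->
  forall v, s ^+ l <> xx b * v.
Proof.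
move=> hs; elim: l => [|l IH] v e.
  have /killP : exists t, s ^+ 0 = xx b * t by exists v.
  by rewrite expr0 /kill rmorph1 => /eqP; rewrite oner_eq0.
by rewrite exprS in e; have [[w]|[w]] := xx_dvdM e; [exact: hs|exact: IH].
Qed.

(** Powers of [f] and of [xx b] form a regular sequence, so they satisfy only the Koszul relations.
    This is what keeps O(y) / f^l free of finite dimensional submodules. *)
Lemma regular_pair b (f : S) l N s t : (forall v, f <> xx b * v) ->
  f ^+ l * s = xx b ^+ N * t ->
  exists w, s = xx b ^+ N * w /\ t = f ^+ l * w.
Proof.
move=> hf e; have [w ew] := xx_dvdXM (xx_ndvdX hf) e.
exists w; split=> //; rewrite ew mulrCA in e.
by rewrite (mulfI (xxn_neq0 b N) (esym e)).
Qed.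

Variables p q : nat.
Local Notation vx := (@vx p q).
Local Notation Shom := (@Shom k p q).

Lemma mdegree2 (m : mpoly.multinom 2) : mdegree p q m = vx 0 *+ m 0 + vx 1 *+ m 1.
Proof.
rewrite /mdegree !big_ord_recl big_ord0 addr0.
by have -> : lift ord0 ord0 = 1 :> 'I_2 by apply: val_inj.
Qed.

Lemma Shom_mon (c : k) a b :
  Shom (vx 0 *+ a + vx 1 *+ b) (c *: (xx 0 ^+ a * xx 1 ^+ b)).
Proof.
pose m := mpoly.mnm_add (mpoly.mnm_muln (mpoly.mnm1 (0 : 'I_2)) a)
                        (mpoly.mnm_muln (mpoly.mnm1 (1 : 'I_2)) b).
have m0 : m 0 = a by rewrite /m mpoly.mnmDE !mpoly.mulmnE !mpoly.mnm1E /= mul1n addn0.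
have m1 : m 1 = b by rewrite /m mpoly.mnmDE !mpoly.mulmnE !mpoly.mnm1E /= mul1n.
rewrite -{2}m0 -{2}m1 -mpolyX2 => m'.
rewrite mpoly.mcoeffZ mpoly.mcoeffX; case: (m =P m') => [<- _|_]; last by rewrite mulr0 eqxx.
by rewrite mdegree2 m0 m1.
Qed.

Lemma Shom_ind d (P : S -> Prop) : P 0 -> (forall s t, P s -> P t -> P (s + t)) ->
  (forall c a b, c != 0 -> vx 0 *+ a + vx 1 *+ b = d -> P (c *: (xx 0 ^+ a * xx 1 ^+ b))) ->
  forall s, Shom d s -> P s.
Proof.
move=> P0 PD Pm s hs; rewrite [s]mpoly.mpolyE big_seq.
apply: big_ind => // m ms; rewrite mpolyX2; apply: Pm; first by rewrite -mpoly.mcoeff_msupp.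
by rewrite -mdegree2; apply: hs; rewrite -mpoly.mcoeff_msupp.
Qed.

Lemma ShomZ x (c : k) s : Shom x s -> Shom x (c *: s).
Proof.
move=> h m; rewrite mpoly.mcoeffZ => e; apply: h; apply: contraNneq e => ->.
by rewrite mulr0.
Qed.

Lemma Shom_xx b : Shom (vx b) (xx b).
Proof.
have := @Shom_mon 1 (b == 0) (b == 1); rewrite scale1r.
by elim/I2P: b => /=; rewrite ?expr0 ?expr1 ?mulr1 ?mul1r ?mulr0n ?mulr1n ?addr0 ?add0r.
Qed.

Lemma Shom_1 : Shom 0 1.
Proof. by have := @Shom_mon 1 0 0; rewrite scale1r !expr0 mulr1 !mulr0n addr0. Qed.

Lemma ShomX x s n : Shom x s -> Shom (x *+ n) (s ^+ n).
Proof.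
move=> h; elim: n => [|n IH]; first by rewrite mulr0n expr0; exact: Shom_1.
by rewrite mulrS exprS; exact: ShomM.
Qed.

Lemma Shom_xxn b n : Shom (vx b *+ n) (xx b ^+ n).
Proof. by apply: ShomX; exact: Shom_xx. Qed.
End Poly.

(** * Homogeneous primes and factorization *)

Section Primes.
Variables (k : closedFieldType).
Local Notation S := (Spol k).
Local Notation xx := (@xx k).

(** Every term of the expanded power contains [a] at least [l] times or [b] at least [n] times.
    Multiplying out one factor [a + b] at a time avoids binomial coefficients. *)
Lemma exprD_split (a b : S) l n :
  exists u v, (a + b) ^+ (l + n) = u * a ^+ l + v * b ^+ n.
Proof.
move: {2}(l + n)%N (erefl (l + n)%N) => m; elim: m l n => [|m IH] l n e.
  by move: e => /eqP; rewrite addn_eq0 => /andP[/eqP -> /eqP ->]; exists 1, 0; rewrite !expr0; ring.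
case: l n e => [|l] [|n] //= e.
- by exists ((a + b) ^+ n.+1), 0; rewrite add0n expr0; ring.
- by exists 0, ((a + b) ^+ l.+1); rewrite addn0 expr0; ring.
have [|u [v e1]] := IH l n.+1; first by lia.
have [|u' [v' e2]] := IH l.+1 n; first by lia.
exists (u + b * u'), (a * v + v').
rewrite addSn [LHS]exprS mulrDl {1}e1 -addSnnS e2 !exprS; ring.
Qed.

(* The quotient S / (s, t) is finite dimensional. *)
Definition mprim (s t : S) : Prop :=
  exists M, forall i, exists a b, xx i ^+ M = a * s + b * t.

Lemma mprimI s t :
  (forall i, exists M a b, xx i ^+ M = a * s + b * t) -> mprim s t.
Proof.
move=> h; have [M0 [a0 [b0 e0]]] := h 0; have [M1 [a1 [b1 e1]]] := h 1.
exists (M0 + M1)%N; elim/I2P.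
  by exists (a0 * xx 0 ^+ M1), (b0 * xx 0 ^+ M1); rewrite exprD e0; ring.
by exists (a1 * xx 1 ^+ M0), (b1 * xx 1 ^+ M0); rewrite exprD e1; ring.
Qed.

Lemma mprimX s t l n : mprim s t -> mprim (s ^+ l) (t ^+ n).
Proof.
move=> [M h]; apply: mprimI => i; have [a [b e]] := h i.
have [u [v e']] := exprD_split (a * s) (b * t) l n.
exists (M * (l + n))%N, (u * a ^+ l), (v * b ^+ n).
by rewrite exprM e e' !exprMn !mulrA.
Qed.

Lemma mprimC s t : mprim s t -> mprim t s.
Proof. by move=> [M h]; exists M => i; have [a [b e]] := h i; exists b, a; rewrite addrC. Qed.

Variables p q : nat.
Hypotheses (p_gt0 : (0 < p)%N) (q_gt0 : (0 < q)%N).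
Local Notation L := (Lpq p q).
Local Notation vx := (@vx p q).
Local Notation Shom := (@Shom k p q).

Lemma wt_gt0 b : (0 < wt p q b)%N. Proof. by elim/I2P: b. Qed.

Lemma vx_inj b n n' : vx b *+ n = vx b *+ n' -> n = n'.
Proof.
move=> e; have /vx_othP[t [e1 e2]] :
  vx b *~ n%:Z + vx (other b) *~ 0 = vx b *~ n'%:Z + vx (other b) *~ 0.
  by rewrite !mulr0z !addr0 -!pmulrn.
have := wt_gt0 (other b); have : t * wt p q (other b) = 0 by lia.
move=> /eqP; rewrite mulf_eq0 => /orP[/eqP t0|/eqP w0]; last by lia.
by move: e1; rewrite t0; lia.
Qed.

(** If the part [u] of [v] outside degree [d - d'] were nonzero, its leading monomial would have
    degree [d - d'], since leading monomials are multiplicative and [f * u] is homogeneous; but [u]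
    has no term of that degree. *)
Lemma Shom_div d d' (f v : S) : f != 0 -> Shom d' f -> Shom d (f * v) ->
  Shom (d - d') v.
Proof.
move=> f0 hf hv.
pose v' : S := \sum_(m <- mpoly.msupp v | mdegree p q m == d - d') mpoly.mcoeff m v *: mpoly.mpolyX k m.
have hv' : Shom (d - d') v' by exact: Shom_comp.
suff : v - v' == 0 by rewrite subr_eq0 => /eqP ->.
apply/negPn/negP => u0; set u := v - v' in u0.
have hfu : Shom d (f * u).
  rewrite /u mulrBr; apply: ShomB => //.
  by have := ShomM hf hv'; rewrite addrC subrK.
have fu0 : f * u != 0 by rewrite mulf_neq0.
have := hfu (mpoly.mlead (f * u)).
rewrite mpoly.mleadM // -mpoly.mleadM // -mpoly.mcoeff_msupp mpoly.mlead_supp // mpoly.mleadM //.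
move=> /(_ isT); rewrite mdegreeD (hf (mpoly.mlead f)); last by rewrite -mpoly.mcoeff_msupp mpoly.mlead_supp.
move=> /(canRL (addKr _)); rewrite addrC => du.
have : mpoly.mcoeff (mpoly.mlead u) u != 0 by rewrite -mpoly.mcoeff_msupp mpoly.mlead_supp.
rewrite {2}/u mpoly.mcoeffB /v' raddf_sum /= -big_filter.
case: (boolP (mpoly.mlead u \in mpoly.msupp v)) => hm.
  rewrite (bigD1_seq (mpoly.mlead u)) ?filter_uniq ?mpoly.msupp_uniq ?mem_filter ?hm ?du ?eqxx //=.
  rewrite mpoly.mcoeffZ mpoly.mcoeffX eqxx mulr1 big1 ?addr0 ?subrr ?eqxx // => m nm.
  by rewrite mpoly.mcoeffZ mpoly.mcoeffX (negbTE nm) mulr0.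
rewrite big_seq big1 => [|m].
  by rewrite subr0 -mpoly.mcoeff_msupp (negbTE hm).
rewrite mem_filter => /andP[_ hm']; rewrite mpoly.mcoeffZ mpoly.mcoeffX.
by case: (m =P mpoly.mlead u) hm' hm => [->|_ _ _]; [move=> ->|rewrite mulr0].
Qed.

(* f is prime of degree d and b is a variable coprime to f; by prm_dvd, modulo f
   every homogeneous element is zero or invertible up to finite dimension. *)
Record prm (f : S) (d : L) (b : 'I_2) : Prop := Prm {
  prm_hom : Shom d f;
  prm_ndvd : forall v, f <> xx b * v;
  prm_comp : mprim f (xx b);
  prm_dvd : forall e s, Shom e s -> (exists v, s = f * v) \/ mprim s f;
  prm_pt : exists w : 'I_2 -> k, mpoly.meval w f = 0 /\ w b != 0
}.

Lemma prm_neq0 f d b : prm f d b -> f != 0.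
Proof. by move=> h; apply/eqP => e; apply: (prm_ndvd h (v := 0)); rewrite mulr0. Qed.

(** Evaluate at the point of [prm_pt], where [f] vanishes and [xx b] does not. *)
Lemma prm_nonunit f d b l N v : prm f d b -> (0 < l)%N -> xx b ^+ N <> f ^+ l * v.
Proof.
move=> h l0 /(congr1 (mpoly.meval _)) e; have [w [w0 wb]] := prm_pt h.
move: (e w); rewrite rmorphM !rmorphXn /= w0 expr0n gtn_eqF // mul0r /xx mpoly.mevalXU => /eqP.
by rewrite expf_eq0 (negbTE wb) andbF.
Qed.

(** Modulo [xx b] only powers of the other variable remain, and a degree contains at most one of
    them by [vx_inj]. For [c] equal to 0 the exponent [n] is arbitrary, hence the guard in the last
    conjunct. *)
Lemma hom_xx b d s : Shom d s -> exists c n w,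
  s = c *: xx (other b) ^+ n + xx b * w /\ (c != 0 -> vx (other b) *+ n = d).
Proof.
move: s; apply: Shom_ind => [|s t [c [n [w [es hs]]]] [c' [n' [w' [et ht]]]]|c m n c0 e].
- by exists 0, 0%N, 0; rewrite scale0r mulr0 addr0 eqxx.
- have [c0|c0] := eqVneq c 0.
    by exists c', n', (w + w'); split=> //; rewrite es et c0 scale0r mulrDr; ring.
  have [c0'|c0'] := eqVneq c' 0.
    by exists c, n, (w + w'); split=> //; rewrite es et c0' scale0r mulrDr; ring.
  exists (c + c'), n, (w + w'); split; last by move=> _; exact: hs.
  have nn : n' = n by apply: (@vx_inj (other b)); rewrite hs // ht.
  by rewrite es et nn scalerDl mulrDr addrACA.
- elim/I2P: b => /=.
    case: m e => [|m] e; last by exists 0, 0%N, (c *: (xx 0 ^+ m * xx 1 ^+ n)); rewrite scale0r add0r eqxx; split=> //; rewrite exprS -mulrA -scalerAr.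
    by exists c, n, 0; rewrite mulr0 addr0 expr0 mul1r; split=> //; rewrite -e mulr0n add0r.
  case: n e => [|n] e; last by exists 0, 0%N, (c *: (xx 0 ^+ m * xx 1 ^+ n)); rewrite scale0r add0r eqxx; split=> //; rewrite exprS mulrCA -scalerAr.
  by exists c, m, 0; rewrite mulr0 addr0 expr0 mulr1; split=> //; rewrite -e mulr0n addr0.
Qed.

Lemma otherK : involutive other. Proof. by elim/I2P. Qed.

Lemma xx_eqF b v : xx (other b) <> xx b * v.
Proof.
move=> e; have : kill b (xx (other b)) = 0 by apply/killP; exists v.
rewrite kill_xx; have -> : other b == b = false by elim/I2P: b {e}.
by move/eqP; rewrite (negbTE (xx_neq0 _ _)).
Qed.

Lemma prm_xx b : prm (xx b) (vx b) (other b).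
Proof.
split.
- exact: Shom_xx.
- by move=> v; rewrite -{1}(otherK b); exact: xx_eqF.
- exists 1%N => i; case: (eqVneq i b) => [->|ib]; first by exists 1, 0; rewrite expr1; ring.
  have -> : i = other b by move: ib; elim/I2P: b; elim/I2P: i.
  by exists 0, 1; rewrite expr1; ring.
- move=> e s /(hom_xx b)[c [n [w [es _]]]].
  have [c0|c0] := eqVneq c 0; first by left; exists w; rewrite es c0 scale0r add0r.
  right; apply: mprimI => i; case: (eqVneq i b) => [->|ib].
    by exists 1%N, 0, 1; rewrite expr1; ring.
  have -> : i = other b by move: ib; elim/I2P: b {es}; elim/I2P: i.
  exists n, (c^-1)%:A, (- (c^-1 *: w)).
  rewrite es mulrDr !mulr_algl scalerA mulVf // scale1r mulNr -scalerAl [w * _]mulrC.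
  by rewrite addrK.
- exists (fun i => if i == b then 0 else 1); rewrite /xx mpoly.mevalXU eqxx; split=> //.
  have -> : other b == b = false by elim/I2P: b.
  exact: oner_neq0.
Qed.

Lemma relpq : vx 0 *+ p = vx 1 *+ q.
Proof.
have := (vx_natP p q p 0 0 q).2; rewrite !mulr0n addr0 add0r; apply.
by exists 1; lia.
Qed.

(** The equation of the ordinary point with parameter [lam], for [lam] nonzero; it is homogeneous
    because both terms have the degree of [relpq]. *)
Definition ff (lam : k) : S := xx 0 ^+ p - lam *: xx 1 ^+ q.

Lemma Shom_ff lam : Shom (vx 0 *+ p) (ff lam).
Proof.
apply: ShomB; first exact: Shom_xxn.
by apply: ShomZ; rewrite relpq; exact: Shom_xxn.
Qed.

(** Division by [ff lam] trades [xx 0 ^+ p] for [lam *: xx 1 ^+ q], which keeps the degree. Among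
    the monomials whose exponent of [xx 0] is below p, a degree contains at most one. *)
Lemma hom_ff lam d s : Shom d s -> exists c m n w,
  [/\ s = c *: (xx 0 ^+ m * xx 1 ^+ n) + ff lam * w, (m < p)%N &
      (c != 0 -> vx 0 *+ m + vx 1 *+ n = d)].
Proof.
move: s; apply: Shom_ind => [|s t [c [m [n [w [es mp hs]]]]] [c' [m' [n' [w' [et mp' ht]]]]]|c m n c0 e].
- by exists 0, 0%N, 0%N, 0; rewrite scale0r mulr0 addr0 eqxx.
- have [c0|c0] := eqVneq c 0.
    by exists c', m', n', (w + w'); split=> //; rewrite es et c0 scale0r mulrDr; ring.
  have [c0'|c0'] := eqVneq c' 0.
    by exists c, m, n, (w + w'); split=> //; rewrite es et c0' scale0r mulrDr; ring.
  exists (c + c'), m, n, (w + w'); split=> //; last by move=> _; exact: hs.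
  have [t0 [e1 e2]] := (vx_natP p q m n m' n').1 (etrans (hs c0) (esym (ht c0'))).
  have t00 : t0 = 0 by nia.
  have mm : m' = m by move: e1; rewrite t00; lia.
  have nn : n' = n by move: e2; rewrite t00; lia.
  by rewrite es et nn mm scalerDl mulrDr addrACA.
- elim/ltn_ind: m c n c0 e => m IH c n c0 e.
  case: (ltnP m p) => mp; first by exists c, m, n, 0; rewrite mulr0 addr0.
  have e' : vx 0 *+ (m - p) + vx 1 *+ (n + q) = d.
    by rewrite -e; apply/vx_natP; exists (- 1); lia.
  have mlt : (m - p < m)%N by rewrite ltn_subrL p_gt0 (leq_trans p_gt0 mp).
  have [l0|l0] := eqVneq lam 0.
    exists 0, 0%N, 0%N, (c *: (xx 0 ^+ (m - p) * xx 1 ^+ n)).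
    rewrite eqxx /ff l0 !scale0r subr0 add0r -scalerAr mulrA -exprD subnKC //.
  have [||c1 [m1 [n1 [w [ew m1p h1]]]]] := IH _ mlt (c * lam) (n + q)%N.
  - by rewrite mulf_neq0.
  - exact: e'.
  exists c1, m1, n1, (c *: (xx 0 ^+ (m - p) * xx 1 ^+ n) + w); split=> //.
  rewrite mulrDr addrCA -ew /ff mulrBl -!scalerAr -!scalerAl scalerA.
  rewrite mulrA -exprD subnKC // [xx 1 ^+ q * _]mulrCA -exprD [(q + n)%N]addnC.
  by rewrite subrK.
Qed.

Lemma prm_ff lam : lam != 0 -> prm (ff lam) (vx 0 *+ p) 1.
Proof.
move=> l0; split.
- exact: Shom_ff.
- move=> v e; have : kill 1 (ff lam) = 0 by apply/killP; exists v.
  rewrite /kill rmorphB /= linearZ /= !rmorphXn /= -!/(kill _ _) !kill_xx /=.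
  rewrite expr0n gtn_eqF // scaler0 subr0 => /eqP.
  by rewrite (negbTE (xxn_neq0 _ _ _)).
- apply: mprimI; elim/I2P.
    exists p, 1, (lam *: xx 1 ^+ q.-1); rewrite mul1r /ff -scalerAl -exprSr prednK //.
    by rewrite subrK.
  by exists 1%N, 0, 1; rewrite expr1; ring.
- move=> e s /(hom_ff lam)[c [m [n [w [es mp _]]]]].
  have [c0|c0] := eqVneq c 0; first by left; exists w; rewrite es c0 scale0r add0r.
  right; have e0 : xx 0 ^+ m * xx 1 ^+ n = c^-1%:A * s + (- (c^-1 *: w)) * ff lam.
    rewrite es mulrDr !mulr_algl scalerA mulVf // scale1r mulNr -scalerAl [w * _]mulrC.
    by rewrite addrK.
  apply: mprimI; elim/I2P.
    (* Modulo [ff lam] this power becomes a multiple of [xx 1 ^+ (q * n)], hence of [xx 1 ^+ n] as n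
       <= q * n. Multiplying by [xx 0 ^+ m] reaches the monomial of [e0]. *)
    have [u eu] : exists u, xx 0 ^+ (p * n) = ff lam * u + lam ^+ n *: xx 1 ^+ (q * n).
      elim: n {es e0} => [|n [u eu]]; first by exists 0; rewrite !muln0 !expr0 scale1r; ring.
      exists (u * xx 0 ^+ p + lam ^+ n *: xx 1 ^+ (q * n)).
      have -> : lam ^+ n.+1 *: xx 1 ^+ (q * n.+1) =
                (lam ^+ n *: xx 1 ^+ (q * n)) * (lam *: xx 1 ^+ q).
        by rewrite -scalerAl -scalerAr scalerA -exprD -exprSr mulnSr.
      rewrite mulnSr exprD eu {1 2}/ff; set Y := _ *: xx 1 ^+ (q * n); set X := lam *: _; ring.
    exists (m + p * n)%N, (lam ^+ n *: (xx 1 ^+ (q * n - n) * c^-1%:A)),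
      (xx 0 ^+ m * u + lam ^+ n *: (xx 1 ^+ (q * n - n) * (- (c^-1 *: w)))).
    transitivity (xx 0 ^+ m * (ff lam * u) +
        lam ^+ n *: (xx 1 ^+ (q * n - n) * (xx 0 ^+ m * xx 1 ^+ n))).
      rewrite exprD eu mulrDr -scalerAr; congr (_ + _ *: _).
      by rewrite mulrCA -exprD subnK // leq_pmull.
    rewrite e0; set A := _%:A; set W := c^-1 *: w; set Y := xx 1 ^+ _.
    have [B sc] : exists B : S, forall v, lam ^+ n *: v = B * v.
      by exists (lam ^+ n)%:A => v0; rewrite mulr_algl.
    rewrite !sc; ring.
  (* Multiply the monomial of [e0] by [xx 0 ^+ (p - m)] and trade [xx 0 ^+ p] for
     [lam *: xx 1 ^+ q], then divide by [lam]. *)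
  exists (q + n)%N, (lam^-1 *: (xx 0 ^+ (p - m) * c^-1%:A)),
    (lam^-1 *: (xx 0 ^+ (p - m) * (- (c^-1 *: w)) - xx 1 ^+ n)).
  have e1 : xx 0 ^+ (p - m) * (xx 0 ^+ m * xx 1 ^+ n) = xx 0 ^+ p * xx 1 ^+ n.
    by rewrite mulrA -exprD subnK // ltnW.
  transitivity (lam^-1 *: (xx 0 ^+ p * xx 1 ^+ n - xx 1 ^+ n * ff lam)).
    rewrite /ff [xx 0 ^+ p * _]mulrC -mulrBr opprB addrC subrK -scalerAr scalerA.
    by rewrite mulVf // scale1r -exprD addnC.
  have [B sc] : exists B : S, forall v, lam^-1 *: v = B * v.
    by exists (lam^-1)%:A => v0; rewrite mulr_algl.
  rewrite -e1 e0 !sc; ring.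
(* The point (mu, 1) with mu^p = lam lies on [ff lam] and off [xx 1]. *)
- have [mu] : exists mu, root ('X^p - lam%:P) mu.
    by apply: closed_rootP; rewrite size_XnsubC // eqSS gtn_eqF.
  rewrite rootE !hornerE subr_eq0 => /eqP emu.
  exists (fun i => if i == 0 then mu else 1); rewrite oner_neq0; split=> //.
  by rewrite /ff rmorphB /= mpoly.mevalZ !rmorphXn /= /xx !mpoly.mevalXU /= expr1n mulr1 emu subrr.
Qed.
Lemma size_const (s : S) : s != 0 -> mpoly.mdeg (mpoly.mlead s) = 0%N ->
  exists2 c : k, c != 0 & s = c%:A.
Proof.
move=> s0 m0; have := mpoly.mlead_deg s0; rewrite m0 => /esym/eqP/mpoly.msize_poly1P.
by case=> c c0 ->; exists c => //; rewrite mpoly.alg_mpolyC.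
Qed.

(** The total degree of the leading monomial is additive and positive on primes; it is the measure
    for inductions in which prime factors are divided out. *)
Lemma prm_deg f d b : prm f d b -> (0 < mpoly.mdeg (mpoly.mlead f))%N.
Proof.
move=> h; rewrite lt0n; apply/eqP => /(size_const (prm_neq0 h))[c c0 ef].
apply: (@prm_nonunit f d b 1 1 (c^-1 *: xx b) h) => //.
by rewrite !expr1 ef mulr_algl scalerA mulfV // scale1r.
Qed.

Lemma mdeg_mleadM (s t : S) : s != 0 -> t != 0 ->
  mpoly.mdeg (mpoly.mlead (s * t)) = (mpoly.mdeg (mpoly.mlead s) + mpoly.mdeg (mpoly.mlead t))%N.
Proof. by move=> s0 t0; rewrite mpoly.mleadM // mpoly.mdegD. Qed.

Lemma prm_split f d b e s : prm f d b -> Shom e s -> s != 0 ->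
  exists j s', [/\ s = f ^+ j * s', mprim s' f & s' != 0].
Proof.
move=> h; move: {2}(mpoly.mdeg _) (leqnn (mpoly.mdeg (mpoly.mlead s))) => n.
elim: n e s => [|n IH] e s le hs s0; have [[v ev]|hp] := prm_dvd h hs;
  try by exists 0%N, s; rewrite expr0 mul1r.
all: have v0 : v != 0 by apply: contraNneq s0 => e0; rewrite ev e0 mulr0.
all: move: le; rewrite ev mdeg_mleadM ?(prm_neq0 h) // => le; have := prm_deg h.
  by lia.
move=> fd; have hv : Shom (e - d) v.
  by apply: (Shom_div (prm_neq0 h) (prm_hom h)); rewrite -ev.
have [|j [s' [es hs' s0']]] := IH _ v _ hv v0; first by lia.
by exists j.+1, s'; split=> //; rewrite es exprS mulrA.
Qed.

(** The homogenization of degree [n] of a polynomial in one variable, with respect to [xx 0 ^+ p]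
    and [xx 1 ^+ q], which have the same degree. *)
Definition hgn (n : nat) (P : {poly k}) : S :=
  \sum_(i < n.+1) P`_i *: (xx 0 ^+ (i * p) * xx 1 ^+ ((n - i) * q)).

Lemma hgn_XsubC n lam (Q : {poly k}) : (size Q <= n.+1)%N ->
  hgn n.+1 (Q * ('X - lam%:P)) = ff lam * hgn n Q.
Proof.
move=> sQ; rewrite /hgn mulrBr /ff mulrBl !mulr_sumr.
transitivity (\sum_(i < n.+2) (Q * 'X)`_i *: (xx 0 ^+ (i * p) * xx 1 ^+ ((n.+1 - i) * q)) -
  \sum_(i < n.+2) (lam *: Q)`_i *: (xx 0 ^+ (i * p) * xx 1 ^+ ((n.+1 - i) * q))).
  rewrite -sumrB; apply: eq_bigr => i _; rewrite -scalerBl -coefB; congr (_`_ _ *: _).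
  by rewrite [Q * _%:P]mulrC mul_polyC.
congr (_ - _).
  rewrite big_ord_recl coefMX /= scale0r add0r; apply: eq_bigr => i _.
  by rewrite coefMX /bump add1n /= -scalerAr mulrA -exprD -mulSn subSS.
rewrite big_ord_recr /= coefZ (nth_default _ sQ) mulr0 scale0r addr0.
apply: eq_bigr => i _; rewrite coefZ -!scalerAl -!scalerAr scalerA; congr (_ *: _).
by rewrite [xx 1 ^+ q * _]mulrCA -exprD -mulSn -subSn // -ltnS.
Qed.

(** A degree that is a multiple of each generator separately is a multiple of c, and its monomials
    are products of powers of [xx 0 ^+ p] and [xx 1 ^+ q]. *)
Lemma hom_pure s d A B : Shom d s -> d = vx 0 *+ A -> d = vx 1 *+ B ->
  exists2 n, (A = n * p)%N & exists2 P : {poly k}, (size P <= n.+1)%N & s = hgn n P.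
Proof.
move=> hs dA dB.
have [t [e1 e2]] : exists t : int, A%:Z = 0 + t * p%:Z /\ 0 = B%:Z - t * q%:Z.
  by apply: (vx_natP p q A 0 0 B).1; rewrite !mulr0n addr0 add0r -dA.
have [n en] : exists n : nat, t = n%:Z.
  by case: t e1 e2 => n e1 e2; [exists n|nia].
exists n; first by lia.
move: s hs; apply: Shom_ind => [|s t0 [P sP ->] [Q sQ ->]|c a b _ e].
- exists 0; rewrite ?size_poly0 // /hgn big1 // => i _; by rewrite coef0 scale0r.
- exists (P + Q).
    by rewrite (leq_trans (size_polyD _ _)) // geq_max sP.
  by rewrite /hgn -big_split; apply: eq_bigr => i _; rewrite /= coefD scalerDl.
- have [u [e3 e4]] : exists u : int, a%:Z = 0 + u * p%:Z /\ b%:Z = B%:Z - u * q%:Z.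
    by apply: (vx_natP p q a b 0 B).1; rewrite mulr0n add0r e.
  have [i ei] : exists i : nat, u = i%:Z.
    by case: u e3 e4 => i e3 e4; [exists i|nia].
  have lin : (i < n.+1)%N by nia.
  exists (c *: 'X^i); first by rewrite (leq_trans (size_scale_leq _ _)) // size_polyXn.
  rewrite /hgn (bigD1 (Ordinal lin)) //= big1 => [|j ji].
    rewrite coefZ coefXn eqxx mulr1 addr0; congr (_ *: (_ ^+ _ * _ ^+ _)); first by lia.
    rewrite mulnBl; nia.
  rewrite coefZ coefXn; have -> : (j == i :> nat) = false by apply/negbTE; apply: contraNneq ji => e0; apply/eqP/val_inj.
  by rewrite mulr0 scale0r.
Qed.

Lemma hom_xx_pow b d s : Shom d s -> (forall v, s <> xx b * v) ->
  exists n, vx (other b) *+ n = d.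
Proof.
move=> hs nd; have [c [n [w [es h]]]] := hom_xx b hs.
exists n; apply: h; apply/eqP => c0; apply: (nd w).
by rewrite es c0 scale0r add0r.
Qed.

(* Homogeneous polynomials factor because the dehomogenization has a root. *)
Lemma prime_factor d s : Shom d s -> s != 0 ->
  (exists2 c : k, c != 0 & s = c%:A) \/
  exists f d' b v, [/\ prm f d' b, s = f * v, Shom (d - d') v & v != 0].
Proof.
move=> hs s0.
have fin f d' b v : prm f d' b -> s = f * v ->
  exists f d' b v, [/\ prm f d' b, s = f * v, Shom (d - d') v & v != 0].
  move=> h e; exists f, d', b, v; split=> //.
    by apply: (Shom_div (prm_neq0 h) (prm_hom h)); rewrite -e.
  by apply: contraNneq s0 => e0; rewrite e e0 mulr0.
have [[v ev]|n0] := pselect (exists v, s = xx 0 * v).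
  by right; exact: (fin _ _ _ _ (prm_xx 0) ev).
have [[v ev]|n1] := pselect (exists v, s = xx 1 * v).
  by right; exact: (fin _ _ _ _ (prm_xx 1) ev).
(* An element divisible by neither variable contains a pure power of each, so its degree is of the
   kind treated in [hom_pure]. *)
have [|B eB] := hom_xx_pow (b := 0) hs; first by move=> v e; apply: n0; exists v.
have [|A eA] := hom_xx_pow (b := 1) hs; first by move=> v e; apply: n1; exists v.
have [[|n] eA' [P sP es]] := hom_pure hs (esym eA) (esym eB).
  left; exists P`_0; last by rewrite es /hgn big_ord1 /= !mul0n !expr0 mulr1.
  apply: contraNneq s0 => c0; by rewrite es /hgn big_ord1 /= c0 scale0r.
(* A vanishing constant or top coefficient would make a variable divide [s]. Hence [P] is
   nonconstant with a nonzero root, and the root yields a factor [ff lam]. *)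
have P0 : P`_0 != 0.
  apply/eqP => e0; apply: n0; exists (\sum_(i < n.+1) P`_i.+1 *: (xx 0 ^+ (i * p + p.-1) * xx 1 ^+ ((n - i) * q))).
  rewrite es /hgn big_ord_recl e0 scale0r add0r mulr_sumr; apply: eq_bigr => i _.
  rewrite lift0 /= subSS -scalerAr mulrA -exprS; congr (_ *: (_ ^+ _ * _)).
  by rewrite -addnS prednK // mulSn addnC.
have Pn : P`_n.+1 != 0.
  apply/eqP => e0; apply: n1; exists (\sum_(i < n.+1) P`_i *: (xx 0 ^+ (i * p) * xx 1 ^+ ((n - i) * q + q.-1))).
  rewrite es /hgn big_ord_recr /= e0 scale0r addr0 mulr_sumr; apply: eq_bigr => i _.
  rewrite -scalerAr mulrCA -exprS; congr (_ *: (_ * _ ^+ _)).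
  by rewrite -addnS prednK // subSn ?mulSn 1?addnC // -ltnS.
have szP : (1 < size P)%N.
  by rewrite ltnNge; apply: contra Pn => le; rewrite nth_default // (leq_trans le).
have [lam rl] : exists lam, root P lam by apply: closed_rootP; rewrite gtn_eqF.
have l0 : lam != 0.
  by apply: contraTneq rl => ->; rewrite rootE horner_coef0.
have /factor_theorem[Q eQ] := rl; right.
have Q0 : Q != 0 by apply: contraTneq szP => e0; rewrite eQ e0 mul0r size_poly0.
apply: (fin (ff lam) _ 1 (hgn n Q)); first exact: prm_ff.
rewrite es eQ hgn_XsubC //; move: sP; rewrite eQ size_Mmonic ?monicXsubC // size_XsubC addn2 /=.
exact.
Qed.
End Primes.

(** * Finitely generated modules over k[x_1, x_2] are Noetherian *)

Section Gen.
Variables (k : closedFieldType).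
Local Notation S := (Spol k).

Definition submod (M : lmodType S) (V : set M) : Prop :=
  V 0 /\ forall a m m', V m -> V m' -> V (a *: m + m').

Section Submod.
Variables (M : lmodType S) (V : set M).
Hypothesis hV : submod V.
Lemma subm0 : V 0. Proof. by case: hV. Qed.
Lemma submZ a m : V m -> V (a *: m).
Proof. by move=> h; rewrite -[_ *: m]addr0; apply: hV.2 => //; exact: subm0. Qed.
Lemma submD m m' : V m -> V m' -> V (m + m').
Proof. by move=> h h'; rewrite -[m]scale1r; exact: hV.2. Qed.
Lemma submN m : V m -> V (- m).
Proof. by move=> h; rewrite -scaleN1r; exact: submZ. Qed.
Lemma submB m m' : V m -> V m' -> V (m - m').
Proof. by move=> h h'; apply: submD => //; exact: submN. Qed.
Lemma subm_sum (I : eqType) (r : seq I) (F : I -> M) :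
  (forall i, i \in r -> V (F i)) -> V (\sum_(i <- r) F i).
Proof. by move=> h; rewrite big_seq; apply: big_ind => //; [exact: subm0|exact: submD]. Qed.
End Submod.

Section GenM.
Variable M : lmodType S.
Implicit Types (e : seq M) (m : M).
Definition gen e m : Prop := exists c, m = lcomb c e.

Lemma gen_nil m : gen [::] m <-> m = 0.
Proof. by split=> [[c ->]|->]; [|exists (fun=> 0)]; rewrite /lcomb big_ord0. Qed.

Lemma gen_cons a e m : gen (a :: e) m <-> exists s w, gen e w /\ m = s *: a + w.
Proof.
split=> [[c ->]|[s [w [[c ->] ->]]]].
  by exists (c 0%N), (lcomb (fun i => c i.+1) e); rewrite lcomb_cons; split=> //; exists (fun i => c i.+1).
by exists (fun i => if i is j.+1 then c j else s); rewrite lcomb_cons.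
Qed.

Lemma gen_submod e : submod (gen e).
Proof.
elim: e => [|a e [IH0 IH]].
  by split=> [|s m m' /gen_nil -> /gen_nil ->]; apply/gen_nil => //; rewrite scaler0 addr0.
split; first by apply/gen_cons; exists 0, 0; rewrite scale0r addr0.
move=> s m m' /gen_cons[t [w [hw ->]]] /gen_cons[t' [w' [hw' ->]]].
apply/gen_cons; exists (s * t + t'), (s *: w + w'); split; first exact: IH.
by rewrite scalerDr scalerDl scalerA addrACA.
Qed.

Lemma gen_mem e a : a \in e -> gen e a.
Proof.
elim: e => [//|b e IH]; rewrite inE => /orP[/eqP ->|ae]; apply/gen_cons.
  by exists 1, 0; rewrite scale1r addr0; split=> //; case: (gen_submod e).
by exists 0, a; rewrite scale0r add0r; split=> //; exact: IH.
Qed.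

Lemma gen_sub e (V : set M) : submod V -> (forall a, a \in e -> V a) ->
  forall m, gen e m -> V m.
Proof.
move=> sV; elim: e => [|a e IH] h m; first by move=> /gen_nil ->; case: sV.
move=> /gen_cons[s [w [hw ->]]]; apply: sV.2; first by apply: h; rewrite inE eqxx.
by apply: IH => // b be; apply: h; rewrite inE be orbT.
Qed.

Lemma gen_catl e1 e2 m : gen e1 m -> gen (e1 ++ e2) m.
Proof. by apply: gen_sub; [exact: gen_submod|move=> a h; apply: gen_mem; rewrite mem_cat h]. Qed.
Lemma gen_catr e1 e2 m : gen e2 m -> gen (e1 ++ e2) m.
Proof. by apply: gen_sub; [exact: gen_submod|move=> a h; apply: gen_mem; rewrite mem_cat h orbT]. Qed.
End GenM.

Lemma dickson1 (D : nat -> Prop) : (exists n, D n) ->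
  exists n, D n /\ forall m, D m -> (n <= m)%N.
Proof.
move=> [n Dn]; have ex : exists n, `[< D n >] by exists n; apply/asboolP.
case: (ex_minnP ex) => m /asboolP Dm hm; exists m; split=> // l Dl.
by apply: hm; apply/asboolP.
Qed.

(** Dickson's lemma for N^2: what one element (a0, b0) does not dominate lies in finitely many
    columns a < a0 or rows b < b0, and each of these needs at most one more element. *)
Lemma dickson (D : nat -> nat -> Prop) : exists l : seq (nat * nat),
  (forall u, u \in l -> D u.1 u.2) /\
  forall a b, D a b -> exists u, [/\ u \in l, (u.1 <= a)%N & (u.2 <= b)%N].
Proof.
have cols (E : nat -> nat -> Prop) n : exists l : seq (nat * nat),
  (forall u, u \in l -> E u.1 u.2) /\ forall a b, (a < n)%N -> E a b ->
    exists u, [/\ u \in l, (u.1 <= a)%N & (u.2 <= b)%N].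
  elim: n => [|n [l [h1 h2]]]; first by exists [::].
  have [ex|nex] := pselect (exists b, E n b).
    have [b [Eb hb]] := dickson1 ex; exists ((n, b) :: l); split.
      by move=> u; rewrite inE => /orP[/eqP ->|/h1].
    move=> a c; rewrite ltnS leq_eqVlt => /orP[/eqP ->|an] Ec.
      by exists (n, b); rewrite inE eqxx; split=> //; exact: hb.
    by have [u [ul ua ub]] := h2 _ _ an Ec; exists u; rewrite inE ul orbT.
  exists l; split=> // a c; rewrite ltnS leq_eqVlt => /orP[/eqP ->|an] Ec; last exact: h2.
  by case: nex; exists c.
have [[a0 [b0 D0]]|nD] := pselect (exists a b, D a b); last first.
  by exists [::]; split=> // a b Dab; case: nD; exists a, b.
have [l1 [h1 c1]] := cols D a0.
have [l2 [h2 c2]] := cols (fun b a => D a b) b0.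
exists ((a0, b0) :: l1 ++ [seq (u.2, u.1) | u <- l2]); split.
  move=> u; rewrite inE mem_cat => /orP[/eqP -> //|/orP[/h1 //|/mapP[v /h2 Dv ->] //]].
move=> a b Dab; case: (ltnP a a0) => ha.
  have [u [ul ua ub]] := c1 _ _ ha Dab; exists u; split=> //.
  by rewrite inE mem_cat ul orbT.
case: (ltnP b b0) => hb.
  have [u [ul ua ub]] := c2 _ _ hb Dab; exists (u.2, u.1); split=> //.
  by rewrite inE mem_cat (map_f (fun u => (u.2, u.1))) // !orbT.
by exists (a0, b0); rewrite inE eqxx.
Qed.

Lemma mem_lift (A B : eqType) (P : A -> B -> Prop) (l : seq A) :
  (forall a, a \in l -> exists b, P a b) ->
  exists l' : seq B, (forall a, a \in l -> exists2 b, b \in l' & P a b) /\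
    (forall b, b \in l' -> exists2 a, a \in l & P a b).
Proof.
elim: l => [|a l IH] h; first by exists [::].
have [|l' [h1 h2]] := IH; first by move=> x xl; apply: h; rewrite inE xl orbT.
have [|b Pb] := h a; first by rewrite inE eqxx.
exists (b :: l'); split=> x; rewrite inE => /orP[/eqP ->|xl].
- by exists b => //; rewrite inE eqxx.
- by have [y yl Pxy] := h1 _ xl; exists y => //; rewrite inE yl orbT.
- by exists a => //; rewrite inE eqxx.
- by have [y yl Pxy] := h2 _ xl; exists y => //; rewrite inE yl orbT.
Qed.

(** The Groebner basis argument: by [dickson] finitely many leading monomials divide all others, and
    subtracting a multiple of the corresponding element lowers the leading monomial. *)
Lemma noeth_ideal (I : set (S^o : lmodType S)) : submod I ->
  exists e : seq (S^o : lmodType S), (forall a, a \in e -> I a) /\ forall s, I s -> gen e s.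
Proof.
move=> sI.
pose D a b := exists s : S, [/\ I s, s != 0 & mpoly.mlead s 0 = a /\ mpoly.mlead s 1 = b].
have [l [h1 h2]] := dickson D.
have [e [he1 he2]] := @mem_lift _ S (fun u s => [/\ I s, s != 0 & mpoly.mlead s 0 = u.1 /\ mpoly.mlead s 1 = u.2]) l h1.
exists e; split=> [a /he2[u ul [Ia _ _]] //|].
elim/mpoly.mleadrect => s IH Is.
have [->|s0] := eqVneq s 0; first exact: (@gen_submod S^o e).1.
have [|u [ul ua ub]] := h2 (mpoly.mlead s 0) (mpoly.mlead s 1); first by exists s.
have [t te [It t0 [t1 t2]]] := he1 _ ul.
have le : mpoly.lem (mpoly.mlead t) (mpoly.mlead s).
  by apply/mpoly.mnm_lepP; elim/I2P; rewrite ?t1 ?t2.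
pose m := mpoly.mnm_sub (mpoly.mlead s) (mpoly.mlead t).
pose c := mpoly.mcoeff (mpoly.mlead s) s / mpoly.mcoeff (mpoly.mlead t) t.
pose w : S := c *: mpoly.mpolyX k m.
have ct0 : mpoly.mcoeff (mpoly.mlead t) t != 0 by rewrite -mpoly.mcoeff_msupp mpoly.mlead_supp.
have cs0 : mpoly.mcoeff (mpoly.mlead s) s != 0 by rewrite -mpoly.mcoeff_msupp mpoly.mlead_supp.
have c0 : c != 0 by rewrite mulf_neq0 ?invr_eq0.
have X0 : mpoly.mpolyX k m != 0 by rewrite -mpoly.msupp_eq0 mpoly.msuppX.
have w0 : w != 0 by rewrite scaler_eq0 negb_or c0.
have lw : mpoly.mlead (w * t) = mpoly.mlead s.
  by rewrite mpoly.mleadM // mpoly.mleadZ // mpoly.mleadXm mpoly.submK.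
have cw : mpoly.mcoeff (mpoly.mlead s) (w * t) = mpoly.mcoeff (mpoly.mlead s) s.
  rewrite -{1}lw mpoly.mleadM // mpoly.mleadcM mpoly.mleadcZE mpoly.mleadXm mpoly.mcoeffX eqxx mulr1.
  by rewrite divfK.
suff : @gen S^o e (s - w * t).
  move=> h; rewrite -[s](subrK (w * t)); apply: (submD (@gen_submod S^o e)) => //.
  by apply: (submZ (@gen_submod S^o e)); exact: (@gen_mem S^o).
have Ist : I (s - w * t) by apply: (submB sI) => //; exact: (submZ sI).
have [->|u0] := eqVneq (s - w * t) 0; first exact: (@gen_submod S^o e).1.
apply: IH => //; rewrite lt_neqAle; apply/andP; split.
  apply/eqP => e1; have : mpoly.mcoeff (mpoly.mlead (s - w * t)) (s - w * t) != 0.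
    by rewrite -mpoly.mcoeff_msupp mpoly.mlead_supp.
  by rewrite e1 mpoly.mcoeffB cw subrr eqxx.
by apply: le_trans (mpoly.mleadB_le _ _) _; rewrite lw joinxx.
Qed.

(** Induction on the generators. The coefficients of the first generator [a] in elements of [V] form
    an ideal [J]; lifts of generators of [J] reduce an element of [V] to one in the span of the
    remaining generators. *)
Lemma noeth (M : lmodType S) (e : seq M) (V : set M) : submod V ->
  exists l : seq M, (forall a, a \in l -> V a) /\ forall m, V m -> gen e m -> gen l m.
Proof.
elim: e V => [|a e IH] V sV.
  by exists [::]; split=> // m _ /gen_nil ->; exact/gen_nil.
have [sG0 sG] := gen_submod e.
pose J : set (S^o : lmodType S) := [set s | exists w, gen e w /\ V (s *: a + w)].
have sJ : submod J.
  split; first by exists 0; rewrite scale0r addr0; split=> //; case: sV.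
  move=> t s s' [w [hw h]] [w' [hw' h']]; exists (t *: w + w'); split; first exact: sG.
  have := sV.2 t _ _ h h'; congr V.
  by rewrite scalerDr addrACA scalerA -scalerDl.
have [js [hj1 hj2]] := noeth_ideal sJ.
have [l1 [hl1 hl2]] := mem_lift (P := fun s m => V m /\ exists w, gen e w /\ m = s *: a + w)
  (l := js) (fun s sj => let: ex_intro w (conj hw h) := hj1 s sj in
     ex_intro _ (s *: a + w) (conj h (ex_intro _ w (conj hw erefl)))).
have [l2 [hl3 hl4]] := IH V sV.
exists (l1 ++ l2); split.
  by move=> x; rewrite mem_cat => /orP[/hl2[? _ []]|/hl3].
move=> m Vm /gen_cons[s [w [hw em]]].
have [m' [gm' [w' [hw' em']]]] : exists m', gen l1 m' /\ exists w, gen e w /\ m' = s *: a + w.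
  have Js : J s by exists w; rewrite -em.
  apply: (@gen_sub S^o js (fun s => exists m', gen l1 m' /\ exists w, gen e w /\ m' = s *: a + w)) (hj2 _ Js).
    split; first by exists 0; split; [exact: (gen_submod l1).1|exists 0; rewrite scale0r addr0].
    move=> t u u' [x [gx [y [gy ex]]]] [x' [gx' [y' [gy' ex']]]].
    exists (t *: x + x'); split; first exact: (gen_submod l1).2.
    exists (t *: y + y'); split; first exact: sG.
    by rewrite ex ex' scalerDr addrACA scalerA -scalerDl.
  by move=> u uj; have [x xl [_ hx]] := hl1 _ uj; exists x; split=> //; exact: gen_mem.
have Vm' : V m' by apply: (gen_sub sV _ gm') => x /hl2[? _ []].
rewrite -[m](subrK m'); apply: submD; first exact: gen_submod.
  apply: gen_catr; apply: hl4; first exact: submB.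
  by rewrite em em' opprD addrACA subrr add0r; exact: (submB (gen_submod e)).
exact: gen_catl.
Qed.
End Gen.

(** * Homogeneous components; finite dimension in terms of powers of the variables *)

Section Graded.
Variables (k : closedFieldType) (p q : nat).
Local Notation S := (Spol k).
Local Notation L := (Lpq p q).
Local Notation xx := (@xx k).
Local Notation vx := (@vx p q).
Local Notation Shom := (@Shom k p q).
Local Notation grmod := (grmod k p q).

Section Comp.
Variable M : grmod.

(** A decomposition is picked by choice and looked up at [x]; by [hc_uniq] the result does not
    depend on the pick. *)
Definition hc (x : L) (m : M) : M :=
  let d := cid (ghom_sum m) in let d' := cid (projT2 d) in
  if x \in projT1 d then projT1 d' x else 0.

Lemma hc_ex m : exists r f, [/\ uniq r, forall x, ghom x (f x), m = \sum_(x <- r) f x &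
  forall x, hc x m = if x \in r then f x else 0].
Proof.
rewrite /hc; set d := cid _; set d' := cid _.
by have [ur hf e] := projT2 d'; exists (projT1 d), (projT1 d').
Qed.

Lemma hc_uniq r (f : L -> M) m : uniq r -> (forall x, ghom x (f x)) -> m = \sum_(x <- r) f x ->
  forall x, hc x m = if x \in r then f x else 0.
Proof.
move=> ur hf e x; have [r' [f' [ur' hf' e' ->]]] := hc_ex m.
pose R := undup (x :: r ++ r'); have uR : uniq R by exact: undup_uniq.
have sr : {subset r <= R} by move=> z zr; rewrite mem_undup inE mem_cat zr orbT.
have sr' : {subset r' <= R} by move=> z zr; rewrite mem_undup inE mem_cat zr !orbT.
have := @ghom_direct _ _ _ M R (fun x => (if x \in r' then f' x else 0) - (if x \in r then f x else 0)) uR.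
have hh : forall x, ghom x ((if x \in r' then f' x else 0) - (if x \in r then f x else 0)).
  by move=> z; apply: ghomB; exact: ghom_if.
rewrite sumrB -!big_extend // -e -e' subrr => /(_ hh erefl x).
by rewrite mem_undup inE eqxx => /(_ isT)/eqP; rewrite subr_eq0 => /eqP.
Qed.

Lemma hc_hom x m : ghom x (hc x m).
Proof. by have [r [f [_ hf _ ->]]] := hc_ex m; exact: ghom_if. Qed.

Lemma hc_sum m : exists r, [/\ uniq r, m = \sum_(x <- r) hc x m & forall x, x \notin r -> hc x m = 0].
Proof.
have [r [f [ur hf e h]]] := hc_ex m; exists r; split=> //.
  by rewrite {1}e big_seq [RHS]big_seq; apply: eq_bigr => x xr; rewrite h xr.
by move=> x /negbTE xr; rewrite h xr.
Qed.

Lemma hcD x m m' : hc x (m + m') = hc x m + hc x m'.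
Proof.
have [r [ur e h]] := hc_sum m; have [r' [ur' e' h']] := hc_sum m'.
pose R := undup (x :: r ++ r'); have uR : uniq R by exact: undup_uniq.
have sr : {subset r <= R} by move=> z zr; rewrite mem_undup inE mem_cat zr orbT.
have sr' : {subset r' <= R} by move=> z zr; rewrite mem_undup inE mem_cat zr !orbT.
rewrite (@hc_uniq R (fun x => hc x m + hc x m')) //.
- by rewrite mem_undup inE eqxx.
- move=> z; rewrite -[hc z m']opprK; apply: ghomB; first exact: hc_hom.
  by rewrite -sub0r; apply: ghomB; [exact: ghom0|exact: hc_hom].
- rewrite {1}e {1}e' (big_extend _ ur uR sr) (big_extend _ ur' uR sr') -big_split /=.
  apply: eq_bigr => z _; congr (_ + _); case: ifP => // /negbT; first by move/h.
  by move/h'.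
Qed.

Lemma hc_id x m : ghom x m -> hc x m = m.
Proof.
move=> hm; rewrite (@hc_uniq [:: x] (fun y => if y \in [:: x] then m else 0)) ?inE ?eqxx //.
  by move=> y; case: ifP; [rewrite inE => /eqP ->|move=> _; exact: ghom0].
by rewrite big_seq1 inE eqxx.
Qed.

Lemma hc_neq x y m : ghom x m -> y != x -> hc y m = 0.
Proof.
move=> hm yx; rewrite (@hc_uniq [:: x] (fun y => if y \in [:: x] then m else 0)).
- by rewrite inE (negbTE yx).
- by [].
- by move=> z; case: ifP; [rewrite inE => /eqP ->|move=> _; exact: ghom0].
- by rewrite big_seq1 inE eqxx.
Qed.

Lemma hc0 x : hc x 0 = 0. Proof. by apply: hc_id; exact: ghom0. Qed.

Lemma hc_bigsum x (I : Type) (r : seq I) (F : I -> M) :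
  hc x (\sum_(i <- r) F i) = \sum_(i <- r) hc x (F i).
Proof. by apply: (big_morph (hc x)); [exact: hcD|exact: hc0]. Qed.

Lemma hcZ x y s m : Shom y s -> hc (x + y) (s *: m) = s *: hc x m.
Proof.
move=> hs; have [r [ur e h]] := hc_sum m; rewrite {1}e scaler_sumr hc_bigsum.
have hz z : ghom (z + y) (s *: hc z m) by apply: ghomZ => //; exact: hc_hom.
case: (boolP (x \in r)) => xr.
  rewrite (bigD1_seq x) //= (hc_id (hz x)) big1 ?addr0 // => z zx.
  by apply: (hc_neq (hz z)); apply: contra zx => /eqP/addIr ->.
rewrite h // scaler0 big_seq big1 // => z zr; apply: (hc_neq (hz z)).
by apply: contraNneq xr => /addIr ->.
Qed.

Lemma hcZ' x y s m : Shom y s -> hc x (s *: m) = s *: hc (x - y) m.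
Proof. by move=> hs; rewrite -(hcZ _ _ hs) subrK. Qed.

Lemma gsubP (V : set M) : gsub V <-> submod V /\ forall x m, V m -> V (hc x m).
Proof.
split=> [[V0 VD Vh]|[sV Vh]].
  split=> // x m Vm; have [r [ur e h]] := hc_sum m.
  case: (boolP (x \in r)) => xr; last by rewrite h.
  by apply: (Vh r (hc^~ m) ur (hc_hom^~ m)) => //; rewrite -e.
split; [exact: subm0|exact: sV.2|] => r f ur hf Vs x xr.
have -> : f x = hc x (\sum_(x <- r) f x) by rewrite (hc_uniq ur hf erefl) xr.
exact: Vh.
Qed.

Lemma hom_ind (P : M -> Prop) : P 0 -> (forall m m', P m -> P m' -> P (m + m')) ->
  (forall x m, ghom x m -> P m) -> forall m, P m.
Proof.
move=> P0 PD Ph m; have [r [_ -> _]] := hc_sum m.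
by apply: big_ind => // x _; apply: (Ph x); exact: hc_hom.
Qed.

(* Membership in V, resp. vanishing, up to finite dimension. *)
Definition nearV (V : set M) (m : M) : Prop := exists N, forall b, V (xx b ^+ N *: m).
Definition near0 (m : M) : Prop := exists N, forall b, xx b ^+ N *: m = 0.

Lemma near_mono (V W : set M) m : (forall x, V x -> W x) -> nearV V m -> nearV W m.
Proof. by move=> h [N hN]; exists N => b; exact: h. Qed.

Lemma near_in (V : set M) m : V m -> nearV V m.
Proof. by move=> h; exists 0%N => b; rewrite expr0 scale1r. Qed.

Lemma nearE (V : set M) m N N' : submod V -> (N <= N')%N ->
  (forall b, V (xx b ^+ N *: m)) -> forall b, V (xx b ^+ N' *: m).
Proof. by move=> sV le h b; rewrite -(subnK le) exprD -scalerA; exact: submZ. Qed.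

Lemma near_submod (V : set M) : submod V -> submod (nearV V).
Proof.
move=> sV; split; first by apply: near_in; exact: subm0.
move=> a m m' [N h] [N' h']; exists (N + N')%N => b.
rewrite scalerDr scalerA mulrC -scalerA; apply: sV.2.
  exact: (nearE sV (leq_addr N' N) h).
exact: (nearE sV (leq_addl N N') h').
Qed.

Lemma near_near (V : set M) m : submod V -> nearV (nearV V) m -> nearV V m.
Proof.
move=> sV [N h]; have [N0 h0] := h 0; have [N1 h1] := h 1.
exists (N + (N0 + N1))%N; elim/I2P; rewrite addnC exprD -scalerA.
  exact: (nearE sV (leq_addr N1 N0) h0).
exact: (nearE sV (leq_addl N0 N1) h1).
Qed.

Lemma near_hom (V : set M) x m : gsub V -> nearV V m -> nearV V (hc x m).
Proof.
move=> /gsubP[sV hV] [N h]; exists N => b; rewrite -(hcZ _ _ (@Shom_xxn k p q b N)).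
exact: hV.
Qed.

Lemma near_gsub (V : set M) : gsub V -> gsub (nearV V).
Proof.
move=> gV; have [sV _] := (gsubP V).1 gV; apply/gsubP; split; first exact: near_submod.
by move=> x m; exact: near_hom.
Qed.

Lemma zero_gsub : gsub [set 0 : M].
Proof.
apply/gsubP; split; first by split=> // a m m' /= -> ->; rewrite scaler0 addr0.
by move=> x m /= ->; rewrite hc0.
Qed.

Lemma near0_gsub : gsub (near0 : set M). Proof. exact: near_gsub zero_gsub. Qed.
Lemma near0_submod : submod (near0 : set M).
Proof. by have /gsubP[] := near0_gsub. Qed.

Lemma near0_idem m : nearV (near0 : set M) m -> near0 m.
Proof. by apply: (@near_near [set 0]); have /gsubP[] := zero_gsub. Qed.

(** Large powers of both variables lie in the ideal generated by [s] and [t]. *)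
Lemma near_mprim (V : set M) s t m : submod V -> mprim s t -> V (s *: m) -> V (t *: m) -> nearV V m.
Proof.
move=> sV [N h] Vs Vt; exists N => b; have [u [v ->]] := h b.
by rewrite scalerDl -!scalerA; apply: submD => //; exact: submZ.
Qed.

Lemma common_near (V : set M) (e : seq M) : submod V -> (forall a, a \in e -> nearV V a) ->
  exists N, forall a, a \in e -> forall b, V (xx b ^+ N *: a).
Proof.
move=> sV; elim: e => [|a e IH] h; first by exists 0%N.
have [|N hN] := IH; first by move=> x xe; apply: h; rewrite inE xe orbT.
have [|N' hN'] := h a; first by rewrite inE eqxx.
exists (N + N')%N => x; rewrite inE => /orP[/eqP ->|xe].
  exact: (nearE sV (leq_addl N N') hN').
exact: (nearE sV (leq_addr N' N) (hN _ xe)).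
Qed.
End Comp.
Hypotheses (p_gt0 : (0 < p)%N) (q_gt0 : (0 < q)%N).

Lemma homX M x m b i : @ghom _ _ _ M x m -> ghom (x + vx b *+ i) (xx b ^+ i *: m).
Proof. by move=> h; apply: ghomZ => //; exact: Shom_xxn. Qed.

(** By linear algebra, [size e + 1] of the elements [xx b ^+ i *: m] satisfy a nontrivial relation
    modulo [W]. Their degrees are distinct by [vx_inj], so each term of the relation lies in [W]. *)
Lemma dep (M : grmod) (W : set M) (e : seq M) b x m : gsub W -> ghom x m ->
  (forall i, exists u, kspan e u /\ W (xx b ^+ i *: m - u)) ->
  exists i, W (xx b ^+ i *: m).
Proof.
move=> /gsubP[sW hW] hm h.
have {h}h i : exists c : nat -> k, W (xx b ^+ i *: m - lcomb (fun j => mpoly.mpolyC 2 (c j)) e).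
  by have [u [[c ->] hu]] := h i; exists c.
pose c i := projT1 (cid (h i)); have hcc i := projT2 (cid (h i)).
pose A := \matrix_(i < (size e).+1, j < size e) c i j.
have [v vA v0] : exists2 v : 'rV[k]_(size e).+1, v *m A = 0 & v != 0.
  have /rowV0Pn[v vk v0] : kermx A != 0.
    by rewrite -mxrank_eq0 mxrank_ker subn_eq0 -ltnNge ltnS rank_leq_col.
  by exists v => //; apply/sub_kermxP.
have [i vi] : exists i, v 0 i != 0.
  by apply/existsP; rewrite -negb_forall; apply: contra v0 => /forallP h0; apply/eqP/rowP => j; rewrite mxE; exact/eqP/h0.
exists i.
pose s := \sum_(j < (size e).+1) mpoly.mpolyC 2 (v 0 j) *: (xx b ^+ j *: m).
have Ws : W s.
  have -> : s = \sum_(j < (size e).+1) mpoly.mpolyC 2 (v 0 j) *: (xx b ^+ j *: m - lcomb (fun l => mpoly.mpolyC 2 (c j l)) e).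
    transitivity (s - \sum_(j < (size e).+1) mpoly.mpolyC 2 (v 0 j) *: lcomb (fun l => mpoly.mpolyC 2 (c j l)) e).
      rewrite [X in _ - X](_ : _ = 0) ?subr0 // /lcomb.
      under eq_bigr => j _ do rewrite scaler_sumr.
      rewrite exchange_big big1 // => l _ /=.
      under eq_bigr => j _ do rewrite scalerA -mpoly.mpolyCM.
      rewrite -scaler_suml.
      rewrite -(big_morph (@mpoly.mpolyC 2 k) (@mpoly.mpolyCD 2 k) (@mpoly.mpolyC0 2 k)).
      have -> : \sum_(j < (size e).+1) v 0 j * c j l = 0.
        by have /rowP/(_ l) := vA; rewrite !mxE => e0; apply: etrans e0; apply: eq_bigr => j _; rewrite mxE.
      by rewrite mpoly.mpolyC0 scale0r.
    by rewrite -sumrB; apply: eq_bigr => j _; rewrite scalerBr.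
  by apply: subm_sum => // j _; apply: submZ => //; exact: hcc.
have hC (a : k) : Shom 0 (mpoly.mpolyC 2 a : S).
  by rewrite -mpoly.alg_mpolyC; apply: ShomZ; exact: Shom_1.
have hj j : ghom (x + vx b *+ j) (mpoly.mpolyC 2 (v 0 (inord j)) *: (xx b ^+ j *: m)).
  by have := ghomZ (hC (v 0 (inord j))) (homX b j hm); rewrite addr0.
have := hW (x + vx b *+ i) s Ws.
rewrite /s hc_bigsum (bigD1 i) //= big1 => [|j ji].
  have := hj i; rewrite inord_val => /hc_id ->; rewrite addr0 => h0.
  have := submZ sW (mpoly.mpolyC 2 (v 0 i)^-1) h0.
  by rewrite (scalerA (mpoly.mpolyC 2 (v 0 i)^-1)) -mpoly.mpolyCM mulVf // mpoly.mpolyC1 scale1r.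
have := hj j; rewrite inord_val => /hc_neq; apply.
apply: contra ji => /eqP/addrI e0; apply/eqP/val_inj/esym.
exact: (vx_inj p_gt0 q_gt0 e0).
Qed.

Lemma kspan_mem (M : lmodType S) (e : seq M) a (c : k) : a \in e -> kspan e (mpoly.mpolyC 2 c *: a).
Proof.
elim: e => [//|b e IH]; rewrite inE => /orP[/eqP ->|ae]; apply/kspan_consP.
  by exists c, 0; rewrite addr0; split=> //; exact: kspan0.
by exists 0, (mpoly.mpolyC 2 c *: a); rewrite mpoly.mpolyC0 scale0r add0r; split=> //; exact: IH.
Qed.

Lemma kspanD (M : lmodType S) (e : seq M) u v : kspan e u -> kspan e v -> kspan e (u + v).
Proof. by move=> hu hv; have := kspanP 1 hu hv; rewrite mpoly.mpolyC1 scale1r. Qed.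

(** Only the N^2 monomials with both exponents below N survive modulo the two N-th powers. *)
Lemma trunc1 (M : lmodType S) (a : M) N : exists l : seq M, forall s : S, exists u,
  kspan l u /\ gen [seq xx b ^+ N *: a | b <- [:: 0; 1]] (s *: a - u).
Proof.
pose l := [seq (xx 0 ^+ ij.1 * xx 1 ^+ ij.2) *: a | ij <- allpairs pair (iota 0 N) (iota 0 N)].
exists l; set G := gen _; have sG : submod G by exact: gen_submod.
elim/S_ind => [|s t [u [hu gu]] [v [hv gv]]|c i j].
- exists 0; rewrite scale0r subrr; split; [exact: kspan0|exact: subm0].
- exists (u + v); split; first exact: kspanD.
  by rewrite scalerDl opprD addrACA; exact: submD.
- case: (ltnP i N) => iN; last first.
    exists 0; split; first exact: kspan0.
    have -> : (c *: (xx 0 ^+ i * xx 1 ^+ j)) *: a - 0 =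
              (c *: (xx 0 ^+ (i - N) * xx 1 ^+ j)) *: (xx 0 ^+ N *: a).
      by rewrite subr0 scalerA -scalerAl mulrAC -exprD subnK.
    by apply: submZ => //; apply: gen_mem; rewrite /= !inE eqxx.
  case: (ltnP j N) => jN; last first.
    exists 0; split; first exact: kspan0.
    have -> : (c *: (xx 0 ^+ i * xx 1 ^+ j)) *: a - 0 =
              (c *: (xx 0 ^+ i * xx 1 ^+ (j - N))) *: (xx 1 ^+ N *: a).
      by rewrite subr0 scalerA -scalerAl -mulrA -exprD subnK.
    by apply: submZ => //; apply: gen_mem; rewrite /= !inE eqxx orbT.
  exists (mpoly.mpolyC 2 c *: ((xx 0 ^+ i * xx 1 ^+ j) *: a)); split.
    apply: kspan_mem; apply/mapP; exists (i, j) => //.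
    by apply/allpairsP; exists (i, j); rewrite !mem_iota.
  by rewrite scalerA mpoly.mul_mpolyC subrr; exact: subm0.
Qed.

Lemma trunc (M : lmodType S) (e : seq M) N : exists l : seq M, forall m : M, gen e m -> exists u,
  kspan l u /\ gen [seq xx b ^+ N *: a | a <- e, b <- [:: 0; 1]] (m - u).
Proof.
elim: e => [|a e [l IH]].
  by exists [::] => m /gen_nil ->; exists 0; rewrite subrr; split; [exact: kspan0|exact/gen_nil].
have [l' hl'] := trunc1 a N; exists (l' ++ l) => m /gen_cons[s [w [hw ->]]].
have [u [hu gu]] := IH _ hw; have [v [hv gv]] := hl' s.
exists (v + u); split; first exact: kspan_catl.
rewrite opprD addrACA; apply: submD; first exact: gen_submod.
  exact: (gen_catl _ gv).
exact: (gen_catr _ gu).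
Qed.

(** In a finite dimensional quotient the powers of a variable applied to a homogeneous element stay
    in a finite span, so [dep] applies. Conversely, once large powers bring the generators into [V],
    [trunc] leaves only finitely many monomials. *)
Lemma cofdimP (M : grmod) (V : set M) : gsub V -> cofdim V <-> forall m, nearV V m.
Proof.
move=> gV; have [sV hV] := (gsubP V).1 gV; split=> [[e he]|h].
  apply: hom_ind => [|m m'|x m hm]; [|exact: submD (near_submod sV) _ _|].
    exact: subm0 (near_submod sV).
  have hb b : exists i, V (xx b ^+ i *: m).
    apply: (dep gV hm (e := e)) => i; have [u hu Vu] := he (xx b ^+ i *: m).
    by exists u.
  have [i0 h0] := hb 0; have [i1 h1] := hb 1; exists (i0 + i1)%N.
  by elim/I2P; [rewrite addnC|]; rewrite exprD -scalerA; exact: submZ.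
have [e he] := gfingen M.
have [N hN] := common_near (e := e) sV (fun a _ => h a).
have [l hl] := trunc e N; exists l => m.
have [u [hu gu]] := hl m (he m); exists u => //.
apply: (gen_sub sV _ gu) => x /allpairsP[[a b] [/= ae _ ->]].
exact: hN.
Qed.

(** For the converse [V] itself is finitely generated by [noeth]; one exponent then kills all
    generators and [trunc] bounds the dimension. *)
Lemma fdimP (M : grmod) (V : set M) : gsub V -> fdim V <-> forall m, V m -> near0 m.
Proof.
move=> gV; have [sV hV] := (gsubP V).1 gV; have [s0 _] := (gsubP _).1 (zero_gsub M).
split=> [[e he]|h].
  move=> m Vm; have [r [_ -> _]] := hc_sum m.
  apply: (subm_sum (near0_submod M)) => x _; have Vx := hV x _ Vm; move: (hc_hom x m) Vx.
  move: (hc x m) => {Vm r}m hm Vm.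
  have hb b : exists i, [set 0] (xx b ^+ i *: m).
    apply: (dep (zero_gsub M) hm (e := e)) => i; exists (xx b ^+ i *: m); split; last by rewrite /= subrr.
    by apply: he; exact: submZ.
  have [i0 h0] := hb 0; have [i1 h1] := hb 1; exists (i0 + i1)%N.
  elim/I2P; last by rewrite exprD -scalerA h1 scaler0.
  by rewrite addnC exprD -scalerA h0 scaler0.
have [e he] := gfingen M; have [l [hl1 hl2]] := noeth e sV.
have [N hN] := common_near (e := l) s0 (fun a al => h a (hl1 a al)).
have [l' hl'] := trunc l N; exists l' => m Vm.
have [u [hu gu]] := hl' m (hl2 m Vm (he m)).
suff : [set 0] (m - u) by move=> /= /eqP; rewrite subr_eq0 => /eqP ->.
apply: (gen_sub s0 _ gu) => x /allpairsP[[a b] [/= ae _ ->]].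
exact: hN.
Qed.
End Graded.

(** * Graded quotient modules *)

Section GradedQuotient.
Variables (k : closedFieldType) (p q : nat).

(** The proof [hV] is carried as an argument so that the closure instances, and with them the
    quotient structures, can be found from the type alone. *)
Definition gq_pred (M : grmod k p q) (V : set M) (hV : gsub V) : {pred M} := fun m => `[< V m >].

Lemma gq_pred_closed (M : grmod k p q) (V : set M) (hV : gsub V) : zmod_closed (gq_pred hV).
Proof.
have [sV _] := (gsubP V).1 hV; split=> [|x y /asboolP h1 /asboolP h2]; apply/asboolP.
  exact: subm0.
exact: submB.
Qed.
End GradedQuotient.

HB.instance Definition _ k p q (M : grmod k p q) (V : set M) (hV : gsub V) :=
  GRing.isZmodClosed.Build M (gq_pred hV) (gq_pred_closed hV).

Definition gqt k p q (M : grmod k p q) (V : set M) (hV : gsub V) : Type := Quotient.quot (gq_pred hV).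
HB.instance Definition _ k p q (M : grmod k p q) (V : set M) (hV : gsub V) :=
  GRing.Zmodule.copy (gqt hV) (Quotient.quot (gq_pred hV)).

Section GradedQuotient.
Variables (k : closedFieldType) (p q : nat) (M : grmod k p q) (V : set M) (hV : gsub V).
Local Notation S := (Spol k).

Definition gpi (m : M) : gqt hV := \pi_(Quotient.quot (gq_pred hV)) m.

Lemma gpiB : {morph gpi : x y / x - y}.
Proof. by move=> x y; rewrite /gpi raddfB. Qed.

Lemma gpiP x y : gpi x = gpi y <-> V (x - y).
Proof.
split=> [/eqP|h]; first by rewrite eqmodE /= Quotient.equivE => /asboolP.
by apply/eqP; rewrite eqmodE /= Quotient.equivE; apply/asboolP.
Qed.

Lemma gpi_surj (u : gqt hV) : exists m, u = gpi m.
Proof. by elim/quotW: u => m; exists m. Qed.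

Definition gscale (a : S) (u : gqt hV) : gqt hV := gpi (a *: repr (u : Quotient.quot (gq_pred hV))).

Lemma gscaleE a m : gscale a (gpi m) = gpi (a *: m).
Proof.
apply/gpiP; rewrite -scalerBr; have [sV _] := (gsubP V).1 hV; apply: submZ => //.
by apply/gpiP; rewrite /gpi reprK.
Qed.

Lemma gpiD : {morph gpi : x y / x + y}.
Proof.
move=> x y; have g0 : gpi 0 = 0 by have := gpiB 0 0; rewrite !subrr.
have gN z : gpi (- z) = - gpi z by rewrite -sub0r gpiB g0 sub0r.
by rewrite -[y in LHS]opprK gpiB gN opprK.
Qed.
Lemma gscaleA a b u : gscale a (gscale b u) = gscale (a * b) u.
Proof. by have [m ->] := gpi_surj u; rewrite !gscaleE scalerA. Qed.
Lemma gscale1 : left_id 1 gscale.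
Proof. by move=> u; have [m ->] := gpi_surj u; rewrite !gscaleE scale1r. Qed.
Lemma gscaleDr : right_distributive gscale +%R.
Proof.
move=> a u v; have [m ->] := gpi_surj u; have [n ->] := gpi_surj v.
by rewrite -gpiD !gscaleE -gpiD scalerDr.
Qed.
Lemma gscaleDl u : {morph gscale^~ u : a b / a + b}.
Proof. by move=> a b; have [m ->] := gpi_surj u; rewrite !gscaleE -gpiD scalerDl. Qed.
End GradedQuotient.

HB.instance Definition _ k p q (M : grmod k p q) (V : set M) (hV : gsub V) :=
  GRing.Zmodule_isLmodule.Build (Spol k) (gqt hV) (@gscaleA k p q M V hV) (@gscale1 k p q M V hV)
    (@gscaleDr k p q M V hV) (@gscaleDl k p q M V hV).

Section GradedQuotient.
Variables (k : closedFieldType) (p q : nat) (M : grmod k p q) (V : set M) (hV : gsub V).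
Local Notation S := (Spol k).
Local Notation L := (Lpq p q).
Local Notation gpi := (@gpi k p q M V hV).

Lemma gpi_lin : linear (gpi : M -> gqt hV).
Proof. by move=> a u v; rewrite gpiD -gscaleE. Qed.

Lemma gpiZ a m : gpi (a *: m) = a *: gpi m. Proof. by rewrite -gscaleE. Qed.
Lemma gpi0 : gpi 0 = 0. Proof. by have := gpiB hV 0 0; rewrite !subrr. Qed.

Lemma gpi_eq0 m : gpi m = 0 <-> V m.
Proof. by rewrite -gpi0 gpiP subr0. Qed.

Definition gq_hom (x : L) : set (gqt hV) := [set u | exists2 m, ghom x m & u = gpi m].

Lemma gpi_sum (I : Type) (r : seq I) (F : I -> M) : gpi (\sum_(i <- r) F i) = \sum_(i <- r) gpi (F i).
Proof. by apply: (big_morph gpi); [exact: gpiD|exact: gpi0]. Qed.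

Definition gquot : grmod k p q.
Proof.
refine (@GrMod k p q (gqt hV : lmodType S) gq_hom _ _ _ _ _ _).
- by move=> x; exists 0; [exact: ghom0|rewrite gpi0].
- by move=> x _ _ [m hm ->] [n hn ->]; exists (m - n); [exact: ghomB|rewrite gpiB].
- by move=> x y s _ hs [m hm ->]; exists (s *: m); [exact: ghomZ|rewrite gpiZ].
- move=> u; have [m ->] := gpi_surj u; have [r [ur e h]] := hc_sum m.
  exists r, (fun x => gpi (hc x m)); split=> // [x|]; first by exists (hc x m) => //; exact: hc_hom.
  by rewrite {1}e gpi_sum.
- move=> r f ur hf e x xr.
  pose g x : M := s2val (cid2 (hf x)).
  have gh y : ghom y (g y) by rewrite /g; case: (cid2 (hf y)).
  have ge y : f y = gpi (g y) by rewrite /g; case: (cid2 (hf y)).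
  have Vs : V (\sum_(y <- r) g y).
    apply/gpi_eq0; rewrite gpi_sum; apply: etrans e.
    by apply: eq_bigr => y _; rewrite ge.
  rewrite ge; apply/gpi_eq0; have := ((gsubP V).1 hV).2 x _ Vs.
  by rewrite (hc_uniq ur gh erefl) xr.
- have [e he] := gfingen M; exists (map gpi e) => u; have [m ->] := gpi_surj u.
  have [c ->] := he m; exists c; rewrite lcomb_map //; exact: gpi_lin.
Defined.

Definition pr (m : M) : gquot := gpi m.
Lemma pr_lin : linear pr. Proof. exact: gpi_lin. Qed.
Lemma pr_hom x m : ghom x m -> ghom x (pr m). Proof. by move=> h; exists m. Qed.
Lemma pr_eq0 m : pr m = 0 <-> V m. Proof. exact: gpi_eq0. Qed.
Lemma pr_surj u : exists m, u = pr m. Proof. exact: gpi_surj. Qed.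
End GradedQuotient.

(** * The quotient category *)

Section Category.
Variables (k : closedFieldType) (p q : nat).
Hypotheses (p_gt0 : (0 < p)%N) (q_gt0 : (0 < q)%N).
Local Notation S := (Spol k).
Local Notation L := (Lpq p q).
Local Notation xx := (@xx k).
Local Notation grmod := (grmod k p q).
Implicit Types M N P : grmod.

Lemma hc_dsum M N x (u : dsum M N) : hc x u = (hc x u.1, hc x u.2).
Proof.
have [r [ur e h]] := hc_sum u.
have h1 := @hc_uniq _ _ _ M r (fun z => (hc z u).1) u.1 ur (fun z => (hc_hom z u).1).
have h2 := @hc_uniq _ _ _ N r (fun z => (hc z u).2) u.2 ur (fun z => (hc_hom z u).2).
have [e1 e2] : u.1 = \sum_(z <- r) (hc z u).1 /\ u.2 = \sum_(z <- r) (hc z u).2.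
  by move: e; rewrite pair_sum => e; rewrite {1 3}e.
rewrite (h1 e1) (h2 e2); case: (boolP (x \in r)) => xr; first by case: (hc x u).
by rewrite h.
Qed.

Lemma gsub_pair M N (G : set (dsum M N)) : submod G ->
  (forall x m n, G (m, n) -> G (hc x m, hc x n)) -> gsub G.
Proof. by move=> sG hG; apply/gsubP; split=> // x [m n] /hG; rewrite hc_dsum. Qed.

Lemma pairZ M N (a : S) m n : a *: ((m, n) : dsum M N) = (a *: m, a *: n).
Proof. by []. Qed.
Lemma pairD M N m n m' n' : ((m, n) : dsum M N) + (m', n') = (m + m', n + n').
Proof. by []. Qed.
Lemma pairB M N m n m' n' : ((m, n) : dsum M N) - (m', n') = (m - m', n - n').
Proof. by []. Qed.

Lemma nearV_hom M (V : set M) m : gsub V -> (forall x, nearV V (hc x m)) -> nearV V m.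
Proof.
move=> /gsubP[sV _] h; have [r [_ -> _]] := hc_sum m.
by apply: (subm_sum (near_submod sV)).
Qed.

Definition gdom M N (G : set (dsum M N)) : set M := [set m | exists n, G (m, n)].

Lemma gdom_gsub M N (G : set (dsum M N)) : gsub G -> gsub (gdom G).
Proof.
move=> /gsubP[sG hG]; apply/gsubP; split; first split.
- by exists 0; exact: (subm0 sG).
- by move=> a m m' [n h] [n' h']; exists (a *: n + n'); exact: (sG.2 a _ _ h h').
- by move=> x m [n h]; exists (hc x n); have := hG x _ h; rewrite hc_dsum.
Qed.

Definition gker M N (G : set (dsum M N)) : set N := [set n | G (0, n)].

Lemma gker_gsub M N (G : set (dsum M N)) : gsub G -> gsub (gker G).
Proof.
move=> /gsubP[sG hG]; apply/gsubP; split; first split.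
- exact: (subm0 sG).
- move=> a m m' h h'; have := sG.2 a _ _ h h'.
  by congr G; congr (_, _) => /=; rewrite scaler0 addr0.
- by move=> x m h; have := hG x _ h; rewrite hc_dsum /= hc0.
Qed.

Definition gimg M N (G : set (dsum M N)) : set N := [set n | exists m, G (m, n)].

Lemma gimg_gsub M N (G : set (dsum M N)) : gsub G -> gsub (gimg G).
Proof.
move=> /gsubP[sG hG]; apply/gsubP; split; first split.
- by exists 0; exact: (subm0 sG).
- by move=> a m m' [n h] [n' h']; exists (a *: n + n'); exact: (sG.2 a _ _ h h').
- by move=> x m [n h]; exists (hc x n); have := hG x _ h; rewrite hc_dsum.
Qed.

Lemma mkq M N (G : set (dsum M N)) : gsub G -> (forall m, nearV (gdom G) m) ->
  (forall n, G (0, n) -> near0 n) -> is_qgraph G.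
Proof.
move=> gG hd hk; split=> //.
  exact: ((cofdimP p_gt0 q_gt0 (gdom_gsub gG)).2 hd).
exact: ((fdimP p_gt0 q_gt0 (gker_gsub gG)).2 hk).
Qed.

Section Access.
Variables (M N : grmod) (f : qhom M N).
Lemma qg_sub : gsub (graph f). Proof. by case: (graphP f). Qed.
Lemma qg_submod : submod (graph f). Proof. by have /gsubP[] := qg_sub. Qed.
Lemma qg0 : graph f (0, 0). Proof. exact: (subm0 qg_submod). Qed.
Lemma qgD m n m' n' : graph f (m, n) -> graph f (m', n') -> graph f (m + m', n + n').
Proof. exact: (submD qg_submod). Qed.
Lemma qgB m n m' n' : graph f (m, n) -> graph f (m', n') -> graph f (m - m', n - n').
Proof. exact: (submB qg_submod). Qed.
Lemma qgZ a m n : graph f (m, n) -> graph f (a *: m, a *: n).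
Proof. exact: (submZ qg_submod). Qed.
Lemma qgH x m n : graph f (m, n) -> graph f (hc x m, hc x n).
Proof. by have /gsubP[_ h] := qg_sub => /(h x); rewrite hc_dsum. Qed.
Lemma qdom m : nearV (gdom (graph f)) m.
Proof. by case: (graphP f) => h1 h2 _; exact: ((cofdimP p_gt0 q_gt0 (gdom_gsub h1)).1 h2). Qed.
Lemma qker n : graph f (0, n) -> near0 n.
Proof. by case: (graphP f) => h1 _ h2; exact: ((fdimP p_gt0 q_gt0 (gker_gsub h1)).1 h2). Qed.
Lemma qfun m n n' : graph f (m, n) -> graph f (m, n') -> near0 (n - n').
Proof. by move=> h h'; apply: qker; rewrite -(subrr m); exact: qgB. Qed.
End Access.

Lemma near0Z M a (m : M) : near0 m -> near0 (a *: m).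
Proof. exact: (submZ (near0_submod M)). Qed.
Lemma near0D M (m m' : M) : near0 m -> near0 m' -> near0 (m + m').
Proof. exact: (submD (near0_submod M)). Qed.
Lemma near0B M (m m' : M) : near0 m -> near0 m' -> near0 (m - m').
Proof. exact: (submB (near0_submod M)). Qed.
Lemma near0N M (m : M) : near0 m -> near0 (- m).
Proof. exact: (submN (near0_submod M)). Qed.
Lemma near00 M : near0 (0 : M). Proof. exact: (subm0 (near0_submod M)). Qed.
Lemma near0H M x (m : M) : near0 m -> near0 (hc x m).
Proof. by have /gsubP[_] := near0_gsub M; apply. Qed.
Lemma near0_mul M (K : nat) (m : M) : (forall b, near0 (xx b ^+ K *: m)) -> near0 m.
Proof. by move=> h; apply: near0_idem; exists K. Qed.
Lemma near0_trans M (a b c : M) : near0 (a - b) -> near0 (b - c) -> near0 (a - c).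
Proof. by move=> h h'; rewrite -(subrKA b); exact: near0D. Qed.
Lemma near0_sym M (a b : M) : near0 (a - b) -> near0 (b - a).
Proof. by move=> h; rewrite -opprB; exact: near0N. Qed.

(** The best choices in the colimit are explicit: the common domain as [M''] and all elements killed
    by large powers of both variables as [N'']. *)
Lemma qeqP M N (f g : qhom M N) :
  qeq f g <-> forall m n1 n2, graph f (m, n1) -> graph g (m, n2) -> near0 (n1 - n2).
Proof.
split=> [[M'' [N'' [[gM cM] [gN fN] hd h]]] m n1 n2 h1 h2|h].
  have [K hK] := (cofdimP p_gt0 q_gt0 gM).1 cM m.
  apply: (near0_mul (K := K)) => b; apply: ((fdimP p_gt0 q_gt0 gN).1 fN).
  by rewrite scalerBr; apply: (h _ _ _ (hK b)); exact: qgZ.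
pose M'' := [set m | gdom (graph f) m /\ gdom (graph g) m].
have gM : gsub M''.
  have [[sf hf] [sg hg]] := ((gsubP _).1 (gdom_gsub (qg_sub f)), (gsubP _).1 (gdom_gsub (qg_sub g))).
  apply/gsubP; split; first split; first by split; exact: subm0.
    by move=> a m m' [h1 h2] [h1' h2']; split; [exact: sf.2|exact: sg.2].
  by move=> x m [h1 h2]; split; [exact: hf|exact: hg].
exists M'', (@near0 _ _ _ N); split; [split=> //|split; first exact: near0_gsub| |].
- apply/(cofdimP p_gt0 q_gt0 gM) => m; have [K hK] := qdom f m; have [K' hK'] := qdom g m.
  have [sf _] := (gsubP _).1 (gdom_gsub (qg_sub f)).
  have [sg _] := (gsubP _).1 (gdom_gsub (qg_sub g)).
  exists (K + K')%N => b; split; first exact: (nearE sf (leq_addr K' K) hK).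
  exact: (nearE sg (leq_addl K K') hK').
- exact: ((fdimP p_gt0 q_gt0 (near0_gsub N)).2 (fun _ => id)).
- by move=> m [].
- by move=> m n1 n2 _; exact: h.
Qed.

(** Large powers of the variables bring [m] into the domain of [f], and [near0_mul] removes them
    again; partially defined maps are handled in this way. *)
Lemma qdomI M N (f : qhom M N) P (m : M) (y : P) :
  (forall a n, graph f (a *: m, n) -> near0 (a *: y)) -> near0 y.
Proof.
by move=> h; have [K hK] := qdom f m; apply: (near0_mul (K := K)) => b; have [n hn] := hK b; exact: (h _ n).
Qed.

Lemma qeq_refl M N (f : qhom M N) : qeq f f.
Proof. by apply/qeqP => m n1 n2; exact: qfun. Qed.
Lemma qeq_sym M N (f g : qhom M N) : qeq f g -> qeq g f.
Proof. by move=> /qeqP h; apply/qeqP => m n1 n2 h1 h2; apply: near0_sym; exact: (h m). Qed.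
Lemma qeq_trans M N (g f h : qhom M N) : qeq f g -> qeq g h -> qeq f h.
Proof.
move=> /qeqP h1 /qeqP h2; apply/qeqP => m n1 n2 e1 e2.
apply: (qdomI (f := g) (m := m)) => a n hn; rewrite scalerBr.
by apply: (near0_trans (h1 _ _ _ _ hn) (h2 _ _ _ hn _)); exact: qgZ.
Qed.

Lemma qcomp_eq M N P (g g' : qhom N P) (f f' : qhom M N) :
  qeq g g' -> qeq f f' -> qeq (qcomp g f) (qcomp g' f').
Proof.
move=> /qeqP hg /qeqP hf; apply/qeqP => m n1 n2 [/= a [f1 g1]] [/= b [f2 g2]].
have [K hK] := hf _ _ _ f1 f2.
apply: (qdomI (f := g') (m := a)) => s c hc0.
apply: (near0_mul (K := K)) => i.
have z : graph g' (xx i ^+ K *: (s *: a) - xx i ^+ K *: (s *: b), xx i ^+ K *: c - xx i ^+ K *: (s *: n2)).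
  exact: (qgB (qgZ _ hc0) (qgZ _ (qgZ s g2))).
have e0 : xx i ^+ K *: (s *: a) - xx i ^+ K *: (s *: b) = 0.
  by rewrite -scalerBr -scalerBr scalerA mulrC -scalerA hK scaler0.
rewrite e0 in z; have := near0D (qker z) (near0Z (xx i ^+ K) (hg _ _ _ (qgZ s g1) hc0)).
by rewrite scalerBr scalerBr addrC addrA subrK scalerBr.
Qed.

Lemma qcompA M N P Q (h : qhom P Q) (g : qhom N P) (f : qhom M N) :
  qeq (qcomp h (qcomp g f)) (qcomp (qcomp h g) f).
Proof.
apply/qeqP => m n1 n2 /= [a [[b [h1 h2]] h3]] [c [h4 [d [h5 h6]]]].
have : graph (qcomp h (qcomp g f)) (m, n2) by exists d; split=> //; exists c.
by apply: qfun; exists a; split=> //; exists b.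
Qed.

Lemma qid_l M N (f : qhom M N) : qeq (qcomp (qid N) f) f.
Proof. by apply/qeqP => m n1 n2 [/= a [h1 ->]] h2; exact: (qfun h1 h2). Qed.
Lemma qid_r M N (f : qhom M N) : qeq (qcomp f (qid M)) f.
Proof. by apply/qeqP => m n1 n2 [/= a [-> h1]] h2; exact: (qfun h1 h2). Qed.

Lemma qzeroP M N (f : qhom M N) : qeq f (qzero M N) <-> forall m n, graph f (m, n) -> near0 n.
Proof.
rewrite qeqP; split=> h m n; first by move=> hf; have := h m n 0 hf erefl; rewrite subr0.
by move=> n2 hf /= ->; rewrite subr0; exact: (h m).
Qed.

Lemma mulm_lin M (x : L) (m : M) : linear (fun s : O k (- x) => (s : S) *: m).
Proof. by move=> a u v; rewrite scalerDl scalerA. Qed.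
Lemma mulm_hom M (x : L) (m : M) : ghom x m -> forall z (s : O k (- x)), ghom z s -> ghom z ((s : S) *: m).
Proof. by move=> hm z s hs; have := ghomZ hs hm; rewrite addrC subrK. Qed.
(** The morphism O(-x) -> M that sends 1 to [m]: homogeneous elements of M serve as test
    morphisms. *)
Definition mulm M (x : L) (m : M) (hm : ghom x m) : qhom (O k (- x)) M := qlin (mulm_lin m) (mulm_hom hm).

Lemma mulmE M x (m : M) (hm : ghom x m) s n : graph (mulm hm) (s, n) <-> n = (s : S) *: m.
Proof. by []. Qed.

(** A homogeneous element with negligible image gives a test morphism [mulm] that [f] cannot tell
    from zero. *)
Lemma monoP M N (f : qhom M N) : mono f <-> forall m n, graph f (m, n) -> near0 n -> near0 m.
Proof.
split=> [hf m n hmn nn|h Z g h' /qeqP e].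
  apply: (nearV_hom (zero_gsub M)) => x.
  have := qgH x hmn; have := near0H x nn; move: (hc x n) (hc_hom x m) => n'.
  move: (hc x m) => m' hm' nn' hmn'.
  have : qeq (mulm hm') (qzero _ _).
    apply: hf; apply/qeqP => s n1 n2 [/= a [-> h1]] [/= b [-> h2]].
    rewrite -[n1 - n2]subr0 in h1 h2 *; rewrite subr0; apply: near0B; last exact: qker h2.
    have := near0D (qfun h1 (qgZ s hmn')) (near0Z s nn').
    by rewrite subrK.
  by move=> /qzeroP /(_ (1 : S) ((1 : S) *: m') erefl); rewrite scale1r.
apply/qeqP => z m1 m2 h1 h2; have [K hK] := qdom f m1.
apply: (qdomI (f := f) (m := m1)) => a n1 hn1.
apply: (qdomI (f := f) (m := a *: m2)) => b n2 hn2.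
rewrite !scalerBr; apply: (h _ (b *: n1 - n2)); first by apply: qgB => //; exact: qgZ.
apply: (e ((b * a) *: z)); first by exists (b *: (a *: m1)); split; [rewrite scalerA; exact: qgZ|exact: qgZ].
by exists (b *: (a *: m2)); split; [rewrite scalerA; exact: qgZ|].
Qed.

(** The test object is the quotient of N by the image: the projection to it vanishes after [f],
    hence vanishes. *)
Lemma epiP M N (f : qhom M N) : epi f <-> forall n, nearV (gimg (graph f)) n.
Proof.
split=> [hf n|h Z g g' /qeqP e].
  have gI := gimg_gsub (qg_sub f); pose Q := gquot gI.
  have : qeq (qlin (@pr_lin _ _ _ N _ gI) (@pr_hom _ _ _ N _ gI)) (qzero N Q).
    apply: hf; apply/qeqP => m n1 n2 [/= a [h1 ->]] [/= b [h2 ->]]; rewrite subr0.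
    have -> : pr gI a = 0 by apply/pr_eq0; exists m.
    exact: near00.
  move=> /qzeroP /(_ n (pr gI n) erefl)[K hK]; exists K => b; apply/(pr_eq0 gI).
  rewrite -(hK b); have := pr_lin gI (xx b ^+ K) n 0; rewrite !addr0 => ->.
  have -> : pr gI 0 = 0 by apply/pr_eq0; have [s _] := (gsubP _).1 gI; exact: subm0.
  by rewrite addr0.
apply/qeqP => n z1 z2 h1 h2; have [K hK] := h n.
apply: (near0_mul (K := K)) => b; have [m hm] := hK b; rewrite scalerBr; apply: (e m).
  by exists (xx b ^+ K *: n); split=> //; exact: qgZ.
by exists (xx b ^+ K *: n); split=> //; exact: qgZ.
Qed.

(** The inverse is the transposed graph: [epi] provides its domain, and [mono] makes it
    single-valued up to finite dimension. *)
Lemma qisoP M N (f : qhom M N) : qiso f <-> mono f /\ epi f.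
Proof.
split=> [[g [/qeqP h1 /qeqP h2]]|[/monoP fm /epiP fe]].
  split.
    apply/monoP => m n hmn nn; apply: (qdomI (f := g) (m := n)) => a b hb.
    have hb0 : near0 b by have [K hK] := nn; apply: (near0_mul (K := K)) => i;
      have := qgZ (xx i ^+ K) hb; rewrite scalerA mulrC -scalerA hK scaler0; exact: qker.
    have := h1 (a *: m) b (a *: m) (ex_intro _ (a *: n) (conj (qgZ a hmn) hb)) erefl.
    by move=> /near0_sym h; have := near0D h hb0; rewrite subrK.
  apply/epiP => n; have [K hK] := qdom g n.
  suff : nearV (nearV (gimg (graph f))) n.
    by apply: near_near; have /gsubP[] := gimg_gsub (qg_sub f).
  exists K => b; have [m hm] := hK b; have [K' hK'] := qdom f m.
  suff : nearV (nearV (gimg (graph f))) (xx b ^+ K *: n).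
    by apply: near_near; have /gsubP[] := gimg_gsub (qg_sub f).
  exists K' => i; have [n' hn'] := hK' i.
  have := h2 (xx i ^+ K' *: (xx b ^+ K *: n)) n' _ (ex_intro _ _ (conj (qgZ _ hm) hn')) erefl.
  move=> [K2 h]; exists K2 => j; exists (xx j ^+ K2 *: (xx i ^+ K' *: m)).
  have := h j; rewrite scalerBr => /eqP; rewrite subr_eq0 => /eqP <-.
  exact: qgZ.
have gP : is_qgraph ([set u | graph f (u.2, u.1)] : set (dsum N M)).
  apply: mkq => // [|n e]; last by apply: (fm _ _ e); exact: near00.
  apply: gsub_pair; last by move=> x m n; exact: qgH.
  by split; [exact: qg0|move=> a [m n] [m' n']; exact: (qg_submod f).2].
exists (QHom gP); split; apply/qeqP => x y z [/= w [h1 h2]] ->.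
  by apply: (fm _ (w - w)); [exact: qgB h2 h1|rewrite subrr; exact: near00].
exact: qfun h2 h1.
Qed.

Lemma nearV_mul M (V : set M) (K : nat) m : submod V -> (forall b, nearV V (xx b ^+ K *: m)) -> nearV V m.
Proof. by move=> sV h; apply: near_near => //; exists K. Qed.

Lemma relcomp_gsub M N P (G : set (dsum M N)) (H : set (dsum N P)) : gsub G -> gsub H ->
  gsub ([set u | exists n, G (u.1, n) /\ H (n, u.2)] : set (dsum M P)).
Proof.
move=> /gsubP[sG hG] /gsubP[sH hH]; apply: gsub_pair; first split.
- by exists 0; split; [exact: (subm0 sG)|exact: (subm0 sH)].
- move=> a [m x] [m' x'] [/= n [h1 h2]] [/= n' [h1' h2']]; exists (a *: n + n').
  by split; [exact: (sG.2 a _ _ h1 h1')|exact: (sH.2 a _ _ h2 h2')].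
- move=> x m y [/= n [h1 h2]]; exists (hc x n).
  by have := hG x _ h1; have := hH x _ h2; rewrite !hc_dsum.
Qed.

Lemma relinv_gsub M N (G : set (dsum M N)) : gsub G ->
  gsub ([set u | G (u.2, u.1)] : set (dsum N M)).
Proof.
move=> /gsubP[sG hG]; apply: gsub_pair; first split.
- exact: (subm0 sG).
- by move=> a [m x] [m' x'] h h'; exact: (sG.2 a _ _ h h').
- by move=> x m n /(hG x); rewrite hc_dsum.
Qed.

Lemma near0_graph M N (f : qhom M N) m n : near0 m -> graph f (m, n) -> near0 n.
Proof.
move=> [K hK] h; apply: (near0_mul (K := K)) => b.
by have := qgZ (xx b ^+ K) h; rewrite hK; exact: qker.
Qed.

(** The kernel property is tested on the morphisms [mulm]. Conversely, the factorizations required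
    by the universal properties are the relations obtained by composing with the transposed graph of
    [f] or of [g]. *)
Lemma sexP B E A (f : qhom B E) (g : qhom E A) : short_exact f g <->
  [/\ mono f, epi g, (forall b e a, graph f (b, e) -> graph g (e, a) -> near0 a)
    & (forall e a, graph g (e, a) -> near0 a -> nearV (gimg (graph f)) e)].
Proof.
have [sI hI] := (gsubP _).1 (gimg_gsub (qg_sub f)).
split=> [[[fm /qzeroP gf hk] [ge _ _]]|[fm ge gf hk]].
  split=> // [b e a h1 h2|e a hea na]; first by apply: (gf b); exists e.
  apply: nearV_hom => // [|x]; first exact: gimg_gsub (qg_sub f).
  have := near0H x na; have := qgH x hea; move: (hc x a) (hc x e) (hc_hom x e) => {a hea na} a {}e he hea na.
  have [|u /qeqP hu] := hk _ (mulm he).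
    apply/qzeroP => s c [/= e' [-> h]].
    by have := near0D (qfun h (qgZ s hea)) (near0Z s na); rewrite subrK.
  have [K hK] := qdom u (1 : S).
  apply: (nearV_mul sI (K := K)) => b; have [n hn] := hK b.
  have [K' hK'] := qdom f n; apply: (nearV_mul sI (K := K')) => i; have [m hm] := hK' i.
  have hfu : graph (qcomp f u) (xx i ^+ K' *: ((xx b ^+ K)%:A : O k (- x)), m).
    by exists (xx i ^+ K' *: n); split=> //; exact: qgZ.
  have := hu _ _ _ hfu ((mulmE _ _ _).2 erefl).
  have -> : (xx i ^+ K' *: ((xx b ^+ K)%:A : O k (- x)) : S) = xx i ^+ K' * xx b ^+ K.
    by rewrite /GRing.scale /= mulr1.
  move=> [K2 h]; exists K2 => j; exists (xx j ^+ K2 *: (xx i ^+ K' *: n)).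
  have := h j; rewrite scalerBr => /eqP; rewrite subr_eq0 => /eqP e1.
  have := qgZ (xx j ^+ K2) hm; rewrite e1.
  by rewrite -!scalerA.
split.
  split=> //; first by apply/qzeroP => b a [e [h1 h2]]; exact: (gf b e).
  move=> Z h /qzeroP hz.
  pose G : set (dsum Z B) := [set u | exists n, graph h (u.1, n) /\ graph f (u.2, n)].
  have gG : gsub G := relcomp_gsub (qg_sub h) (relinv_gsub (qg_sub f)).
  have [sd _] := (gsubP _).1 (gdom_gsub gG).
  have GP : is_qgraph G.
    apply: mkq => // [z|b [e [h1 h2]]]; last by apply: ((monoP f).1 fm _ _ h2); exact: qker h1.
    have [K hK] := qdom h z; apply: (nearV_mul sd (K := K)) => b; have [e he] := hK b.
    have [K' hK'] := qdom g e; apply: (nearV_mul sd (K := K')) => i; have [a ha] := hK' i.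
    have [|K2 hK2] := hk _ _ ha; first by apply: (hz (xx i ^+ K' *: (xx b ^+ K *: z))); exists (xx i ^+ K' *: e); split=> //; exact: qgZ.
    exists K2 => j; have [b' hb'] := hK2 j; exists b', (xx j ^+ K2 *: (xx i ^+ K' *: e)); split=> //.
    by do 2 apply: qgZ.
  exists (QHom GP); apply/qeqP => z e1 e2 [/= b [[e [h1 h2]] h3]] h4.
  by apply: (near0_trans (qfun h3 h2)); exact: qfun h1 h4.
split=> //; first by apply/qzeroP => b a [e [h1 h2]]; exact: (gf b e).
move=> Z h /qzeroP hz.
pose G : set (dsum A Z) := [set u | exists n, graph g (n, u.1) /\ graph h (n, u.2)].
have gG : gsub G := relcomp_gsub (relinv_gsub (qg_sub g)) (qg_sub h).
have [sd _] := (gsubP _).1 (gdom_gsub gG).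
have GP : is_qgraph G.
  apply: mkq => // [a|z [e [h1 h2]]].
    have [K hK] := (epiP g).1 ge a; apply: (nearV_mul sd (K := K)) => b; have [e he] := hK b.
    have [K' hK'] := qdom h e; exists K' => i; have [z hz'] := hK' i.
    by exists z, (xx i ^+ K' *: e); split=> //; exact: qgZ.
  have [K hK] := hk _ _ h1 (near00 _).
  apply: (near0_mul (K := K)) => b; have [b' hb'] := hK b.
  by apply: (hz b'); exists (xx b ^+ K *: e); split=> //; exact: qgZ.
exists (QHom GP); apply/qeqP => e z1 z2 [/= a [h1 [e' [h2 h3]]]] h4.
have [||K hK] := hk (e' - e) (a - a); first exact: qgB h2 h1.
  by rewrite subrr; exact: near00.
apply: (near0_mul (K := K)) => b; have [b' hb'] := hK b.
by apply: (hz b'); exists (xx b ^+ K *: (e' - e)); split=> //; apply: qgZ; exact: qgB.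
Qed.
End Category.

(** * Line bundles and torsion sheaves *)

Section Torsion.
Variables (k : closedFieldType) (p q : nat).
Hypotheses (p_gt0 : (0 < p)%N) (q_gt0 : (0 < q)%N).
Local Notation S := (Spol k).
Local Notation L := (Lpq p q).
Local Notation xx := (@xx k).
Local Notation vx := (@vx p q).
Local Notation Shom := (@Shom k p q).
Local Notation grmod := (grmod k p q).
Local Notation O := (@O k p q).
Local Notation prm := (@prm k p q).
Implicit Types M N P : grmod.
Local Notation qdom := (@qdom _ _ _ p_gt0 q_gt0 _ _).
Local Notation qker := (@qker _ _ _ p_gt0 q_gt0 _ _).
Local Notation qfun := (@qfun _ _ _ p_gt0 q_gt0 _ _).
Local Notation mkq := (@mkq _ _ _ p_gt0 q_gt0).

(** [O 0] is S with its own grading, so components of polynomials become a case of [hc]. *)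
Definition scomp (e : L) (s : S) : S := @hc k p q (O 0) e s.

Lemma scomp_hom e s : Shom e (scomp e s).
Proof. by have := @hc_hom k p q (O 0) e s; rewrite /ghom /= /Ohom addr0. Qed.

Lemma hcZr M x d (a : S) (m : M) : ghom d m -> hc x (a *: m) = scomp (x - d) a *: m.
Proof.
move=> hm; have [r [ur e h]] := @hc_sum k p q (O 0) a.
have hz z : ghom (z + d) ((hc z (a : O 0) : S) *: m).
  by rewrite addrC; apply: ghomZ => //; exact: scomp_hom.
rewrite {1}(e : a = _) scaler_suml hc_bigsum.
case: (boolP (x - d \in r)) => xr.
  rewrite (bigD1_seq (x - d)) //= big1 ?addr0 => [|z zx].
    by rewrite hc_id //; have := hz (x - d); rewrite subrK.
  by apply: (hc_neq (hz z)); apply: contra zx => /eqP ->; rewrite addrK.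
rewrite /scomp h // scale0r big_seq big1 // => z zr; apply: (hc_neq (hz z)).
by apply: contraNneq xr => ->; rewrite addrK.
Qed.

Lemma gen_gsub M (e : seq M) : (forall a, a \in e -> exists x, ghom x a) -> gsub (gen e).
Proof.
move=> h; apply/gsubP; split; first exact: gen_submod.
elim: e h => [|a e IH] h x m; first by move=> /gen_nil ->; apply/gen_nil; exact: hc0.
have [d hd] := h a (mem_head _ _).
move=> /gen_cons[s [w [hw ->]]]; rewrite hcD (hcZr _ _ hd); apply/gen_cons.
exists (scomp (x - d) s), (hc x w); split=> //; apply: IH => // b be.
by apply: h; rewrite inE be orbT.
Qed.

Lemma gen1 (M : lmodType S) (a m : M) : gen [:: a] m <-> exists s, m = s *: a.
Proof.
rewrite gen_cons; split=> [[s [w [/gen_nil -> ->]]]|[s ->]]; first by exists s; rewrite addr0.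
by exists s, 0; rewrite addr0; split=> //; exact/gen_nil.
Qed.

Lemma gen2 (M : lmodType S) (a b m : M) : gen [:: a; b] m <-> exists s t, m = s *: a + t *: b.
Proof.
rewrite gen_cons; split=> [[s [w [/gen1[t ->] ->]]]|[s [t ->]]]; first by exists s, t.
by exists s, (t *: b); split=> //; apply/gen1; exists t.
Qed.

Definition one (y : L) : O y := (1 : S).
Lemma one_hom y : ghom (- y) (one y).
Proof. by rewrite /ghom /= /Ohom addNr; exact: Shom_1. Qed.
Lemma oneZ y (s : O y) : s = (s : S) *: one y.
Proof. by rewrite /one /GRing.scale /= mulr1. Qed.

Lemma near0_O y (s : O y) : near0 s -> s = 0.
Proof.
move=> [K hK]; have /eqP := hK 0; rewrite /GRing.scale /= mulf_eq0.
by rewrite (negbTE (xxn_neq0 _ _ _)) => /eqP.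
Qed.

Lemma dsum_homI M N x (m : M) (n : N) : ghom x m -> ghom x n -> @ghom _ _ _ (dsum M N) x (m, n).
Proof. by []. Qed.

Section Q.
Variables (f : S) (d : L) (b : 'I_2) (hf : prm f d b) (l : nat) (y : L).

Lemma Qgsub : gsub (gen [:: f ^+ l : O y]).
Proof.
apply: gen_gsub => a; rewrite inE => /eqP ->; exists (d *+ l - y).
by rewrite /ghom /= /Ohom subrK; apply: ShomX; exact: (prm_hom hf).
Qed.

Lemma prZ M (V : set M) (gV : gsub V) a m : pr gV (a *: m) = a *: pr gV m.
Proof.
have z : pr gV 0 = 0 by apply/pr_eq0; have [s _] := (gsubP _).1 gV; exact: subm0.
by have := pr_lin gV a m 0; rewrite z !addr0.
Qed.

Lemma prD M (V : set M) (gV : gsub V) m m' : pr gV (m + m') = pr gV m + pr gV m'.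
Proof. by have := pr_lin gV 1 m m'; rewrite !scale1r. Qed.

Lemma Qm_subproof : {M : grmod & {e : M | [/\ ghom (- y) e, forall u, exists s, u = s *: e
   & forall s, s *: e = 0 <-> exists t, s = f ^+ l * t]}}.
Proof.
exists (gquot Qgsub), (pr Qgsub (one y)); split.
- by apply: pr_hom; exact: one_hom.
- by move=> u; have [m ->] := pr_surj u; exists (m : S); rewrite -prZ -oneZ.
move=> s; rewrite -prZ pr_eq0 gen1; split=> -[t e]; exists t; last first.
  by rewrite e /one /GRing.scale /= mulr1 mulrC.
by move: e; rewrite /one /GRing.scale /= mulr1 mulrC.
Qed.

(* O(y) / f^l, sealed. *)
Definition Qm : grmod := projT1 Qm_subproof.
Definition qe : Qm := projT1 (projT2 Qm_subproof).
Lemma qe_hom : ghom (- y) qe. Proof. by case: (projT2 (projT2 Qm_subproof)). Qed.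
Lemma qe_gen (u : Qm) : exists s, u = s *: qe.
Proof. by case: (projT2 (projT2 Qm_subproof)). Qed.
Lemma qe_eq0 s : s *: qe = 0 <-> exists t, s = f ^+ l * t.
Proof. by case: (projT2 (projT2 Qm_subproof)). Qed.
Lemma qe_ann (u : Qm) : f ^+ l *: u = 0.
Proof. by have [s ->] := qe_gen u; rewrite scalerA; apply/qe_eq0; exists s. Qed.

(** By [regular_pair] no power of [xx b] is a zero divisor on S / f^l. *)
Lemma near0_Q (u : Qm) : near0 u -> u = 0.
Proof.
have [s ->] := qe_gen u => -[K hK]; apply/qe_eq0.
have := hK b; rewrite scalerA => /qe_eq0[t e].
by have [w [_ ew]] := regular_pair (prm_ndvd hf) (esym e); exists w.
Qed.

Lemma mprim_comp n K : mprim (f ^+ n) (xx b ^+ K).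
Proof. by apply: mprimX; exact: (prm_comp hf). Qed.

(* Up to finite dimension, Qm is generated by xx b ^+ K *: qe. *)
Lemma Q_nearV (V : set Qm) K : submod V -> V (xx b ^+ K *: qe) -> forall u, nearV V u.
Proof.
move=> sV hV u; have [s ->] := qe_gen u; apply: submZ; first exact: near_submod.
apply: (near_mprim sV (mprim_comp l K) _ hV).
by rewrite qe_ann; exact: (subm0 sV).
Qed.

(** The graph spanned by a single pair is already a morphism: its domain is everything by [Q_nearV],
    and if [s *: (xx b ^+ K *: qe)] vanishes, then [f ^+ l] divides [s]. *)
Lemma HomQ_ex (B : grmod) K (z : B) : ghom (vx b *+ K - y) z -> near0 (f ^+ l *: z) ->
  exists h : qhom Qm B, graph h (xx b ^+ K *: qe, z).
Proof.
move=> hz nz; pose e : seq (dsum Qm B) := [:: (xx b ^+ K *: qe, z)].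
have gG : gsub (gen e).
  apply: gen_gsub => a; rewrite inE => /eqP ->; exists (vx b *+ K - y).
  apply: dsum_homI => //.
  by rewrite addrC; apply: ghomZ; [exact: Shom_xxn|exact: qe_hom].
have GP : is_qgraph (gen e).
  apply: mkq => // [u|n /gen1[s []]].
    apply: (@Q_nearV (gdom (gen e)) K); first by have /gsubP[] := gdom_gsub gG.
    by exists z; apply/gen1; exists 1; rewrite scale1r.
  rewrite scalerA => /esym/qe_eq0[t et] ->.
  have [w [_ ew]] := regular_pair (prm_ndvd hf) (etrans (esym et) (mulrC _ _)).
  by rewrite ew mulrC -scalerA; exact: near0Z.
by exists (QHom GP); apply/gen1; exists 1; rewrite scale1r.
Qed.

Lemma HomQ_eq (B : grmod) (h h' : qhom Qm B) K (z z' : B) :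
  graph h (xx b ^+ K *: qe, z) -> graph h' (xx b ^+ K *: qe, z') -> near0 (z - z') -> qeq h h'.
Proof.
move=> hz hz' e; apply/(qeqP p_gt0 q_gt0) => m n1 n2 h1 h2; have [s es] := qe_gen m.
apply: near0_idem; apply: (near_mprim (near0_submod B) (mprim_comp l K)).
  rewrite scalerBr; apply: near0B.
    by have := qgZ (f ^+ l) h1; rewrite qe_ann; exact: qker.
  by have := qgZ (f ^+ l) h2; rewrite qe_ann; exact: qker.
have c1 := qgZ (xx b ^+ K) h1; have c2 := qgZ (xx b ^+ K) h2.
rewrite es scalerA mulrC -scalerA in c1 c2.
rewrite scalerBr; apply: (near0_trans (qfun c1 (qgZ s hz))).
apply: (near0_trans (b := s *: z')); first by rewrite -scalerBr; exact: near0Z.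
by apply: near0_sym; exact: (qfun c2 (qgZ s hz')).
Qed.

Lemma qdom1 (B : grmod) (h : qhom Qm B) : exists K (z : B),
  ghom (vx b *+ K - y) z /\ graph h (xx b ^+ K *: qe, z).
Proof.
have [K hK] := qdom h qe; have [n hn] := hK b.
have hd : ghom (vx b *+ K - y) (xx b ^+ K *: qe).
  by rewrite addrC; apply: ghomZ; [exact: Shom_xxn|exact: qe_hom].
exists K, (hc (vx b *+ K - y) n); split; first exact: hc_hom.
by have := qgH (vx b *+ K - y) hn; rewrite (hc_id hd).
Qed.

Lemma HomQ_zero (B : grmod) :
  (forall K (z : B), ghom (vx b *+ K - y) z -> near0 (f ^+ l *: z) -> near0 z) ->
  Hom_zero Qm B.
Proof.
move=> hB h; apply/(qzeroP p_gt0 q_gt0) => m n hmn.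
have [K [z [hz hq]]] := qdom1 h.
have nz : near0 z.
  apply: (hB _ _ hz); have := qgZ (f ^+ l) hq; rewrite qe_ann; exact: qker.
have [s es] := qe_gen m.
apply: near0_idem; apply: (near_mprim (near0_submod B) (mprim_comp l K)).
  by have := qgZ (f ^+ l) hmn; rewrite qe_ann; exact: qker.
have h1 := qgZ s hq; have h2 := qgZ (xx b ^+ K) hmn.
rewrite es scalerA mulrC -scalerA in h2.
by have := near0D (qfun h2 h1) (near0Z s nz); rewrite subrK.
Qed.

Lemma HomQ_nonzero (B : grmod) K (z : B) :
  ghom (vx b *+ K - y) z -> near0 (f ^+ l *: z) -> ~ near0 z -> ~ Hom_zero Qm B.
Proof.
move=> hz nz zn hB; have [h hh] := HomQ_ex hz nz.
by apply: zn; exact: ((qzeroP p_gt0 q_gt0 _).1 (hB h) _ _ hh).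
Qed.

(** Ext^1(O(y) / f^l, B) is the cokernel of f^l on B with [xx b] inverted, in degree d l - y: for a
    lift [e] of the generator, [f ^+ l *: e] comes from B, and changing the lift by [w] changes it
    by [f ^+ l *: w]. The hypothesis says that this cokernel is zero. *)
Lemma ExtQ_zero (B : grmod) :
  (forall K (z : B), ghom (d *+ l + vx b *+ K - y) z ->
     exists K' w, near0 (xx b ^+ K' *: z - f ^+ l *: w)) ->
  Ext1_zero Qm B.
Proof.
move=> hB E i g /(sexP p_gt0 q_gt0)[im ge gi hk].
have [K hK] := (epiP p_gt0 q_gt0 g).1 ge qe; have [e he] := hK b.
have hd n : ghom (vx b *+ n - y) (xx b ^+ n *: qe).
  by rewrite addrC; apply: ghomZ; [exact: Shom_xxn|exact: qe_hom].
have {he} := qgH (vx b *+ K - y) he; rewrite (hc_id (hd K)).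
have := hc_hom (vx b *+ K - y) e; move: (hc _ e) => {}e eh he.
have [|K1 hK1] := hk (f ^+ l *: e) 0 _ (near00 _).
  by have := qgZ (f ^+ l) he; rewrite qe_ann.
have [z hz] := hK1 b.
have zd : ghom (d *+ l + vx b *+ (K + K1) - y) (xx b ^+ K1 *: (f ^+ l *: e)).
  have := ghomZ (@Shom_xxn k p q b K1) (ghomZ (ShomX (prm_hom hf)) eh).
  have -> // : d *+ l + vx b *+ (K + K1) - y = vx b *+ K - y + d *+ l + vx b *+ K1.
  by rewrite mulrnDr addrA [LHS](ACl (2*4*1*3)).
have {hz} := qgH (d *+ l + vx b *+ (K + K1) - y) hz; rewrite (hc_id zd).
have := hc_hom (d *+ l + vx b *+ (K + K1) - y) z; move: (hc _ z) => {}z zh hz.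
have [K2 [w hw]] := hB _ _ zh.
have [K3 hK3] := qdom i w; have [v hv] := hK3 b.
have [K4 hK4] := qdom g v; have [c hc0] := hK4 b.
have c0 : c = 0.
  by apply: near0_Q; apply: (gi _ _ _ (qgZ (xx b ^+ K4) hv)).
rewrite c0 in hc0.
pose K' := (K4 + (K3 + K2 + K1) + K)%N.
(* The corrected lift: subtracting the image of [w] makes it killed by [f ^+ l] up to finite
   dimension. The exponents bring both terms to a common denominator. *)
pose e1 := xx b ^+ K4 *: (xx b ^+ (K3 + K2 + K1) *: e - v).
have ge1 : graph g (e1, xx b ^+ K' *: qe).
  have := qgB (qgZ (xx b ^+ K4) (qgZ (xx b ^+ (K3 + K2 + K1)) he)) hc0.
  by rewrite subr0 -scalerBr !scalerA -!exprD.
have fe1 : near0 (f ^+ l *: e1).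
  rewrite /e1 scalerA mulrC -scalerA; apply: near0Z; rewrite scalerBr.
  have hh := qgB (qgZ (xx b ^+ (K3 + K2)) hz) (qgZ (f ^+ l) hv).
  have ez : xx b ^+ (K3 + K2) *: z - f ^+ l *: (xx b ^+ K3 *: w) =
            xx b ^+ K3 *: (xx b ^+ K2 *: z - f ^+ l *: w).
    by rewrite scalerBr !scalerA -exprD [_ ^+ l * _]mulrC.
  rewrite ez in hh; have := near0_graph p_gt0 q_gt0 (near0Z _ hw) hh.
  have -> // : xx b ^+ (K3 + K2) *: (xx b ^+ K1 *: (f ^+ l *: e)) =
            f ^+ l *: (xx b ^+ (K3 + K2 + K1) *: e).
  by rewrite !scalerA !exprD; congr (_ *: _); ring.
pose e2 := hc (vx b *+ K' - y) e1.
have ge2 : graph g (e2, xx b ^+ K' *: qe) by have := qgH (vx b *+ K' - y) ge1; rewrite (hc_id (hd K')).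
have fe2 : near0 (f ^+ l *: e2).
  by rewrite /e2 -(hcZ _ _ (ShomX (prm_hom hf))); exact: near0H.
have [t ht] := HomQ_ex (hc_hom _ _) fe2.
exists t; apply: (HomQ_eq (K := K') (z := xx b ^+ K' *: qe) (z' := xx b ^+ K' *: qe)) => //.
  by exists e2.
by rewrite subrr; exact: near00.
Qed.

(** The class of [z] is realised by a pushout, B (+) O(y') modulo (z, -f^l). The twist [y'] absorbs
    the denominator: the generator of O(y') goes to [xx b ^+ K *: qe]. *)
Lemma ExtQ_nonzero (B : grmod) K (z : B) : ghom (d *+ l + vx b *+ K - y) z ->
  (forall K' w, ~ near0 (xx b ^+ K' *: z - f ^+ l *: w)) -> ~ Ext1_zero Qm B.
Proof.
move=> hz hn hE; pose y' := y - vx b *+ K; pose D := dsum B (O y').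
pose v : D := (z, - (f ^+ l) : O y').
have vh : ghom (d *+ l + vx b *+ K - y) v.
  apply: dsum_homI => //.
  have -> : d *+ l + vx b *+ K - y = d *+ l - y' by rewrite /y' opprB addrA.
  rewrite /ghom /= /Ohom subrK -sub0r; apply: ShomB; first exact: Shom0.
  by apply: ShomX; exact: (prm_hom hf).
have gV : gsub (gen [:: v]) by apply: gen_gsub => a; rewrite inE => /eqP ->; eexists; exact: vh.
pose E := gquot gV.
have i_lin : linear (fun m : B => pr gV (m, 0) : E).
  by move=> a m m'; rewrite -pr_lin; congr pr; congr (_, _); rewrite /= ?scaler0 ?addr0.
have i_hom x m : ghom x m -> ghom x (pr gV (m, 0)).
  by move=> h; apply: pr_hom; apply: dsum_homI => //; exact: ghom0.
have j_lin : linear (fun m : D => (m.2 : S) *: (xx b ^+ K *: qe) : Qm).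
  move=> a [m s] [m' s']; transitivity ((a * (s : S) + (s' : S)) *: (xx b ^+ K *: qe)) => //.
  by rewrite scalerDl -scalerA.
have j_hom x (m : D) : ghom x m -> ghom x ((m.2 : S) *: (xx b ^+ K *: qe)).
  case: m => m s [_ /= hs]; have := ghomZ hs (ghomZ (@Shom_xxn k p q b K) qe_hom).
  by rewrite /y' [- y + _]addrC addrCA -(opprB y) addNr addr0.
pose i := qlin i_lin i_hom.
pose fp := qlin (@pr_lin _ _ _ D _ gV) (@pr_hom _ _ _ D _ gV); pose fj := qlin j_lin j_hom.
pose G : set (dsum E Qm) := [set u | exists n, graph fp (n, u.1) /\ graph fj (n, u.2)].
have gG : gsub G := relcomp_gsub (relinv_gsub (qg_sub fp)) (qg_sub fj).
have Gin m s : G (pr gV (m, s), s *: (xx b ^+ K *: qe)) by exists (m, s).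
have prV m s : pr gV (m, s) = 0 -> exists t : S, m = t *: z /\ (s : S) = - (t * f ^+ l).
  by move=> /pr_eq0/gen1[t [-> ->]]; exists t; rewrite /GRing.scale /= mulrN.
have jV s t : s = - (t * f ^+ l) -> s *: (xx b ^+ K *: qe) = 0.
  by move=> ->; rewrite scaleNr -scalerA qe_ann scaler0 oppr0.
have GP : is_qgraph G.
  apply: mkq => // [u|n [[m s] [/= e1 ->]]].
    have [[m s] ->] := pr_surj u; apply: near_in; exists (s *: (xx b ^+ K *: qe)); exact: Gin.
  by have [t [_ /jV ->]] := prV _ _ (esym e1); exact: near00.
have injz m : near0 (pr gV (m, 0)) -> near0 m.
  move=> [N hN]; exists N => c; have := hN c; rewrite -prZ pairZ scaler0.
  move=> /prV[t [-> /eqP]]; rewrite eq_sym oppr_eq0 mulf_eq0 expf_eq0 (negbTE (prm_neq0 hf)) andbF orbF.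
  by move=> /eqP ->; rewrite scale0r.
have Eexact m s (t : S) : pr gV (m, s) = pr gV (m + t *: z, (s : S) - t * f ^+ l : O y').
  apply/eqP; rewrite -subr_eq0 -scaleN1r -prZ -prD; apply/eqP/pr_eq0/gen1; exists (- t).
  congr (_, _); rewrite /= ?scaleN1r ?opprD ?addrA ?subrr ?sub0r ?scaleNr //.
  by rewrite /GRing.scale /= mulrN.
have [|t /(qeqP p_gt0 q_gt0) ht] := hE E i (QHom GP).
  apply/(sexP p_gt0 q_gt0); split.
  - by apply/(monoP p_gt0 q_gt0) => m n /= ->; exact: injz.
  - apply/(epiP p_gt0 q_gt0) => u; apply: (@Q_nearV (gimg G) K); first by have /gsubP[] := gimg_gsub gG.
    by exists (pr gV (0, one y')); have := Gin 0 (one y'); rewrite /one scale1r.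
  - move=> m u c /= -> [[m' s] [/= e1 ->]].
    have : pr gV (m' - m, s) = 0 by rewrite -[s]subr0 -pairB -[X in _ - X]scale1r -scaleNr prD prZ scaleN1r e1 subrr.
    by move=> /prV[t [_ /jV ->]]; exact: near00.
  - move=> u c [[m s] [/= -> ->]] /near0_Q; rewrite scalerA => /qe_eq0[t].
    rewrite mulrC => /esym/(regular_pair (prm_ndvd hf))[w [_ ew]].
    apply: near_in; exists (m + w *: z); rewrite /i /= (Eexact m s w) ew mulrC subrr.
    done.
(* The splitting is evaluated at a power of [xx b] times the generator; multiplied by [f ^+ l] it
   expresses a power of [xx b] times [z] as a multiple of [f ^+ l]. *)
have [K1 [u [hu tu]]] := qdom1 t.
have {tu} := qgZ (xx b ^+ K) tu; rewrite scalerA -exprD.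
have [[m s] ->] := pr_surj (xx b ^+ K *: u) => tu.
have h1 : near0 (s *: (xx b ^+ K *: qe) - xx b ^+ (K + K1) *: qe).
  by apply: (ht (xx b ^+ (K + K1) *: qe)) => //; exists (pr gV (m, s)); split=> //; exact: Gin.
have {h1} := near0_Q h1; rewrite addnC exprD -scalerA -scalerBl scalerA => /qe_eq0[t1 et1].
have [t2 [_ et2]] := regular_pair (prm_ndvd hf) (etrans (esym et1) (mulrC _ _)).
have := qgZ (f ^+ l) tu; rewrite qe_ann => /qker; rewrite (Eexact m s t2).
have -> : (s : S) - t2 * f ^+ l = xx b ^+ K1 by rewrite mulrC -et2 subKr.
rewrite -prZ pairZ (Eexact _ _ (xx b ^+ K1)).
rewrite [X in pr gV (_, X)](_ : _ = 0); last by rewrite /GRing.scale /= mulrC subrr.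
move=> /injz h; apply: (hn K1 (- (m + t2 *: z))).
by rewrite scalerN opprK addrC.
Qed.
End Q.
End Torsion.

(** * Hom and Ext from line bundles *)

Section LineBundles.
Variables (k : closedFieldType) (p q : nat).
Hypotheses (p_gt0 : (0 < p)%N) (q_gt0 : (0 < q)%N).
Local Notation S := (Spol k).
Local Notation xx := (@xx k).
Local Notation vx := (@vx p q).
Local Notation Shom := (@Shom k p q).
Local Notation grmod := (grmod k p q).
Local Notation O := (@O k p q).
Local Notation prm := (@prm k p q).
Implicit Types M N P : grmod.
Local Notation qdom := (@qdom _ _ _ p_gt0 q_gt0 _ _).
Local Notation qfun := (@qfun _ _ _ p_gt0 q_gt0 _ _).
Local Notation mkq := (@mkq _ _ _ p_gt0 q_gt0).
Local Notation Qm := (@Qm k p q).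
Local Notation one := (@one k p q).

Lemma ShomN x s : Shom x s -> Shom x (- s).
Proof. by move=> h; rewrite -sub0r; apply: ShomB => //; exact: Shom0. Qed.

Lemma mprim01 K : mprim (xx 0 ^+ K) (xx 1 ^+ K).
Proof. by exists K; elim/I2P; [exists 1, 0|exists 0, 1]; ring. Qed.

Lemma onen_hom b K x : ghom (vx b *+ K - x) (xx b ^+ K *: one x).
Proof. by rewrite addrC; apply: ghomZ; [exact: Shom_xxn|exact: one_hom]. Qed.

(* s and t generate O up to finite dimension and their only relation is the
   Koszul one, so u and v can be prescribed subject to it. *)
Lemma HomO_mk x (B : grmod) (s t : S) dx dy (u v : B) : mprim s t ->
  (forall a b, a * s = b * t -> exists w, a = w * t /\ b = w * s) ->
  Shom dx s -> Shom dy t -> ghom (dx - x) u -> ghom (dy - x) v ->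
  near0 (t *: u - s *: v) ->
  exists h : qhom (O x) B, graph h (s *: one x, u) /\ graph h (t *: one x, v).
Proof.
move=> st reg hs ht hu hv uv.
pose e : seq (dsum (O x) B) := [:: (s *: one x, u); (t *: one x, v)].
have gG : gsub (gen e).
  apply: gen_gsub => a; rewrite !inE => /orP[]/eqP ->; [exists (dx - x)|exists (dy - x)];
    by apply: dsum_homI => //; rewrite addrC; apply: ghomZ => //; exact: one_hom.
have in1 : gen e (s *: one x, u) by apply: gen_mem; rewrite inE eqxx.
have in2 : gen e (t *: one x, v) by apply: gen_mem; rewrite !inE eqxx orbT.
have GP : is_qgraph (gen e).
  apply: mkq => // [m|n /gen2[a [c en]]].
    have [sd _] := (gsubP _).1 (gdom_gsub gG).
    rewrite [m]oneZ; apply: submZ; first exact: near_submod.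
    by apply: (near_mprim sd st); [exists u|exists v].
  have e1 : (0 : O x) = a *: (s *: one x) + c *: (t *: one x) := congr1 fst en.
  have -> : n = a *: u + c *: v := congr1 snd en.
  have e2 : a * s = (- c) * t.
    apply/eqP; rewrite -subr_eq0 mulNr opprK; apply/eqP; move: e1.
    by rewrite /one /GRing.scale /= !mulr1.
  have [w [-> ew]] := reg _ _ e2.
  have -> : c = - (w * s) by rewrite -ew opprK.
  by rewrite scaleNr -!scalerA -scalerBr; exact: near0Z.
by exists (QHom GP).
Qed.

Lemma reg01 K (a b : S) : a * xx 0 ^+ K = b * xx 1 ^+ K -> exists w, a = w * xx 1 ^+ K /\ b = w * xx 0 ^+ K.
Proof.
rewrite mulrC [b * _]mulrC => e.
have [w [-> ->]] := regular_pair (b := 1) (f := xx 0) (fun v => @xx_eqF k 1 v) e.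
by exists w; rewrite mulrC [_ ^+ _ * w]mulrC.
Qed.

Lemma HomO_eq2 x (B : grmod) (h h' : qhom (O x) B) s t u v u' v' : mprim s t ->
  graph h (s *: one x, u) -> graph h (t *: one x, v) ->
  graph h' (s *: one x, u') -> graph h' (t *: one x, v') ->
  near0 (u - u') -> near0 (v - v') -> qeq h h'.
Proof.
move=> st hu hv hu' hv' eu ev; apply/(qeqP p_gt0 q_gt0) => m n1 n2 h1 h2.
rewrite [m]oneZ in h1 h2; move: (m : S) h1 h2 => a h1 h2.
have aux (c : S) w w' : graph h (c *: one x, w) -> graph h' (c *: one x, w') -> near0 (w - w') ->
  near0 (c *: (n1 - n2)).
  move=> hw hw' ew; rewrite scalerBr.
  have c1 := qgZ c h1; have c2 := qgZ c h2; rewrite scalerA mulrC -scalerA in c1 c2.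
  apply: (near0_trans (qfun c1 (qgZ a hw))); apply: (near0_trans (b := a *: w')).
    by rewrite -scalerBr; exact: near0Z.
  by apply: near0_sym; exact: (qfun c2 (qgZ a hw')).
apply: near0_idem; apply: (near_mprim (near0_submod B) st); first exact: aux hu hu' eu.
exact: aux hv hv' ev.
Qed.

Lemma HomO_eq x (B : grmod) (h h' : qhom (O x) B) K u v u' v' :
  graph h (xx 0 ^+ K *: one x, u) -> graph h (xx 1 ^+ K *: one x, v) ->
  graph h' (xx 0 ^+ K *: one x, u') -> graph h' (xx 1 ^+ K *: one x, v') ->
  near0 (u - u') -> near0 (v - v') -> qeq h h'.
Proof. exact: (HomO_eq2 (mprim01 K)). Qed.

Lemma qdomO x (B : grmod) (h : qhom (O x) B) : exists K u v,
  [/\ ghom (vx 0 *+ K - x) u, ghom (vx 1 *+ K - x) v,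
      graph h (xx 0 ^+ K *: one x, u) & graph h (xx 1 ^+ K *: one x, v)].
Proof.
have [K hK] := qdom h (one x); have [u hu] := hK 0; have [v hv] := hK 1.
exists K, (hc (vx 0 *+ K - x) u), (hc (vx 1 *+ K - x) v); split; try exact: hc_hom.
  by have := qgH (vx 0 *+ K - x) hu; rewrite hc_id //; exact: onen_hom.
by have := qgH (vx 1 *+ K - x) hv; rewrite hc_id //; exact: onen_hom.
Qed.

Lemma HomO_zero x (B : grmod) : (forall K u v, ghom (vx 0 *+ K - x) u -> ghom (vx 1 *+ K - x) v ->
   near0 (xx 1 ^+ K *: u - xx 0 ^+ K *: v) -> near0 (u : B) /\ near0 (v : B)) -> Hom_zero (O x) B.
Proof.
move=> hB h; have [K [u [v [uh vh hu hv]]]] := qdomO h.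
have [|nu nv] := hB _ _ _ uh vh.
  have h1 := qgZ (xx 1 ^+ K) hu; have h2 := qgZ (xx 0 ^+ K) hv.
  by rewrite scalerA mulrC -scalerA in h1; exact: qfun h1 h2.
by apply: (HomO_eq hu hv (u' := 0) (v' := 0)) => //; rewrite subr0.
Qed.

Lemma HomOO_zero x y : (forall w, Shom (y - x) w -> w = 0) -> Hom_zero (O x) (O y).
Proof.
move=> hw; apply: HomO_zero => K u v uh vh /near0_O e.
have e' : xx 0 ^+ K * v = xx 1 ^+ K * u by apply/esym/eqP; rewrite -subr_eq0; exact/eqP.
have [w [ev eu]] := regular_pair (b := 1) (f := xx 0) (fun v => @xx_eqF k 1 v) e'.
have w0 : w = 0.
  apply: hw; have -> : y - x = vx 0 *+ K - x + y - vx 0 *+ K.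
    by rewrite [RHS]addrC !addrA addNr add0r addrC.
  apply: (Shom_div (xxn_neq0 k 0 K)); first exact: Shom_xxn.
  by rewrite -eu.
by rewrite eu ev w0 !mulr0; split; exact: near00.
Qed.

Lemma HomO_nonzero x (B : grmod) (m : B) : ghom (- x) m -> ~ near0 m -> ~ Hom_zero (O x) B.
Proof.
move=> hm nm hB; rewrite -[x]opprK in hB.
have /(qzeroP p_gt0 q_gt0) h := hB (mulm hm).
by apply: nm; have := h (one _) ((1 : S) *: m) erefl; rewrite scale1r.
Qed.

(** [xx b ^+ K] and [f ^+ l] generate O up to finite dimension; the first is sent to [z], and the
    second to 0 since it kills the target. *)
Lemma HomOQ_nonzero x f d b (hf : prm f d b) l y K (z : Qm hf l y) :
  ghom (vx b *+ K - x) z -> z <> 0 -> ~ Hom_zero (O x) (Qm hf l y).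
Proof.
move=> hz z0 hB.
have [|||||||h [h1 _]] := @HomO_mk x (Qm hf l y) (xx b ^+ K) (f ^+ l) (vx b *+ K) (d *+ l) z 0.
- by apply: mprimC; exact: (mprim_comp hf).
- move=> a c; rewrite mulrC [c * _]mulrC => /esym/(regular_pair (prm_ndvd hf))[w [-> ->]].
  by exists w; rewrite mulrC [_ ^+ _ * w]mulrC.
- exact: Shom_xxn.
- by apply: ShomX; exact: (prm_hom hf).
- done.
- exact: ghom0.
- by rewrite qe_ann scaler0 subr0; exact: near00.
by apply: z0; apply: near0_Q; apply: ((qzeroP p_gt0 q_gt0 _).1 (hB h) _ _ h1).
Qed.

Lemma HomOQ_zero x f d b (hf : prm f d b) l y :
  (forall K (z : Qm hf l y), ghom (vx b *+ K - x) z -> z = 0) -> Hom_zero (O x) (Qm hf l y).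
Proof.
move=> hB h; apply/(qzeroP p_gt0 q_gt0) => m n hmn.
have [K [u [v [uh vh hu hv]]]] := qdomO h.
have [z [hz]] : exists z, ghom (vx b *+ K - x) z /\ graph h (xx b ^+ K *: one x, z).
  have hc c : exists z, ghom (vx c *+ K - x) z /\ graph h (xx c ^+ K *: one x, z).
    by elim/I2P: c; [exists u|exists v].
  exact: hc.
rewrite (hB _ _ hz) => h0; rewrite [m]oneZ in hmn.
apply: near0_idem; apply: (near_mprim (near0_submod _) (mprim_comp hf l K)).
  by rewrite qe_ann; exact: near00.
have h1 := qgZ (m : S) h0; have h2 := qgZ (xx b ^+ K) hmn.
rewrite scalerA mulrC -scalerA in h2.
by have := qfun h2 h1; rewrite scaler0 subr0.
Qed.
(** The Cech criterion for the two charts on which one of the variables is invertible: [z] stands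
    for z / (x_1 x_2)^K on the overlap, and the hypothesis writes it as u / x_1^(K+M) - v /
    x_2^(K+M). *)
Lemma ExtO_zero x (B : grmod) :
  (forall K (z : B), ghom (vx 0 *+ K + vx 1 *+ K - x) z -> exists (M : nat) (u v : B),
     near0 ((xx 0 ^+ M * xx 1 ^+ M) *: z - (xx 1 ^+ (K + M) *: u - xx 0 ^+ (K + M) *: v))) ->
  Ext1_zero (O x) B.
Proof.
move=> hB E i g /(sexP p_gt0 q_gt0)[im ge gi hk].
have [K hK] := (epiP p_gt0 q_gt0 g).1 ge (one x).
(* Lifts of the generator over the two charts; their difference on the overlap comes from an element
   [z] of B. *)
have lift b : exists e, ghom (vx b *+ K - x) e /\ graph g (e, xx b ^+ K *: one x).
  have [e he] := hK b; exists (hc (vx b *+ K - x) e); split; first exact: hc_hom.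
  by have := qgH (vx b *+ K - x) he; rewrite [X in graph _ (_, X)]hc_id //; exact: onen_hom.
have [e0 [h0 g0]] := lift 0; have [e1 [h1 g1]] := lift 1.
have [|K1 hK1] := hk (xx 1 ^+ K *: e0 - xx 0 ^+ K *: e1) 0 _ (near00 _).
  have := qgB (qgZ (xx 1 ^+ K) g0) (qgZ (xx 0 ^+ K) g1).
  by rewrite !scalerA [xx 1 ^+ _ * _]mulrC subrr.
have [z hz] := hK1 0.
pose K2 := (K + K1)%N.
have {hz} hz : graph i (xx 1 ^+ K1 *: z, xx 1 ^+ K2 *: (xx 0 ^+ K1 *: e0) - xx 0 ^+ K2 *: (xx 1 ^+ K1 *: e1)).
  have := qgZ (xx 1 ^+ K1) hz; congr (graph i (_, _)).
  by rewrite /K2 !exprD !scalerBr !scalerA; congr (_ *: _ - _ *: _); ring.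
have homb b (e : E) (M : nat) : ghom (vx b *+ K - x) e -> ghom (vx b *+ (K + M) - x) (xx b ^+ M *: e).
  move=> he; have := ghomZ (@Shom_xxn k p q b M) he; by rewrite mulrnDr addrAC.
have zd : ghom (vx 0 *+ K2 + vx 1 *+ K2 - x) (xx 1 ^+ K2 *: (xx 0 ^+ K1 *: e0) - xx 0 ^+ K2 *: (xx 1 ^+ K1 *: e1)).
  apply: ghomB.
    have := ghomZ (@Shom_xxn k p q 1 K2) (homb 0 e0 K1 h0); by rewrite addrAC.
  have := ghomZ (@Shom_xxn k p q 0 K2) (homb 1 e1 K1 h1); by rewrite addrC addrA.
have {hz} := qgH (vx 0 *+ K2 + vx 1 *+ K2 - x) hz; rewrite (hc_id zd).
have := hc_hom (vx 0 *+ K2 + vx 1 *+ K2 - x) (xx 1 ^+ K1 *: z); move: (hc _ _) => {}z zh hz.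
have [M [u [v huv]]] := hB _ _ zh.
have [N1 hN1] := qdom i u; have [N2 hN2] := qdom i v.
have [sd _] := (gsubP _).1 (gdom_gsub (qg_sub i)).
have [u' hu'] := nearE sd (leq_addr N2 N1) hN1 0.
have [v' hv'] := nearE sd (leq_addl N1 N2) hN2 1.
have [N3 hN3] := qdom g u'; have [N4 hN4] := qdom g v'.
have [sg _] := (gsubP _).1 (gdom_gsub (qg_sub g)).
have [cu hcu] := nearE sg (leq_addr N4 N3) hN3 0.
have [cv hcv] := nearE sg (leq_addl N3 N4) hN4 1.
pose N := (N3 + N4 + (N1 + N2))%N.
have {hu'} hu' := qgZ (xx 0 ^+ (N3 + N4)) hu'; have {hv'} hv' := qgZ (xx 1 ^+ (N3 + N4)) hv'.
have cu0 : cu = 0 by apply: near0_O; exact: gi hu' hcu.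
have cv0 : cv = 0 by apply: near0_O; exact: gi hv' hcv.
rewrite cu0 in hcu; rewrite cv0 in hcv.
rewrite scalerA -exprD -/N in hu'; rewrite scalerA -exprD -/N in hv'.
have sub4 (a b c d : E) : (a - b) - (c - d) = (a - c) - (b - d).
  by rewrite !opprD !opprK addrACA.
pose T := (K2 + M + N)%N.
(* The lifts are corrected by the images of [u] and [v], over the common denominator [T]; they then
   agree on the overlap and [HomO_mk] glues them. *)
pose a0 := xx 0 ^+ (K1 + M + N) *: e0 - xx 0 ^+ (N3 + N4) *: u'.
pose a1 := xx 1 ^+ (K1 + M + N) *: e1 - xx 1 ^+ (N3 + N4) *: v'.
have ga0 : graph g (a0, xx 0 ^+ T *: one x).
  have := qgB (qgZ (xx 0 ^+ (K1 + M + N)) g0) hcu; rewrite subr0 scalerA -exprD.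
  by congr (graph g (_, _ ^+ _ *: _)); rewrite /T /K2; lia.
have ga1 : graph g (a1, xx 1 ^+ T *: one x).
  have := qgB (qgZ (xx 1 ^+ (K1 + M + N)) g1) hcv; rewrite subr0 scalerA -exprD.
  by congr (graph g (_, _ ^+ _ *: _)); rewrite /T /K2; lia.
have na : near0 (xx 1 ^+ T *: a0 - xx 0 ^+ T *: a1).
  have hh := qgB (qgZ (xx 0 ^+ (M + N) * xx 1 ^+ (M + N)) hz)
    (qgB (qgZ (xx 1 ^+ T) hu') (qgZ (xx 0 ^+ T) hv')).
  have nz : near0 ((xx 0 ^+ (M + N) * xx 1 ^+ (M + N)) *: z -
      (xx 1 ^+ T *: (xx 0 ^+ N *: u) - xx 0 ^+ T *: (xx 1 ^+ N *: v))).
    have := near0Z (xx 0 ^+ N * xx 1 ^+ N) huv; rewrite !scalerBr !scalerA.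
    congr near0; rewrite /T -/K2 !exprD; congr (_ *: _ - (_ *: _ - _ *: _)); ring.
  have := near0_graph p_gt0 q_gt0 nz hh; congr near0.
  rewrite /a0 /a1 !scalerBr !scalerA sub4 /T /K2 !exprD.
  congr (_ *: _ - _ - (_ *: _ - _)); ring.
have [|||||||h [hh0 hh1]] := @HomO_mk x E (xx 0 ^+ T) (xx 1 ^+ T) (vx 0 *+ T) (vx 1 *+ T)
   (hc (vx 0 *+ T - x) a0) (hc (vx 1 *+ T - x) a1).
- exact: mprim01.
- exact: reg01.
- exact: Shom_xxn.
- exact: Shom_xxn.
- exact: hc_hom.
- exact: hc_hom.
- have := near0H (vx 0 *+ T + vx 1 *+ T - x) na.
  rewrite hcD -scaleNr (hcZ' _ _ (@Shom_xxn k p q 1 T)) (hcZ' _ _ (ShomN (@Shom_xxn k p q 0 T))).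
  rewrite scaleNr; congr near0; congr (_ *: hc _ _ - _ *: hc _ _).
    by rewrite addrAC addrK.
  by rewrite [vx 0 *+ T + _]addrC addrAC addrK.
have ga0' : graph g (hc (vx 0 *+ T - x) a0, xx 0 ^+ T *: one x).
  by have := qgH (vx 0 *+ T - x) ga0; rewrite [X in graph _ (_, X)]hc_id //; exact: onen_hom.
have ga1' : graph g (hc (vx 1 *+ T - x) a1, xx 1 ^+ T *: one x).
  by have := qgH (vx 1 *+ T - x) ga1; rewrite [X in graph _ (_, X)]hc_id //; exact: onen_hom.
exists h; apply: (HomO_eq (K := T) (u := xx 0 ^+ T *: one x) (v := xx 1 ^+ T *: one x)
   (u' := xx 0 ^+ T *: one x) (v' := xx 1 ^+ T *: one x)) => //; try (by rewrite subrr; exact: near00).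
  by exists (hc (vx 0 *+ T - x) a0).
by exists (hc (vx 1 *+ T - x) a1).
Qed.
End LineBundles.

(** * Graded submodules as objects *)

Section GradedSub.
Variables (k : closedFieldType) (p q : nat).

Definition gs_pred (M : grmod k p q) (V : set M) (hV : gsub V) : {pred M} := fun m => `[< V m >].

Lemma gs_pred_closed (M : grmod k p q) (V : set M) (hV : gsub V) : submod_closed (gs_pred hV).
Proof.
have [sV _] := (gsubP V).1 hV; split=> [|a x y /asboolP h1 /asboolP h2]; apply/asboolP.
  exact: subm0.
exact: sV.2.
Qed.
End GradedSub.

HB.instance Definition _ k p q (M : grmod k p q) (V : set M) (hV : gsub V) :=
  GRing.isSubmodClosed.Build (Spol k) M (gs_pred hV) (gs_pred_closed hV).

Definition gst k p q (M : grmod k p q) (V : set M) (hV : gsub V) : Type := {x : M | x \in gs_pred hV}.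
HB.instance Definition _ k p q (M : grmod k p q) (V : set M) (hV : gsub V) :=
  Choice.on (gst hV).
HB.instance Definition _ k p q (M : grmod k p q) (V : set M) (hV : gsub V) :=
  [isSub for (@proj1_sig _ _ : gst hV -> M)].
HB.instance Definition _ k p q (M : grmod k p q) (V : set M) (hV : gsub V) :=
  [SubChoice_isSubLmodule of gst hV by <:].

Section GradedSub.
Variables (k : closedFieldType) (p q : nat) (M : grmod k p q) (V : set M) (hV : gsub V).
Local Notation S := (Spol k).
Local Notation L := (Lpq p q).

Lemma gsvP (u : gst hV) : V (\val u).
Proof. by apply/asboolP; exact: (valP u). Qed.

Definition gsin (m : M) (h : V m) : gst hV := exist _ m (introT (asboolP _) h).

Lemma gsvL a (u v : gst hV) : \val (a *: u + v) = a *: \val u + \val v.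
Proof. exact: linearP. Qed.
Lemma gsv0 : \val (0 : gst hV) = 0.
Proof. exact: raddf0. Qed.
Lemma gsvB (u v : gst hV) : \val (u - v) = \val u - \val v.
Proof. exact: raddfB. Qed.
Lemma gsvZ a (u : gst hV) : \val (a *: u) = a *: \val u.
Proof. exact: linearZ. Qed.
Lemma gsv_sum (r : seq L) (F : L -> gst hV) : \val (\sum_(x <- r) F x) = \sum_(x <- r) \val (F x).
Proof. exact: raddf_sum. Qed.

Definition gsubm : grmod k p q.
Proof.
refine (@GrMod k p q (gst hV : lmodType S) (fun x => [set u | ghom x (\val u)]) _ _ _ _ _ _).
- by move=> x; rewrite /mkset gsv0; exact: ghom0.
- by move=> x m m' h h'; rewrite /mkset gsvB; exact: ghomB.
- by move=> x y s m hs h; rewrite /mkset gsvZ; exact: ghomZ.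
- move=> m; have [r [ur e h]] := hc_sum (\val m).
  have hh x : V (hc x (\val m)) by apply: ((gsubP V).1 hV).2; exact: gsvP.
  exists r, (fun x => gsin (hh x)); split=> //; first by move=> x; exact: hc_hom.
  by apply: val_inj; rewrite gsv_sum {1}e.
- move=> r f ur hf e x xr; apply: val_inj; rewrite [RHS]gsv0.
  have := @ghom_direct _ _ _ M r (fun x => \val (f x)) ur hf; rewrite -gsv_sum e gsv0.
  by move=> /(_ erefl); apply.
- have [e he] := gfingen M; have [l [hl1 hl2]] := noeth e ((gsubP V).1 hV).1.
  have [l' [h1 h2]] := @mem_lift M (gst hV) (fun a u => a = \val u) l (fun a al => ex_intro _ (gsin (hl1 a al)) erefl).
  exists l' => m; have gm : gen l (\val m) by apply: hl2; [exact: gsvP|exact: he].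
  suff : exists u, gen l' u /\ \val u = \val m by move=> [u [gu /val_inj <-]].
  apply: (gen_sub (V := fun x => exists u, gen l' u /\ \val u = x)) gm.
    split; first by exists 0; rewrite gsv0; split=> //; exact: (subm0 (gen_submod l')).
    move=> a x x' [u [gu <-]] [u' [gu' <-]]; exists (a *: u + u'); split; first exact: (gen_submod l').2.
    by rewrite gsvL.
  by move=> a /h1[u ul ->]; exists u; split=> //; exact: gen_mem.
Defined.

Definition gsi (u : gsubm) : M := \val (u : gst hV).
Lemma gsi_lin : linear gsi. Proof. by move=> a u v; exact: gsvL. Qed.
Lemma gsi_hom x u : ghom x u -> ghom x (gsi u). Proof. by []. Qed.
Lemma gsi_in u : V (gsi u). Proof. exact: gsvP. Qed.
Lemma gsi_ex m : V m -> exists u, m = gsi u. Proof. by move=> h; exists (gsin h). Qed.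
Lemma gsi_inj0 u : gsi u = 0 -> u = 0. Proof. by move=> h; apply: val_inj; rewrite [RHS]gsv0. Qed.
Lemma gsi0 : gsi 0 = 0. Proof. exact: gsv0. Qed.
Lemma gsiZ a u : gsi (a *: u) = a *: gsi u. Proof. exact: gsvZ. Qed.
Lemma gsi_sum (r : seq L) (F : L -> gsubm) : gsi (\sum_(x <- r) F x) = \sum_(x <- r) gsi (F x).
Proof. exact: gsv_sum. Qed.
Lemma gsi_hc x u : gsi (hc x u) = hc x (gsi u).
Proof.
have [r [ur eu hr]] := hc_sum u.
rewrite (@hc_uniq _ _ _ M r (fun z => gsi (hc z u)) (gsi u) ur).
- by case: ifP => // /negbT /hr ->; exact: gsi0.
- by move=> z; apply: gsi_hom; exact: hc_hom.
- by rewrite {1}eu gsi_sum.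
Qed.
End GradedSub.

(** * Pullback and pushout of extensions; retracts and direct sums *)

Section ExtProps.
Variables (k : closedFieldType) (p q : nat).
Hypotheses (p_gt0 : (0 < p)%N) (q_gt0 : (0 < q)%N).
Local Notation xx := (@xx k).
Local Notation grmod := (grmod k p q).
Implicit Types A B C D E M N P : grmod.
Local Notation qdom := (@qdom _ _ _ p_gt0 q_gt0 _ _).
Local Notation qker := (@qker _ _ _ p_gt0 q_gt0 _ _).
Local Notation qfun := (@qfun _ _ _ p_gt0 q_gt0 _ _).
Local Notation mkq := (@mkq _ _ _ p_gt0 q_gt0).
Local Notation qeqP := (@qeqP _ _ _ p_gt0 q_gt0 _ _ _ _).
Local Notation sexP := (@sexP _ _ _ p_gt0 q_gt0 _ _ _ _ _).

Lemma near0_lin M N (h : M -> N) m : linear h -> near0 m -> near0 (h m).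
Proof.
move=> hl [K hK]; exists K => b.
have h0 : h 0 = 0 by have := hl (-1) 0 0; rewrite scaler0 addr0 scaleN1r addNr.
by have := hl (xx b ^+ K) m 0; rewrite h0 !addr0 hK h0.
Qed.

Lemma prB M (V : set M) (gV : gsub V) m m' : pr gV (m - m') = pr gV m - pr gV m'.
Proof. by rewrite -scaleN1r prD prZ scaleN1r. Qed.

Lemma pr_eqP M (V : set M) (gV : gsub V) m m' : pr gV m = pr gV m' <-> V (m - m').
Proof.
split=> [e|/(pr_eq0 gV)/eqP]; first by apply/(pr_eq0 gV); rewrite prB e subrr.
by rewrite prB subr_eq0 => /eqP.
Qed.

(** Pull the extension back along [f]: the fibre product of E and A over C is an extension of A by
    B, so it splits, and a splitting followed by the projection to E is the lift. *)
Lemma ExtLift A B E C (i : qhom B E) (g : qhom E C) (f : qhom A C) :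
  Ext1_zero A B -> short_exact i g -> exists s : qhom A E, qeq (qcomp g s) f.
Proof.
move=> hE /sexP[im ge gi hk].
pose V : set (dsum E A) := [set u | exists c, graph g (u.1, c) /\ graph f (u.2, c)].
have gV : gsub V := relcomp_gsub (qg_sub g) (relinv_gsub (qg_sub f)).
pose P := gsubm gV.
have l1 : linear (fun u : P => (gsi u).1) by move=> a u v; rewrite gsi_lin.
have l2 : linear (fun u : P => (gsi u).2) by move=> a u v; rewrite gsi_lin.
have h1 x (u : P) : ghom x u -> ghom x (gsi u).1 by move=> /gsi_hom[].
have h2 x (u : P) : ghom x u -> ghom x (gsi u).2 by move=> /gsi_hom[].
pose p1 := qlin l1 h1; pose p2 := qlin l2 h2.
pose J : set (dsum B P) := [set u : dsum B P | graph i (u.1, (gsi u.2).1) /\ (gsi u.2).2 = 0].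
have gJ : gsub J.
  apply: gsub_pair; first split.
  - have z : gsi (0 : P) = 0 by exact: gsi0.
    by split; [change (graph i (0, (gsi (0 : P)).1)); rewrite z; exact: qg0|change ((gsi (0 : P)).2 = 0); rewrite z].
  - move=> a [m u] [m' u'] [/= e1 e2] [/= e1' e2']; have e3 := gsi_lin a u u'; split.
      change (graph i (a *: m + m', (gsi (a *: u + u' : P)).1)); rewrite e3.
      exact: ((qg_submod i).2 a _ _ e1 e1').
    change ((gsi (a *: u + u' : P)).2 = 0); rewrite e3.
    by rewrite /= e2 e2' scaler0 addr0.
  - move=> x m u [/= e1 e2]; rewrite /J /= gsi_hc hc_dsum /= e2 hc0; split=> //.
    exact: qgH.
have JP : is_qgraph J.
  apply: mkq => // [b|u [/= e1 e2]]; last first.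
    have [K hK] := qker e1; exists K => c; apply: gsi_inj0; rewrite gsiZ; case: (gsi u) e2 hK => x y /= -> hK.
    by rewrite pairZ hK scaler0.
  have [sd _] := (gsubP _).1 (gdom_gsub gJ).
  have [K hK] := qdom i b; apply: (nearV_mul sd (K := K)) => c; have [e he] := hK c.
  have [K' hK'] := qdom g e; apply: (nearV_mul sd (K := K')) => c'; have [x hx] := hK' c'.
  have nx : near0 x := gi _ _ _ (qgZ _ he) hx.
  have [K2 hK2] := nx; exists K2 => c''.
  have [|u eu] := @gsi_ex _ _ _ _ _ gV (xx c'' ^+ K2 *: (xx c' ^+ K' *: e), 0).
    by exists 0; split=> /=; [have := qgZ (xx c'' ^+ K2) hx; rewrite hK2|exact: qg0].
  exists u; rewrite /J /= -eu; split=> //=; do 2 apply: qgZ; exact: he.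
have ex2 : short_exact (QHom JP) p2.
  apply/sexP; split.
  - apply/(monoP p_gt0 q_gt0) => b u [/= e1 e2] nu; apply: ((monoP p_gt0 q_gt0 i).1 im _ _ e1).
    by apply: (near0_lin (h := fun u : P => (gsi u).1)).
  - apply/(epiP p_gt0 q_gt0) => a.
    have [sd _] := (gsubP _).1 (gimg_gsub (qg_sub p2)).
    have [K hK] := qdom f a; apply: (nearV_mul sd (K := K)) => c; have [x hx] := hK c.
    have [K' hK'] := (epiP p_gt0 q_gt0 g).1 ge x; exists K' => c'; have [e he] := hK' c'.
    have [|u eu] := @gsi_ex _ _ _ _ _ gV (e, xx c' ^+ K' *: (xx c ^+ K *: a)).
      by exists (xx c' ^+ K' *: x); split=> //; exact: qgZ.
    by exists u; rewrite /= -eu.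
  - by move=> b u a [/= e1 e2] ->; rewrite e2; exact: near00.
  - move=> u a /= -> [K hK]; have [sd _] := (gsubP _).1 (gimg_gsub gJ).
    have [c [/= hc1 hc2]] := gsi_in u; have na : near0 (gsi u).2 by exists K.
    have nc : near0 c := near0_graph p_gt0 q_gt0 na hc2.
    have [K1 hK1] := hk _ _ hc1 nc; exists (K + K1)%N => j.
    have [b hb] := hK1 j; exists (xx j ^+ K *: b).
    have ez := gsiZ (xx j ^+ (K + K1)) u; split.
      change (graph i (xx j ^+ K *: b, (gsi (xx j ^+ (K + K1) *: u : P)).1)); rewrite ez /=.
      by rewrite exprD -scalerA; exact: qgZ.
    change ((gsi (xx j ^+ (K + K1) *: u : P)).2 = 0); rewrite ez /=.
    by rewrite addnC exprD -scalerA hK scaler0.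
have [s /qeqP hs] := hE P (QHom JP) p2 ex2.
exists (qcomp p1 s); apply/qeqP => a c1 c2 [/= e [[u [su /= ->]] he]] hf.
have := hs a (gsi u).2 a (ex_intro _ u (conj su erefl)) erefl.
have [c [/= hc1 hc2]] := gsi_in u => na.
apply: (near0_trans (qfun he hc1)).
exact: (near0_graph p_gt0 q_gt0 na (qgB hc2 hf)).
Qed.

Lemma pr_hc M (V : set M) (gV : gsub V) x m : hc x (pr gV m) = pr gV (hc x m).
Proof.
have [r [ur e h]] := hc_sum m.
rewrite (@hc_uniq _ _ _ (gquot gV) r (fun z => pr gV (hc z m)) (pr gV m) ur).
- case: ifP => // /negbT /h ->; apply/esym/pr_eq0.
  by have [sV _] := (gsubP _).1 gV; exact: subm0.
- by move=> z; apply: pr_hom; exact: hc_hom.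
- rewrite {1}e; apply: (big_morph (pr gV)); first exact: prD.
  by apply/pr_eq0; have [sV _] := (gsubP _).1 gV; exact: subm0.
Qed.

(** Push the extension out along [psi]: a section of the resulting extension of A by B' yields a
    retraction onto B', and this is composed with E -> Q. *)
Lemma ExtPush A B B' E (i : qhom B E) (g : qhom E A) (psi : qhom B B') :
  Ext1_zero A B' -> short_exact i g -> exists t : qhom E B', qeq (qcomp t i) psi.
Proof.
move=> hE /sexP[im ge gi hk].
pose D := dsum E B'.
pose V : set D := [set u : D | exists b, graph i (b, u.1) /\ graph psi (b, u.2)].
have gV : gsub V := relcomp_gsub (relinv_gsub (qg_sub i)) (qg_sub psi).
have [sV _] := (gsubP _).1 gV.
pose Q := gquot gV.
(* The sign makes the square commute: modulo [V], the class of (i b, 0) is that of (0, -psi b). *)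
have j_lin : linear (fun b : B' => pr gV (0, - b) : Q).
  by move=> a u v; rewrite -pr_lin; congr pr; congr (_, _); rewrite /= ?scaler0 ?addr0 // opprD scalerN.
have j_hom x b : ghom x b -> ghom x (pr gV (0, - b)).
  move=> h; apply: pr_hom; apply: dsum_homI; first exact: ghom0.
  by rewrite -sub0r; apply: ghomB => //; exact: ghom0.
have f_lin : linear (fun u : D => u.1 : E) by [].
have f_hom x (u : D) : ghom x u -> ghom x u.1 by case.
pose j := qlin j_lin j_hom; pose fp := qlin (@pr_lin _ _ _ D _ gV) (@pr_hom _ _ _ D _ gV).
pose gf := qcomp g (qlin f_lin f_hom).
pose G : set (dsum Q A) := [set u : dsum Q A | exists n, graph fp (n, u.1) /\ graph gf (n, u.2)].
have gG : gsub G := relcomp_gsub (relinv_gsub (qg_sub fp)) (qg_sub gf).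
have GE u a : G (u, a) <-> exists e b, u = pr gV (e, b) /\ graph g (e, a).
  split=> [[[e b] [/= e1 [e' [/= -> h]]]]|[e [b [-> h]]]]; first by exists e, b.
  by exists (e, b); split=> //; exists e.
have jnear b : near0 (pr gV (0, b)) -> near0 b.
  move=> [K hK]; apply: (near0_mul (K := K)) => c.
  have := hK c; rewrite -prZ => /pr_eq0[b0 [/= h1 h2]]; rewrite scaler0 in h1.
  apply: (near0_graph p_gt0 q_gt0 _ h2).
  by apply: ((monoP p_gt0 q_gt0 i).1 im _ _ h1); exact: near00.
have Vd e b c : V (e, c) -> pr gV (e, b) = pr gV (0, b - c).
  by move=> h; apply/pr_eqP; rewrite pairB subr0 subKr.
have gV0 e b a : V (e, b) -> graph g (e, a) -> near0 a.
  by move=> [b0 [/= h _]]; exact: gi h.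
have GP : is_qgraph G.
  apply: mkq => // [u|a /GE[e [b [/esym/pr_eq0 h1 h2]]]]; last exact: gV0 h1 h2.
  have [[e b] ->] := pr_surj u; have [K hK] := qdom g e; exists K => c.
  by have [a ha] := hK c; exists a; apply/GE; exists (xx c ^+ K *: e), (xx c ^+ K *: b); rewrite -prZ.
have ex2 : short_exact j (QHom GP).
  apply/sexP; split.
  - apply/(monoP p_gt0 q_gt0) => b u /= -> /jnear h; rewrite -[b]opprK; exact: near0N.
  - apply/(epiP p_gt0 q_gt0) => a; have [K hK] := (epiP p_gt0 q_gt0 g).1 ge a; exists K => c.
    by have [e he] := hK c; exists (pr gV (e, 0)); apply/GE; exists e, 0.
  - move=> b u a /= -> /GE[e [b' [h1 h2]]].
    apply: (gV0 e (b' + b)) h2; apply/(pr_eq0 gV).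
    have -> : (e, b' + b) = (e, b') - (0, - b) :> D by rewrite pairB subr0 opprK.
    by rewrite prB h1 subrr.
  - move=> u a /GE[e [b [-> h]]] na; have [K hK] := hk _ _ h na.
    have [sd _] := (gsubP _).1 (gimg_gsub (qg_sub j)).
    apply: (nearV_mul sd (K := K)) => c; have [b0 hb0] := hK c.
    have [K' hK'] := qdom psi b0; exists K' => c'; have [b1 hb1] := hK' c'.
    exists (b1 - xx c' ^+ K' *: (xx c ^+ K *: b)).
    change (xx c' ^+ K' *: (xx c ^+ K *: pr gV (e, b)) = pr gV (0, - (b1 - xx c' ^+ K' *: (xx c ^+ K *: b)))).
    transitivity (pr gV (xx c' ^+ K' *: (xx c ^+ K *: ((e, b) : D)))); first by rewrite !prZ.
    rewrite opprB.
    by apply: (Vd (xx c' ^+ K' *: (xx c ^+ K *: e))); exists (xx c' ^+ K' *: b0); split=> //; exact: qgZ.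
have [s /qeqP hs] := hE Q j (QHom GP) ex2.
(* The class of (e, 0) minus the value of [s] at g(e) lies in the image of [j], and [b] is its
   coordinate there. *)
pose T : set (dsum E B') := [set u : dsum E B' | exists a, graph g (u.1, a) /\ graph s (a, pr gV u)].
have gT : gsub T.
  apply: gsub_pair; first split.
  - exists 0; split; first exact: qg0.
    have z : pr gV 0 = 0 by apply/pr_eq0; exact: subm0.
    by rewrite z; exact: qg0.
  - move=> a u u' [x [h1 h2]] [x' [h1' h2']]; exists (a *: x + x'); split.
      exact: (qg_submod g).2 a _ _ h1 h1'.
    by rewrite pr_lin; exact: (qg_submod s).2 a _ _ h2 h2'.
  - move=> x e b [a [/= h1 h2]]; exists (hc x a); split; first exact: qgH.
    by have := qgH x h2; rewrite pr_hc hc_dsum.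
have [sT _] := (gsubP _).1 (gdom_gsub gT).
have TP : is_qgraph T.
  apply: mkq => // [e|b [a [/= h1 h2]]]; last first.
    by apply: jnear; apply: (near0_graph p_gt0 q_gt0 _ h2); exact: qker h1.
  have [K hK] := qdom g e; apply: (nearV_mul sT (K := K)) => c; have [a ha] := hK c.
  have [K' hK'] := qdom s a; apply: (nearV_mul sT (K := K')) => c'; have [u hu] := hK' c'.
  have {ha} ha := qgZ (xx c' ^+ K') ha.
  clear hK hK'; move: (xx c' ^+ K' *: (xx c ^+ K *: e)) (xx c' ^+ K' *: a) ha hu => {}e {}a ha hu.
  have [[e1 b1] eu] := pr_surj u.
  have [K1 hK1] := qdom g e1; apply: (nearV_mul sT (K := K1)) => d; have [a1 ha1] := hK1 d.
  have n1 : near0 (a1 - xx d ^+ K1 *: a).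
    apply: (hs (xx d ^+ K1 *: a)) => //; exists (xx d ^+ K1 *: u); split; first exact: qgZ.
    by apply/GE; exists (xx d ^+ K1 *: e1), (xx d ^+ K1 *: b1); rewrite eu -prZ.
  have [K2 hK2] := hk _ _ (qgB ha1 (qgZ (xx d ^+ K1) ha)) n1.
  apply: (nearV_mul sT (K := K2)) => d'; have [b2 hb2] := hK2 d'.
  have [K3 hK3] := qdom psi b2; exists K3 => d''; have [b3 hb3] := hK3 d''.
  pose X := xx d'' ^+ K3 * (xx d' ^+ K2 * xx d ^+ K1).
  have XE (M : grmod) (m : M) : xx d'' ^+ K3 *: (xx d' ^+ K2 *: (xx d ^+ K1 *: m)) = X *: m by rewrite !scalerA /X mulrA.
  exists (X *: b1 - b3), (X *: a); rewrite XE; split; first exact: qgZ.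
  have -> : pr gV (X *: e, X *: b1 - b3) = X *: u; last exact: qgZ.
  apply/esym; rewrite eu -prZ pairZ; apply/pr_eqP; rewrite pairB subKr.
  exists (xx d'' ^+ K3 *: b2); split=> //.
  by have := qgZ (xx d'' ^+ K3) hb2; rewrite !scalerBr !XE.
exists (QHom TP); apply/qeqP => b b1 b2 [/= e [h1 [a [/= h2 h3]]]] h4.
apply: jnear; rewrite -(Vd e); last by exists b.
by apply: (near0_graph p_gt0 q_gt0 _ h3); exact: gi h1 h2.
Qed.

Local Notation qcomp_eq := (@qcomp_eq _ _ _ p_gt0 q_gt0 _ _ _ _ _ _ _).
Local Notation qeq_trans := (@qeq_trans _ _ _ p_gt0 q_gt0 _ _).
Local Notation qeq_sym := (@qeq_sym _ _ _ p_gt0 q_gt0 _ _ _ _).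
Local Notation qeq_refl := (@qeq_refl _ _ _ p_gt0 q_gt0 _ _).
Local Notation qcompA := (@qcompA _ _ _ p_gt0 q_gt0 _ _ _ _).
Local Notation qid_l := (@qid_l _ _ _ p_gt0 q_gt0 _ _).
Local Notation qid_r := (@qid_r _ _ _ p_gt0 q_gt0 _ _).

(** The section inverts [g] on the kernel of [t], which is a complement of the image of [i]. *)
Lemma ret_sec B E A (i : qhom B E) (g : qhom E A) (t : qhom E B) :
  short_exact i g -> qeq (qcomp t i) (qid B) -> exists s : qhom A E, qeq (qcomp g s) (qid A).
Proof.
move=> /sexP[im ge gi hk] /qeqP ht.
have {}ht b e b' : graph i (b, e) -> graph t (e, b') -> near0 (b' - b).
  by move=> h1 h2; apply: (ht b) => //; exists e.
pose G : set (dsum A E) := [set u : dsum A E | graph g (u.2, u.1) /\ exists b, graph t (u.2, b) /\ near0 b].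
have gG : gsub G.
  apply: gsub_pair; first split.
  - by split; [exact: qg0|exists 0; split; [exact: qg0|exact: near00]].
  - move=> a [m u] [m' u'] [h1 [b [h2 h3]]] [h1' [b' [h2' h3']]]; split.
      exact: ((qg_submod g).2 a _ _ h1 h1').
    exists (a *: b + b'); split; first exact: ((qg_submod t).2 a _ _ h2 h2').
    by apply: near0D => //; exact: near0Z.
  - move=> x m e [h1 [b [h2 h3]]]; split; first exact: qgH.
    by exists (hc x b); split; [exact: qgH|exact: near0H].
have [sG _] := (gsubP _).1 (gdom_gsub gG).
have GP : is_qgraph G.
  apply: mkq => // [a|e [h1 [b [h2 h3]]]]; last first.
    have [K hK] := hk _ _ h1 (near00 _); apply: (near0_mul (K := K)) => c.
    have [b1 hb1] := hK c; apply: (near0_graph p_gt0 q_gt0 _ hb1).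
    have := near0B (near0Z (xx c ^+ K) h3) (ht _ _ _ hb1 (qgZ _ h2)).
    by rewrite subKr.
  have [K hK] := (epiP p_gt0 q_gt0 g).1 ge a; apply: (nearV_mul sG (K := K)) => c.
  have [e he] := hK c; move: (xx c ^+ K *: a) he => {}a he {hK}.
  have [K1 hK1] := qdom t e; apply: (nearV_mul sG (K := K1)) => c1; have [b hb] := hK1 c1.
  have [K2 hK2] := qdom i b; apply: (nearV_mul sG (K := K2)) => c2; have [e1 he1] := hK2 c2.
  have [K3 hK3] := qdom g e1; apply: (nearV_mul sG (K := K3)) => c3; have [a1 ha1] := hK3 c3.
  have [K4 hK4] := gi _ _ _ (qgZ _ he1) ha1; apply: (nearV_mul sG (K := K4)) => c4.
  have [K5 hK5] := qdom t (xx c4 ^+ K4 *: (xx c3 ^+ K3 *: e1)); exists K5 => c5; have [b5 hb5] := hK5 c5.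
  pose Y := xx c5 ^+ K5 * (xx c4 ^+ K4 * xx c3 ^+ K3).
  pose X := Y * (xx c2 ^+ K2 * xx c1 ^+ K1).
  have YE (M : grmod) (m : M) : xx c5 ^+ K5 *: (xx c4 ^+ K4 *: (xx c3 ^+ K3 *: m)) = Y *: m by rewrite !scalerA /Y mulrA.
  have XE (M : grmod) (m : M) : Y *: (xx c2 ^+ K2 *: (xx c1 ^+ K1 *: m)) = X *: m by rewrite !scalerA /X mulrA.
  exists (X *: e - Y *: e1); split => /=.
    have := qgB (qgZ X he) (qgZ (xx c5 ^+ K5) (qgZ (xx c4 ^+ K4) ha1)).
    by rewrite YE XE hK4 scaler0 subr0 YE.
  rewrite YE in hb5; have h1 : graph t (X *: e, Y *: (xx c2 ^+ K2 *: b)).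
    by have := qgZ Y (qgZ (xx c2 ^+ K2) hb); rewrite XE.
  exists (Y *: (xx c2 ^+ K2 *: b) - b5); split; first exact: qgB.
  by apply: near0_sym; exact: ht (qgZ Y he1) hb5.
exists (QHom GP); apply/qeqP => a a1 a2 [/= e [[h1 _] h2]] ->; exact: qfun h2 h1.
Qed.

(** Direct summands are used in this form: vanishing of Hom and Ext^1 passes to retracts without a
    complement being chosen. *)
Definition retract A' A := exists (j : qhom A' A) (r : qhom A A'), qeq (qcomp r j) (qid A').

Lemma retract_refl A : retract A A.
Proof. by exists (qid A), (qid A); exact: qid_l. Qed.

Lemma retract_trans A B C : retract A B -> retract B C -> retract A C.
Proof.
move=> [j [r h]] [j' [r' h']]; exists (qcomp j' j), (qcomp r r').
apply: (qeq_trans (qcompA _ _ _)); apply: (qeq_trans (g := qcomp r j)) h.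
apply: qcomp_eq; last exact: qeq_refl.
apply: (qeq_trans (qeq_sym (qcompA _ _ _))).
apply: (qeq_trans (g := qcomp r (qid B))); last exact: qid_r.
by apply: qcomp_eq => //; exact: qeq_refl.
Qed.

Lemma iso_retract A B : isomorphic A B -> retract A B /\ retract B A.
Proof. by move=> [f [g [h1 h2]]]; split; [exists f, g|exists g, f]. Qed.

Lemma iso_sym A B : isomorphic A B -> isomorphic B A.
Proof. by move=> [f [g [h1 h2]]]; exists g, f. Qed.

Lemma iso_refl A : isomorphic A A.
Proof. by exists (qid A), (qid A); split; exact: qid_l. Qed.

Lemma iso_trans A B C : isomorphic A B -> isomorphic B C -> isomorphic A C.
Proof.
have aux A1 B1 C1 (f : qhom A1 B1) (g : qhom B1 A1) (f' : qhom B1 C1) (g' : qhom C1 B1) :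
    qeq (qcomp g f) (qid A1) -> qeq (qcomp g' f') (qid B1) ->
    qeq (qcomp (qcomp g g') (qcomp f' f)) (qid A1).
  move=> h h'; apply: (qeq_trans (qcompA _ _ _)); apply: (qeq_trans (g := qcomp g f)) h.
  apply: qcomp_eq; last exact: qeq_refl.
  apply: (qeq_trans (qeq_sym (qcompA _ _ _))).
  apply: (qeq_trans (g := qcomp g (qid B1))); last exact: qid_r.
  by apply: qcomp_eq => //; exact: qeq_refl.
move=> [f [g [h1 h2]]] [f' [g' [h1' h2']]]; exists (qcomp f' f), (qcomp g g').
by split; exact: aux.
Qed.

Section Dsum.
Variables A B : grmod.
Lemma inl_lin : linear (fun a : A => (a, 0) : dsum A B).
Proof. by move=> a u v; congr (_, _); rewrite /= scaler0 addr0. Qed.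
Lemma inl_hom x (a : A) : ghom x a -> @ghom _ _ _ (dsum A B) x (a, 0).
Proof. by move=> h; apply: dsum_homI => //; exact: ghom0. Qed.
Lemma inr_lin : linear (fun b : B => (0, b) : dsum A B).
Proof. by move=> a u v; congr (_, _); rewrite /= scaler0 addr0. Qed.
Lemma inr_hom x (b : B) : ghom x b -> @ghom _ _ _ (dsum A B) x (0, b).
Proof. by move=> h; apply: dsum_homI => //; exact: ghom0. Qed.
Lemma prl_lin : linear (fun u : dsum A B => u.1). Proof. by []. Qed.
Lemma prl_hom x (u : dsum A B) : ghom x u -> ghom x u.1. Proof. by case. Qed.
Lemma prr_lin : linear (fun u : dsum A B => u.2). Proof. by []. Qed.
Lemma prr_hom x (u : dsum A B) : ghom x u -> ghom x u.2. Proof. by case. Qed.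
Definition qinl := qlin inl_lin inl_hom.
Definition qinr := qlin inr_lin inr_hom.
Definition qprl := qlin prl_lin prl_hom.
Definition qprr := qlin prr_lin prr_hom.

Lemma retract_l : retract A (dsum A B).
Proof. by exists qinl, qprl; apply/qeqP => m n1 n2 [/= u [-> ->]] ->; rewrite subrr; exact: near00. Qed.
Lemma retract_r : retract B (dsum A B).
Proof. by exists qinr, qprr; apply/qeqP => m n1 n2 [/= u [-> ->]] ->; rewrite subrr; exact: near00. Qed.

Lemma copair C (f : qhom A C) (g : qhom B C) : exists h : qhom (dsum A B) C,
  forall u c, graph h (u, c) <-> exists c1 c2, [/\ graph f (u.1, c1), graph g (u.2, c2) & c = c1 + c2].
Proof.
pose G : set (dsum (dsum A B) C) := [set u : dsum (dsum A B) C | exists c1 c2, [/\ graph f (u.1.1, c1), graph g (u.1.2, c2) & u.2 = c1 + c2]].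
have gG : gsub G.
  apply: gsub_pair; first split.
  - by exists 0, 0; rewrite addr0; split=> //; exact: qg0.
  - move=> a [[x y] z] [[x' y'] z'] [c1 [c2 [h1 h2 h3]]] [c1' [c2' [h1' h2' h3']]].
    exists (a *: c1 + c1'), (a *: c2 + c2'); split.
    + exact: ((qg_submod f).2 a _ _ h1 h1').
    + exact: ((qg_submod g).2 a _ _ h2 h2').
    + by rewrite /= (h3 : z = _) (h3' : z' = _) scalerDr addrACA.
  - move=> x [m m'] c [c1 [c2 [h1 h2 h3]]]; exists (hc x c1), (hc x c2); rewrite hc_dsum; split.
    + exact: qgH.
    + exact: qgH.
    + by rewrite /= (h3 : c = _) hcD.
have GP : is_qgraph G.
  apply: mkq => // [[a b]|c [c1 [c2 [h1 h2 h3]]]]; last first.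
    by rewrite (h3 : c = _); apply: near0D; [exact: qker h1|exact: qker h2].
  have [K hK] := qdom f a; have [K' hK'] := qdom g b.
  have [sf _] := (gsubP _).1 (gdom_gsub (qg_sub f)); have [sg _] := (gsubP _).1 (gdom_gsub (qg_sub g)).
  exists (K + K')%N => c; have [c1 h1] := nearE sf (leq_addr K' K) hK c.
  have [c2 h2] := nearE sg (leq_addl K K') hK' c.
  by exists (c1 + c2), c1, c2.
by exists (QHom GP) => u c.
Qed.

Lemma pairing C (f : qhom C A) (g : qhom C B) : exists h : qhom C (dsum A B),
  forall c u, graph h (c, u) <-> graph f (c, u.1) /\ graph g (c, u.2).
Proof.
pose G : set (dsum C (dsum A B)) := [set u : dsum C (dsum A B) | graph f (u.1, u.2.1) /\ graph g (u.1, u.2.2)].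
have gG : gsub G.
  apply: gsub_pair; first split.
  - by split; exact: qg0.
  - move=> a [z [x y]] [z' [x' y']] [h1 h2] [h1' h2']; split.
    + exact: ((qg_submod f).2 a _ _ h1 h1').
    + exact: ((qg_submod g).2 a _ _ h2 h2').
  - by move=> x c [m m'] [h1 h2]; rewrite hc_dsum; split; exact: qgH.
have GP : is_qgraph G.
  apply: mkq => // [c|[a b] [h1 h2]]; last first.
    have [K hK] := qker h1; have [K' hK'] := qker h2.
    exists (K + K')%N => c; rewrite pairZ; congr (_, _).
      by rewrite addnC exprD -scalerA hK scaler0.
    by rewrite exprD -scalerA hK' scaler0.
  have [K hK] := qdom f c; have [K' hK'] := qdom g c.
  have [sf _] := (gsubP _).1 (gdom_gsub (qg_sub f)); have [sg _] := (gsubP _).1 (gdom_gsub (qg_sub g)).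
  exists (K + K')%N => c'; have [c1 h1] := nearE sf (leq_addr K' K) hK c'.
  have [c2 h2] := nearE sg (leq_addl K K') hK' c'.
  by exists (c1, c2).
by exists (QHom GP) => u c.
Qed.
End Dsum.

Lemma Hom_ret A A' B B' : retract A' A -> retract B' B -> Hom_zero A B -> Hom_zero A' B'.
Proof.
move=> [j [r /qeqP hr]] [j' [r' /qeqP hr']] h f; apply/(qzeroP p_gt0 q_gt0) => a b hab.
have /(qzeroP p_gt0 q_gt0) h0 := h (qcomp j' (qcomp f r)).
have [K1 hK1] := qdom j a; apply: (near0_mul (K := K1)) => c1; have [x hx] := hK1 c1.
have [K2 hK2] := qdom r x; apply: (near0_mul (K := K2)) => c2; have [a' ha'] := hK2 c2.
have na := hr _ _ _ (ex_intro _ _ (conj (qgZ (xx c2 ^+ K2) hx) ha')) erefl.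
have [K3 hK3] := qdom f a'; apply: (near0_mul (K := K3)) => c3; have [b1 hb1] := hK3 c3.
have [K4 hK4] := qdom j' b1; apply: (near0_mul (K := K4)) => c4; have [y hy] := hK4 c4.
have [K5 hK5] := qdom r' y; apply: (near0_mul (K := K5)) => c5; have [b2 hb2] := hK5 c5.
have ny : near0 y.
  apply: (h0 (xx c4 ^+ K4 *: (xx c3 ^+ K3 *: (xx c2 ^+ K2 *: x)))).
  exists (xx c4 ^+ K4 *: b1); split=> //; exists (xx c4 ^+ K4 *: (xx c3 ^+ K3 *: a')); split; last exact: qgZ.
  by do 2 apply: qgZ.
have nb2 : near0 b2 := near0_graph p_gt0 q_gt0 (near0Z _ ny) hb2.
have e1 := hr' _ _ _ (ex_intro _ _ (conj (qgZ (xx c5 ^+ K5) hy) hb2)) erefl.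
have nb1 : near0 (xx c5 ^+ K5 *: (xx c4 ^+ K4 *: b1)) by rewrite -[_ *: _](subKr b2); exact: near0B.
set Z := xx c3 ^+ K3 *: _.
have e2 : near0 (b1 - Z).
  apply: (near0_graph p_gt0 q_gt0 (near0Z (xx c3 ^+ K3) na) (f := f)).
  rewrite scalerBr; apply: qgB => //; do 2 apply: qgZ.
  by apply: (qgZ (xx c1 ^+ K1)).
by rewrite -[Z](subKr b1) !scalerBr; apply: near0B => //; rewrite -!scalerBr; do 2 apply: near0Z.
Qed.

Lemma Hom_dsum_l A B C : Hom_zero A C -> Hom_zero B C -> Hom_zero (dsum A B) C.
Proof.
move=> hA hB f; apply/(qzeroP p_gt0 q_gt0) => -[a b] c h.
have /(qzeroP p_gt0 q_gt0) h1 := hA (qcomp f (qinl A B)).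
have /(qzeroP p_gt0 q_gt0) h2 := hB (qcomp f (qinr A B)).
have [K1 hK1] := qdom f (a, 0); apply: (near0_mul (K := K1)) => c1; have [x hx] := hK1 c1.
have := near0D (h1 _ _ (ex_intro _ _ (conj erefl (_ : graph f ((xx c1 ^+ K1 *: a, 0), x)))))
  (h2 _ _ (ex_intro _ _ (conj erefl (_ : graph f ((0, xx c1 ^+ K1 *: b), xx c1 ^+ K1 *: c - x))))).
rewrite subrKC; apply.
  by move: hx; rewrite pairZ scaler0.
have := qgB (qgZ (xx c1 ^+ K1) h) hx.
by rewrite !pairZ scaler0 pairB subrr subr0.
Qed.

Lemma Ext_ret_l A A' B : retract A' A -> Ext1_zero A B -> Ext1_zero A' B.
Proof.
move=> [j [r hr]] hE E i g ex; have [s hs] := ExtLift r hE ex.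
exists (qcomp s j); apply: (qeq_trans (qcompA _ _ _)); apply: (qeq_trans (g := qcomp r j)) hr.
by apply: qcomp_eq => //; exact: qeq_refl.
Qed.

Lemma Ext_ret_r A B B' : retract B' B -> Ext1_zero A B -> Ext1_zero A B'.
Proof.
move=> [j [r hr]] hE E i g ex; have [t ht] := ExtPush j hE ex.
apply: (ret_sec (t := qcomp r t) ex).
apply: (qeq_trans (qeq_sym (qcompA _ _ _))); apply: (qeq_trans (g := qcomp r j)) hr.
by apply: qcomp_eq => //; exact: qeq_refl.
Qed.

Lemma Ext_dsum_l A B C : Ext1_zero A C -> Ext1_zero B C -> Ext1_zero (dsum A B) C.
Proof.
move=> hA hB E i g ex.
have [s1 /qeqP h1] := ExtLift (qinl A B) hA ex; have [s2 /qeqP h2] := ExtLift (qinr A B) hB ex.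
have [h hh] := copair s1 s2; exists h; apply/qeqP => -[a b] u1 u2 [/= e [/hh[e1 [e2 [/= c1 c2 ->]]] hg]] ->.
have [K hK] := qdom g e1; apply: (near0_mul (K := K)) => c; have [v hv] := hK c.
have hv' := qgB (qgZ (xx c ^+ K) hg) hv; rewrite scalerDr addrC addKr in hv'.
have n1 := h1 (xx c ^+ K *: a) v (xx c ^+ K *: a, 0) (ex_intro _ _ (conj (qgZ _ c1) hv)) erefl.
have n2 := h2 (xx c ^+ K *: b) _ (0, xx c ^+ K *: b) (ex_intro _ _ (conj (qgZ _ c2) hv')) erefl.
have := near0D n1 n2; congr near0.
rewrite addrACA [v + _]addrC subrK scalerBr -opprD; congr (_ - _).
by rewrite pairD addr0 add0r pairZ.
Qed.

Lemma Ext_dsum_r A B C : Ext1_zero C A -> Ext1_zero C B -> Ext1_zero C (dsum A B).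
Proof.
move=> hA hB E i g ex.
have [t1 /qeqP h1] := ExtPush (qprl A B) hA ex; have [t2 /qeqP h2] := ExtPush (qprr A B) hB ex.
have [t ht] := pairing t1 t2; apply: (ret_sec (t := t) ex).
apply/qeqP => u v w [/= e [hi /ht[c1 c2]]] ->.
have [K hK] := h1 u v.1 u.1 (ex_intro _ _ (conj hi c1)) erefl.
have [K' hK'] := h2 u v.2 u.2 (ex_intro _ _ (conj hi c2)) erefl.
case: u v {hi c1 c2} hK hK' => a b [a' b'] /= hK hK'.
exists (K + K')%N => c; rewrite pairB pairZ; congr (_, _).
  by rewrite addnC exprD -scalerA hK scaler0.
by rewrite exprD -scalerA hK' scaler0.
Qed.
End ExtProps.

(** * Hom and Ext between line bundles and torsion sheaves *)

Section Tables.
Variables (k : closedFieldType) (p q : nat).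
Hypotheses (p_gt0 : (0 < p)%N) (q_gt0 : (0 < q)%N).
Local Notation S := (Spol k).
Local Notation L := (Lpq p q).
Local Notation xx := (@xx k).
Local Notation vx := (@vx p q).
Local Notation Shom := (@Shom k p q).
Local Notation grmod := (grmod k p q).
Local Notation O := (@O k p q).
Local Notation prm := (@prm k p q).
Local Notation Qm := (@Qm k p q).
Local Notation one := (@one k p q).
Local Notation qe := (@qe k p q _ _ _ _ _ _).
Implicit Types A B M N P : grmod.
Local Notation qfun := (@qfun _ _ _ p_gt0 q_gt0 _ _).
Local Notation qeqP := (@qeqP _ _ _ p_gt0 q_gt0 _ _ _ _).
Local Notation sexP := (@sexP _ _ _ p_gt0 q_gt0 _ _ _ _ _).
Local Notation monoP := (@monoP _ _ _ p_gt0 q_gt0 _ _).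
Local Notation epiP := (@epiP _ _ _ p_gt0 q_gt0 _ _).

Lemma Shom_mon1 (i j : nat) d : vx 0 *+ i + vx 1 *+ j = d -> Shom d (xx 0 ^+ i * xx 1 ^+ j).
Proof. by move=> <-; have := @Shom_mon k p q 1 i j; rewrite scale1r. Qed.

Lemma mon_neq0 (i j : nat) : xx 0 ^+ i * xx 1 ^+ j != 0.
Proof. by rewrite mulf_neq0 ?xxn_neq0. Qed.

Lemma HomOO x y : Hom_zero (O x) (O y) <-> ~ exists i j : nat, y - x = vx 0 *+ i + vx 1 *+ j.
Proof.
split=> [h [i [j e]]|h].
  apply: (HomO_nonzero p_gt0 q_gt0 (m := xx 0 ^+ i * xx 1 ^+ j : O y)) h.
    by apply: Shom_mon1; rewrite -e addrC.
  by move/near0_O/eqP; rewrite (negPf (mon_neq0 i j)).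
apply: (HomOO_zero p_gt0 q_gt0) => w; elim/Shom_ind: w / => // [s t -> ->|c i j _ e]; first by rewrite addr0.
by case: h; exists i, j.
Qed.

(** A nonzero Cech class is carried by monomials divisible by neither [xx 0 ^+ K] nor [xx 1 ^+ K];
    the complementary exponents K - i and K - j are positive and express [x - y]. *)
Lemma ExtOO_zero x y : ~ (exists i j : nat, x - y = vx 0 *+ i.+1 + vx 1 *+ j.+1) -> Ext1_zero (O x) (O y).
Proof.
move=> h; apply: (ExtO_zero p_gt0 q_gt0) => K z hz.
suff [u [v ->]] : exists u v : S, z = xx 1 ^+ K * u - xx 0 ^+ K * v.
  exists 0%N, u, v; rewrite !expr0 mul1r addn0 scale1r subrr; exact: near00.
elim/Shom_ind: z / hz => [|s t [u [v ->]] [u' [v' ->]]|c i j _ e].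
- by exists 0, 0; rewrite !mulr0 subrr.
- by exists (u + u'), (v + v'); ring.
have [Ki|iK] := leqP K i.
  exists 0, (- (c *: (xx 0 ^+ (i - K) * xx 1 ^+ j))).
  rewrite mulr0 sub0r mulrN opprK -scalerAr mulrA -exprD subnKC //.
have [Kj|jK] := leqP K j.
  exists (c *: (xx 0 ^+ i * xx 1 ^+ (j - K))), 0.
  by rewrite mulr0 subr0 -scalerAr mulrCA -exprD subnKC.
case: h; exists (K - i).-1, (K - j).-1; rewrite !prednK ?subn_gt0 //.
rewrite !mulrnBr ?(ltnW iK) ?(ltnW jK) //.
have -> : x - y = vx 0 *+ K + vx 1 *+ K - (vx 0 *+ K + vx 1 *+ K - x + y).
  by rewrite opprD opprB addrA subrKC.
by rewrite -e addrACA opprD.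
Qed.

Lemma regXY a b (u v : S) : xx 1 ^+ b * u = xx 0 ^+ a * v ->
  exists w, u = xx 0 ^+ a * w /\ v = xx 1 ^+ b * w.
Proof.
by move=> /(@regular_pair k 0 (xx 1) b a u v (fun w => @xx_eqF k 0 w))[w [-> ->]]; exists w.
Qed.

(** The nonsplit extension is the Koszul complex of [xx 0 ^+ a] and [xx 1 ^+ b], with middle term
    O(y + a x_1) (+) O(y + b x_2). A splitting would put 1 into the ideal of these two powers, which
    vanish at the origin. *)
Lemma ExtOO_nonzero x y (i j : nat) : x - y = vx 0 *+ i.+1 + vx 1 *+ j.+1 -> ~ Ext1_zero (O x) (O y).
Proof.
move=> e hE; pose a := i.+1; pose b := j.+1.
have ex0 : x = vx 0 *+ a + vx 1 *+ b + y by rewrite -e subrK.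
pose E := dsum (O (y + vx 0 *+ a)) (O (y + vx 1 *+ b)).
have il : linear (fun s : O y => (xx 0 ^+ a * s, xx 1 ^+ b * s) : E).
  by move=> c u v; apply/pair_equal_spec; split; rewrite /= /GRing.scale /=; ring.
have ih z (s : O y) : ghom z s -> @ghom _ _ _ E z (xx 0 ^+ a * s, xx 1 ^+ b * s).
  move=> hs; apply: dsum_homI; [have := ShomM (@Shom_xxn k p q 0 a) hs|have := ShomM (@Shom_xxn k p q 1 b) hs];
  by rewrite /ghom /= /Ohom; congr Shom; rewrite addrCA; congr (_ + _); rewrite addrC.
have gl : linear (fun u : E => (xx 1 ^+ b * u.1 - xx 0 ^+ a * u.2) : O x).
  move=> c [u1 u2] [v1 v2].
  change (xx 1 ^+ b * (c * u1 + v1) - xx 0 ^+ a * (c * u2 + v2) =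
    c * (xx 1 ^+ b * u1 - xx 0 ^+ a * u2) + (xx 1 ^+ b * v1 - xx 0 ^+ a * v2)); ring.
have A4 (V : zmodType) (z y0 u v : V) : v + (z + (y0 + u)) = z + (u + v + y0).
  by rewrite !addrA [LHS](ACl (2*4*1*3)).
have gh z (u : E) : ghom z u -> @ghom _ _ _ (O x) z (xx 1 ^+ b * u.1 - xx 0 ^+ a * u.2).
  move=> [h1 h2]; apply: (@ghomB _ _ _ (O x)); [have := ShomM (@Shom_xxn k p q 1 b) h1|have := ShomM (@Shom_xxn k p q 0 a) h2];
  rewrite /ghom /= /Ohom; congr Shom; rewrite ex0.
    exact: A4.
  by rewrite [vx 0 *+ a + vx 1 *+ b]addrC; exact: A4.
pose f := qlin il ih; pose g := qlin gl gh.
have near0E1 (u : E) : near0 u -> u = 0.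
  move=> [K hK]; have e0 := hK 0; case: u {hK} e0 => u1 u2; rewrite pairZ => /pair_equal_spec[e1 e2].
  have c0 (s : S) : xx 0 ^+ K * s = 0 -> s = 0.
    by move=> /eqP; rewrite mulf_eq0 (negPf (xxn_neq0 _ _ _)) => /eqP.
  by apply/pair_equal_spec; split; apply: c0.
have [|s /qeqP hs] := hE E f g.
  apply/sexP; split.
  - apply/monoP => m n /= -> /near0E1/pair_equal_spec[/eqP].
    rewrite mulf_eq0 (negPf (xxn_neq0 _ _ _)) => /eqP -> _; exact: near00.
  - apply/epiP => n; exists (a + b)%N => c.
    case: (I2P (P := fun c => c = 0 \/ c = 1) _ _ c); [by left|by right| |] => ->.
      exists (0, - (xx 0 ^+ b * n)); rewrite /graph /= mulr0 sub0r mulrN opprK /GRing.scale /= exprD; ring.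
    by exists (xx 1 ^+ a * n, 0); rewrite /graph /= mulr0 subr0 /GRing.scale /= exprD; ring.
  - move=> m [n1 n2] r /= [-> ->] -> /=; rewrite mulrCA [X in _ - X]mulrCA [X in _ * X - _]mulrC.
    have -> : xx 0 ^+ a * (m * xx 1 ^+ b) - xx 1 ^+ b * (xx 0 ^+ a * m) = 0 by ring.
    exact: near00.
  - move=> [n1 n2] r /= -> /near0_O /= /eqP; rewrite subr_eq0 => /eqP /regXY[w [-> ->]].
    by apply: near_in; exists w.
have [K [u [v [_ _ hu hv]]]] := qdomO p_gt0 q_gt0 s.
have E1 : xx 1 ^+ b * u.1 - xx 0 ^+ a * u.2 = xx 0 ^+ K.
  have := hs (xx 0 ^+ K *: one x) (xx 1 ^+ b * u.1 - xx 0 ^+ a * u.2) (xx 0 ^+ K *: one x)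
    (ex_intro _ u (conj hu erefl)) erefl.
  by move/near0_O/eqP; rewrite subr_eq0 => /eqP ->; rewrite /GRing.scale /= mulr1.
have : xx 1 ^+ K *: u - xx 0 ^+ K *: v = 0.
  apply: near0E1; apply: (qfun (qgZ (xx 1 ^+ K) hu)).
  by have := qgZ (xx 0 ^+ K) hv; rewrite !scalerA mulrC.
move=> /eqP; rewrite subr_eq0 => /eqP F.
have F1 : xx 1 ^+ K * u.1 = xx 0 ^+ K * v.1 by exact: (congr1 fst F).
have F2 : xx 1 ^+ K * u.2 = xx 0 ^+ K * v.2 by exact: (congr1 snd F).
have [w1 [ew1 _]] := regXY F1; have [w2 [ew2 _]] := regXY F2.
have : xx 1 ^+ b * w1 - xx 0 ^+ a * w2 = 1.
  apply: (mulfI (xxn_neq0 k 0 K)); rewrite mulr1 -{2}E1 ew1 ew2; ring.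
move/(congr1 (mpoly.meval (fun=> 0))).
rewrite rmorphB !rmorphM !rmorphXn rmorph1 /= /xx !mpoly.mevalXU.
by rewrite !exprS !mul0r subrr => /eqP; rewrite eq_sym oner_eq0.
Qed.

Lemma ExtOO x y : Ext1_zero (O x) (O y) <->
  ~ exists i j : nat, x - y = vx 0 *+ i.+1 + vx 1 *+ j.+1.
Proof.
split=> [h [i [j e]]|]; last exact: ExtOO_zero.
exact: (ExtOO_nonzero e h).
Qed.

Lemma mprim_torsion M f g (m : M) : mprim f g -> f *: m = 0 -> g *: m = 0 -> near0 m.
Proof.
move=> [K hK] h1 h2; exists K => b; have [u [v ->]] := hK b.
by rewrite scalerDl -!scalerA h1 h2 !scaler0 addr0.
Qed.

Section Prime.
Variables (f : S) (d : L) (b : 'I_2) (hf : prm f d b) (l : nat) (y : L).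
Notation Q := (Qm hf l y).

(** The quotient of Q by a power of [xx b] is finite dimensional. So, up to a power of the other
    variable, [z] is divisible by the power of [xx b], and one of [u], [v] can be taken to be 0. *)
Lemma ExtOQ_zero x : Ext1_zero (O x) Q.
Proof.
apply: (ExtO_zero p_gt0 q_gt0) => K z _.
have [M hM] := mprim_comp hf l K.
suff : exists u v : Q, (xx 0 ^+ M * xx 1 ^+ M) *: z = xx 1 ^+ (K + M) *: u - xx 0 ^+ (K + M) *: v.
  by move=> [u [v e]]; exists M, u, v; rewrite e subrr; exact: near00.
have [u [v e]] := hM (other b).
have ez : xx (other b) ^+ M *: z = xx b ^+ K *: (v *: z).
  by rewrite e scalerDl -scalerA qe_ann scaler0 add0r scalerA mulrC.
have ez' : (xx b ^+ M * xx (other b) ^+ M) *: z = xx b ^+ (K + M) *: (v *: z).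
  by rewrite -scalerA ez scalerA -exprD addnC.
have aux c (w : Q) : (xx c ^+ M * xx (other c) ^+ M) *: z = xx c ^+ (K + M) *: w ->
    exists u v : Q, (xx 0 ^+ M * xx 1 ^+ M) *: z = xx 1 ^+ (K + M) *: u - xx 0 ^+ (K + M) *: v.
  elim/I2P: c => /= h; first by exists 0, (- w); rewrite scaler0 sub0r scalerN opprK.
  by exists w, 0; rewrite scaler0 subr0 mulrC.
exact: aux ez'.
Qed.

Lemma HomQO_zero x : Hom_zero Q (O x).
Proof.
apply: (HomQ_zero p_gt0 q_gt0) => K z _ /near0_O h.
suff -> : z = 0 by exact: near00.
by move: h => /eqP; rewrite mulf_eq0 (negPf (expf_neq0 _ (prm_neq0 hf))) => /eqP.
Qed.

Variables (f' : S) (d' : L) (b' : 'I_2) (hf' : prm f' d' b') (l' : nat) (y' : L).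
Notation Q' := (Qm hf' l' y').
Hypothesis cop : mprim f f'.

Lemma HomQQ_cop : Hom_zero Q Q'.
Proof.
apply: (HomQ_zero p_gt0 q_gt0) => K z _ /near0_Q h.
by apply: (mprim_torsion (mprimX l l' cop)) => //; exact: qe_ann.
Qed.

Lemma ExtQQ_cop : Ext1_zero Q Q'.
Proof.
apply: (ExtQ_zero p_gt0 q_gt0) => K z _; have [M hM] := mprimX l l' cop.
have [u [v e]] := hM b; exists M, (u *: z).
rewrite e scalerDl -(scalerA v) qe_ann scaler0 addr0 scalerA mulrC subrr; exact: near00.
Qed.
End Prime.

(* The coefficients of vx b in x, defined up to multiples of wt b. *)
Definition res b (x : L) (n : int) := exists c : int, x = vx b *~ n + vx (other b) *~ c.

Section Exceptional.
Variable b : 'I_2.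
Notation Qx l y := (Qm (prm_xx k p_gt0 q_gt0 b) l y).

Lemma mon_b (i j : nat) : exists i' j' : nat, xx 0 ^+ i * xx 1 ^+ j = xx b ^+ i' * xx (other b) ^+ j' /\
  vx 0 *+ i + vx 1 *+ j = vx b *+ i' + vx (other b) *+ j'.
Proof.
elim/I2P: b => /=; first by exists i, j.
by exists j, i; rewrite mulrC addrC.
Qed.

Lemma Shom_ind_b e (P : S -> Prop) : P 0 -> (forall s t, P s -> P t -> P (s + t)) ->
  (forall (c : k) (i j : nat), vx b *+ i + vx (other b) *+ j = e -> P (c *: (xx b ^+ i * xx (other b) ^+ j))) ->
  forall s, Shom e s -> P s.
Proof.
move=> h0 hD hm; apply: Shom_ind => // c i j _.
by have [i' [j' [-> ->]]] := mon_b i j; exact: hm.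
Qed.

Lemma Shom_res e (P : S -> Prop) : P 0 -> (forall s t, P s -> P t -> P (s + t)) ->
  (forall (i : nat) s, res b e i -> P (xx b ^+ i * s)) ->
  forall s, Shom e s -> P s.
Proof.
move=> h0 hD hm; apply: Shom_ind_b => // c i j e1; rewrite scalerAr; apply: hm.
by exists j; rewrite -e1.
Qed.

Lemma res_ex e (n : nat) : res b e n -> exists K j : nat,
  Shom (e + vx (other b) *+ K) (xx b ^+ n * xx (other b) ^+ j).
Proof.
move=> [c ->]; pose m := `|c|%N; exists m, (absz (c + m%:Z)).
have := ShomM (@Shom_xxn k p q b n) (@Shom_xxn k p q (other b) (absz (c + m%:Z))).
congr Shom; rewrite -addrA; congr (_ + _).
by rewrite -[RHS](mulrzDr _ c m) [LHS](_ : _ = vx (other b) *~ (absz (c + m%:Z))) //; congr (_ *~ _); lia.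
Qed.

Lemma Qx_neq0 l y (i j : nat) : (i < l)%N -> (xx b ^+ i * xx (other b) ^+ j) *: (qe : Qx l y) <> 0.
Proof.
move=> il /qe_eq0[t]; rewrite -(subnKC (ltnW il)) exprD -mulrA => /(mulfI (xxn_neq0 _ _ _)).
have := subn_gt0 i l; rewrite il; case: (l - i)%N => // n _.
rewrite exprS -mulrA => h.
exact: (@xx_ndvdX k b (xx (other b)) j (fun v => @xx_eqF k b v)) h.
Qed.

Lemma Qel l y e (n : nat) : (n < l)%N -> res b (e + y) n -> exists K (z : Qx l y),
  [/\ ghom (e + vx (other b) *+ K) z, z <> 0 & exists j, z = (xx b ^+ n * xx (other b) ^+ j) *: qe].
Proof.
move=> nl /res_ex[K [j h]]; exists K, ((xx b ^+ n * xx (other b) ^+ j) *: qe); split.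
- have := ghomZ h (qe_hom (prm_xx k p_gt0 q_gt0 b) l y).
  by rewrite [- y + _](_ : _ = e + vx (other b) *+ K) // addrC addrAC addrK.
- exact: Qx_neq0.
- by exists j.
Qed.

Lemma Qhom l y e (z : Qx l y) : ghom e z -> exists s, Shom (e + y) s /\ z = s *: qe.
Proof.
move=> hz; have [s es] := qe_gen z; exists (scomp (e + y) s); split; first exact: scomp_hom.
by rewrite -{1}(hc_id hz) es (hcZr _ _ (qe_hom _ l y)) opprK.
Qed.

(** The other variable is invertible on the target, so only the residue of the coefficient of [vx b]
    matters: morphisms are given by [xx b ^+ n] times powers of the other variable, which are
    nonzero for n < l. *)
Lemma HomOQx l x y : Hom_zero (O x) (Qx l y) <-> ~ exists2 n : nat, (n < l)%N & res b (y - x) n.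
Proof.
split=> [h [n nl hn]|h].
  have [K [z [h1 h2 _]]] : exists K (z : Qx l y), [/\ ghom (- x + vx (other b) *+ K) z, z <> 0 &
     exists j, z = (xx b ^+ n * xx (other b) ^+ j) *: qe] by apply: Qel; rewrite // addrC.
  rewrite addrC in h1; exact: HomOQ_nonzero h1 h2 h.
apply: (HomOQ_zero p_gt0 q_gt0) => K z /Qhom[s [hs ->]].
elim/Shom_res: s / hs => [|s t e1 e2|i s hi].
- by rewrite scale0r.
- by rewrite scalerDl e1 e2 addr0.
apply/qe_eq0; have [li|il] := leqP l i; first by exists (xx b ^+ (i - l) * s); rewrite mulrA -exprD subnKC.
case: h; exists i => //; move: hi => [c e]; exists (c - K%:Z).
by rewrite mulrzBr addrA -e -pmulrn [RHS](ACl (1*4*3*2)) /= subrr add0r.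
Qed.

(** Up to the other variable the generator goes to [xx b ^+ n]: this is nonzero for n < l', and
    [xx b ^+ l] kills it for l' <= n + l. *)
Lemma HomQQx l y l' y' : Hom_zero (Qx l y) (Qx l' y') <->
  ~ exists n : nat, [/\ (n < l')%N, (l' <= n + l)%N & res b (y' - y) n].
Proof.
split=> [h [n [nl ln hn]]|h].
  have [K [z [h1 h2 [j ez]]]] : exists K (z : Qx l' y'), [/\ ghom (- y + vx (other b) *+ K) z, z <> 0 &
     exists j, z = (xx b ^+ n * xx (other b) ^+ j) *: qe] by apply: Qel; rewrite // addrC.
  rewrite addrC in h1; apply: (HomQ_nonzero p_gt0 q_gt0) h1 _ _ h; last by move/near0_Q.
  suff -> : xx b ^+ l *: z = 0 by exact: near00.
  rewrite ez scalerA; apply/qe_eq0; exists (xx b ^+ (n + l - l') * xx (other b) ^+ j).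
  by rewrite !mulrA -!exprD subnKC // addnC.
apply: (HomQ_zero p_gt0 q_gt0) => K z /Qhom[s [hs ->]] /near0_Q; rewrite scalerA => /qe_eq0[t et].
have [m lm] : exists m, (l' <= m + l)%N /\ (m = (l' - l)%N) by exists (l' - l)%N; split=> //; rewrite addnC -maxnE leq_maxr.
have [t' es] : exists t', s = xx b ^+ m * t'.
  have [ll|ll] := leqP l l'.
    exists t; apply: (mulfI (xxn_neq0 k b l)); rewrite et mulrA -exprD; congr (_ ^+ _ * _); lia.
  by exists s; rewrite (_ : m = 0%N) ?expr0 ?mul1r //; lia.
suff -> : s *: (qe : Qx l' y') = 0 by exact: near00.
have := Shom_div (xxn_neq0 k b m) (@Shom_xxn k p q b m) (eq_ind _ (Shom _) hs _ es).
rewrite es => ht'; elim/Shom_res: t' / ht' {es} => [|s1 t1 e1 e2|i s1 hi].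
- by rewrite mulr0 scale0r.
- by rewrite mulrDr scalerDl e1 e2 addr0.
rewrite mulrA -exprD; apply/qe_eq0; have [li|il] := leqP l' (m + i); first by exists (xx b ^+ (m + i - l') * s1); rewrite mulrA -exprD subnKC.
case: h; exists (m + i)%N; split=> //; first by lia.
move: hi => [c e]; exists (c - K%:Z); rewrite PoszD mulrzDr mulrzBr -!pmulrn.
have -> : y' - y = (vx (other b) *+ K - y + y' - vx b *+ m) + vx b *+ m - vx (other b) *+ K.
  by rewrite subrK [RHS](ACl (1*4*3*2)) /= subrr add0r.
by rewrite e [LHS](ACl (3*1*2*4)) /= -!addrA.
Qed.

(** Classes live in the cokernel of [xx b ^+ l] on the target: [xx b ^+ n] is nonzero there when n
    is below both lengths. *)
Lemma ExtQQx l y l' y' : Ext1_zero (Qx l y) (Qx l' y') <->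
  ~ exists n : nat, [/\ (n < l)%N, (n < l')%N & res b (vx b *+ l + y' - y) n].
Proof.
split=> [h [n [nl ln hn]]|h].
  have [K [z [h1 h2 [j ez]]]] : exists K (z : Qx l' y'), [/\ ghom (vx b *+ l - y + vx (other b) *+ K) z, z <> 0 &
     exists j, z = (xx b ^+ n * xx (other b) ^+ j) *: qe] by apply: Qel; rewrite // addrAC.
  rewrite addrAC in h1; apply: (ExtQ_nonzero p_gt0 q_gt0) h1 _ h => K' w /near0_Q.
  have [s ->] := qe_gen w; rewrite ez !scalerA -scalerBl => /qe_eq0[t e].
  have ll : (n < minn l l')%N by rewrite leq_min nl.
  apply: (@Qx_neq0 (minn l l') y n (K' + j) ll); apply/qe_eq0.
  exists (xx b ^+ (l - minn l l') * s + xx b ^+ (l' - minn l l') * t).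
  rewrite mulrDr !mulrA -!exprD !subnKC ?geq_minl ?geq_minr // -e exprD; ring.
apply: (ExtQ_zero p_gt0 q_gt0) => K z /Qhom[s [hs ->]]; exists 0%N.
suff [w ->] : exists w, s *: (qe : Qx l' y') = xx b ^+ l *: w.
  by exists w; rewrite expr0 scale1r subrr; exact: near00.
elim/Shom_res: s / hs => [|s1 t1 [w1 e1] [w2 e2]|i s1 hi].
- by exists 0; rewrite scale0r scaler0.
- by exists (w1 + w2); rewrite scalerDl e1 e2 scalerDr.
have [li|il] := leqP l i.
  by exists (xx b ^+ (i - l) * s1 *: qe); rewrite scalerA mulrA -exprD subnKC.
have [li'|il'] := leqP l' i.
  by exists 0; rewrite scaler0; apply/qe_eq0; exists (xx b ^+ (i - l') * s1); rewrite mulrA -exprD subnKC.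
case: h; exists i; split=> //; move: hi => [c e]; exists (c - K%:Z).
by rewrite mulrzBr addrA -e -pmulrn [RHS](ACl (1*4*3*2*5)) /= addrK.
Qed.

Lemma ExtQxO l y x : Ext1_zero (Qx l y) (O x) <->
  ~ exists2 n : nat, (n < l)%N & res b (vx b *+ l + x - y) n.
Proof.
split=> [h [n nl hn]|h].
  have [K [j hj]] := res_ex hn.
  have h1 : @ghom _ _ _ (O x) (vx b *+ l + vx (other b) *+ K - y) (xx b ^+ n * xx (other b) ^+ j).
    by move: hj; rewrite /ghom /= /Ohom; congr Shom; rewrite [LHS](ACl (1*4*3*2)).
  apply: (ExtQ_nonzero p_gt0 q_gt0) h1 _ h => K' w /near0_O e.
  apply: (@Qx_neq0 l y n (K' + j) nl); apply/qe_eq0; exists w.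
  move/eqP: e; rewrite subr_eq0 => /eqP; rewrite /GRing.scale /= => <-; rewrite exprD; ring.
apply: (ExtQ_zero p_gt0 q_gt0) => K z hz; exists 0%N.
suff [w ->] : exists w, z = xx b ^+ l * w.
  by exists w; rewrite expr0 scale1r subrr; exact: near00.
elim/Shom_res: z / hz => [|s1 t1 [w1 e1] [w2 e2]|i s1 hi].
- by exists 0; rewrite mulr0.
- by exists (w1 + w2); rewrite e1 e2 mulrDr.
have [li|il] := leqP l i.
  by exists (xx b ^+ (i - l) * s1); rewrite mulrA -exprD subnKC.
case: h; exists i => //; move: hi => [c e]; exists (c - K%:Z).
by rewrite mulrzBr addrA -e -pmulrn [RHS](ACl (1*4*3*2*5)) /= addrK.
Qed.
End Exceptional.

Lemma mprim_xx : mprim (xx 0) (xx 1).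
Proof. by have := @mprim01 k 1; rewrite !expr1. Qed.

(* The primes of ordinary points: those associated with neither variable. *)
Definition ordinary (f : S) := mprim f (xx 0) /\ mprim f (xx 1).

(** If [f] divided a monomial, its coprimality to both variables would make it divide a power of
    [xx b], against [prm_nonunit]. *)
Lemma ordinary_mon f d b (hf : prm f d b) (i j : nat) v : ordinary f ->
  xx 0 ^+ i * xx 1 ^+ j <> f * v.
Proof.
move=> [h0 h1] e.
have [M hM] := mprimX 1 i h0; have [N hN] := mprimX 1 j h1.
have [u1 [v1 e1]] := hM b; have [u2 [v2 e2]] := hN b; rewrite !expr1 in e1 e2.
apply: (prm_nonunit (N := (M + N)%N) (l := 1) (v := u1 * (u2 * f + v2 * xx 1 ^+ j) + v1 * xx 0 ^+ i * u2 + v1 * v2 * v) hf isT).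
by rewrite exprD e1 e2 expr1; transitivity (f * (u1 * (u2 * f + v2 * xx 1 ^+ j) + v1 * xx 0 ^+ i * u2) + v1 * v2 * (xx 0 ^+ i * xx 1 ^+ j)); [ring|rewrite e; ring].
Qed.

Lemma eff_ex b e : exists K i j : nat, e + vx b *+ K = vx b *+ i + vx (other b) *+ j.
Proof.
have [a [c ->]] := L_coords_oth b e; pose n := absz c.
pose m := a - n%:Z * (wt p q b)%:Z; pose c' := c + n%:Z * (wt p q (other b))%:Z.
have -> : vx b *~ a + vx (other b) *~ c = vx b *~ m + vx (other b) *~ c'.
  by apply/vx_othP; exists n%:Z; rewrite /m /c'; split; ring.
have c0 : 0 <= c' by have := wt_gt0 p_gt0 q_gt0 (other b); rewrite /c' /n; nia.
exists (absz m), (absz (m + (absz m)%:Z)), (absz c').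
rewrite addrAC -[_ + vx b *+ _](mulrzDr _ m (absz m)).
by rewrite [RHS](_ : _ = vx b *~ (absz (m + (absz m)%:Z)) + vx (other b) *~ (absz c')) //; congr (_ *~ _ + _ *~ _); lia.
Qed.

Lemma ordinary_monb f d b (hf : prm f d b) c (i j : nat) v : ordinary f ->
  xx c ^+ i * xx (other c) ^+ j <> f * v.
Proof.
move=> ho; elim/I2P: c => /=; [|rewrite mulrC]; exact: (ordinary_mon hf (v := v)).
Qed.

Lemma ordinary_el f d b (hf : prm f d b) l y e : ordinary f -> (0 < l)%N -> exists K (z : Qm hf l y),
  [/\ ghom (e + vx b *+ K) z, z <> 0 & forall K' w, xx b ^+ K' *: z <> f ^+ l *: w].
Proof.
move=> ho l0; have [K [i [j e1]]] := eff_ex b (e + y).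
have key K' t : xx b ^+ (K' + i) * xx (other b) ^+ j <> f ^+ l * t.
  rewrite -(prednK l0) exprS -mulrA; exact: (ordinary_monb hf).
exists K, ((xx b ^+ i * xx (other b) ^+ j) *: qe); split.
- have := ghomZ (ShomM (@Shom_xxn k p q b i) (@Shom_xxn k p q (other b) j)) (qe_hom hf l y).
  by rewrite -e1 [- y + _](_ : _ = e + vx b *+ K) // addrC addrAC addrK.
- by move/qe_eq0 => [t]; exact: (key 0%N).
- move=> K' w; rewrite qe_ann scalerA mulrA -exprD => /qe_eq0[t]; exact: key.
Qed.

Lemma ordinary_HomO f d b (hf : prm f d b) l y x : ordinary f -> (0 < l)%N -> ~ Hom_zero (O x) (Qm hf l y).
Proof.
move=> ho l0; have [K [z [h1 h2 _]]] := ordinary_el hf y (- x) ho l0.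
by apply: (HomOQ_nonzero p_gt0 q_gt0) h2; rewrite addrC; exact: h1.
Qed.

(** [f ^+ l] acts as zero on the sheaf, so every nonzero class survives in the cokernel;
    [ordinary_el] provides one in the required degree. *)
Lemma ordinary_self f d b (hf : prm f d b) l y : ordinary f -> (0 < l)%N -> ~ Ext1_zero (Qm hf l y) (Qm hf l y).
Proof.
move=> ho l0; have [K [z [h1 h2 h3]]] := ordinary_el hf y (d *+ l - y) ho l0.
rewrite addrAC in h1; apply: (ExtQ_nonzero p_gt0 q_gt0) h1 _ => K' w /near0_Q/eqP.
by rewrite subr_eq0 => /eqP; exact: h3.
Qed.

Lemma ordinary_ff : ordinary (ff p q (1 : k)).
Proof.
have hf := prm_ff p_gt0 q_gt0 (oner_neq0 k); split; last exact: prm_comp hf.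
have [[v /(congr1 (mpoly.meval (fun=> 1)))]|/mprimC //] := prm_dvd hf (@Shom_xx k p q 0).
rewrite /ff rmorphM rmorphB scale1r !rmorphXn /= /xx !mpoly.mevalXU !expr1n subrr mul0r.
by move/eqP; rewrite oner_eq0.
Qed.

Lemma Shom_uniq d d' (s : S) : s != 0 -> Shom d s -> Shom d' s -> d = d'.
Proof.
move=> s0 h h'; have c : mpoly.mcoeff (mpoly.mlead s) s != 0 by rewrite mpoly.mleadc_eq0.
by rewrite -(h _ c) (h' _ c).
Qed.

(** If [f] is not coprime to the variable other than [b], it divides that variable, and comparison
    of total degrees shows that the two are associated. *)
Lemma prm_dichotomy f d b : prm f d b -> ordinary f \/ exists c, [/\ b = other c, d = vx c & exists2 a : k, a != 0 & f = a *: xx c].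
Proof.
move=> hf; have [|] := prm_dvd hf (@Shom_xx k p q (other b)); last first.
  move=> h; left; have h' := prm_comp hf; move/mprimC in h; move: h h'.
  by rewrite /ordinary; elim/I2P: (b).
move=> [v ev]; right; have f0 := prm_neq0 hf.
have v0 : v != 0 by apply: contraTneq (xx_neq0 k (other b)) => v0; rewrite ev v0 mulr0 eqxx.
have : mpoly.mdeg (mpoly.mlead (xx (other b))) = 1%N by rewrite /xx mpoly.mleadXm mpoly.mdeg1.
rewrite ev mdeg_mleadM // => h1; have h2 := prm_deg hf.
have [|c c0 evc] := size_const v0; first by lia.
have ef : f = c^-1 *: xx (other b) by rewrite ev evc -scalerAr mulr1 scalerA mulVf // scale1r.
exists (other b); split; first by rewrite otherK.
  apply: (Shom_uniq f0); first exact: prm_hom hf.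
  by rewrite ef; apply: ShomZ; exact: Shom_xx.
by exists c^-1; rewrite ?invr_eq0.
Qed.
End Tables.

(** * Indecomposable direct summands *)

Section TorsionSummand.
Variables (k : closedFieldType) (p q : nat).
Hypotheses (p_gt0 : (0 < p)%N) (q_gt0 : (0 < q)%N).
Local Notation S := (Spol k).
Local Notation L := (Lpq p q).
Local Notation xx := (@xx k).
Local Notation Shom := (@Shom k p q).
Local Notation grmod := (grmod k p q).
Local Notation prm := (@prm k p q).
Local Notation Qm := (@Qm k p q).
Local Notation qe := (@qe k p q _ _ _ _ _ _).
Implicit Types A B M N P X : grmod.
Local Notation mkq := (@mkq _ _ _ p_gt0 q_gt0).

Lemma hom_gens X : exists e : seq X, (forall a, a \in e -> exists x, ghom x a) /\ forall m, gen e m.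
Proof.
have [e0 he0] := gfingen X.
have [e [he1 he2]] : exists e : seq X, (forall a, a \in e -> exists x, ghom x a) /\ forall a, a \in e0 -> gen e a.
  elim: e0 {he0} => [|a e0 [e [h1 h2]]]; first by exists [::].
  have [r [_ ea _]] := hc_sum a; exists ([seq hc x a | x <- r] ++ e); split.
    move=> c; rewrite mem_cat => /orP[/mapP[x _ ->]|/h1 //]; exists x; exact: hc_hom.
  move=> c; rewrite inE => /orP[/eqP ->|/h2 h]; last exact: gen_catr.
  apply: gen_catl; rewrite {2}ea; apply: subm_sum; first exact: gen_submod.
  by move=> x xr; apply: gen_mem; apply: map_f.
exists e; split=> // m; apply: (gen_sub (gen_submod e) he2); exact: he0.
Qed.

Lemma Q_tf f d b (hf : prm f d b) l y s (n : Qm hf l y) : mprim s f -> s *: n = 0 -> n = 0.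
Proof.
move=> h e; apply: near0_Q; have := mprimX 1 l h; rewrite expr1 => h'.
exact: (mprim_torsion h' e (qe_ann n)).
Qed.

Lemma near_torsion X f s (m : X) i : mprim s f -> near0 (s *: m) -> near0 (f ^+ i *: m) -> near0 m.
Proof.
move=> h h1 h2; apply: near0_idem; have := mprimX 1 i h; rewrite expr1 => h'.
exact: (near_mprim (near0_submod X) h').
Qed.

Section Retraction.
Variables (X : grmod) (f : S) (d : L) (b : 'I_2) (hf : prm f d b) (l : nat) (e : L) (m : X).
Hypotheses (hm : ghom e m) (l_gt0 : (0 < l)%N) (fm : near0 (f ^+ l *: m)).
Hypotheses (fm1 : ~ near0 (f ^+ l.-1 *: m)).
Hypotheses (ord : forall x (n : X) i, ghom x n -> near0 (f ^+ i *: n) -> near0 (f ^+ l *: n)).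
Notation Q := (Qm hf l (- e)).

(** Partial retractions from X to Q, with values determined exactly: [m] goes to the generator and
    f^l X to 0. The lemmas below run Baer's extension argument, Q behaving like an injective module
    over S / f^l up to finite dimension. *)
Let good (G : set (dsum X Q)) := [/\ gsub G, (forall x s, G (f ^+ l *: x + s *: m, s *: qe))
  & forall n, G (0, n) -> n = 0].

(** Maximality of the order of [m] enters here: if [s *: m] lay in f^l X with s = f^i s1, [s1] prime
    to [f] and i < l, then [ord] would make [f ^+ i *: m] negligible, against [fm1]. *)
Lemma good0 : exists G, good G.
Proof.
pose G : set (dsum X Q) := [set u : dsum X Q | exists x s, u = (f ^+ l *: x + s *: m, s *: qe)].
have hG x y s : hc x (f ^+ l *: y + s *: m) = f ^+ l *: hc (x - d *+ l) y + scomp (x - e) s *: m.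
  by rewrite hcD (hcZ' _ _ (ShomX (n := l) (prm_hom hf))) (hcZr _ _ hm).
exists G; split.
- apply: gsub_pair; first split.
    + by exists 0, 0; rewrite scaler0 !scale0r addr0.
    + move=> a u u' [x [s ->]] [x' [s' ->]]; exists (a *: x + x'), (a * s + s').
      rewrite pairZ pairD; congr (_, _); rewrite ?scalerDl ?scalerDr !scalerA //.
      by rewrite addrACA mulrC.
    + move=> x u n [y [s [-> ->]]].
      exists (hc (x - d *+ l) y), (scomp (x - e) s); congr (_, _) => //.
      by rewrite (hcZr _ _ (qe_hom hf l (- e))) opprK.
- by move=> x s; exists x, s.
- move=> n [y [s /pair_equal_spec[/esym e0 en]]]; have [r [_ -> _]] := hc_sum n.
  rewrite big1 // => x _; rewrite en (hcZr _ _ (qe_hom hf l (- e))) opprK.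
  have := hG x y s; rewrite e0 hc0; have := @scomp_hom k p q (x - e) s.
  move: (hc _ _) (hc_hom (x - d *+ l) y) (scomp _ _) => Y hY s' hs' /esym e1.
  have [->|s0] := eqVneq s' 0; first by rewrite scale0r.
  have [i [s1 [es h1 _]]] := prm_split p_gt0 q_gt0 hf hs' s0.
  have [li|il] := leqP l i.
    by apply/qe_eq0; exists (f ^+ (i - l) * s1); rewrite es mulrA -exprD subnKC.
  have e2 : f ^+ i *: (s1 *: m + f ^+ (l - i) *: Y) = 0.
    by rewrite scalerDr !scalerA -es -exprD subnKC ?(ltnW il) // addrC.
  have n1 : near0 (f ^+ (l + (l - i)) *: Y).
    have : f ^+ l *: (s1 *: m + f ^+ (l - i) *: Y) = 0.
      by rewrite -[in X in f ^+ X](subnK (ltnW il)) exprD -scalerA e2 scaler0.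
    rewrite scalerDr [in X in _ + X]scalerA -exprD => /eqP; rewrite addr_eq0 => /eqP h.
    rewrite -[_ *: Y]opprK -h; apply: near0N; rewrite scalerA mulrC -scalerA; exact: near0Z.
  have n2 : near0 (s1 *: (f ^+ i *: m)).
    have := ord hY n1; rewrite scalerA [s1 * _]mulrC -es.
    by move/eqP: e1; rewrite addr_eq0 => /eqP -> /near0N; rewrite opprK.
  case: fm1; have n3 : near0 (f ^+ i *: m).
    apply: (near_torsion h1 n2 (i := l)); rewrite scalerA mulrC -scalerA; exact: near0Z.
  rewrite -(subnK (_ : i <= l.-1)%N); last by rewrite -ltnS prednK.
  by rewrite exprD -scalerA; exact: near0Z.
Qed.

(** Take the least [j] such that some [s0 * f ^+ j] with [s0] prime to [f] multiplies [t] into the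
    domain. The value there is f^j w', so [t] can be sent to w' / s0. *)
Lemma good_ext G t x : good G -> ghom x t -> exists G', [/\ good G', (forall u, G u -> G' u) & nearV (gdom G') t].
Proof.
move=> [gG G0 Gi] ht; have [sG cG] := (gsubP _).1 gG.
have Gun z n n' : G (z, n) -> G (z, n') -> n = n'.
  move=> h h'; have := subm_sum; have := submB sG h h'; rewrite pairB subrr => /Gi/eqP.
  by rewrite subr_eq0 => /eqP.
have [j [[s0 [c [w [hs0 cs0 hw]]]] jmin]] : exists j, (exists s c w, [/\ Shom c s, mprim s f & G ((s * f ^+ j) *: t, w)]) /\
   forall i, (exists s c w, [/\ Shom c s, mprim s f & G ((s * f ^+ i) *: t, w)]) -> (j <= i)%N.
  apply: dickson1; exists l, 1, 0, 0; split; first exact: Shom_1.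
    by apply: mprimI => i; exists 0%N, 1, 0; rewrite expr0; ring.
  by have := G0 t 0; rewrite !scale0r addr0 mul1r.
pose y := (x + (c + d *+ j)).
have hst : ghom y ((s0 * f ^+ j) *: t) by apply: ghomZ => //; apply: ShomM => //; exact: ShomX (prm_hom hf).
have {}hw : G ((s0 * f ^+ j) *: t, hc y w) by have := cG y _ hw; rewrite hc_dsum /= hc_id.
have hwh := hc_hom y w; move: (hc y w) hwh hw => {}w hwh hw.
have jl : (j <= l)%N.
  apply: jmin; exists 1, 0, 0; split; [exact: Shom_1| |by have := G0 t 0; rewrite !scale0r addr0 mul1r].
  by apply: mprimI => i; exists 0%N, 1, 0; rewrite expr0; ring.
(* [f ^+ (l - j)] kills [w], being then the value at an element of f^l X; in Q this means that
   [f ^+ j] divides [w]. *)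
have [w' [hw' ew]] : exists w', ghom (x + c) w' /\ w = f ^+ j *: w'.
  have e1 : f ^+ (l - j) *: w = 0.
    apply: (Gun (f ^+ l *: (s0 *: t))); last by have := G0 (s0 *: t) 0; rewrite !scale0r addr0.
    have := submZ sG (f ^+ (l - j)) hw; rewrite pairZ !scalerA.
    by rewrite mulrCA -exprD subnK // mulrC.
  have [s es] := qe_gen w; move: e1; rewrite es scalerA => /qe_eq0[s'].
  rewrite -{2}(subnK jl) exprD -mulrA => /(mulfI (expf_neq0 _ (prm_neq0 hf))) e1.
  exists (hc (x + c) (s' *: qe)); split; first exact: hc_hom.
  rewrite -es -[LHS](hc_id hwh) es e1 -scalerA (hcZ' _ _ (ShomX (n := j) (prm_hom hf))).
  by rewrite /y addrA addrK.
(* The equation with [s0] replaces the division by [s0]; it has at most one solution by [Q_tf]. *)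
pose G' : set (dsum X Q) := [set u : dsum X Q | exists z n a, [/\ G (z, n), u.1 = z + a *: t & s0 *: (u.2 - n) = a *: w']].
have GG' u : G u -> G' u.
  by move=> h; exists u.1, u.2, 0; case: u h => u1 u2 /= h; rewrite scale0r addr0 subrr scaler0 scale0r.
have G'H z a n n1 y' : G (z, n) -> s0 *: (n1 - n) = a *: w' ->
   [/\ G (hc y' z, hc y' n), hc y' (z + a *: t) = hc y' z + scomp (y' - x) a *: t & s0 *: (hc y' n1 - hc y' n) = scomp (y' - x) a *: w'].
  move=> h1 h2; split; first by have := cG y' _ h1; rewrite hc_dsum.
    by rewrite hcD (hcZr _ _ ht).
  have := congr1 (hc (y' + c)) h2; rewrite (hcZ _ _ hs0) (hcZr _ _ hw').
  have := hcD y' (n1 - n) n; rewrite subrK => ->; rewrite addrK => ->.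
  by rewrite opprD addrACA subrr addr0.
have gG' : gsub G'.
  apply: gsub_pair; first split.
  - by apply: GG'; exact: subm0.
  - move=> a1 u u' [z [n [a [h1 h2 h3]]]] [z' [n' [a' [h1' h2' h3']]]].
    exists (a1 *: z + z'), (a1 *: n + n'), (a1 * a + a'); split.
    + by have := sG.2 a1 _ _ h1 h1'.
    + change (a1 *: u.1 + u'.1 = a1 *: z + z' + (a1 * a + a') *: t).
      by rewrite h2 h2' scalerDr addrACA scalerDl scalerA.
    + change (s0 *: (a1 *: u.2 + u'.2 - (a1 *: n + n')) = (a1 * a + a') *: w').
      rewrite opprD addrACA -scalerBr scalerDr h3' scalerDl -[(a1 * a) *: _]scalerA -h3.
      by rewrite !scalerA mulrC.
  - move=> y' u1 u2 [z [n [a [/= h1 -> h3]]]]; have [h1' h2' h3'] := G'H _ _ _ _ y' h1 h3.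
    by exists (hc y' z), (hc y' n), (scomp (y' - x) a).
have [sG' _] := (gsubP _).1 (gdom_gsub gG').
exists G'; split=> //; first split=> //.
- by move=> z s; apply: GG'.
- move=> n1 [z [n [a [/= h1 h2 h3]]]]; have [r [_ -> _]] := hc_sum n1.
  rewrite big1 // => y' _; have [] := G'H _ _ _ _ y' h1 h3; rewrite -h2 hc0 => {}h1 {}h2 {}h3.
  move: (hc y' z) (hc y' n) (hc y' n1) (scomp _ a) (@scomp_hom k p q (y' - x) a) h1 h2 h3 => {}z {}n {}n1 {}a ha h1 h2 h3.
  have zE : z = - (a *: t) by apply/eqP; rewrite -addr_eq0 -h2.
  apply: (Q_tf (hf := hf) cs0).
  have [a0|a0] := eqVneq a 0.
    move: h1 h3; rewrite zE a0 !scale0r oppr0 => /Gi ->; by rewrite subr0.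
  have [i [a1 [ea ha1 _]]] := prm_split p_gt0 q_gt0 hf ha a0.
  have ha1h : Shom (y' - x - d *+ i) a1.
    apply: (Shom_div (expf_neq0 i (prm_neq0 hf)) (ShomX (n := i) (prm_hom hf))).
    by rewrite -ea.
  have ji : (j <= i)%N.
    apply: jmin; exists a1, (y' - x - d *+ i), (- n); split=> //.
    have := submN sG h1; rewrite zE -scaleN1r pairZ !scaleN1r opprK ea.
    by rewrite [f ^+ i * _]mulrC.
  pose a2 := f ^+ (i - j) * a1.
  have ea2 : a = a2 * f ^+ j by rewrite /a2 ea mulrAC -exprD subnK.
  have e3 : s0 *: n = - a2 *: w.
    apply: (Gun (s0 *: z)); first by have := submZ sG s0 h1; rewrite pairZ.
    have := submZ sG (- a2) hw; rewrite pairZ zE; congr (G (_, _)).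
    rewrite scalerN !scalerA -scaleNr ea2; congr (_ *: _); ring.
  move: h3; rewrite scalerBr e3 ew scalerA mulNr -ea2 scaleNr opprK => /eqP.
  by rewrite -[X in _ == X]add0r (inj_eq (addIr _)) => /eqP.
apply: (near_mprim sG' (mprimX 1 l cs0)).
  exists w', 0, 0, s0; split; first exact: (subm0 sG).
    by rewrite /= expr1 add0r.
  by rewrite /= subr0.
exists 0, 0, 0, (f ^+ l); split; first exact: (subm0 sG).
  by rewrite /= add0r.
by rewrite /= subr0 scaler0 qe_ann.
Qed.

Lemma torsion_retract : retract Q X.
Proof.
have [j0 hj] : exists h : qhom Q X, graph h (xx b ^+ 0 *: qe, m).
  by apply: HomQ_ex; rewrite // mulr0n sub0r opprK.
have [gens [hgens gX]] := hom_gens X.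
have [G [[gG G0 Gi] hdom]] : exists G, good G /\ forall a, a \in gens -> nearV (gdom G) a.
  elim: gens hgens {gX} => [|a gens IH] hgens.
    by have [G hG] := good0; exists G.
  have [|G [hG IHG]] := IH; first by move=> c ca; apply: hgens; rewrite inE ca orbT.
  have [x hx] := hgens a (mem_head _ _).
  have [G' [hG' GG' ha]] := good_ext hG hx; exists G'; split=> // c.
  rewrite inE => /orP[/eqP -> //|/IHG]; apply: near_mono => z [n hn]; exists n; exact: GG'.
have [sG _] := (gsubP _).1 (gdom_gsub gG).
have GP : is_qgraph G.
  apply: mkq => // [z|n /Gi ->]; last exact: near00.
  exact: (gen_sub (near_submod sG) hdom).
exists j0, (QHom GP); apply: (HomQ_eq p_gt0 q_gt0 (K := 0) (z := qe) (z' := qe)).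
- exists m; split=> //; have := G0 0 1; by rewrite scaler0 !scale1r add0r.
- by rewrite expr0 scale1r.
- by rewrite subrr; exact: near00.
Qed.
End Retraction.

(* An element of maximal order in the f-primary part generates a summand. *)
Lemma torsion_summand X e s (m : X) c : ghom e m -> Shom c s -> s != 0 -> near0 (s *: m) -> ~ near0 m ->
  exists f d b (hf : prm f d b) l y, (0 < l)%N /\ retract (Qm hf l y) X.
Proof.
move=> hm hs s0 sm nm.
(* Prime factors of the annihilator [s] are stripped off until a single prime kills some nonzero
   multiple of [m]. *)
have [f [d [b [hf [e' [m' [hm' fm' nm']]]]]]] : exists f d b (_ : prm f d b) e' (m' : X),
    [/\ ghom e' m', near0 (f *: m') & ~ near0 m'].
  have [N] := ubnP (mpoly.mdeg (mpoly.mlead s)); elim: N s c s0 hs sm => // N IH s c s0 hs sm sN.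
  have [[a a0 es]|[f [d [b [v [hf es hv v0]]]]]] := prime_factor p_gt0 q_gt0 hs s0.
    case: nm; have := near0Z (a^-1)%:A sm.
    by rewrite scalerA es mulr_algl scalerA mulVf // !scale1r.
  have [h|h] := pselect (near0 (v *: m)).
    apply: (IH v (c - d)) => //; move: sN; rewrite es mdeg_mleadM ?(prm_neq0 hf) //.
    by have := prm_deg hf; lia.
  exists f, d, b, hf, (e + (c - d)), (v *: m); split=> //; first exact: ghomZ.
  by rewrite scalerA -es.
(* The f-primary part of X. Being finitely generated, it is killed by one power of [f]; with [l] the
   least such exponent, an element that needs all of it has maximal order. *)
pose T : set X := [set n | exists i, near0 (f ^+ i *: n)].
have sT : submod T.
  split; first by exists 0%N; rewrite scaler0; exact: near00.
  move=> a n n' [i h] [i' h']; exists (i + i')%N; rewrite scalerDr; apply: near0D.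
    by rewrite scalerA mulrC -scalerA addnC exprD -scalerA; do 2 apply: near0Z.
  by rewrite exprD -scalerA; exact: near0Z.
have [gens gX] := gfingen X; have [l0 [hl1 hl2]] := noeth gens sT.
have [l1 hl] : exists l1, forall a, a \in l0 -> near0 (f ^+ l1 *: a).
  elim: l0 hl1 {hl2} => [|a l0 IH] hl1; first by exists 0%N.
  have [|i hi] := IH; first by move=> c' ca; apply: hl1; rewrite inE ca orbT.
  have [i' hi'] := hl1 a (mem_head _ _); exists (i + i')%N => c'.
  rewrite inE => /orP[/eqP ->|/hi h]; first by rewrite exprD -scalerA; exact: near0Z.
  by rewrite addnC exprD -scalerA; exact: near0Z.
have [l [hl' lmin]] : exists l, (forall x (n : X), ghom x n -> T n -> near0 (f ^+ l *: n)) /\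
    forall i, (forall x (n : X), ghom x n -> T n -> near0 (f ^+ i *: n)) -> (l <= i)%N.
  apply: dickson1; exists l1 => x n _ Tn.
  have sV : submod [set n : X | near0 (f ^+ l1 *: n)].
    split; first by rewrite /= scaler0; exact: near00.
    move=> a u u' h h'; rewrite /= scalerDr; apply: near0D => //.
    by rewrite scalerA mulrC -scalerA; exact: near0Z.
  exact: (gen_sub sV hl) (hl2 _ Tn (gX n)).
have l_gt0 : (0 < l)%N.
  rewrite lt0n; apply/eqP => l00; case: nm'.
  have := hl' _ _ hm'; rewrite l00 expr0 scale1r; apply; by exists 1%N; rewrite expr1.
have [x [n [hn Tn nn]]] : exists x (n : X), [/\ ghom x n, T n & ~ near0 (f ^+ l.-1 *: n)].
  apply: contrapT => h; suff : (l <= l.-1)%N by lia.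
  apply: lmin => x n hn Tn; apply: contrapT => h'; apply: h; by exists x, n.
exists f, d, b, hf, l, (- x); split=> //; apply: (torsion_retract hf hn l_gt0 _ nn).
  exact: hl' hn Tn.
by move=> x' n' i hn' h; apply: hl' hn' _; exists i.
Qed.
End TorsionSummand.

(** * Line bundle summands of torsion-free sheaves *)

Section FreeSummand.
Variables (k : closedFieldType) (p q : nat).
Hypotheses (p_gt0 : (0 < p)%N) (q_gt0 : (0 < q)%N).
Local Notation S := (Spol k).
Local Notation L := (Lpq p q).
Local Notation xx := (@xx k).
Local Notation vx := (@vx p q).
Local Notation Shom := (@Shom k p q).
Local Notation grmod := (grmod k p q).
Implicit Types A B M N P X : grmod.
Local Notation mkq := (@mkq _ _ _ p_gt0 q_gt0).
Local Notation O := (@O k p q).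
Local Notation one := (@one k p q).

(** The degree 0 part of S is k: a combination of the two generators of L(p,q) with nonnegative
    coefficients vanishes only trivially. *)
Lemma scomp_xx0 b d : @scomp k p q 0 (xx b * d) = 0.
Proof.
rewrite /scomp -[xx b * d]/(xx b *: (d : O (0 : L))) (hcZ' _ _ (@Shom_xx k p q b)) sub0r.
suff -> : hc (- vx b) (d : O (0 : L)) = 0 by rewrite scaler0.
have : Shom (- vx b) (hc (- vx b) (d : O (0 : L))).
  by have := hc_hom (- vx b) (d : O (0 : L)); rewrite /ghom /= /Ohom addr0.
move: (hc _ _) => s; elim/Shom_ind: s / => // [s t -> ->|c i j _ e]; first by rewrite addr0.
have : vx 0 *+ i + vx 1 *+ j + vx b = vx 0 *+ 0 + vx 1 *+ 0 by rewrite e addNr !mulr0n addr0.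
have [i' [j' [-> ij]]] : exists i' j', vx 0 *+ i + vx 1 *+ j + vx b = vx 0 *+ i' + vx 1 *+ j' /\ (0 < i' + j')%N.
  elim/I2P: (b); first by exists i.+1, j; rewrite mulrSr addrAC; split; [|lia].
  by exists i, j.+1; rewrite [in RHS]mulrSr addrA; split; [|lia].
move/vx_natP => [n [e1 e2]]; nia.
Qed.

Lemma scompE x y (t : O y) : hc x t = @scomp k p q (x + y) t :> S.
Proof.
rewrite {1}(oneZ t) (hcZr _ _ (@one_hom k p q y)) opprK.
by rewrite /GRing.scale /= mulr1.
Qed.

Lemma subm_sum_cond (M : lmodType S) (V : set M) (I : finType) (P : pred I) (F : I -> M) :
  submod V -> (forall i, P i -> V (F i)) -> V (\sum_(i | P i) F i).
Proof.
move=> sV h; rewrite big_mkcond; apply: subm_sum => // i _.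
by case: ifP => [/h|_] //; exact: (subm0 sV).
Qed.

Section Free.
Variable X : grmod.

(** Linear independence up to finite dimension, in triangular form for induction on the list. *)
Fixpoint indep (e : seq X) : Prop :=
  if e is a :: e' then (forall s w, gen e' w -> near0 (s *: a + w) -> s = 0) /\ indep e' else True.

Lemma indep_near0 e v : indep e -> gen e v -> near0 v -> v = 0.
Proof.
elim: e v => [|a e IH] v /=; first by move=> _ /gen_nil.
move=> [h1 h2] /gen_cons[s [w [hw ->]]] nv; have s0 := h1 s w hw nv.
by move: nv; rewrite s0 scale0r add0r; exact: IH.
Qed.

Lemma indep_reg e n u v : indep e -> gen e v -> gen e u -> xx 1 ^+ n *: v = xx 0 *: u ->
  exists w, [/\ gen e w, v = xx 0 *: w & u = xx 1 ^+ n *: w].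
Proof.
elim: e v u => [|a e IH] v u /=.
  by move=> _ /gen_nil -> /gen_nil -> _; exists 0; rewrite !scaler0; split=> //; apply/gen_nil.
move=> [h1 h2] /gen_cons[s [v' [hv' ->]]] /gen_cons[t [u' [hu' ->]]] E.
have E' : (xx 1 ^+ n * s - xx 0 * t) *: a + (xx 1 ^+ n *: v' - xx 0 *: u') = 0.
  move/eqP: E; rewrite -subr_eq0 => /eqP <-.
  by rewrite !scalerDr !scalerA opprD addrACA scalerBl.
have st : xx 1 ^+ n * s - xx 0 * t = 0.
  apply: (h1 _ (xx 1 ^+ n *: v' - xx 0 *: u')); last by rewrite E'; exact: near00.
  apply: submB; [exact: gen_submod|apply: submZ => //; exact: gen_submod..].
move: E'; rewrite st scale0r add0r => /eqP; rewrite subr_eq0 => /eqP /(IH _ _ h2 hv' hu')[w [hw -> ->]].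
have {}st : xx 1 ^+ n * s = xx 0 ^+ 1 * t by apply/eqP; rewrite expr1 -subr_eq0 st.
have [c [-> ->]] := regXY st.
exists (c *: a + w); split; first by apply/gen_cons; exists c, w.
  by rewrite expr1 scalerDr scalerA.
by rewrite scalerDr scalerA.
Qed.

(** A generator without nonzero multiple in the span of the list is added to it; for any other one a
    multiplier is recorded. The product [s] of the multipliers maps X into the free module on
    [e]. *)
Lemma indep_max : exists e : seq X, [/\ indep e, (forall a, a \in e -> exists x, ghom x a) &
  exists s c, [/\ Shom c s, s != 0 & forall m, gen e (s *: m)]].
Proof.
have [gens [hg gX]] := hom_gens X.
suff [e [h1 h2 [s [c [h3 h4 h5]]]]] : exists e : seq X, [/\ indep e, (forall a, a \in e -> exists x, ghom x a) &
    exists s c, [/\ Shom c s, s != 0 & forall a, a \in gens -> gen e (s *: a)]].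
  exists e; split=> //; exists s, c; split=> // m.
  apply: (gen_sub (V := [set m | gen e (s *: m)])) (gX m) => //.
  split; first by rewrite /= scaler0; apply: subm0; exact: gen_submod.
  move=> a u u' h h'; rewrite /= scalerDr scalerA mulrC -scalerA.
  by have := (gen_submod e).2 a _ _ h h'.
elim: gens hg {gX} => [|a gens IH] hg.
  by exists [::]; split=> //; exists 1, 0; split; [exact: Shom_1|exact: oner_neq0|].
have [|e [h1 h2 [s [c [h3 h4 h5]]]]] := IH; first by move=> u ug; apply: hg; rewrite inE ug orbT.
have [x ha] := hg a (mem_head _ _).
have [[t [d [ht t0 gt]]]|no] := pselect (exists t d, [/\ Shom d t, t != 0 & gen e (t *: a)]).
  exists e; split=> //; exists (t * s), (d + c); split; first exact: ShomM.
    by rewrite mulf_neq0.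
  move=> u; rewrite inE => /orP[/eqP ->|/h5 h]; last by rewrite -scalerA; apply: submZ => //; exact: gen_submod.
  by rewrite mulrC -scalerA; apply: submZ => //; exact: gen_submod.
exists (a :: e); split.
- split=> // t w hw nw; apply: contrapT => /eqP t0.
  have [z tz] : exists z, @scomp k p q z t <> 0.
    apply: contrapT => h; case/eqP: t0; have [r [_ -> _]] := @hc_sum _ _ _ (Defs.O k (0 : L)) t.
    by rewrite big1 // => z _; apply: contrapT => h'; apply: h; exists z.
  case: no; have := near0H (z + x) nw; rewrite hcD (hcZr _ _ ha) addrK => -[N hN].
  exists (xx 0 ^+ N * scomp z t), (vx 0 *+ N + z); split.
  + by apply: ShomM; [exact: Shom_xxn|exact: scomp_hom].
  + by rewrite mulf_neq0 ?xxn_neq0 //; apply/eqP.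
  + have := hN 0; rewrite scalerDr scalerA => /eqP; rewrite addr_eq0 => /eqP ->.
    apply: submN; first exact: gen_submod.
    apply: submZ; first exact: gen_submod.
    by have [_ hc'] := (gsubP _).1 (gen_gsub h2); exact: hc'.
- move=> u; rewrite inE => /orP[/eqP ->|/h2 //]; by exists x.
- exists s, c; split=> // u; rewrite inE => /orP[/eqP ->|/h5 [d hd]].
    by apply/gen_cons; exists s, 0; rewrite addr0; split=> //; apply: subm0; exact: gen_submod.
  by apply/gen_cons; exists 0, (s *: u); rewrite scale0r add0r; split=> //; exists d.
Qed.

Lemma hom_gens_sub (V : set X) : gsub V -> exists g : seq X,
  [/\ forall a, a \in g -> V a, forall a, a \in g -> exists x, ghom x a & forall v, V v -> gen g v].
Proof.
move=> gV; have [sV cV] := (gsubP _).1 gV.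
have [e0 he0] := gfingen X; have [l [h1 h2]] := noeth e0 sV.
have [g [k1 k2 k3]] : exists g : seq X, [/\ forall a, a \in g -> V a, forall a, a \in g -> exists x, ghom x a & forall a, a \in l -> gen g a].
  elim: l h1 {h2} => [|a l IH] h1; first by exists [::].
  have [|g [k1 k2 k3]] := IH; first by move=> u ul; apply: h1; rewrite inE ul orbT.
  have [r [_ ea _]] := hc_sum a; exists ([seq hc x a | x <- r] ++ g); split.
  - move=> u; rewrite mem_cat => /orP[/mapP[x _ ->]|/k1 //]; apply: cV; exact: h1 (mem_head _ _).
  - move=> u; rewrite mem_cat => /orP[/mapP[x _ ->]|/k2 //]; exists x; exact: hc_hom.
  - move=> u; rewrite inE => /orP[/eqP ->|/k3 h]; last exact: gen_catr.
    apply: gen_catl; rewrite {2}ea; apply: subm_sum; first exact: gen_submod.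
    by move=> x xr; apply: gen_mem; apply: map_f.
exists g; split=> // v hv; apply: (gen_sub (gen_submod g) k3); exact: h2.
Qed.

Section Minimal.
Variables (M : set X) (g : seq X).
Hypotheses (gM : gsub M) (hg : forall a, a \in g -> M a) (genM : forall v, M v -> gen g v).
Hypothesis reg : forall n u v, M v -> M u -> xx 1 ^+ n *: v = xx 0 *: u ->
  exists w, [/\ M w, v = xx 0 *: w & u = xx 1 ^+ n *: w].
Hypothesis tf0 : forall v, M v -> xx 0 *: v = 0 -> v = 0.
Variable dg : nat -> L.
Hypothesis hdg : forall i, (i < size g)%N -> ghom (dg i) g`_i.
Hypothesis gmin : forall g' : seq X, (forall a, a \in g' -> a \in g) -> (forall v, M v -> gen g' v) ->
  (size g <= size g')%N.

Lemma min_nth_redundant i (w : X) : (i < size g)%N ->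
  gen [seq g`_j | j <- iota 0 (size g) & j != i] w -> w = g`_i -> False.
Proof.
move=> ig hw ew; pose g' := [seq g`_j | j <- iota 0 (size g) & j != i].
have : (size g <= size g')%N.
  apply: gmin.
    move=> a /mapP[j]; rewrite mem_filter mem_iota => /andP[_ /andP[_ jg]] ->; exact: mem_nth.
  move=> v /genM; apply: (gen_sub (gen_submod g')) => a ag; rewrite -(nth_index 0 ag).
  have [->|ne] := eqVneq (index a g) i; first by rewrite -ew.
  by apply: gen_mem; apply: map_f; rewrite mem_filter ne mem_iota /= index_mem.
rewrite /g' size_map size_filter => h.
have := count_predC (pred1 i) (iota 0 (size g)); rewrite size_iota.
rewrite (count_uniq_mem _ (iota_uniq _ _)) mem_iota /= ig => e.
by move: h; rewrite -[X in (X <= _)%N]e ltnn.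
Qed.

(** A saturated module has depth two, which forces freeness. If [xx 0] divides all coefficients of a
    relation, it is cancelled and the degree drops. Otherwise powers of [xx 1] remain modulo [xx 0];
    dividing by the least of them with [reg] produces a relation with an invertible coefficient, so
    a generator is redundant. *)
Lemma min_free (N : nat) (c : nat -> S) x : (forall i, (i < size g)%N -> Shom (x - dg i) (c i)) ->
  lcomb c g = 0 -> forall i, (i < size g)%N -> (mpoly.mdeg (mpoly.mlead (c i)) < N)%N -> c i = 0.
Proof.
elim: N c x => // N IH c x hcc c0 i ig cN; apply: contrapT => /eqP ci0.
have [sM cM] := (gsubP _).1 gM.
have gMi j : (j < size g)%N -> M g`_j by move=> jg; apply: hg; exact: mem_nth.
have [H|H] := pselect (forall j, (j < size g)%N -> exists v, c j = xx 0 * v).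
  have [c' hc'] : exists c' : nat -> S, forall j, (j < size g)%N -> c j = xx 0 * c' j.
    have [|f hf] := @choice _ _ (fun (j : nat) v => (j < size g)%N -> c j = xx 0 * v); last by exists f.
    by move=> j; have [/H[v hv]|] := boolP (j < size g)%N; [exists v|exists 0].
  have e0 : lcomb c' g = 0.
    apply: tf0; first by apply: subm_sum => // j _; apply: submZ => //; exact: gMi.
    rewrite -[RHS]c0 /lcomb scaler_sumr; apply: eq_bigr => j _.
    by rewrite scalerA hc'.
  have c'0 : c' i = 0.
    apply: (IH c' (x - vx 0) _ e0 i ig) => [j jg|].
      rewrite [x - vx 0 - dg j]addrAC; apply: (Shom_div (xx_neq0 k 0) (@Shom_xx k p q 0)).
      by rewrite -hc' //; exact: hcc.
    move: cN; rewrite hc' // mdeg_mleadM ?xx_neq0 //; last first.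
      by apply: contraNneq ci0 => h; rewrite hc' // h mulr0.
    by rewrite /xx mpoly.mleadXm mpoly.mdeg1; lia.
  by rewrite hc' // c'0 mulr0 eqxx in ci0.
have [cf [nf [wf hf]]] : exists (cf : nat -> k) (nf : nat -> nat) (wf : nat -> S), forall j, (j < size g)%N ->
    c j = cf j *: xx 1 ^+ nf j + xx 0 * wf j /\ (cf j != 0 -> vx 1 *+ nf j = x - dg j).
  have hh (j : nat) : exists u : k * nat * S, (j < size g)%N -> c j = u.1.1 *: xx 1 ^+ u.1.2 + xx 0 * u.2 /\ (u.1.1 != 0 -> vx 1 *+ u.1.2 = x - dg j).
    have [jg|] := boolP (j < size g)%N; last by exists (0, 0%N, 0).
    by have [a [n [w h]]] := hom_xx p_gt0 q_gt0 0 (hcc j jg); exists (a, n, w).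
  have [F hF] := choice hh.
  by exists (fun j => (F j).1.1), (fun j => (F j).1.2), (fun j => (F j).2).
(* The least exponent of [xx 1] that occurs modulo [xx 0], attained at [jj]; after division by this
   power the coefficient at [jj] is the scalar [cf jj]. *)
have [n0 [[jj [jg cj0 nj]] jmin]] : exists n, (exists j, [/\ (j < size g)%N, cf j != 0 & nf j = n]) /\
   forall n', (exists j, [/\ (j < size g)%N, cf j != 0 & nf j = n']) -> (n <= n')%N.
  apply: dickson1.
  apply: contrapT => h; apply: H => j jg; have [ej _] := hf j jg; exists (wf j).
  have [cz|cz] := eqVneq (cf j) 0; first by rewrite ej cz scale0r add0r.
  by case: h; exists (nf j), j.
pose a i := cf i *: xx 1 ^+ (nf i - n0).
have ca i' : (i' < size g)%N -> c i' = xx 1 ^+ n0 * a i' + xx 0 * wf i'.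
  move=> ig'; have [-> _] := hf i' ig'; congr (_ + _); rewrite /a -scalerAr.
  have [->|ne] := eqVneq (cf i') 0; first by rewrite !scale0r.
  by rewrite -exprD subnKC //; apply: jmin; exists i'.
have sMl (f : nat -> S) : M (lcomb f g) by apply: subm_sum => // j _; apply: submZ => //; exact: gMi.
have [|w [Mw mw _]] := reg (n := n0) (sMl a) (sMl (fun i => - wf i)).
  apply/eqP; rewrite -subr_eq0 -c0 /lcomb !scaler_sumr -sumrB; apply/eqP; apply: eq_bigr => i' _.
  by rewrite !scalerA -scalerBl ca // mulrN opprK.
have [d ed] := genM Mw.

have e0 : lcomb (fun i => a i - xx 0 * d i) g = 0.
  transitivity (lcomb a g - xx 0 *: lcomb d g); last by rewrite -ed mw subrr.
  rewrite /lcomb scaler_sumr -sumrB; apply: eq_bigr => i' _.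
  by rewrite scalerBl scalerA.
have h0 : \sum_(i < size g) scomp (dg jj - dg i) (a i - xx 0 * d i) *: g`_i = 0.
  transitivity (hc (dg jj) (lcomb (fun i => a i - xx 0 * d i) g)); last by rewrite e0 hc0.
  rewrite hc_bigsum; apply: eq_bigr => i' _.
  by rewrite (hcZr _ _ (hdg _)).
(* By [scomp_xx0] the multiple of [xx 0] contributes nothing in degree 0, so the coefficient at [jj]
   is an invertible scalar. *)
have E : scomp (dg jj - dg jj) (a jj - xx 0 * d jj) = (cf jj)%:A.
  rewrite subrr /a nj subnn expr0 /scomp hcD.
  rewrite [X in X + _](_ : _ = (cf jj)%:A); last first.
    apply: (@hc_id k p q (O (0 : L))); rewrite /ghom /= /Ohom addr0.
    by apply: ShomZ; exact: Shom_1.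
  by rewrite -mulrN -[X in _ + X]/(scomp 0 (xx 0 * - d jj)) scomp_xx0 addr0.
move: h0; rewrite (bigD1 (Ordinal jg)) //= E => h0; exfalso.
apply: (@min_nth_redundant jj ((- (cf jj)^-1)%:A *: \sum_(i < size g | i != Ordinal jg) scomp (dg jj - dg i) (a i - xx 0 * d i) *: g`_i)) => //.
  apply: submZ; first exact: gen_submod.
  apply: subm_sum_cond => [|i' ne]; first exact: gen_submod.
  apply: submZ; first exact: gen_submod.
  apply: gen_mem; apply: (map_f (fun j => g`_j)); rewrite mem_filter mem_iota /= ltn_ord andbT.
  by apply: contraNneq ne => h; apply/eqP/val_inj.
move/eqP: h0; rewrite addrC addr_eq0 => /eqP ->; rewrite scalerN -scaleNr scalerA -scaleNr opprK.
by rewrite mulr_algl scalerA mulVf // !scale1r.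
Qed.
End Minimal.

(* X is isomorphic, via multiplication by s, to a graded submodule of a free
   module; the saturation of the image is again free. *)
Lemma line_summand : (exists m : X, ~ near0 m) ->
  (forall x c s (m : X), ghom x m -> Shom c s -> s != 0 -> near0 (s *: m) -> near0 m) ->
  exists y, retract (O y) X.
Proof.
move=> [m0 nm0] tf.
have [e [ie he [s [c [hs s0 gs]]]]] := indep_max.
pose sX : set X := [set v | exists m, v = s *: m].
have tfs (m : X) : near0 (s *: m) -> near0 m.
  move=> h; have [r [_ -> _]] := hc_sum m; apply: subm_sum => [|x _]; first exact: near0_submod.
  apply: (tf x c s) => //; first exact: hc_hom.
  by have := near0H (x + c) h; rewrite (hcZ _ _ hs).
have ssX : submod sX.
  split; first by exists 0; rewrite scaler0.
  move=> a u u' [m ->] [m' ->]; exists (a *: m + m').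
  by rewrite scalerDr !scalerA mulrC.
have gsX : gsub sX.
  apply/gsubP; split=> // x u [m ->]; exists (hc (x - c) m).
  by rewrite (hcZ' _ _ hs).
(* The saturation of s X in the free module: the two agree up to finite dimension, and divisibility
   by the variables is inherited from the free module. *)
pose M : set X := [set v | gen e v /\ nearV sX v].
have [sN cN] := (gsubP _).1 (near_gsub gsX).
have [sE cE] := (gsubP _).1 (gen_gsub he).
have gM : gsub M.
  apply/gsubP; split; first split.
  - by split; [exact: subm0|exact: (subm0 sN)].
  - by move=> a u u' [h1 h2] [h1' h2']; split; [exact: sE.2|exact: sN.2].
  - by move=> x u [h1 h2]; split; [exact: cE|exact: cN].
have sXM (m : X) : M (s *: m) by split=> //; apply: near_in; exists m.
pose homgen n := exists g : seq X, [/\ size g = n, forall a, a \in g -> M a, forall a, a \in g -> exists x, ghom x a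
  & forall v, M v -> gen g v].
have [n [[g [gsz hg1 hg2 hg3]] gmin]] : exists n, homgen n /\ forall i, homgen i -> (n <= i)%N.
  by apply: dickson1; have [g [h1 h2 h3]] := hom_gens_sub gM; exists (size g), g.
have reg i u v : M v -> M u -> xx 1 ^+ i *: v = xx 0 *: u ->
    exists w, [/\ M w, v = xx 0 *: w & u = xx 1 ^+ i *: w].
  move=> [hv nv] [hu nu] /(indep_reg ie hv hu)[w [hw ev eu]]; exists w; split=> //; split=> //.
  apply: near_near => //; have := mprim_xx k => /(mprimX 1 i)/(near_mprim sN (m := w)); apply.
    by rewrite expr1 -ev.
  by rewrite -eu.
have near0M v : M v -> near0 v -> v = 0 by move=> [hv _]; exact: (indep_near0 ie hv).
have tf0 v : M v -> xx 0 *: v = 0 -> v = 0.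
  move=> hv e0; apply: near0M => //.
  have [r [_ -> _]] := hc_sum v; apply: subm_sum => [|x _]; first exact: near0_submod.
  apply: (tf x (vx 0) (xx 0)); [exact: hc_hom|exact: Shom_xx|exact: xx_neq0|].
  by rewrite -(hcZ _ _ (@Shom_xx k p q 0)) e0 hc0; exact: near00.
have [dg hdg] : exists dg : nat -> L, forall i, (i < size g)%N -> ghom (dg i) g`_i.
  have [|f hf] := @choice _ _ (fun (i : nat) x => (i < size g)%N -> ghom x g`_i); last by exists f.
  move=> i; have [ig|] := boolP (i < size g)%N; last by exists 0.
  by have [x hx] := hg2 _ (mem_nth 0 ig); exists x.
have free c' i : lcomb c' g = 0 -> (i < size g)%N -> c' i = 0.
  move=> h ig; have [r [_ -> _]] := @hc_sum _ _ _ (Defs.O k (0 : L)) (c' i).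
  rewrite big1 // => z _; pose x := z + dg i.
  have -> : hc z (c' i : O (0 : L)) = scomp (x - dg i) (c' i) by rewrite /x addrK.
  apply: (min_free gM hg1 hg3 reg tf0 hdg _ (c := fun j => scomp (x - dg j) (c' j)) (x := x) _ _ ig (ltnSn _)).
  - move=> g' h1 h2; rewrite gsz; apply: gmin; exists g'; split=> // a /h1; [exact: hg1|exact: hg2].
  - by move=> j _; exact: scomp_hom.
  - rewrite -[RHS](hc0 X x) -h hc_bigsum; apply: eq_bigr => j _.
    by rewrite (hcZr _ _ (hdg _ (ltn_ord _))).
have {hg2} : g <> [::].
  move=> g0; case: nm0; apply: tfs; have := hg3 _ (sXM m0); rewrite g0 => /gen_nil ->; exact: near00.
case: g gsz hg1 hg3 hdg free => // g1 g' gsz hg1 hg3 hdg free _.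
pose d1 := dg 0%N; have hd1 : ghom d1 g1 by exact: (hdg 0%N).
have free1 t w : gen g' w -> t *: g1 + w = 0 -> t = 0.
  move=> [c' ->] h; apply: (free (fun i => if i is i'.+1 then c' i' else t) 0%N) => //.
  by rewrite lcomb_cons.
pose y := c - d1.
have gen'H x w : gen g' w -> gen g' (hc x w).
  move=> hw; suff : gsub (gen g') by move=> /gsubP[_]; exact.
  apply: gen_gsub => a ag; exists (dg (index a g').+1).
  by rewrite -{2}(nth_index 0 ag); apply: (hdg (index a g').+1); rewrite ltnS index_mem.
(* The retraction takes [m] to the coefficient of [g1] in [s *: m]. The section will be given by
   preimages of [xx b ^+ K *: g1] under [s], which exist because [g1] lies in the saturation. *)
pose G : set (dsum X (O y)) := [set u : dsum X (O y) | exists w, gen g' w /\ s *: u.1 = (u.2 : S) *: g1 + w].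
have Gun m (t t' : O y) : G (m, t) -> G (m, t') -> t = t'.
  move=> [w [hw e1]] [w' [hw' e1']]; apply/eqP; rewrite -subr_eq0; apply/eqP.
  apply: (free1 _ (w - w')); first exact: (submB (gen_submod g') hw hw').
  rewrite scalerBl addrACA -opprD -e1 -e1'; exact: subrr.
have gG : gsub G.
  apply: gsub_pair; first split.
  - by exists 0; rewrite scaler0 scale0r addr0; split=> //; exact: (subm0 (gen_submod g')).
  - move=> a u u' [w [hw e1]] [w' [hw' e1']]; exists (a *: w + w'); split; first exact: (gen_submod g').2.
    change (s *: (a *: u.1 + u'.1) = (a * u.2 + u'.2) *: g1 + (a *: w + w')).
    rewrite scalerDr e1' scalerDl addrACA -scalerA -scalerDr -e1 !scalerA mulrC.
    by [].
  - move=> x m t [w [hw /= e1]]; exists (hc (x + c) w); split; first exact: gen'H.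
    have := congr1 (hc (x + c)) e1; rewrite (hcZ _ _ hs) => ->; rewrite hcD (hcZr _ _ hd1).
    by congr (_ *: _ + _); rewrite -addrA -/y scompE.
have GP : is_qgraph G.
  apply: mkq => // [m|t h]; last first.
    rewrite (Gun 0 t 0 h); first exact: near00.
    by exists 0; rewrite scaler0 scale0r addr0; split=> //; exact: (subm0 (gen_submod g')).
  apply: near_in; have /gen_cons[t [w [hw e1]]] := hg3 _ (sXM m).
  by exists t, w.
have [_ [K hK]] := hg1 g1 (mem_head _ _).
have ex b : exists u, ghom (vx b *+ K - y) u /\ s *: u = xx b ^+ K *: g1.
  have [m em] := hK b; exists (hc (vx b *+ K - y) m); split; first exact: hc_hom.
  rewrite -(hcZ _ _ hs) -em; apply: hc_id.
  have := homX b K hd1; congr ghom; rewrite /y opprB addrA subrK addrC.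
  by [].
have [u [hu eu]] := ex 0; have [v [hv ev]] := ex 1.
have [|i [hi0 hi1]] := HomO_mk p_gt0 q_gt0 (@mprim01 k K) (@reg01 k K) (@Shom_xxn k p q 0 K) (@Shom_xxn k p q 1 K) hu hv.
  apply: tfs; rewrite scalerBr !scalerA ![s * _]mulrC -!scalerA eu ev !scalerA mulrC subrr; exact: near00.
exists y, i, (QHom GP); apply: (HomO_eq p_gt0 q_gt0 (K := K) (u := xx 0 ^+ K *: one y) (v := xx 1 ^+ K *: one y)
   (u' := xx 0 ^+ K *: one y) (v' := xx 1 ^+ K *: one y)) => //; try (by rewrite subrr; exact: near00).
  exists u; split=> //; exists 0; split; first exact: (subm0 (gen_submod g')).
  by rewrite /= addr0 eu /GRing.scale /= mulr1.
exists v; split=> //; exists 0; split; first exact: (subm0 (gen_submod g')).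
by rewrite /= addr0 ev /GRing.scale /= mulr1.
Qed.
End Free.
End FreeSummand.

(** * Indecomposability, uniseriality and length *)

Section Structure.
Variables (k : closedFieldType) (p q : nat).
Hypotheses (p_gt0 : (0 < p)%N) (q_gt0 : (0 < q)%N).
Local Notation S := (Spol k).
Local Notation L := (Lpq p q).
Local Notation xx := (@xx k).
Local Notation vx := (@vx p q).
Local Notation Shom := (@Shom k p q).
Local Notation grmod := (grmod k p q).
Local Notation prm := (@prm k p q).
Local Notation Qm := (@Qm k p q).
Local Notation qe := (@qe k p q _ _ _ _ _ _).
Implicit Types A B M N P X : grmod.
Local Notation qdom := (@qdom _ _ _ p_gt0 q_gt0 _ _).
Local Notation qker := (@qker _ _ _ p_gt0 q_gt0 _ _).
Local Notation qfun := (@qfun _ _ _ p_gt0 q_gt0 _ _).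
Local Notation mkq := (@mkq _ _ _ p_gt0 q_gt0).
Local Notation qeqP := (@qeqP _ _ _ p_gt0 q_gt0 _ _ _ _).
Local Notation O := (@O k p q).
Local Notation one := (@one k p q).
Local Notation sexP := (@sexP _ _ _ p_gt0 q_gt0 _ _ _ _ _).
Local Notation monoP := (@monoP _ _ _ p_gt0 q_gt0 _ _).
Local Notation epiP := (@epiP _ _ _ p_gt0 q_gt0 _ _).
Local Notation qisoP := (@qisoP _ _ _ p_gt0 q_gt0 _ _).
Local Notation qcomp_eq := (@qcomp_eq _ _ _ p_gt0 q_gt0 _ _ _ _ _ _ _).
Local Notation qeq_trans := (@qeq_trans _ _ _ p_gt0 q_gt0 _ _).
Local Notation qeq_sym := (@qeq_sym _ _ _ p_gt0 q_gt0 _ _ _ _).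
Local Notation qeq_refl := (@qeq_refl _ _ _ p_gt0 q_gt0 _ _).
Local Notation qcompA := (@qcompA _ _ _ p_gt0 q_gt0 _ _ _ _).
Local Notation qid_l := (@qid_l _ _ _ p_gt0 q_gt0 _ _).
Local Notation qid_r := (@qid_r _ _ _ p_gt0 q_gt0 _ _).
Local Notation retract := (@retract k p q).

Lemma is_zeroP M : is_zero M <-> forall m : M, near0 m.
Proof.
split=> [[f [g [/qeqP h _]]] m|h].
  apply: (qdomI p_gt0 q_gt0 (f := qcomp g f)) => a n hn.
  have := h _ _ _ hn (erefl : graph (qid M) (a *: m, a *: m)) => h1.
  suff h2 : near0 n by rewrite -[a *: m](subKr n); exact: near0B.
  have [z [/= _ hz]] := hn; apply: (near0_graph p_gt0 q_gt0 _ hz).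
  by rewrite [z]thinmx0; exact: near00.
exists (qzero M (gzero k p q)); apply/qisoP; split.
  by apply/monoP => m n _ _; exact: h.
by apply/epiP => n; apply: near_in; exists 0; rewrite /graph /= thinmx0.
Qed.

Lemma nonzero_hom M : ~ is_zero M -> exists x (m : M), ghom x m /\ ~ near0 m.
Proof.
move=> h; apply: contrapT => h'; apply: h; apply/is_zeroP => m.
have [r [_ -> _]] := hc_sum m; apply: subm_sum => [|x _]; first exact: near0_submod.
by apply: contrapT => h2; apply: h'; exists x, (hc x m); split=> //; exact: hc_hom.
Qed.

(** The factorization is [u] followed by the transposed graph of [v]. *)
Lemma mono_factor U V X (u : qhom U X) (v : qhom V X) : mono v ->
  (forall a m, graph u (a, m) -> nearV (gimg (graph v)) m) -> exists w, qeq (qcomp v w) u.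
Proof.
move=> /monoP mv h.
pose G : set (dsum U V) := [set z | exists m, graph u (z.1, m) /\ graph v (z.2, m)].
have gG : gsub G := relcomp_gsub (qg_sub u) (relinv_gsub (qg_sub v)).
have [sG _] := (gsubP _).1 (gdom_gsub gG).
have GP : is_qgraph G.
  apply: mkq => // [a|c [m [/= h1 h2]]]; last exact: mv h2 (qker h1).
  have [K hK] := qdom u a; apply: (nearV_mul sG (K := K)) => c; have [m hm] := hK c.
  have [K' hK'] := h _ _ hm; exists K' => c'; have [n hn] := hK' c'.
  by exists n, (xx c' ^+ K' *: m); split=> //; exact: qgZ.
exists (QHom GP); apply/qeqP => a m1 m2 [/= c [[m [h1 h2]] h3]] h4.
exact: near0_trans (qfun h3 h2) (qfun h1 h4).
Qed.

Lemma epi_factor X Y Y' (t : qhom X Y) (t' : qhom X Y') : epi t ->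
  (forall x n n', graph t (x, n) -> near0 n -> graph t' (x, n') -> near0 n') -> exists u, qeq (qcomp u t) t'.
Proof.
move=> /epiP et h.
pose G : set (dsum Y Y') := [set z | exists x, graph t (x, z.1) /\ graph t' (x, z.2)].
have gG : gsub G := relcomp_gsub (relinv_gsub (qg_sub t)) (qg_sub t').
have [sG _] := (gsubP _).1 (gdom_gsub gG).
have GP : is_qgraph G.
  apply: mkq => // [y|c [x [/= h1 h2]]]; last exact: h h1 (near00 _) h2.
  have [K hK] := et y; apply: (nearV_mul sG (K := K)) => c; have [x hx] := hK c.
  have [K' hK'] := qdom t' x; exists K' => c'; have [n hn] := hK' c'.
  by exists n, (xx c' ^+ K' *: x); split=> //; exact: qgZ.
exists (QHom GP); apply/qeqP => a m1 m2 [/= c [h1 [x [h2 h3]]]] h4.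
have h5 := qgB h3 h4; apply: (h (x - a) (c - c) (m1 - m2)) => //.
  exact: (qgB h2 h1).
by rewrite subrr; exact: near00.
Qed.

Lemma mono_iso U V X (u : qhom U X) (v : qhom V X) : mono u -> mono v ->
  (forall a m, graph u (a, m) -> nearV (gimg (graph v)) m) ->
  (forall a m, graph v (a, m) -> nearV (gimg (graph u)) m) -> isomorphic U V.
Proof.
move=> mu mv h1 h2; have [w hw] := mono_factor mv h1; have [w' hw'] := mono_factor mu h2.
have aux U1 V1 (u1 : qhom U1 X) (v1 : qhom V1 X) (w1 : qhom U1 V1) (w2 : qhom V1 U1) : mono u1 ->
   qeq (qcomp v1 w1) u1 -> qeq (qcomp u1 w2) v1 -> qeq (qcomp w2 w1) (qid U1).
  move=> mu1 e1 e2; apply: mu1; apply: (qeq_trans (qcompA _ _ _)).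
  apply: (qeq_trans (g := qcomp v1 w1)); first by apply: qcomp_eq => //; exact: qeq_refl.
  by apply: (qeq_trans e1); apply: qeq_sym; exact: qid_r.
by exists w, w'; split; [exact: aux mu hw hw'|exact: aux mv hw' hw].
Qed.

Lemma epi_iso X Y Y' (t : qhom X Y) (t' : qhom X Y') : epi t -> epi t' ->
  (forall x n n', graph t (x, n) -> near0 n -> graph t' (x, n') -> near0 n') ->
  (forall x n n', graph t' (x, n) -> near0 n -> graph t (x, n') -> near0 n') -> isomorphic Y Y'.
Proof.
move=> et et' h1 h2; have [w hw] := epi_factor et h1; have [w' hw'] := epi_factor et' h2.
have aux Y1 Y2 (t1 : qhom X Y1) (t2 : qhom X Y2) (w1 : qhom Y1 Y2) (w2 : qhom Y2 Y1) : epi t1 ->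
   qeq (qcomp w1 t1) t2 -> qeq (qcomp w2 t2) t1 -> qeq (qcomp w2 w1) (qid Y1).
  move=> et1 e1 e2; apply: et1; apply: (qeq_trans (qeq_sym (qcompA _ _ _))).
  apply: (qeq_trans (g := qcomp w2 t2)); first by apply: qcomp_eq => //; exact: qeq_refl.
  by apply: (qeq_trans e2); apply: qeq_sym; exact: qid_l.
by exists w, w'; split; [exact: aux et hw hw'|exact: aux et' hw' hw].
Qed.

Lemma near_nearV M (V : set M) m n : gsub V -> near0 (m - n) -> V m -> nearV V n.
Proof.
move=> gV [K hK] hm; exists K => b; have [sV _] := (gsubP _).1 gV.
have /eqP := hK b; rewrite scalerBr subr_eq0 => /eqP <-; exact: submZ.
Qed.

(** The complement is the kernel of [r], as a graded submodule of X. The second clause serves for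
    indecomposable X, whose complement may be zero. *)
Lemma retract_dsum A X (j : qhom A X) (r : qhom X A) : qeq (qcomp r j) (qid A) ->
  exists B, isomorphic (dsum A B) X /\ (is_zero B -> qiso r).
Proof.
move=> /qeqP hr.
pose V : set X := [set x | exists a, graph r (x, a) /\ near0 a].
have gV : gsub V.
  apply/gsubP; split; first split.
  - by exists 0; split; [exact: qg0|exact: near00].
  - move=> a u u' [c [h1 h2]] [c' [h1' h2']]; exists (a *: c + c').
    split; first by apply: qgD => //; exact: qgZ.
    by apply: near0D => //; exact: near0Z.
  - by move=> x u [c [h1 h2]]; exists (hc x c); split; [exact: qgH|exact: near0H].
pose i := qlin (@gsi_lin _ _ _ _ _ gV) (@gsi_hom _ _ _ _ _ gV).
have [h hh] := copair p_gt0 q_gt0 j i; exists (gsubm gV); split.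
  exists h; apply/qisoP; split.
    apply/monoP => -[a v] x /hh[c1 [c2 [/= h1 -> e]]] nx.
    have [a' [h2 n2]] := gsi_in v.
    have nc : near0 (c1 + gsi v) by rewrite -e.
    have na : near0 a.
      have [K hK] := qdom r c1; apply: (near0_mul (K := K)) => b; have [a1 ha1] := hK b.
      have n3 := hr _ _ _ (ex_intro _ _ (conj (qgZ (xx b ^+ K) h1) ha1)) erefl.
      have n4 : near0 a1.
        have := near0_graph p_gt0 q_gt0 (near0Z (xx b ^+ K) nc) (_ : graph r (_, a1 + xx b ^+ K *: a')).
        rewrite scalerDr => /(_ (qgD ha1 (qgZ _ h2))) h3.
        by rewrite -[a1](addrK (xx b ^+ K *: a')); apply: near0B => //; exact: near0Z.
      by rewrite -[_ *: a](subKr a1); exact: near0B.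
    have nv : near0 (gsi v).
      by rewrite -[gsi v](addKr c1) addrC; apply: near0B => //; exact: near0_graph na h1.
    have [K hK] := na; have [K' hK'] := nv; exists (K + K')%N => b; rewrite pairZ; congr (_, _).
      by rewrite addnC exprD -scalerA hK scaler0.
    by rewrite exprD -scalerA; apply: gsi_inj0; rewrite gsiZ gsiZ hK' scaler0.
  apply/epiP => x; have [sI _] := (gsubP _).1 (gimg_gsub (qg_sub h)).
  have [K hK] := qdom r x; apply: (nearV_mul sI (K := K)) => b; have [a ha] := hK b.
  have [K1 hK1] := qdom j a; apply: (nearV_mul sI (K := K1)) => b1; have [c hc1] := hK1 b1.
  have [K2 hK2] := qdom r c; exists K2 => b2; have [a2 ha2] := hK2 b2.
  have n2 := hr _ _ _ (ex_intro _ _ (conj (qgZ (xx b2 ^+ K2) hc1) ha2)) erefl.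
  have [|v ev] := @gsi_ex _ _ _ _ _ gV (xx b2 ^+ K2 *: (xx b1 ^+ K1 *: (xx b ^+ K *: x)) - xx b2 ^+ K2 *: c).
    exists (xx b2 ^+ K2 *: (xx b1 ^+ K1 *: a) - a2); split; last exact: near0_sym.
    by apply: qgB => //; do 2 apply: qgZ.
  exists (xx b2 ^+ K2 *: (xx b1 ^+ K1 *: a), v); apply/hh; exists (xx b2 ^+ K2 *: c), (gsi v); split=> //.
    exact: qgZ.
  by rewrite -ev subrKC.
move=> /is_zeroP hz; apply/qisoP; split.
  apply/monoP => x a h1 na; have [|v ->] := @gsi_ex _ _ _ _ _ gV x; first by exists a.
  by apply: near0_lin; [exact: gsi_lin|exact: hz].
apply/epiP => a; have [sI _] := (gsubP _).1 (gimg_gsub (qg_sub r)).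
have [K1 hK1] := qdom j a; apply: (nearV_mul sI (K := K1)) => b1; have [c hc1] := hK1 b1.
have [K2 hK2] := qdom r c; apply: (nearV_mul sI (K := K2)) => b2; have [a2 ha2] := hK2 b2.
have n2 := hr _ _ _ (ex_intro _ _ (conj (qgZ (xx b2 ^+ K2) hc1) ha2)) erefl.
by apply: (near_nearV _ n2); [exact: gimg_gsub (qg_sub r)|exists (xx b2 ^+ K2 *: c)].
Qed.

Lemma indec_retract X A : indecomposable X -> retract A X -> ~ is_zero A -> isomorphic X A.
Proof.
move=> [_ hX] [j [r hr]] nA; have [B [hi hz]] := retract_dsum hr.
have [//|zB] := hX A B (iso_sym hi).
by exists r; exact: hz.
Qed.

Lemma O_nonzero y : ~ is_zero (O y).
Proof. by move/is_zeroP/(_ (one y))/near0_O/eqP; rewrite oner_eq0. Qed.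

Lemma qe_neq0 f d b (hf : prm f d b) l y : (0 < l)%N -> (qe : Qm hf l y) <> 0.
Proof.
move=> l0 h; have [t] : exists t, 1 = f ^+ l * t by apply/(qe_eq0 hf l y); rewrite scale1r.
by apply: (prm_nonunit (N := 0) hf l0); rewrite expr0.
Qed.

Lemma Q_nonzero f d b (hf : prm f d b) l y : (0 < l)%N -> ~ is_zero (Qm hf l y).
Proof. by move=> l0 /is_zeroP/(_ qe)/near0_Q; exact: qe_neq0. Qed.

Lemma nonzero_retract X : ~ is_zero X -> (exists y, retract (O y) X) \/
  exists f d b (hf : prm f d b) l y, (0 < l)%N /\ retract (Qm hf l y) X.
Proof.
move=> nX; have [[x [c [s [m [h1 h2 h3 h4 h5]]]]]|h] := pselect (exists x c s (m : X),
    [/\ ghom x m, Shom c s, s != 0, near0 (s *: m) & ~ near0 m]).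
  right; exact: torsion_summand h1 h2 h3 h4 h5.
left; apply: line_summand => //.
  by have [x [m [_ nm]]] := nonzero_hom nX; exists m.
by move=> x c s m h1 h2 h3 h4; apply: contrapT => h5; apply: h; exists x, c, s, m.
Qed.

(** Elements of two different summands have no common nonzero multiple. *)
Lemma uniform_indec X : ~ is_zero X ->
  (forall x y (u v : X), ghom x u -> ghom y v -> ~ near0 u -> ~ near0 v ->
     exists s t : S, s *: u = t *: v /\ ~ near0 (s *: u)) -> indecomposable X.
Proof.
move=> nX hX; split=> // A B /iso_sym[f [g hfg]]; apply: contrapT => /not_orP[nA nB].
have /qisoP[/monoP mf _] : qiso f by exists g.
have [x [a [ha na]]] := nonzero_hom nA; have [y [c [hc' nc]]] := nonzero_hom nB.
have aux (D : dsum A B) z : ghom z D -> ~ near0 D -> exists b K u, [/\ ghom (z + vx b *+ K) u, ~ near0 u & graph f (xx b ^+ K *: D, u)].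
  move=> hD nD; have [K hK] := qdom f D; apply: contrapT => h; apply: nD.
  apply: (near0_mul (K := K)) => b; have [u hu] := hK b.
  have hz := homX b K hD; have := qgH (z + vx b *+ K) hu; rewrite (hc_id hz) => hu'.
  have [nu|nu] := pselect (near0 (hc (z + vx b *+ K) u)); first exact: mf hu' nu.
  by case: h; exists b, K, (hc (z + vx b *+ K) u); split=> //; exact: hc_hom.
have [||b1 [K1 [u [hu nu gu]]]] := aux (a, 0) x.
- by apply: dsum_homI => //; exact: ghom0.
- by move=> h; apply: na; exact: (near0_lin (h := fun u : dsum A B => u.1) (@prl_lin _ _ _ A B) h).
have [||b2 [K2 [v [hv nv gv]]]] := aux (0, c) y.
- by apply: dsum_homI => //; exact: ghom0.
- by move=> h; apply: nc; exact: (near0_lin (h := fun u : dsum A B => u.2) (@prr_lin _ _ _ A B) h).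
have [s [t [e ne]]] := hX _ _ _ _ hu hv nu nv; apply: ne.
have h := qgB (qgZ s gu) (qgZ t gv); rewrite e subrr in h.
have {h} := mf _ _ h (near00 _) => h.
have h1 := near0_lin (h := fun u : dsum A B => u.1) (@prl_lin _ _ _ A B) h.
have h2 : near0 (s *: (xx b1 ^+ K1 *: a)).
  by move: h1; rewrite !pairZ pairB !scaler0 subr0.
apply: (near0_graph p_gt0 q_gt0 (m := s *: (xx b1 ^+ K1 *: ((a, 0) : dsum A B))) (f := f)); last exact: qgZ.
rewrite !pairZ !scaler0; exact: (near0_lin (h := fun a => (a, 0) : dsum A B) (@inl_lin _ _ _ A B)).
Qed.

Lemma O_indec y : indecomposable (O y).
Proof.
apply: uniform_indec; first exact: O_nonzero.
move=> x x' u v hu hv nu nv; exists (v : S), (u : S); split; first by rewrite /GRing.scale /= mulrC.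
move/near0_O/eqP; rewrite mulf_eq0 => /orP[/eqP h|/eqP h]; [apply: nv|apply: nu]; rewrite h; exact: near00.
Qed.

Section Tube.
Variables (f : S) (d : L) (b : 'I_2) (hf : prm f d b).
Notation Q l y := (Qm hf l y).

Lemma Q_homP l y x (z : Q l y) : ghom x z -> exists s, Shom (x + y) s /\ z = s *: qe.
Proof.
move=> hz; have [s es] := qe_gen z; exists (scomp (x + y) s); split; first exact: scomp_hom.
by rewrite -{1}(hc_id hz) es (hcZr _ _ (qe_hom hf l y)) opprK.
Qed.

Lemma Q_homf l y x (z : Q l y) : ghom x z -> z <> 0 -> exists i s,
  [/\ z = (f ^+ i * s) *: qe, mprim s f & (i < l)%N].
Proof.
move=> /Q_homP[s [hs ->]] nz; have s0 : s != 0 by apply: contra_notN nz => /eqP ->; rewrite scale0r.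
have [i [s' [es h' _]]] := prm_split p_gt0 q_gt0 hf hs s0; exists i, s'; rewrite -es; split=> //.
rewrite ltnNge; apply: contra_notN nz => li; apply/qe_eq0; exists (f ^+ (i - l) * s').
by rewrite es mulrA -exprD subnKC.
Qed.

Lemma mprim_nz l y s (z : Q l y) : mprim s f -> z <> 0 -> s *: z <> 0.
Proof. by move=> h nz e; apply: nz; exact: Q_tf h e. Qed.

Lemma Q_indec l y : (0 < l)%N -> indecomposable (Q l y).
Proof.
move=> l0; apply: uniform_indec; first exact: Q_nonzero.
have aux (u v : Q l y) i j s t : u = (f ^+ i * s) *: qe -> v = (f ^+ j * t) *: qe -> mprim s f -> mprim t f ->
   v <> 0 -> (i <= j)%N -> exists s1 t1 : S, s1 *: u = t1 *: v /\ ~ near0 (t1 *: v).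
  move=> eu ev hs ht nv ij; exists (t * f ^+ (j - i)), s; split.
    rewrite eu ev !scalerA; congr (_ *: _); rewrite -{2}(subnK ij) exprD; ring.
  by move/near0_Q; exact: mprim_nz.
move=> x x' u v hu hv nu nv.
have u0 : u <> 0 by move=> h; apply: nu; rewrite h; exact: near00.
have v0 : v <> 0 by move=> h; apply: nv; rewrite h; exact: near00.
have [i [s [eu hs _]]] := Q_homf hu u0; have [j [t [ev ht _]]] := Q_homf hv v0.
have [ij|/ltnW ji] := leqP i j.
  by have [s1 [t1 [e ne]]] := aux u v i j s t eu ev hs ht v0 ij; exists s1, t1; rewrite e.
by have [s1 [t1 [e ne]]] := aux v u j i t s ev eu ht hs u0 ji; exists t1, s1.
Qed.

(** A nonzero homogeneous element is a power of [f] times something invertible up to finite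
    dimension, so the least power occurring in [V] determines [V]. The subobjects thus form a
    chain. *)
Lemma Q_sub l y (V : set (Q l y)) : gsub V -> exists i, [/\ (i <= l)%N,
  forall z, V z -> exists w, z = f ^+ i *: w & forall w, nearV V (f ^+ i *: w)].
Proof.
move=> gV; have [sV cV] := (gsubP _).1 gV.
have mprim1 s : mprim 1 s by apply: mprimI => c; exists 0%N, 1, 0; rewrite expr0; ring.
have Vl : V ((f ^+ l * 1) *: qe) by rewrite mulr1 qe_ann; exact: subm0.
have [i [[s [hs Vs]] imin]] : exists i, (exists s, mprim s f /\ V ((f ^+ i * s) *: qe)) /\
    forall j, (exists s, mprim s f /\ V ((f ^+ j * s) *: qe)) -> (i <= j)%N.
  by apply: dickson1; exists l, 1.
have il : (i <= l)%N by apply: imin; exists 1.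
exists i; split=> //.
- move=> z Vz; have [r [_ -> _]] := hc_sum z.
  apply: (@subm_sum _ _ (fun z => exists w, z = f ^+ i *: w)).
    split; first by exists 0; rewrite scaler0.
    move=> a u u' [w ->] [w' ->]; exists (a *: w + w').
    by rewrite scalerDr !scalerA mulrC.
  move=> x _; have := cV x _ Vz; have := hc_hom x z; move: (hc x z) => {z Vz r} z hz Vz.
  have [->|/eqP nz] := eqVneq z 0; first by exists 0; rewrite scaler0.
  have [j [t [ez ht jl]]] := Q_homf hz nz.
  have ij : (i <= j)%N by apply: imin; exists t; rewrite -ez.
  by exists ((f ^+ (j - i) * t) *: qe); rewrite scalerA mulrA -exprD subnKC.
- move=> w; have [t ->] := qe_gen w; rewrite scalerA mulrC -scalerA; apply: submZ; first exact: near_submod.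
  apply: (near_mprim sV (mprimX 1 l hs)).
    by rewrite expr1 scalerA mulrC.
  by rewrite qe_ann; exact: subm0.
Qed.

Lemma Q_uniserial l y : uniserial (Q l y).
Proof.
move=> U V u v mu mv.
have [i [_ h1 h2]] := Q_sub (gimg_gsub (qg_sub u)); have [j [_ h3 h4]] := Q_sub (gimg_gsub (qg_sub v)).
have [ij|/ltnW ji] := leqP i j; [right|left].
  apply: (mono_factor mu) => a m h; have [|w ->] := h3 m; first by exists a.
  by rewrite -(subnKC ij) exprD -scalerA; exact: h2.
apply: (mono_factor mv) => a m h; have [|w ->] := h1 m; first by exists a.
by rewrite -(subnKC ji) exprD -scalerA; exact: h4.
Qed.

Lemma Q_simple y : simple_obj (Q 1 y).
Proof.
split; first exact: Q_nonzero.
move=> U u mu; have [i [i1 h1 h2]] := Q_sub (gimg_gsub (qg_sub u)).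
case: i i1 h1 h2 => [|[|//]] _ h1 h2.
  right; apply/qisoP; split=> //; apply/epiP => n; by have := h2 n; rewrite expr0 scale1r.
left; apply/is_zeroP => m; have [K hK] := qdom u m; apply: (near0_mul (K := K)) => c.
have [n hn] := hK c; have /monoP mu' := mu; apply: (mu' _ _ hn).
have [|w ->] := h1 n; first by exists (xx c ^+ K *: m).
by rewrite qe_ann; exact: near00.
Qed.

Lemma Q_incl l y : exists h : qhom (Q l (y - d)) (Q l.+1 y), graph h (qe, f *: qe).
Proof.
have [||h] := @HomQ_ex k p q p_gt0 q_gt0 f d b hf l (y - d) (Q l.+1 y) 0 (f *: qe).
- rewrite mulr0n sub0r opprB addrC; exact: ghomZ (prm_hom hf) (qe_hom hf _ y).
- by rewrite scalerA -exprSr qe_ann; exact: near00.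
by rewrite expr0 scale1r; exists h.
Qed.

Lemma Q_proj l y l' : (l' <= l)%N -> exists h : qhom (Q l y) (Q l' y), graph h (qe, qe).
Proof.
move=> ll; have [||h] := @HomQ_ex k p q p_gt0 q_gt0 f d b hf l y (Q l' y) 0 qe.
- by rewrite mulr0n sub0r; exact: qe_hom.
- by rewrite -(subnK ll) exprD -scalerA qe_ann scaler0; exact: near00.
by rewrite expr0 scale1r; exists h.
Qed.

Lemma Q_incl_mono l y (h : qhom (Q l (y - d)) (Q l.+1 y)) : graph h (qe, f *: qe) -> mono h.
Proof.
move=> hq; apply/monoP => m n hm nn; have [s es] := qe_gen m.
have : near0 (s *: (f *: (qe : Q l.+1 y))).
  rewrite es in hm; have := qfun hm (qgZ s hq) => h1.
  by rewrite -[s *: _](subKr n); exact: near0B.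
move/near0_Q; rewrite scalerA => /qe_eq0[t]; rewrite exprS mulrC -mulrA => /(mulfI (prm_neq0 hf)) e.
by rewrite es (_ : s *: qe = 0); [exact: near00|apply/qe_eq0; exists t].
Qed.

Lemma Q_epi l y A (h : qhom A (Q l y)) a : graph h (a, qe) -> epi h.
Proof.
move=> hq; apply/epiP => n; apply: near_in; have [s ->] := qe_gen n.
by exists (s *: a); exact: qgZ.
Qed.

(** In the simple object W, [f *: z] generates zero or everything. In the second case [z] is, up to
    finite dimension, a multiple of [f *: z], and by iteration of [f ^+ l *: z], which is
    negligible. *)
Lemma Q_simple_kill l y (W : grmod) K (z : W) (h : qhom (Q l y) W) : simple_obj W ->
  graph h (xx b ^+ K *: qe, z) -> ghom (vx b *+ K - y) z -> near0 (f *: z).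
Proof.
move=> [_ sW] hz hzh; apply: contrapT => nz.
have nl : near0 (f ^+ l *: z).
  have := qgZ (f ^+ l) hz; rewrite qe_ann => h1; exact: qker h1.
pose V := gen [:: f *: z].
have gV : gsub V.
  apply: gen_gsub => a; rewrite inE => /eqP ->; exists (vx b *+ K - y + d); exact: ghomZ (prm_hom hf) hzh.
pose i := qlin (@gsi_lin _ _ _ _ _ gV) (@gsi_hom _ _ _ _ _ gV).
have mi : mono i.
  apply/monoP => m n /= -> [K' hK']; exists K' => c; apply: gsi_inj0; rewrite gsiZ; exact: hK'.
have [/is_zeroP h0|/qisoP[_ /epiP hi]] := sW _ i mi.
  have [|v ev] := @gsi_ex _ _ _ _ _ gV (f *: z); first by apply: gen_mem; exact: mem_head.
  by apply: nz; rewrite ev; apply: near0_lin; [exact: gsi_lin|exact: h0].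
apply: nz; suff : near0 z by exact: near0Z.
have [K1 hK1] := hi z; apply: (near0_mul (K := (K1 * l)%N)) => c.
have [v /= ev] := hK1 c; have /gen1[s es] := gsi_in v.
have E : xx c ^+ K1 *: z = s *: (f *: z) by rewrite -es.
have {}E j : xx c ^+ (K1 * j) *: z = s ^+ j *: (f ^+ j *: z).
  elim: j => [|j IH]; first by rewrite muln0 !expr0 !scale1r.
  transitivity ((s * f) *: (xx c ^+ (K1 * j) *: z)); last by rewrite IH !scalerA; congr (_ *: _); rewrite !exprSr; ring.
  rewrite mulnSr exprD -scalerA E !scalerA; congr (_ *: _); ring.
by rewrite E; exact: near0Z.
Qed.
(** The kernel contains f Q by [Q_simple_kill], and no element prime to [f], since that would
    generate everything. As [g] is any epimorphism onto a simple object, this serves both to build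
    composition series and to compare them. *)
Lemma Q_sex l y (W : grmod) (h : qhom (Q l (y - d)) (Q l.+1 y)) (g : qhom (Q l.+1 y) W) :
  simple_obj W -> epi g -> graph h (qe, f *: qe) -> short_exact h g.
Proof.
move=> sW eg hq; have [K [z [hz gz]]] := qdom1 p_gt0 q_gt0 g.
have fz := Q_simple_kill sW gz hz.
have nz : ~ near0 z.
  move=> nz; case: sW => nW _; apply: nW; apply/is_zeroP => w.
  have /epiP eg' := eg; have [K1 hK1] := eg' w; apply: (near0_mul (K := K1)) => c; have [m hm] := hK1 c.
  have [s es] := qe_gen m; rewrite es in hm.
  have n1 : near0 (xx b ^+ K *: (xx c ^+ K1 *: w)).
    have h1 := qgZ (xx b ^+ K) hm; have h2 := qgZ s gz.
    have e1 : xx b ^+ K *: (s *: (qe : Q l.+1 y)) = s *: (xx b ^+ K *: qe) by rewrite !scalerA mulrC.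
    rewrite e1 in h1; have h3 := qfun h1 h2.
    by rewrite -[_ *: (_ *: w)](subrK (s *: z)); apply: near0D => //; exact: near0Z.
  have [M hM] := mprimX 1 K (prm_comp hf).
  have n2 : near0 (f ^+ l.+1 *: (xx c ^+ K1 *: w)).
    by have := qgZ (f ^+ l.+1) hm; rewrite qe_ann => /qker.
  exact: near0_idem (near_mprim (near0_submod W) (mprim_comp hf l.+1 K) n2 n1).
have gE s n : graph g (s *: qe, n) -> near0 (xx b ^+ K *: n - s *: z).
  move=> h1; apply: (qfun (qgZ (xx b ^+ K) h1)).
  by have := qgZ s gz; rewrite !scalerA mulrC.
apply/sexP; split=> //; first exact: Q_incl_mono hq.
- move=> m e n hm he; have [s es] := qe_gen m; rewrite es in hm.
  have n1 := near0_Q (qfun hm (qgZ s hq)); have {n1} ee : e = s *: (f *: qe) by apply/eqP; rewrite -subr_eq0 n1.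
  rewrite ee scalerA in he; have n2 := gE _ _ he.
  have n3 : near0 (xx b ^+ K *: n).
    rewrite -[_ *: n](subrK ((s * f) *: z)); apply: near0D => //; rewrite -scalerA; exact: near0Z.
  have n4 : near0 (f ^+ l.+1 *: n) by have := qgZ (f ^+ l.+1) he; rewrite qe_ann => /qker.
  exact: near0_idem (near_mprim (near0_submod W) (mprim_comp hf l.+1 K) n4 n3).
- move=> e n he nn.
  have [sI cI] := (gsubP _).1 (gimg_gsub (qg_sub h)).
  have gI := near_gsub (gimg_gsub (qg_sub h)); have [sN _] := (gsubP _).1 gI.
  have [r [_ -> _]] := hc_sum e; apply: subm_sum => // x _; apply: near_in.
  have := qgH x he; have := near0H x nn; have := hc_hom x e; move: (hc x e) (hc x n) => {e n he nn} e n xe nn he.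
  have [->|/eqP e0] := eqVneq e 0; first exact: subm0.
  have [i [s [ee hs il]]] := Q_homf xe e0.
  case: i ee il => [|i] ee il; last first.
    exists ((f ^+ i * s) *: qe); have := qgZ (f ^+ i * s) hq; rewrite scalerA ee exprS.
    by rewrite (_ : f ^+ i * s * f = f * f ^+ i * s) //; ring.
  case: nz; rewrite expr0 mul1r in ee; rewrite ee in he.
  have n2 := gE _ _ he; apply: (near_torsion hs (i := 1)); last by rewrite expr1.
  rewrite -[s *: z](subKr (xx b ^+ K *: n)); apply: near0B => //; exact: near0Z.
Qed.

Lemma Q_has_length l y : has_length l (Q l y).
Proof.
elim: l y => [|l IH] y /=.
  by apply/is_zeroP => m; rewrite -[m]scale1r -(expr0 f) qe_ann; exact: near00.
have [h hq] := Q_incl l y; have [g gq] := @Q_proj l.+1 y 1 isT.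
exists (Q l (y - d)), (Q 1 y), h, g; split=> //; last exact: Q_simple.
by apply: Q_sex => //; [exact: Q_simple|exact: Q_epi gq].
Qed.

Lemma Q_is_top l y : (0 < l)%N -> is_top (Q l y) (Q 1 y).
Proof.
move=> l0; have [t tq] := @Q_proj l y 1 l0; exists t; split; first exact: Q_epi tq.
move=> Z g; split=> [/(qzeroP p_gt0 q_gt0) h W w sW|h]; last by apply: h; exact: Q_simple.
apply/(qzeroP p_gt0 q_gt0) => a n [/= m [h1 h2]].
have [K [z [hz gz]]] := qdom1 p_gt0 q_gt0 w; have fz := Q_simple_kill sW gz hz.
have [s es] := qe_gen m; rewrite es in h2.
have tm : graph t (m, s *: qe) by rewrite es; exact: qgZ.
have /near0_Q/qe_eq0[s' e'] : near0 (s *: (qe : Q 1 y)) by apply: (h a); exists m.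
have n1 : near0 (xx b ^+ K *: n).
  have := qfun (qgZ (xx b ^+ K) h2) (_ : graph w (_, s *: z)).
  have := qgZ s gz; rewrite [in X in X -> _]scalerA mulrC -[in X in X -> _]scalerA => h3 /(_ h3) h4.
  rewrite -[_ *: n](subrK (s *: z)); apply: near0D => //.
  by rewrite e' expr1 mulrC -scalerA; exact: near0Z.
have n2 : near0 (f ^+ l *: n) by have := qgZ (f ^+ l) h2; rewrite qe_ann => /qker.
exact: near0_idem (near_mprim (near0_submod W) (mprim_comp hf l K) n2 n1).
Qed.
End Tube.

Lemma short_exact_ker (A A' B C : grmod) (i : qhom A B) (i' : qhom A' B) (g : qhom B C) :
  short_exact i g -> short_exact i' g -> isomorphic A A'.
Proof.
move=> /sexP[m1 _ z1 k1] /sexP[m2 _ z2 k2].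
have aux A1 A2 (i1 : qhom A1 B) (i2 : qhom A2 B) :
    (forall b e a, graph i1 (b, e) -> graph g (e, a) -> near0 a) ->
    (forall e a, graph g (e, a) -> near0 a -> nearV (gimg (graph i2)) e) ->
    forall a m, graph i1 (a, m) -> nearV (gimg (graph i2)) m.
  move=> z0 k0 a m h; have [sI _] := (gsubP _).1 (gimg_gsub (qg_sub i2)).
  have [K hK] := qdom g m; apply: (nearV_mul sI (K := K)) => c; have [n hn] := hK c.
  exact: k0 hn (z0 _ _ _ (qgZ _ h) hn).
by apply: (mono_iso m1 m2); apply: aux.
Qed.

Lemma is_zero_iso X Y : isomorphic X Y -> is_zero X -> is_zero Y.
Proof. by move=> h; exact: (iso_trans p_gt0 q_gt0 (iso_sym h)). Qed.

Lemma mono_comp A B C (g : qhom B C) (f : qhom A B) : mono f -> mono g -> mono (qcomp g f).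
Proof.
move=> /monoP mf /monoP mg; apply/monoP => m n [/= x [h1 h2]] nn.
exact: mf h1 (mg _ _ h2 nn).
Qed.

Lemma epi_comp A B C (g : qhom B C) (f : qhom A B) : epi f -> epi g -> epi (qcomp g f).
Proof.
move=> ef eg Z u v huv; apply: eg; apply: ef.
by apply: (qeq_trans (qeq_sym (qcompA _ _ _))); apply: (qeq_trans huv); exact: qcompA.
Qed.

Lemma sex_iso_mid (U V X Y : grmod) (i : qhom U X) (g : qhom X V) (f : qhom X Y) : qiso f -> short_exact i g ->
  exists i' g', @short_exact k p q U Y V i' g' /\ True.
Proof.
move=> [f' [h1 h2]] /sexP[mi eg z kk].
have [mf ef] : mono f /\ epi f by apply/qisoP; exists f'.
have [mf' ef'] : mono f' /\ epi f' by apply/qisoP; exists f.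
exists (qcomp f i), (qcomp g f'); split=> //; apply/sexP; split.
- exact: mono_comp.
- exact: epi_comp.
- move=> u y a [/= x [h3 h4]] [/= x' [h5 h6]].
  have /qeqP h1' := h1; have n1 := h1' x x' x (ex_intro _ y (conj h4 h5)) erefl.
  have [K hK] := qdom g x; apply: (near0_mul (K := K)) => c; have [b hb] := hK c.
  have n2 := z _ _ _ (qgZ (xx c ^+ K) h3) hb.
  have := near0_graph p_gt0 q_gt0 (near0Z (xx c ^+ K) n1) (_ : graph g (_, xx c ^+ K *: a - b)).
  rewrite scalerBr => /(_ (qgB (qgZ _ h6) hb)) n3.
  by rewrite -[_ *: a](subrK b); exact: near0D.
- move=> y a [/= x [h3 h4]] na; have [sI _] := (gsubP _).1 (gimg_gsub (qg_sub (qcomp f i))).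
  have [K hK] := kk _ _ h4 na; apply: (nearV_mul sI (K := K)) => c; have [u hu] := hK c.
  have [K1 hK1] := qdom f (xx c ^+ K *: x); apply: (nearV_mul sI (K := K1)) => c1; have [y' hy'] := hK1 c1.
  have /qeqP h2' := h2.
  have n1 := h2' (xx c1 ^+ K1 *: (xx c ^+ K *: y)) _ _ (ex_intro _ _ (conj (qgZ _ (qgZ _ h3)) hy')) erefl.
  apply: (near_nearV _ n1); first exact: gimg_gsub (qg_sub _).
  by exists (xx c1 ^+ K1 *: u); exists (xx c1 ^+ K1 *: (xx c ^+ K *: x)); split=> //; exact: qgZ.
Qed.

(** Whatever the composition series, the kernel of its last step is the sheaf one shorter, by
    [Q_sex] and [short_exact_ker]; so the length drops by one on both sides. *)
Lemma Q_length_uniq f d b (hf : prm f d b) j l y X : has_length j X -> isomorphic X (Qm hf l y) -> j = l.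
Proof.
elim: j l y X => [|j IH] l y X /=.
  move=> zX /is_zero_iso/(_ zX); case: l => // l h; by case: (@Q_nonzero f d b hf l.+1 y isT h).
move=> [U [V [i [g [ex sV hU]]]]] [f' hf'].
have [i' [g' [ex' _]]] := sex_iso_mid hf' ex.
have [_ eg _ _] := (sexP).1 ex'.
case: l f' hf' i' g' ex' eg => [|l] f' hf' i' g' ex' eg.
  case: sV => nV _; case: nV; apply/is_zeroP => v; have /epiP eg' := eg.
  have [K hK] := eg' v; apply: (near0_mul (K := K)) => c; have [m hm] := hK c.
  apply: (near0_graph p_gt0 q_gt0 _ hm); rewrite -[m]scale1r -(expr0 f) qe_ann; exact: near00.
have [h hq] := Q_incl hf l y; congr _.+1; apply: (IH l (y - d) U hU).
exact: short_exact_ker ex' (Q_sex sV eg hq).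
Qed.
End Structure.

(** * Recognition of the exceptional sheaves; rigid indecomposables *)

Section Exceptional.
Variables (k : closedFieldType) (p q : nat).
Hypotheses (p_gt0 : (0 < p)%N) (q_gt0 : (0 < q)%N).
Local Notation S := (Spol k).
Local Notation xx := (@xx k).
Local Notation vx := (@vx p q).
Local Notation grmod := (grmod k p q).
Local Notation prm := (@prm k p q).
Local Notation Qm := (@Qm k p q).
Local Notation qe := (@qe k p q _ _ _ _ _ _).
Implicit Types A B M N P X : grmod.
Local Notation qdom := (@qdom _ _ _ p_gt0 q_gt0 _ _).
Local Notation qfun := (@qfun _ _ _ p_gt0 q_gt0 _ _).
Local Notation qeqP := (@qeqP _ _ _ p_gt0 q_gt0 _ _ _ _).
Local Notation O := (@O k p q).
Local Notation one := (@one k p q).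
Local Notation sexP := (@sexP _ _ _ p_gt0 q_gt0 _ _ _ _ _).
Local Notation monoP := (@monoP _ _ _ p_gt0 q_gt0 _ _).
Local Notation epiP := (@epiP _ _ _ p_gt0 q_gt0 _ _).
Local Notation qisoP := (@qisoP _ _ _ p_gt0 q_gt0 _ _).
Local Notation qcomp_eq := (@qcomp_eq _ _ _ p_gt0 q_gt0 _ _ _ _ _ _ _).
Local Notation qeq_trans := (@qeq_trans _ _ _ p_gt0 q_gt0 _ _).
Local Notation qeq_sym := (@qeq_sym _ _ _ p_gt0 q_gt0 _ _ _ _).
Local Notation qeq_refl := (@qeq_refl _ _ _ p_gt0 q_gt0 _ _).
Local Notation qcompA := (@qcompA _ _ _ p_gt0 q_gt0 _ _ _ _).
Local Notation qid_l := (@qid_l _ _ _ p_gt0 q_gt0 _ _).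
Local Notation qid_r := (@qid_r _ _ _ p_gt0 q_gt0 _ _).
Local Notation retract := (@retract k p q).
Notation Qx b l y := (Qm (prm_xx k p_gt0 q_gt0 b) l y).

Lemma uniserial_iso X Y : isomorphic X Y -> uniserial X -> uniserial Y.
Proof.
move=> [f [g [h1 h2]]] hX U V u v mu mv.
have mg : mono g.
  by have /qisoP[] : qiso g by exists f.
have [[w hw]|[w hw]] := hX U V (qcomp g u) (qcomp g v) (mono_comp p_gt0 q_gt0 mu mg) (mono_comp p_gt0 q_gt0 mv mg).
  left; exists w; apply: mg; apply: (qeq_trans (g := qcomp (qcomp g v) w)) => //; exact: qcompA.
right; exists w; apply: mg; apply: (qeq_trans (g := qcomp (qcomp g u) w)) => //; exact: qcompA.
Qed.

Lemma uniserial_indec X : ~ is_zero X -> uniserial X -> indecomposable X.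
Proof.
move=> nX uX; split=> // A B /iso_sym[f [g hfg]].
have [mf _] : mono f /\ epi f by apply/qisoP; exists g.
have ml : mono (qinl A B).
  by apply/monoP => m n /= -> h; exact: (near0_lin (h := fun u : dsum A B => u.1) (@prl_lin _ _ _ A B) h).
have mr : mono (qinr A B).
  by apply/monoP => m n /= -> h; exact: (near0_lin (h := fun u : dsum A B => u.2) (@prr_lin _ _ _ A B) h).
have [[w hw]|[w hw]] := uX A B (qcomp f (qinl A B)) (qcomp f (qinr A B)) (mono_comp p_gt0 q_gt0 ml mf) (mono_comp p_gt0 q_gt0 mr mf).
- left; apply/is_zeroP => // a.
  have /qeqP e : qeq (qcomp (qinr A B) w) (qinl A B).
    by apply: mf; apply: (qeq_trans (g := qcomp (qcomp f (qinr A B)) w)) => //; exact: qcompA.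
  have [K hK] := qdom w a; apply: (near0_mul (K := K)) => c; have [b hb] := hK c.
  have := e (xx c ^+ K *: a) (0, b) (xx c ^+ K *: a, 0) (ex_intro _ b (conj hb erefl)) erefl.
  move/near0N; rewrite opprB => h.
  by have := near0_lin (h := fun u : dsum A B => u.1) (@prl_lin _ _ _ A B) h; rewrite pairB /= subr0.
- right; apply/is_zeroP => // a.
  have /qeqP e : qeq (qcomp (qinl A B) w) (qinr A B).
    by apply: mf; apply: (qeq_trans (g := qcomp (qcomp f (qinl A B)) w)) => //; exact: qcompA.
  have [K hK] := qdom w a; apply: (near0_mul (K := K)) => c; have [b hb] := hK c.
  have := e (xx c ^+ K *: a) (b, 0) (0, xx c ^+ K *: a) (ex_intro _ b (conj hb erefl)) erefl.
  move/near0N; rewrite opprB => h.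
  by have := near0_lin (h := fun u : dsum A B => u.2) (@prr_lin _ _ _ A B) h; rewrite pairB /= subr0.
Qed.

Lemma top_uniq X Y Y' : is_top X Y -> is_top X Y' -> isomorphic Y Y'.
Proof.
have aux (Y1 Y2 : grmod) (t1 : qhom X Y1) (t2 : qhom X Y2) :
    (forall Z (g : qhom Z X), qeq (qcomp t1 g) (qzero Z Y1) <->
      forall W (h : qhom X W), simple_obj W -> qeq (qcomp h g) (qzero Z W)) ->
    (forall Z (g : qhom Z X), qeq (qcomp t2 g) (qzero Z Y2) <->
      forall W (h : qhom X W), simple_obj W -> qeq (qcomp h g) (qzero Z W)) ->
    forall x n n', graph t1 (x, n) -> near0 n -> graph t2 (x, n') -> near0 n'.
  move=> h1 h2 x n n' hn nn hn'.
  pose V : set X := [set x | exists a, graph t1 (x, a) /\ near0 a].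
  have gV : gsub V.
    apply/gsubP; split; first split.
    - by exists 0; split; [exact: qg0|exact: near00].
    - move=> a u u' [c [h3 h4]] [c' [h3' h4']]; exists (a *: c + c').
      split; first by apply: qgD => //; exact: qgZ.
      by apply: near0D => //; exact: near0Z.
    - by move=> y u [c [h3 h4]]; exists (hc y c); split; [exact: qgH|exact: near0H].
  pose i := qlin (@gsi_lin _ _ _ _ _ gV) (@gsi_hom _ _ _ _ _ gV).
  have /h1/h2/(qzeroP p_gt0 q_gt0) h : qeq (qcomp t1 i) (qzero (gsubm gV) Y1).
    apply/(qzeroP p_gt0 q_gt0) => v m [/= u [-> h3]].
    have [a [h4 na]] := gsi_in v; rewrite -[m](subrK a); apply: near0D => //; exact: qfun h3 h4.
  have [|v ev] := @gsi_ex _ _ _ _ _ gV x; first by exists n.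
  by apply: (h v); exists x.
move=> [t [et ht]] [t' [et' ht']]; apply: (epi_iso p_gt0 q_gt0 et et'); exact: aux.
Qed.

Lemma top_iso X X' Y : isomorphic X X' -> is_top X' Y -> is_top X Y.
Proof.
move=> [f [g [h1 h2]]] [t [et ht]]; exists (qcomp t f); split.
  have [_ ef] : mono f /\ epi f by apply/qisoP; exists g.
  exact: (epi_comp p_gt0 q_gt0 ef et).
move=> Z u; split=> [h W w sW|h].
  have e1 : qeq (qcomp t (qcomp f u)) (qzero Z Y) by apply: qeq_trans h; exact: qcompA.
  have := (ht _ _).1 e1 W (qcomp w g) sW; apply: qeq_trans.
  apply: qeq_sym; apply: (qeq_trans (qcompA _ _ _)); apply: qcomp_eq; last exact: qeq_refl.
  apply: (qeq_trans (qeq_sym (qcompA _ _ _))); apply: (qeq_trans (g := qcomp w (qid X))); last exact: qid_r.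
  by apply: qcomp_eq => //; exact: qeq_refl.
apply: (qeq_trans (qeq_sym (qcompA _ _ _))); apply/ht => W w sW.
by apply: (qeq_trans (qcompA _ _ _)); exact: h.
Qed.

Lemma cokernel_uniq (A B C C' : grmod) (f : qhom A B) (c : qhom B C) (c' : qhom B C') :
  is_cokernel f c -> is_cokernel f c' -> isomorphic C C'.
Proof.
move=> [e1 z1 u1] [e2 z2 u2]; have [w hw] := u1 _ _ z2; have [w' hw'] := u2 _ _ z1.
have aux C1 C2 (c1 : qhom B C1) (c2 : qhom B C2) (w1 : qhom C1 C2) (w2 : qhom C2 C1) : epi c1 ->
   qeq (qcomp w1 c1) c2 -> qeq (qcomp w2 c2) c1 -> qeq (qcomp w2 w1) (qid C1).
  move=> et1 h1 h2; apply: et1; apply: (qeq_trans (qeq_sym (qcompA _ _ _))).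
  apply: (qeq_trans (g := qcomp w2 c2)); first by apply: qcomp_eq => //; exact: qeq_refl.
  by apply: (qeq_trans h2); apply: qeq_sym; exact: qid_l.
by exists w, w'; split; [exact: aux e1 hw hw'|exact: aux e2 hw' hw].
Qed.

(** The images of multiplication by the two variables are incomparable subobjects. *)
Lemma O_not_uniserial y : ~ uniserial (O y).
Proof.
have mm i : mono (mulX k i y).
  apply/monoP => m n /= -> /near0_O/eqP; rewrite mulf_eq0 (negPf (xx_neq0 _ i)) /= => /eqP ->; exact: near00.
have aux (b c : 'I_2) (w : qhom (O (y - vx b)) (O (y - vx c))) : c = other b ->
    qeq (qcomp (mulX k c y) w) (mulX k b y) -> False.
  move=> cb /qeqP h; have [K hK] := qdom w (one (y - vx b)); have [u hu] := hK b.
  have := h (xx b ^+ K *: one (y - vx b)) (xx c *: u) (xx b *: (xx b ^+ K *: one (y - vx b))) (ex_intro _ u (conj hu erefl)) erefl.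
  move/near0_O/eqP; rewrite subr_eq0 => /eqP; rewrite /GRing.scale /= mulr1 -exprS => e.
  apply: (@xx_ndvdX k c (xx b) K.+1 _ u); last exact/esym/e.
  by move=> v; rewrite cb -{1}(otherK b); exact: xx_eqF.
move=> /(_ _ _ (mulX k 0 y) (mulX k 1 y) (mm 0) (mm 1))[[w]|[w]]; exact: aux.
Qed.

(** [xx b] acts invertibly, so a twist by a multiple of [vx b] changes nothing; nor does a scalar
    factor in [f]. Taking n = |c| makes m = n + c nonnegative, and [xx b ^+ n] times one generator
    goes to [xx b ^+ m] times the other. *)
Lemma Q_iso f d b (hf : prm f d b) f' d' (hf' : prm f' d' b) (a : k) l y y' (c : int) : a != 0 -> f' = a *: f ->
  y' = y + vx b *~ c -> isomorphic (Qm hf l y) (Qm hf' l y').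
Proof.
move=> a0 ef ey; pose n := absz c; pose m := absz (n%:Z + c).
have fl (s : S) : (exists t, s = f' ^+ l * t) <-> (exists t, s = f ^+ l * t).
  split=> [[t ->]|[t ->]]; rewrite ef exprZn.
    by exists (a ^+ l *: t); rewrite -scalerAl scalerAr.
  by exists (a ^- l *: t); rewrite -scalerAl scalerAr scalerA mulfV ?scale1r // expf_neq0.
have [||h hq] := @HomQ_ex k p q p_gt0 q_gt0 f d b hf l y (Qm hf' l y') n (xx b ^+ m *: qe).
- have := ghomZ (@Shom_xxn k p q b m) (qe_hom hf' l y'); congr ghom; rewrite ey.
  rewrite opprD [vx b *+ m]pmulrn [vx b *+ n]pmulrn [LHS](ACl (3*2*1)) /= -mulrzBr.
  by congr (_ *~ _ - _); rewrite /m /n; lia.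
- rewrite scalerA mulrC -scalerA (_ : f ^+ l *: qe = 0) ?scaler0; first exact: near00.
  by apply/qe_eq0/fl; exists 1; rewrite mulr1.
exists h; apply/qisoP; split.
  apply/monoP => u v hu nv; have [s es] := qe_gen u; rewrite es in hu.
  have h1 := qgZ (xx b ^+ n) hu; have h2 := qgZ s hq.
  have e1 : xx b ^+ n *: (s *: (qe : Qm hf l y)) = s *: (xx b ^+ n *: qe) by rewrite !scalerA mulrC.
  rewrite e1 in h1; have h3 := qfun h1 h2.
  have /near0_Q : near0 (s *: (xx b ^+ m *: (qe : Qm hf' l y'))).
    by rewrite -[_ *: (_ *: _)](subKr (xx b ^+ n *: v)); apply: near0B => //; exact: near0Z.
  rewrite scalerA mulrC -scalerA => h4.
  have : s *: (qe : Qm hf' l y') = 0.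
    have := mprimX m 1 (mprimC (prm_comp hf')); rewrite expr1 => h5.
    exact: (Q_tf h5 h4).
  move=> /qe_eq0/fl h5; rewrite es; have -> : s *: (qe : Qm hf l y) = 0 by apply/qe_eq0.
  exact: near00.
apply/epiP => v; have [sI _] := (gsubP _).1 (gimg_gsub (qg_sub h)).
by apply: (Q_nearV sI (K := m)); exists (xx b ^+ n *: qe).
Qed.

Lemma Hom_zero_iso A B : isomorphic A B -> Hom_zero A B -> is_zero A.
Proof.
move=> [f hf] h; have [/monoP mf _] : mono f /\ epi f by apply/qisoP.
have /(qzeroP p_gt0 q_gt0) f0 := h f; apply/is_zeroP => // m.
have [K hK] := qdom f m; apply: (near0_mul (K := K)) => c; have [n hn] := hK c.
exact: mf hn (f0 _ _ hn).
Qed.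

Lemma Qx_exc_simple b (i : int) : is_exc_simple b i (Qx b 1 (vx b *~ i)).
Proof.
set y := vx b *~ i.
have cl : linear (fun s : O y => (s : S) *: (qe : Qx b 1 y)).
  move=> a u v; change ((a * u + v) *: (qe : Qx b 1 y) = a *: (u *: qe) + v *: qe).
  by rewrite scalerDl scalerA.
have ch x (s : O y) : ghom x s -> ghom x ((s : S) *: (qe : Qx b 1 y)).
  move=> hs; have := ghomZ hs (qe_hom (prm_xx k p_gt0 q_gt0 b) 1 y); congr ghom.
  by rewrite addrC addrK.
exists (qlin cl ch).
suff /sexP[] : short_exact (mulX k b y) (qlin cl ch).
  by move=> h1 h2 h3 h4; have [_] : short_exact (mulX k b y) (qlin cl ch) by apply/sexP.
apply/sexP; split.
- apply/monoP => m n /= -> /near0_O/eqP; rewrite mulf_eq0 (negPf (xx_neq0 _ b)) /= => /eqP ->; exact: near00.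
- apply: (Q_epi p_gt0 q_gt0 (a := one y)); rewrite /graph /= scale1r; exact: erefl.
- move=> u v w /= -> ->; rewrite (_ : _ *: qe = 0); first exact: near00.
  by apply/qe_eq0; exists u; rewrite expr1.
- move=> u v /= -> /near0_Q/qe_eq0[t ->]; rewrite expr1; apply: near_in; by exists t.
Qed.

Lemma res_iso b l y y' : res b (y' - y) 0 -> isomorphic (Qx b l y) (Qx b l y').
Proof.
move=> [c e]; apply: (@Q_iso _ _ _ _ _ _ _ 1 _ _ _ c); rewrite ?oner_neq0 ?scale1r //.
by rewrite mulr0z add0r in e; rewrite -e subrKC.
Qed.

Lemma Q_class f d b (hf : prm f d b) : ordinary f \/
  exists c, mprim f (xx (other c)) /\ forall l y, isomorphic (Qm hf l y) (Qx c l y) .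
Proof.
have [|[c [eb ed [a a0 ef]]]] := prm_dichotomy p_gt0 q_gt0 hf; [by left|right; exists c].
subst b d; split=> [|l y]; first exact: prm_comp hf.
apply: (@Q_iso _ _ _ hf _ _ _ a^-1 l y y 0); first by rewrite invr_eq0.
  by rewrite ef scalerA mulVf // scale1r.
by rewrite mulr0z addr0.
Qed.

Lemma iso_retract_ne A B : isomorphic A B -> ~ is_zero A -> ~ Hom_zero A B.
Proof. by move=> h n /(Hom_zero_iso h). Qed.

(** A uniserial object is indecomposable, hence isomorphic to its line bundle or torsion summand.
    Line bundles are not uniserial; the length gives [l], and the top gives the prime and the
    residue of the twist. *)
Lemma exc_uniserial_iso b (i : int) j X : (0 < j)%N -> is_exc_uniserial b i j X ->
  isomorphic X (Qx b j (vx b *~ i)).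
Proof.
move=> j0 [uX lX [Y [c hc] tY]].
have nX : ~ is_zero X.
  case: j j0 lX => // j _ [U [V [u [v [/sexP[_ /epiP ev _ _] [nV _] _]]]]] /is_zeroP zX; apply: nV.
  apply/is_zeroP => // n; have [K hK] := ev n; apply: (near0_mul (K := K)) => c'; have [m hm] := hK c'.
  exact: (near0_graph p_gt0 q_gt0 (zX p_gt0 q_gt0 m) hm).
have iX := uniserial_indec nX uX.
have [[y ry]|[f [d [b' [hf [l [y [l0 rQ]]]]]]]] := nonzero_retract p_gt0 q_gt0 nX.
  have e := indec_retract p_gt0 q_gt0 iX ry (O_nonzero p_gt0 q_gt0 (y := y)).
  by case: (O_not_uniserial (uniserial_iso e uX)).
have e := indec_retract p_gt0 q_gt0 iX rQ (Q_nonzero p_gt0 q_gt0 l0).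
have jl : j = l := Q_length_uniq p_gt0 q_gt0 lX e.
have eY : isomorphic Y (Qx b 1 (vx b *~ i)).
  by have [c' hc'] := Qx_exc_simple b i; exact: cokernel_uniq hc hc'.
have topX : is_top X (Qm hf 1 y) by apply: (top_iso e); exact: Q_is_top.
have e1 : isomorphic (Qm hf 1 y) (Qx b 1 (vx b *~ i)).
  exact: (iso_trans p_gt0 q_gt0 (top_uniq topX tY) eY).
have n1 : ~ is_zero (Qm hf 1 y) by exact: Q_nonzero.
have [ho|[c' [cop hQ]]] := Q_class hf.
  case: (iso_retract_ne e1 n1); apply: (HomQQ_cop p_gt0 q_gt0).
  by elim/I2P: (b); case: ho.
have ec : c' = b.
  apply/eqP; apply/contraT => ne; case: (iso_retract_ne e1 n1); apply: (HomQQ_cop p_gt0 q_gt0) => //.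
  suff -> : b = other c' by [].
  by move: ne; elim/I2P: (b); elim/I2P: (c').
subst c'; have e2 := iso_trans p_gt0 q_gt0 (iso_sym (hQ 1%N y)) e1.
have n2 : ~ is_zero (Qx b 1 y) by exact: Q_nonzero.
have /contrapT[n [nj _ hn]] : ~ ~ exists n : nat, [/\ (n < 1)%N, (1 <= n + 1)%N & res b (vx b *~ i - y) n].
  by move=> h; apply: (iso_retract_ne e2 n2); apply/HomQQx.
case: n nj hn => // _ hn.
apply: (iso_trans p_gt0 q_gt0 e); rewrite jl; apply: (iso_trans p_gt0 q_gt0 (hQ l y)); exact: res_iso.
Qed.

Lemma nonzero_class X : ~ is_zero X -> [\/ exists y, retract (O y) X,
  exists b l (i : int), (0 < l)%N /\ retract (Qx b l (vx b *~ i)) X |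
  exists f d b (hf : prm f d b) l y, [/\ ordinary f, (0 < l)%N & retract (Qm hf l y) X]].
Proof.
move=> nX; have [[y ry]|[f [d [b [hf [l [y [l0 rQ]]]]]]]] := nonzero_retract p_gt0 q_gt0 nX.
  by constructor 1; exists y.
have [ho|[c [_ hQ]]] := Q_class hf; first by constructor 3; exists f, d, b, hf, l, y.
constructor 2; have [i [a ey]] := L_coords_oth c y; exists c, l, i; split=> //.
apply: (retract_trans p_gt0 q_gt0 (B := Qx c l y)); last first.
  apply: (retract_trans p_gt0 q_gt0 (B := Qm hf l y)) => //; exact: (iso_retract (hQ l y)).2.
apply: (iso_retract (res_iso l _)).1.
by exists a; rewrite ey mulr0z add0r addrAC subrr add0r.
Qed.

Lemma rigid_class X : indecomposable X -> Ext1_zero X X -> (exists y, isomorphic X (O y)) \/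
  exists b l (i : int), [/\ (0 < l)%N, (l < wt p q b)%N & isomorphic X (Qx b l (vx b *~ i))].
Proof.
move=> iX eX; have [[y ry]|[b [l [i [l0 rQ]]]]|[f [d [b [hf [l [y [ho l0 rQ]]]]]]]] := nonzero_class iX.1.
- left; exists y; apply: (indec_retract p_gt0 q_gt0 iX ry); exact: O_nonzero.
- right; exists b, l, i; split=> //; last by apply: (indec_retract p_gt0 q_gt0 iX rQ); exact: Q_nonzero.
  have := Ext_ret_r p_gt0 q_gt0 rQ (Ext_ret_l p_gt0 q_gt0 rQ eX).
  (* [wt b] times [vx b] is a multiple of the other generator, so [l - wt b] has the residue of [l];
     being below [l], it gives a self-extension. *)
  move/ExtQQx => h; rewrite ltnNge; apply/negP => wl; apply: h; exists (l - wt p q b)%N.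
  have w0 := wt_gt0 p_gt0 q_gt0 b; rewrite (_ : (l - wt p q b < l)%N); last by lia.
  split=> //; rewrite addrK; exists (wt p q (other b))%:Z.
  have := (vx_othP p q b l%:Z 0 (l - wt p q b)%:Z (wt p q (other b))%:Z).2.
  rewrite mulr0z addr0 -pmulrn => ->//; exists 1; rewrite !mul1r; split; lia.
- have := Ext_ret_r p_gt0 q_gt0 rQ (Ext_ret_l p_gt0 q_gt0 rQ eX).
  by move=> h; case: (ordinary_self p_gt0 q_gt0 ho l0 h).
Qed.
End Exceptional.

(** * Noncrossing collections of intervals *)

Definition co (b : 'I_2) (m1 m2 : int) : int := if b == 0 then m1 else m2.

Lemma int_max (P : int -> Prop) M : (exists x, P x) -> (forall x, P x -> x <= M) ->
  exists x, P x /\ forall y, P y -> y <= x.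
Proof.
move=> [x Px] hM; have [n] := ubnP (absz (M - x)); elim: n x Px => // n IH x Px hn.
have [[y [Py xy]]|h] := pselect (exists y, P y /\ x < y).
  by apply: (IH y) => //; have := hM _ Py; lia.
by exists x; split=> // y Py; rewrite leNgt; apply/negP => xy; apply: h; exists y.
Qed.

Lemma int_min (P : int -> Prop) M : (exists x, P x) -> (forall x, P x -> M <= x) ->
  exists x, P x /\ forall y, P y -> x <= y.
Proof.
move=> [x Px] hM; have [||y [Py hy]] := @int_max (fun z => P (- z)) (- M).
- by exists (- x); rewrite opprK.
- by move=> z /hM; lia.
by exists (- y); split=> // z Pz; have := hy (- z); rewrite opprK => /(_ Pz); lia.
Qed.

Section Arcs.
Variables p q : nat.
Hypotheses (p_gt0 : (0 < p)%N) (q_gt0 : (0 < q)%N).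
Notation w b := ((wt p q b)%:Z).
Variables (B : int -> int -> Prop) (I : 'I_2 -> int -> int -> Prop).
Hypothesis Bper : forall m1 m2 t, B m1 m2 -> B (m1 + t * p%:Z) (m2 - t * q%:Z).
Hypothesis Iper : forall b a c t, I b a c -> I b (a + t * w b) (c + t * w b).
Hypothesis Ilen : forall b a c, I b a c -> a + 2 <= c.
Hypothesis nBB : forall m1 m2 n1 n2, B m1 m2 -> B n1 n2 -> (m1 - n1) * (m2 - n2) <= 0.
Hypothesis nBI : forall m1 m2 b a c, B m1 m2 -> I b a c -> ~ (a < co b m1 m2 < c).
Hypothesis nII : forall b a c a' c', I b a c -> I b a' c' -> ~ [/\ a < a', a' < c & c < c'].

Let w_gt0 b : 0 < w b.
Proof. by rewrite /wt; case: ifP. Qed.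

(* B is the set of bridging arcs and I b that of the peripheral arcs on side b;
   the intervals of length 1 count as boundary edges. *)
Definition exposed b x := exists m1 m2, B m1 m2 /\ co b m1 m2 = x.
Definition edge b x y := y = x + 1 \/ I b x y.

Lemma edge_long b x y : edge b x y -> x + 2 <= y -> I b x y.
Proof. by case=> // -> ?; lia. Qed.

Lemma exposedD b x t : exposed b x -> exposed b (x + t * w b).
Proof.
move=> [m1 [m2 [h <-]]]; rewrite /exposed /co; elim/I2P: b => /=.
  by exists (m1 + t * p%:Z), (m2 - t * q%:Z); split=> //; exact: Bper.
by exists (m1 - t * p%:Z), (m2 + t * q%:Z); split=> //; have := Bper (- t) h; rewrite !mulNr opprK.
Qed.

Lemma nEI b x a c : exposed b x -> I b a c -> ~ (a < x < c).
Proof. by move=> [m1 [m2 [h <-]]]; exact: nBI. Qed.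

Definition consec_cond := forall b u v, exposed b u -> exposed b v -> u + 2 <= v ->
  (forall y, exposed b y -> ~ (u < y < v)) -> I b u v.
Definition split_cond := forall b a c, I b a c -> exists s, [/\ a < s, s < c, edge b a s & edge b s c].

Section Consequences.
Hypotheses (B0 : exists m1 m2, B m1 m2) (h2 : consec_cond) (h3 : split_cond).

Lemma exposed_le b x : exists u, [/\ exposed b u, u <= x & forall y, exposed b y -> y <= x -> y <= u].
Proof.
have [m1 [m2 hm]] := B0; pose x0 := co b m1 m2.
have [||u [[h1 h4] h5]] := @int_max (fun y => exposed b y /\ y <= x) x.
- exists (x0 + - (`|x0| + `|x|) * w b); split; first by apply: exposedD; exists m1, m2.
  by have := w_gt0 b; nia.
- by move=> y [].
by exists u; split=> // y ey yx; apply: h5.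
Qed.

Lemma exposed_ge b x : exists v, [/\ exposed b v, x <= v & forall y, exposed b y -> x <= y -> v <= y].
Proof.
have [m1 [m2 hm]] := B0; pose x0 := co b m1 m2.
have [||u [[h1 h4] h5]] := @int_min (fun y => exposed b y /\ x <= y) x.
- exists (x0 + (`|x0| + `|x|) * w b); split; first by apply: exposedD; exists m1, m2.
  by have := w_gt0 b; nia.
- by move=> y [].
by exists u; split=> // y ey yx; apply: h5.
Qed.

(** The exposed points next to (x, y) on either side are consecutive, hence joined by an arc over
    (x, y); a shortest arc over (x, y) is then taken. *)
Lemma hull b x y : x + 2 <= y -> (forall z, exposed b z -> ~ (x < z < y)) ->
  exists a c, [/\ I b a c, a <= x, y <= c & forall a' c', I b a' c' -> a' <= x -> y <= c' -> c - a <= c' - a'].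
Proof.
move=> xy hE; have [u [eu ux hu]] := exposed_le b x; have [v [ev yv hv]] := exposed_ge b y.
have Iuv : I b u v.
  apply: h2 => // [|z ez /andP[uz zv]]; first by lia.
  have [zx|xz] := lerP z x; first by have := hu z ez zx; lia.
  have [yz|zy] := lerP y z; first by have := hv z ez yz; lia.
  by apply: (hE z) => //; rewrite xz zy.
have [||n [[a [c [h4 h5 h6 h7]]] hn]] := @int_min (fun n => exists a c, [/\ I b a c, a <= x, y <= c & c - a = n]) 0.
- by exists (v - u), u, v.
- by move=> z [a [c [h4 h5 h6 <-]]]; have := Ilen h4; lia.
exists a, c; split=> // a' c' h8 h9 h10; rewrite h7; apply: hn; by exists a', c'.
Qed.

(** If the splitting point of a shortest arc lay outside (x, y), one of the two pieces would be a
    shorter arc over (x, y). *)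
Lemma hull_split b x y : x + 2 <= y -> (forall z, exposed b z -> ~ (x < z < y)) ->
  exists a s c, [/\ I b a c, a <= x, y <= c & [/\ x < s, s < y, edge b a s & edge b s c]].
Proof.
move=> xy hE; have [a [c [h4 h5 h6 h7]]] := hull xy hE; have [s [h8 h9 h10 h11]] := h3 h4.
exists a, s, c; split=> //; split=> //.
  rewrite ltNge; apply/negP => sx; have := h7 s c (edge_long h11 _) sx h6; lia.
rewrite ltNge; apply/negP => ys; have := h7 a s (edge_long h10 _) h5 ys; lia.
Qed.

(** The alternatives are, in this order, a nonzero Hom from a line bundle, a nonzero Hom from an
    exceptional torsion sheaf and a nonzero Ext^1 from one, to the sheaf encoded by (a, c). *)
Lemma gen_peripheral b a c : a + 2 <= c ->
  [\/ exists m1 m2, B m1 m2 /\ a + 1 < co b m1 m2 <= c,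
      exists a' c', [/\ I b a' c', a' <= a, a + 1 < c' & c' <= c] |
      exists a' c', [/\ I b a' c', a < a', a' < c & c < c']].
Proof.
move=> ac; have [[m1 [m2 h]]|h] := pselect (exists m1 m2, B m1 m2 /\ a + 1 < co b m1 m2 <= c).
  by constructor 1; exists m1, m2.
(* The arc is sought over the translate (a + 1, c + 1). If it starts at [a] or before, its left
   piece gives the Hom; otherwise it starts at a + 1 and the whole arc gives the Ext^1. *)
have [||a' [s [c' [h4 h5 h6 [h7 h8 h9 h10]]]]] := @hull_split b (a + 1) (c + 1); first by lia.
  by move=> z [m1 [m2 [hB <-]]] /andP[h4 h5]; apply: h; exists m1, m2; split=> //; lia.
have [a'a|aa'] := lerP a' a.
  by constructor 2; exists a', s; split; [apply: edge_long => //; lia|lia..].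
by constructor 3; exists a', c'; split=> //; lia.
Qed.

Lemma max_peripheral b x y : x + 2 <= y -> (forall m1 m2, B m1 m2 -> ~ (x < co b m1 m2 < y)) ->
  (forall a c, I b a c -> ~ [/\ a < x, x < c & c < y] /\ ~ [/\ x < a, a < y & y < c]) -> I b x y.
Proof.
move=> xy hB hI.
have hE z : exposed b z -> ~ (x < z < y) by move=> [m1 [m2 [h <-]]]; exact: hB.
have [a [s [c [h4 h5 h6 [h7 h8 h9 h10]]]]] := hull_split xy hE.
have [ax|xa] := ltrP a x.
  have h : I b a s by apply: edge_long => //; lia.
  by case: (hI _ _ h) => [[]].
have [yc|cy] := ltrP y c.
  have h : I b s c by apply: edge_long => //; lia.
  by case: (hI _ _ h) => _ [].
have [-> ->] : x = a /\ y = c by lia.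
by [].
Qed.
End Consequences.

Section Maximal.
Hypothesis MB : forall n1 n2, (forall m1 m2, B m1 m2 -> (m1 - n1) * (m2 - n2) <= 0) ->
  (forall b a c, I b a c -> ~ (a < co b n1 n2 < c)) -> B n1 n2.
Hypothesis MI : forall b x y, x + 2 <= y -> y - x <= w b -> (forall m1 m2, B m1 m2 -> ~ (x < co b m1 m2 < y)) ->
  (forall a c, I b a c -> ~ [/\ a < x, x < c & c < y] /\ ~ [/\ x < a, a < y & y < c]) -> I b x y.

(** A longer interval would cross its own translate by [w b]. *)
Lemma Ilen_le b a c : I b a c -> c - a <= w b.
Proof.
move=> h; rewrite leNgt; apply/negP => h'; have h4 := Iper 1 h; rewrite mul1r in h4.
by apply: (nII h h4); have := w_gt0 b; have := Ilen h; split; lia.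
Qed.

Lemma max_consec : consec_cond.
Proof.
move=> b u v eu ev uv hE; apply: MI => //.
- have := exposedD 1 eu; rewrite mul1r => /hE h; have := w_gt0 b; lia.
- by move=> m1 m2 hm; apply: hE; exists m1, m2.
- move=> a c h; split=> -[h4 h5 h6]; [apply: (nEI eu h)|apply: (nEI ev h)]; lia.
Qed.

(** Choose [s] as large as possible among the ends of edges that start at [a]. An arc crossing (s,
    c) would cross (a, c) or (a, s), or give a larger choice. *)
Lemma max_split : split_cond.
Proof.
move=> b a c h; have ac := Ilen h.
have [||s [[ha sc] smax]] := @int_max (fun s => edge b a s /\ s < c) c.
- by exists (a + 1); split; [left|lia].
- by move=> z []; lia.
have as' : a < s by case: ha => [->|/Ilen]; lia.
exists s; split=> //; have [e|ne] := eqVneq c (s + 1); [by left|right].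
apply: MI; [by lia|by have := Ilen_le h; lia| |].
- by move=> m1 m2 hm /andP[h4 h5]; apply: (nBI hm h); lia.
- move=> a' c' h'; split=> -[h4 h5 h6].
    have [aa|aa] := ltrP a' a; first by apply: (nII h' h); split; lia.
    have [e|ne'] := eqVneq a' a.
      by have := smax c'; rewrite /edge -e => /(_ (conj (or_intror h') h6)); lia.
    case: ha => [e|ha]; first by lia.
    by apply: (nII ha h'); split; lia.
  by apply: (nII h h'); split; lia.
Qed.

(** The left end of a longest peripheral arc lies strictly under no arc. If there were no bridging
    arc, one joining two such points would cross nothing and could be added. *)
Lemma max_bridging : exists m1 m2, B m1 m2.
Proof.
apply: contrapT => B0.
have free b : exists n, forall a c, I b a c -> ~ (a < n < c).
  have [[a [c h]]|h] := pselect (exists a c, I b a c); last first.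
    by exists 0 => a c h'; case: h; exists a, c.
  have [||n [[x [y [h4 h5]]] hn]] := @int_max (fun n => exists a c, I b a c /\ c - a = n) (w b).
  - by exists (c - a), a, c.
  - by move=> z [a' [c' [h' <-]]]; exact: Ilen_le.
  exists x => a' c' h' /andP[h6 h7].
  have [cy|yc] := ltrP c' y; first by apply: (nII h' h4); split.
  by have := hn (c' - a'); rewrite -h5 => /(_ (ex_intro _ _ (ex_intro _ _ (conj h' erefl)))); lia.
have [n1 hn1] := free 0; have [n2 hn2] := free 1.
apply: (B0); exists n1, n2; apply: MB.
  by move=> m1 m2 hm; case: B0; exists m1, m2.
by move=> b; rewrite /co; elim/I2P: b => /=.
Qed.

(** The alternatives are a nonzero Hom or Ext^1 from a line bundle, or a nonzero Ext^1 from a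
    torsion sheaf. If all failed, the arc (n1, n2) would cross nothing, hence belong to [B] and
    satisfy the first. *)
Lemma max_genO n1 n2 : [\/ exists m1 m2, [/\ B m1 m2, m1 <= n1 & m2 <= n2],
   exists m1 m2, [/\ B m1 m2, n1 < m1 & n2 < m2] |
   exists b a c, I b a c /\ a < co b n1 n2 < c].
Proof.
apply: contrapT => h; apply: (h); constructor 1; exists n1, n2; split=> //; apply: MB.
  move=> m1 m2 hm; rewrite leNgt; apply/negP => hp; apply: (h).
  have [|] := boolP (0 < m1 - n1) => h4.
    by constructor 2; exists m1, m2; split=> //; nia.
  by constructor 1; exists m1, m2; split=> //; nia.
by move=> b a c hI hc; apply: (h); constructor 3; exists b, a, c.
Qed.
End Maximal.

Section Generating.
Hypothesis B0 : exists m1 m2, B m1 m2.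
Hypothesis gO : forall n1 n2, [\/ exists m1 m2, [/\ B m1 m2, m1 <= n1 & m2 <= n2],
   exists m1 m2, [/\ B m1 m2, n1 < m1 & n2 < m2] |
   exists b a c, I b a c /\ a < co b n1 n2 < c].
Hypothesis gS : forall b a c, a + 2 <= c ->
  [\/ exists m1 m2, B m1 m2 /\ a + 1 < co b m1 m2 <= c,
      exists a' c', [/\ I b a' c', a' <= a, a + 1 < c' & c' <= c] |
      exists a' c', [/\ I b a' c', a < a', a' < c & c < c']].

(* If neither (c, v) nor any crossing of it is present, the test object
   attached to the arc (c - 1, d) is orthogonal to all arcs. *)
Lemma gen_edge b c v : c + 2 <= v ->
  (forall z, exposed b z -> ~ (c < z < v)) ->
  (forall a' c', I b a' c' -> c < a' -> a' < v -> c' <= v) ->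
  (forall c', I b c c' -> c' <= v) ->
  (forall a' c', I b a' c' -> a' < c -> c < c' -> c' < v -> False) -> I b c v.
Proof.
move=> cv hE hr hc hl; apply: contrapT => nI.
(* Among the edges that end at [v] and start after [c], the longest one. *)
have [d [cd dv hd dmin]] : exists d, [/\ c < d, d < v, edge b d v & forall a', I b a' v -> c < a' -> d <= a'].
  have [[a1 [h4 h5]]|h] := pselect (exists a1, I b a1 v /\ c < a1).
    have [||d [[h6 h7] h8]] := @int_min (fun z => I b z v /\ c < z) c.
    - by exists a1.
    - by move=> z []; lia.
    exists d; split=> //; [by have := Ilen h6; lia|by right|by move=> a' h9 h10; apply: h8].
  exists (v - 1); split; [lia|lia|left; lia|move=> a' h4 h5; case: h; by exists a'].
have [|[m1 [m2 [hB /andP[h4 h5]]]]|[a' [c' [h4 h5 h6 h7]]]|[a' [c' [h4 h5 h6 h7]]]] := gS b (a := c - 1) (c := d).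
- by lia.
- by apply: (hE (co b m1 m2)); [exists m1, m2|lia].
- by apply: (hl a' c') => //; lia.
have c'v : c' <= v.
  have [e|ne] := eqVneq a' c; first by rewrite e in h4; exact: hc.
  by apply: (hr a') => //; lia.
have [e|ne] := eqVneq c' v.
  have [e'|ne'] := eqVneq a' c; first by apply: nI; rewrite -e -e'.
  by have := dmin a'; rewrite -e => /(_ h4); lia.
have Idv : I b d v by apply: edge_long => //; lia.
by apply: (nII h4 Idv); split; lia.
Qed.

Lemma gen_consec : consec_cond.
Proof.
move=> b u v eu ev uv hE; apply: (@gen_edge b u v) => //.
- move=> a' c' h4 h5 h6; rewrite leNgt; apply/negP => h7; apply: (nEI ev h4); lia.
- move=> c' h4; rewrite leNgt; apply/negP => h7; apply: (nEI ev h4); lia.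
- move=> a' c' h4 h5 h6 h7; apply: (nEI eu h4); lia.
Qed.

Lemma gen_split : split_cond.
Proof.
move=> b a v h; have av := Ilen h.
have [||c [[ha cv] cmax]] := @int_max (fun s => edge b a s /\ s < v) v.
- by exists (a + 1); split; [left|lia].
- by move=> z []; lia.
have ac : a < c by case: ha => [->|/Ilen]; lia.
exists c; split=> //; have [e|ne] := eqVneq v (c + 1); [by left|right].
apply: (@gen_edge b c v); [by lia| | | |].
- move=> z ez h4; apply: (nEI ez h); lia.
- move=> a' c' h4 h5 h6; rewrite leNgt; apply/negP => h7; apply: (nII h h4); split; lia.
- move=> c' h4; rewrite leNgt; apply/negP => h7; apply: (nII h h4); split; lia.
- move=> a' c' h4 h5 h6 h7.
  have [aa|aa] := ltrP a' a; first by apply: (nII h4 h); split; lia.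
  have [e|ne'] := eqVneq a' a.
    by have := cmax c'; rewrite /edge -e => /(_ (conj (or_intror h4) h7)); lia.
  case: ha => [e|ha]; first by lia.
  by apply: (nII ha h4); split; lia.
Qed.

(** The difference m1 - m2 orders bridging arcs along the strip. If the neighbours (u, j) and (u',
    j') of a missing arc share an end, [gen_consec] provides a peripheral arc that crosses the
    missing one. *)
Lemma gen_maxB n1 n2 : (forall m1 m2, B m1 m2 -> (m1 - n1) * (m2 - n2) <= 0) ->
  (forall b a c, I b a c -> ~ (a < co b n1 n2 < c)) -> B n1 n2.
Proof.
move=> hB hI; apply: contrapT => nB.
pose h := n1 - n2.
have ne m1 m2 : B m1 m2 -> m1 - m2 <> h.
  move=> hm e; apply: nB; have := hB _ _ hm; rewrite (_ : m2 - n2 = m1 - n1); last by rewrite /h in e; lia.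
  move=> e'; have -> : n1 = m1 by nia.
  by have -> : n2 = m2 by rewrite /h in e; nia.
have [m1 [m2 hm]] := B0.
have [||x [[u [j [huj ex xh]]] hx]] := @int_max (fun x => exists m1 m2, [/\ B m1 m2, m1 - m2 = x & x < h]) h.
- pose t : int := - (`|m1 - m2| + `|h| + 1).
  exists (m1 + t * p%:Z - (m2 - t * q%:Z)), (m1 + t * p%:Z), (m2 - t * q%:Z).
  split=> //; first exact: Bper.
  rewrite /t; nia.
- by move=> z [? [? [_ _]]]; lia.
have [||y [[u' [j' [huj' ey yh]]] hy]] := @int_min (fun x => exists m1 m2, [/\ B m1 m2, m1 - m2 = x & h < x]) h.
- pose t : int := (`|m1 - m2| + `|h| + 1).
  exists (m1 + t * p%:Z - (m2 - t * q%:Z)), (m1 + t * p%:Z), (m2 - t * q%:Z).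
  split=> //; first exact: Bper.
  rewrite /t; nia.
- by move=> z [? [? [_ _]]]; lia.
have lo a c : B a c -> (a <= u /\ j <= c) \/ (u' <= a /\ c <= j').
  move=> hac; have := nBB hac huj; have := nBB hac huj'; have n := ne _ _ hac.
  have [l|g] := ltrP (a - c) h.
    by left; have := hx (a - c) (ex_intro _ a (ex_intro _ c (And3 hac erefl l))); nia.
  by right; have := hy (a - c) (ex_intro _ a (ex_intro _ c (And3 hac erefl (_ : is_true (h < a - c))))); nia.
have uu : u <= u' /\ j' <= j by have := nBB huj huj'; nia.
have nu : u <= n1 <= u' /\ j' <= n2 <= j.
  by have := hB _ _ huj; have := hB _ _ huj'; rewrite /h in xh yh; nia.
have E0 : exposed 0 u by exists u, j.
have E0' : exposed 0 u' by exists u', j'.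
have E1 : exposed 1 j by exists u, j.
have E1' : exposed 1 j' by exists u', j'.
have [e|ne1] := eqVneq u u'.
  have I1 : I 1 j' j.
    apply: gen_consec => //; first by rewrite /h in xh yh; lia.
    by move=> z [a [c [hac <-]]]; rewrite /co /=; have := lo _ _ hac; lia.
  by apply: (hI _ _ _ I1); rewrite /co /=; rewrite /h in xh yh; lia.
have [e|ne2] := eqVneq j j'.
  have I0 : I 0 u u'.
    apply: gen_consec => //; first by rewrite /h in xh yh; lia.
    by move=> z [a [c [hac <-]]]; rewrite /co /=; have := lo _ _ hac; lia.
  by apply: (hI _ _ _ I0); rewrite /co /=; rewrite /h in xh yh; lia.
(* Without a common end, the line bundle of the diagonal (u, j') of the quadrilateral would be
   orthogonal to the collection. *)
have [[a [c [hac h4 h5]]]|[a [c [hac h4 h5]]]|[b [a [c [hI' hc]]]]] := gO u j'.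
- by have := lo _ _ hac; lia.
- by have := lo _ _ hac; lia.
move: hc hI'; rewrite /co; elim/I2P: b => /= hc hI'.
  by apply: (nEI E0 hI').
by apply: (nEI E1' hI').
Qed.
End Generating.
End Arcs.

(** * Hom and Ext in integer coordinates; finite direct sums *)

Section Coordinates.
Variables (k : closedFieldType) (p q : nat).
Hypotheses (p_gt0 : (0 < p)%N) (q_gt0 : (0 < q)%N).
Local Notation xx := (@xx k).
Local Notation vx := (@vx p q).
Local Notation grmod := (grmod k p q).
Local Notation prm := (@prm k p q).
Local Notation Qm := (@Qm k p q).
Implicit Types A B M N P X : grmod.
Local Notation qeqP := (@qeqP _ _ _ p_gt0 q_gt0 _ _ _ _).
Local Notation O := (@O k p q).
Local Notation retract := (@retract k p q).
Notation Qx b l y := (Qm (prm_xx k p_gt0 q_gt0 b) l y).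

Local Notation zabs z := (absz z%R).

Definition Oc (m1 m2 : int) : grmod := O (vx 0 *~ m1 + vx 1 *~ m2).
(* The interval (a, c) encodes the uniserial sheaf of length c - a - 1 with top
   S_(b, c). *)
Definition Pc (b : 'I_2) (a c : int) : grmod := Qx b (zabs (c - a - 1)) (vx b *~ c).

Lemma res_co b (m1 m2 n : int) : res b (vx 0 *~ m1 + vx 1 *~ m2) n <-> exists t : int, co b m1 m2 = n + t * (wt p q b)%:Z.
Proof.
rewrite /res /co; elim/I2P: b => /=; split.
- by move=> [c /vx_intP[t [h _]]]; exists t.
- by move=> [t e]; exists (m2 + t * q%:Z); apply/vx_intP; exists t; split=> //; rewrite addrK.
- by move=> [c]; rewrite [RHS]addrC => /vx_intP[t [_ h]]; exists (- t); rewrite mulNr.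
- move=> [t e]; exists (m1 + t * p%:Z); rewrite [RHS]addrC; apply/vx_intP; exists (- t); rewrite !mulNr; split; first by rewrite addrK.
  by rewrite opprK.
Qed.

Lemma vx_co b (c : int) : vx b *~ c = vx 0 *~ (if b == 0 then c else 0) + vx 1 *~ (if b == 0 then 0 else c).
Proof. by elim/I2P: b => /=; rewrite mulr0z ?addr0 ?add0r. Qed.

Lemma subO (m1 m2 n1 n2 : int) : (vx 0 *~ m1 + vx 1 *~ m2) - (vx 0 *~ n1 + vx 1 *~ n2) =
  vx 0 *~ (m1 - n1) + vx 1 *~ (m2 - n2).
Proof. by rewrite opprD addrACA -!mulrzBr. Qed.

Lemma addO (m1 m2 n1 n2 : int) : (vx 0 *~ m1 + vx 1 *~ m2) + (vx 0 *~ n1 + vx 1 *~ n2) =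
  vx 0 *~ (m1 + n1) + vx 1 *~ (m2 + n2).
Proof. by rewrite addrACA -!mulrzDr. Qed.

Lemma coB b m1 m2 n1 n2 : co b (m1 - n1) (m2 - n2) = co b m1 m2 - co b n1 n2.
Proof. by rewrite /co; case: ifP. Qed.
Lemma coD b m1 m2 n1 n2 : co b (m1 + n1) (m2 + n2) = co b m1 m2 + co b n1 n2.
Proof. by rewrite /co; case: ifP. Qed.
Lemma co_if b c : co b (if b == 0 then c else 0) (if b == 0 then 0 else c) = c.
Proof. by elim/I2P: b. Qed.

Lemma Hom_OO m1 m2 n1 n2 : Hom_zero (Oc m1 m2) (Oc n1 n2) <->
  ~ exists t : int, m1 + t * p%:Z <= n1 /\ m2 - t * q%:Z <= n2.
Proof.
split=> [/HomOO h [t [h1 h2]]|h].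
  apply: h => //; exists (zabs (n1 - (m1 + t * p%:Z))), (zabs (n2 - (m2 - t * q%:Z))).
  rewrite subO !pmulrn; apply/vx_intP; exists t; split; lia.
apply/HomOO => // -[i [j]]; rewrite subO !pmulrn => /vx_intP[t [h1 h2]]; apply: h; exists t; lia.
Qed.

Lemma Ext_OO m1 m2 n1 n2 : Ext1_zero (Oc m1 m2) (Oc n1 n2) <->
  ~ exists t : int, n1 < m1 + t * p%:Z /\ n2 < m2 - t * q%:Z.
Proof.
split=> [/ExtOO h [t [h1 h2]]|h].
  apply: h => //; exists (zabs (m1 + t * p%:Z - n1)).-1, (zabs (m2 - t * q%:Z - n2)).-1.
  rewrite subO !pmulrn; apply/vx_intP; exists (- t); split; lia.
apply/ExtOO => // -[i [j]]; rewrite subO !pmulrn => /vx_intP[t [h1 h2]]; apply: h; exists (- t); lia.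
Qed.

Lemma Hom_OP m1 m2 b a c : a + 2 <= c -> Hom_zero (Oc m1 m2) (Pc b a c) <->
  ~ exists t : int, a + 1 < co b m1 m2 + t * (wt p q b)%:Z <= c.
Proof.
move=> ac; split=> [/HomOQx h [t /andP[h1 h2]]|h].
  apply: h; exists (zabs (c - (co b m1 m2 + t * (wt p q b)%:Z))); first by lia.
  by rewrite vx_co subO; apply/res_co; exists t; rewrite coB co_if; lia.
apply/HomOQx => -[n nl]; rewrite vx_co subO => /res_co[t]; rewrite coB co_if => e.
apply: h; exists t; lia.
Qed.

Lemma Ext_PO m1 m2 b a c : a + 2 <= c -> Ext1_zero (Pc b a c) (Oc m1 m2) <->
  ~ exists t : int, a < co b m1 m2 + t * (wt p q b)%:Z < c.
Proof.
move=> ac; split=> [/ExtQxO h [t /andP[h1 h2]]|h].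
  apply: h; exists (zabs (c - a - 1 + (co b m1 m2 + t * (wt p q b)%:Z) - c)); first by lia.
  rewrite pmulrn (vx_co b (absz _)) (vx_co b c) addO subO; apply/res_co; exists (- t).
  rewrite coB coD !co_if; lia.
apply/ExtQxO => -[n nl]; rewrite pmulrn (vx_co b (absz _)) (vx_co b c) addO subO => /res_co[t].
by rewrite coB coD !co_if => e; apply: h; exists (- t); lia.
Qed.

Lemma Hom_PP b a c a' c' : a + 2 <= c -> a' + 2 <= c' -> Hom_zero (Pc b a' c') (Pc b a c) <->
  ~ exists t : int, let s := t * (wt p q b)%:Z in [/\ a' + s <= a, a + 1 < c' + s & c' + s <= c].
Proof.
move=> ac ac'; split=> [/HomQQx h [t [h1 h2 h3]]|h].
  apply: h; exists (zabs (c - (c' + t * (wt p q b)%:Z))); split; [lia|lia|].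
  rewrite (vx_co b c) (vx_co b c') subO; apply/res_co; exists t; rewrite coB !co_if; lia.
apply/HomQQx => -[n [n1 n2]]; rewrite (vx_co b c) (vx_co b c') subO => /res_co[t]; rewrite coB !co_if => e.
by apply: h; exists t; split; lia.
Qed.

Lemma Ext_PP b a c a' c' : a + 2 <= c -> a' + 2 <= c' -> Ext1_zero (Pc b a' c') (Pc b a c) <->
  ~ exists t : int, let s := t * (wt p q b)%:Z in [/\ a < a' + s, a' + s < c & c < c' + s].
Proof.
move=> ac ac'; split=> [/ExtQQx h [t [h1 h2 h3]]|h].
  apply: h; exists (zabs (c - (a' + t * (wt p q b)%:Z) - 1)); split; [lia|lia|].
  rewrite pmulrn (vx_co b (absz _)) (vx_co b c) (vx_co b c') addO subO; apply/res_co; exists t.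
  rewrite coB coD !co_if; lia.
apply/ExtQQx => -[n [n1 n2]]; rewrite pmulrn (vx_co b (absz _)) (vx_co b c) (vx_co b c') addO subO => /res_co[t].
by rewrite coB coD !co_if => e; apply: h; exists t; split; lia.
Qed.

Lemma cop_oth b b' : b != b' -> mprim (xx b) (xx b').
Proof.
by elim/I2P: b; elim/I2P: b' => // _; [|apply: mprimC]; exact: mprim_xx.
Qed.

Lemma Hom_PP_ne b b' a c a' c' : b != b' -> Hom_zero (Pc b a c) (Pc b' a' c').
Proof. by move=> h; apply: (HomQQ_cop p_gt0 q_gt0); exact: cop_oth. Qed.
Lemma Ext_PP_ne b b' a c a' c' : b != b' -> Ext1_zero (Pc b a c) (Pc b' a' c').
Proof. by move=> h; apply: (ExtQQ_cop p_gt0 q_gt0); exact: cop_oth. Qed.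
Lemma Hom_PO b a c m1 m2 : Hom_zero (Pc b a c) (Oc m1 m2).
Proof. exact: HomQO_zero. Qed.
Lemma Ext_OP b a c m1 m2 : Ext1_zero (Oc m1 m2) (Pc b a c).
Proof. exact: ExtOQ_zero. Qed.

Lemma Oc_indec m1 m2 : indecomposable (Oc m1 m2).
Proof. exact: O_indec. Qed.
Lemma Pc_indec b a c : a + 2 <= c -> indecomposable (Pc b a c).
Proof. by move=> h; apply: Q_indec => //; lia. Qed.

Lemma Pc_exc b (i : int) j : (0 < j)%N -> Pc b (i - j%:Z - 1) i = Qx b j (vx b *~ i).
Proof. by move=> h; rewrite /Pc; congr (Qm _ _ _); lia. Qed.

Lemma Oc_iso m1 m2 n1 n2 (t : int) : m1 = n1 + t * p%:Z -> m2 = n2 - t * q%:Z -> Oc m1 m2 = Oc n1 n2.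
Proof. by move=> e1 e2; rewrite /Oc; congr O; apply/vx_intP; exists t. Qed.

Lemma Pc_iso b a c (t : int) : isomorphic (Pc b a c) (Pc b (a + t * (wt p q b)%:Z) (c + t * (wt p q b)%:Z)).
Proof.
rewrite /Pc; have -> : zabs (c + t * (wt p q b)%:Z - (a + t * (wt p q b)%:Z) - 1) = zabs (c - a - 1) by congr absz; ring.
apply: res_iso; rewrite -mulrzBr addrAC subrr add0r vx_co; apply/res_co; exists t; rewrite co_if; ring.
Qed.

Section Rep.
Variable X : grmod.
Lemma nonzero_co : ~ is_zero X -> [\/ exists m1 m2, retract (Oc m1 m2) X,
  exists b a c, a + 2 <= c /\ retract (Pc b a c) X |
  exists f d b (hf : prm f d b) l y, [/\ ordinary f, (0 < l)%N & retract (Qm hf l y) X]].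
Proof.
move=> /(nonzero_class p_gt0 q_gt0)[[y ry]|[b [l [i [l0 rQ]]]]|h]; last by constructor 3.
  by constructor 1; have [m1 [m2 ey]] := L_coords y; exists m1, m2; rewrite /Oc -ey.
by constructor 2; exists b, (i - l%:Z - 1), i; split; [lia|rewrite Pc_exc].
Qed.

Lemma rigid_co : indecomposable X -> Ext1_zero X X -> (exists m1 m2, isomorphic X (Oc m1 m2)) \/
  exists b a c, a + 2 <= c /\ isomorphic X (Pc b a c).
Proof.
move=> iX /(rigid_class p_gt0 q_gt0 iX)[[y ry]|[b [l [i [l0 _ rQ]]]]].
  by left; have [m1 [m2 ey]] := L_coords y; exists m1, m2; rewrite /Oc -ey.
by right; exists b, (i - l%:Z - 1), i; split; [lia|rewrite Pc_exc].
Qed.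
End Rep.

Lemma dsum_seq_cons A (s : seq grmod) : dsum_seq (A :: s) = dsum A (dsum_seq s).
Proof. by rewrite /dsum_seq big_cons. Qed.

Lemma gzero_zero : is_zero (gzero k p q).
Proof. by apply/is_zeroP => // m; rewrite [m]thinmx0; exact: near00. Qed.

Lemma zero_Hom_l A B : is_zero A -> Hom_zero A B.
Proof.
move=> /is_zeroP h f; apply/(qzeroP p_gt0 q_gt0) => m n; apply: near0_graph => //; exact: h.
Qed.

Lemma zero_Ext_l A B : is_zero A -> Ext1_zero A B.
Proof.
move=> /is_zeroP h E f g _; exists (qzero A E); apply/qeqP => m n1 n2 _ _.
by apply: near0B; exact: h.
Qed.

Lemma zero_Ext_r A B : is_zero B -> Ext1_zero A B.
Proof.
move=> /is_zeroP h E f g ex; apply: (ret_sec p_gt0 q_gt0 (t := qzero E B) ex).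
by apply/qeqP => m n1 n2 _ _; apply: near0B; exact: h.
Qed.

Lemma nth_dsum (I : eqType) (F : I -> grmod) (s : seq I) x : x \in s -> retract (F x) (dsum_seq (map F s)).
Proof.
elim: s => // y s IH; rewrite inE /= dsum_seq_cons => /orP[/eqP ->|/IH h]; first exact: retract_l.
exact: (retract_trans p_gt0 q_gt0 h (retract_r p_gt0 q_gt0 _ _)).
Qed.

Lemma Hom_dsum_seq_l (I : eqType) (F : I -> grmod) (s : seq I) X :
  (forall x, x \in s -> Hom_zero (F x) X) -> Hom_zero (dsum_seq (map F s)) X.
Proof.
elim: s => [|y s IH] h; first by rewrite /dsum_seq big_nil; exact: zero_Hom_l gzero_zero.
rewrite /= dsum_seq_cons; apply: Hom_dsum_l => //; first exact: h (mem_head _ _).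
by apply: IH => x xs; apply: h; rewrite inE xs orbT.
Qed.

Lemma Ext_dsum_seq_l (I : eqType) (F : I -> grmod) (s : seq I) X :
  (forall x, x \in s -> Ext1_zero (F x) X) -> Ext1_zero (dsum_seq (map F s)) X.
Proof.
elim: s => [|y s IH] h; first by rewrite /dsum_seq big_nil; exact: zero_Ext_l gzero_zero.
rewrite /= dsum_seq_cons; apply: Ext_dsum_l => //; first exact: h (mem_head _ _).
by apply: IH => x xs; apply: h; rewrite inE xs orbT.
Qed.

Lemma Ext_dsum_seq_r (I : eqType) (F : I -> grmod) (s : seq I) X :
  (forall x, x \in s -> Ext1_zero X (F x)) -> Ext1_zero X (dsum_seq (map F s)).
Proof.
elim: s => [|y s IH] h; first by rewrite /dsum_seq big_nil; exact: zero_Ext_r gzero_zero.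
rewrite /= dsum_seq_cons; apply: Ext_dsum_r => //; first exact: h (mem_head _ _).
by apply: IH => x xs; apply: h; rewrite inE xs orbT.
Qed.

Lemma dsum_iso A A' B B' : isomorphic A A' -> isomorphic B B' -> isomorphic (dsum A B) (dsum A' B').
Proof.
move=> [f [f' [h1 h2]]] [g [g' [h3 h4]]].
have ex (C C' D D' : grmod) (u : qhom C C') (v : qhom D D') : exists w : qhom (dsum C D) (dsum C' D'),
    forall x y, graph w (x, y) <-> graph u (x.1, y.1) /\ graph v (x.2, y.2).
  have [w hw] := pairing p_gt0 q_gt0 (qcomp u (qprl C D)) (qcomp v (qprr C D)).
  exists w => x y; rewrite hw; split=> [[[a [/= -> ?]] [b [/= -> ?]]]//|[h h']].
  by split; [exists x.1|exists x.2].
have [w hw] := ex _ _ _ _ f g; have [w' hw'] := ex _ _ _ _ f' g'; exists w, w'.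
have aux (C C' D D' : grmod) (u : qhom C C') (u' : qhom C' C) (v : qhom D D') (v' : qhom D' D)
   (z : qhom (dsum C D) (dsum C' D')) (z' : qhom (dsum C' D') (dsum C D)) :
   (forall x y, graph z (x, y) <-> graph u (x.1, y.1) /\ graph v (x.2, y.2)) ->
   (forall x y, graph z' (x, y) <-> graph u' (x.1, y.1) /\ graph v' (x.2, y.2)) ->
   qeq (qcomp u' u) (qid C) -> qeq (qcomp v' v) (qid D) -> qeq (qcomp z' z) (qid (dsum C D)).
  move=> hz hz' /qeqP e1 /qeqP e2; apply/qeqP => m n1 n2 [/= y [/hz[a1 a2] /hz'[b1 b2]]] ->.
  have [K hK] := e1 m.1 n1.1 m.1 (ex_intro _ _ (conj a1 b1)) erefl.
  have [K' hK'] := e2 m.2 n1.2 m.2 (ex_intro _ _ (conj a2 b2)) erefl.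
  case: m n1 {a1 a2 b1 b2} hK hK' => [m m'] [n n'] /= hK hK'.
  exists (K + K')%N => c; rewrite pairB pairZ; congr (_, _).
    by rewrite addnC exprD -scalerA hK scaler0.
  by rewrite exprD -scalerA hK' scaler0.
by split; [exact: aux hw hw' h1 h3|exact: aux hw' hw h2 h4].
Qed.

Lemma dsum_swap A B C : isomorphic (dsum A (dsum B C)) (dsum B (dsum A C)).
Proof.
have sl (A1 B1 C1 : grmod) : linear (fun u : dsum A1 (dsum B1 C1) => (u.2.1, (u.1, u.2.2)) : dsum B1 (dsum A1 C1)) by [].
have sh (A1 B1 C1 : grmod) x (u : dsum A1 (dsum B1 C1)) : ghom x u -> @ghom _ _ _ (dsum B1 (dsum A1 C1)) x (u.2.1, (u.1, u.2.2)).
  by move=> [h1 [h2 h3]]; apply: dsum_homI => //; exact: dsum_homI.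
exists (qlin (sl A B C) (sh A B C)), (qlin (sl B A C) (sh B A C)).
by split; apply/qeqP => -[m1 [m2 m3]] n1 n2 [/= y [-> ->]] ->; rewrite /= subrr; exact: near00.
Qed.

(** The partner of the head of [s] is moved to the front of [s'] by repeated [dsum_swap]; then
    induction. *)
Lemma dsum_seq_iso (I J : eqType) (F : I -> grmod) (F' : J -> grmod) (s : seq I) (s' : seq J) (R : I -> J -> Prop) :
  uniq s' -> size s' = size s -> (forall x, x \in s -> exists2 y, y \in s' & R x y) ->
  (forall x x' y, R x y -> R x' y -> x = x') -> uniq s ->
  (forall x y, R x y -> isomorphic (F x) (F' y)) -> isomorphic (dsum_seq (map F s)) (dsum_seq (map F' s')).
Proof.
have rot (y : J) (s1 : seq J) : y \in s1 -> isomorphic (dsum_seq (map F' s1)) (dsum_seq (map F' (y :: rem y s1))).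
  elim: s1 => // z s1 IH; rewrite inE /=; case: (eqVneq z y) => [->|zy] /=; first by move=> _; exact: iso_refl.
  move=> /IH h; rewrite /= dsum_seq_cons in h; rewrite !dsum_seq_cons.
  apply: (iso_trans p_gt0 q_gt0 (dsum_iso (iso_refl p_gt0 q_gt0 _) h)); exact: dsum_swap.
elim: s s' => [|x s IH] s' us' sz hs inj us hF.
  by rewrite (size0nil sz) /dsum_seq !big_nil; exact: iso_refl.
have [y ys xy] := hs x (mem_head _ _).
apply: (iso_trans p_gt0 q_gt0 _ (iso_sym (rot y s' ys))).
rewrite /= !dsum_seq_cons; apply: dsum_iso; first exact: hF.
move: us; rewrite /= => /andP[xs us].
apply: IH => //; first exact: rem_uniq.
  by rewrite size_rem // sz.
move=> x' xs'; have [|y' ys' xy'] := hs x'; first by rewrite inE xs' orbT.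
exists y' => //; rewrite mem_rem_uniq // inE ys' andbT; apply: contraNneq xs => e.
by rewrite -(inj x' x y) // -e.
Qed.

Lemma tilting_iso A B : isomorphic A B -> tilting A -> tilting B.
Proof.
move=> h [h1 h2]; have [r1 r2] := iso_retract h; split.
  exact: Ext_ret_l r2 (Ext_ret_r p_gt0 q_gt0 r2 h1).
move=> X hX eX; apply: h2; first by apply: Hom_ret hX => //; exact: retract_refl.
exact: Ext_ret_l r1 eX.
Qed.
End Coordinates.

(** * Crossing paths in the strip *)

Section Angle.
Variable R : realType.

(** The retraction of the line onto [0, 1], in terms of absolute values so that it is visibly
    continuous. Composing with it turns continuity on [0, 1] into continuity everywhere. *)
Definition clamp (r : R) : R := (1 + `|r| - `|r - 1|) / 2.

Lemma clamp_id r : 0 <= r <= 1 -> clamp r = r.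
Proof.
move=> /andP[h0 h1]; rewrite /clamp ger0_norm // ler0_norm ?subr_le0 //; lra.
Qed.

Lemma clamp_in r : 0 <= clamp r <= 1.
Proof.
rewrite /clamp; have [h|h] := ler0P r; have [h'|h'] := ler0P (r - 1); lra.
Qed.

Lemma contD (T : topologicalType) (f g : T -> R) : continuous f -> continuous g -> continuous (fun x => f x + g x).
Proof. by move=> cf cg x; apply: cvgD; [exact: cf|exact: cg]. Qed.
Lemma contB (T : topologicalType) (f g : T -> R) : continuous f -> continuous g -> continuous (fun x => f x - g x).
Proof. by move=> cf cg x; apply: cvgB; [exact: cf|exact: cg]. Qed.
Lemma contM (T : topologicalType) (f g : T -> R) : continuous f -> continuous g -> continuous (fun x => f x * g x).
Proof. by move=> cf cg x; apply: cvgM; [exact: cf|exact: cg]. Qed.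
Lemma cont_cst (T : topologicalType) (a : R) : continuous (fun _ : T => a).
Proof. by move=> x; exact: cvg_cst. Qed.
Lemma cont_norm (T : topologicalType) (f : T -> R) : continuous f -> continuous (fun x => `|f x|).
Proof. by move=> cf x; apply: cvg_norm; exact: cf. Qed.
Lemma cont_comp (T U V : topologicalType) (g : U -> V) (f : T -> U) : continuous g -> continuous f -> continuous (fun x => g (f x)).
Proof. by move=> cg cf x; apply: (@continuous_comp _ _ _ f g); [exact: cf|exact: cg]. Qed.
Lemma cont_pair (T U V : topologicalType) (f : T -> U) (g : T -> V) : continuous f -> continuous g -> continuous (fun x => (f x, g x)).
Proof. by move=> cf cg x; apply: cvg_pair; [exact: cf|exact: cg]. Qed.
Lemma cont_fst (T U V : topologicalType) (f : T -> U * V) : continuous f -> continuous (fun x => (f x).1).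
Proof. by move=> cf x; apply: (cvg_comp _ _ (cf x)); exact: cvg_fst. Qed.
Lemma cont_snd (T U V : topologicalType) (f : T -> U * V) : continuous f -> continuous (fun x => (f x).2).
Proof. by move=> cf x; apply: (cvg_comp _ _ (cf x)); exact: cvg_snd. Qed.
Lemma cont_id (T : topologicalType) : continuous (fun x : T => x).
Proof. by move=> x; exact: cvg_id. Qed.
Lemma cont_sum (T : topologicalType) n (f : 'I_n -> T -> R) : (forall i, continuous (f i)) -> continuous (fun x => \sum_(i < n) f i x).
Proof.
move=> cf; elim: n f cf => [|n IH] f cf.
  by rewrite (_ : (fun _ => _) = fun=> 0); [exact: cont_cst|apply/funext => x; rewrite big_ord0].
rewrite (_ : (fun _ => _) = fun x => \sum_(i < n) f (widen_ord (leqnSn n) i) x + f ord_max x).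
  by apply: contD => //; apply: IH.
by apply/funext => x; rewrite big_ord_recr.
Qed.

Lemma cont_clamp : continuous clamp.
Proof.
apply: contM; last exact: cont_cst.
apply: contB.
  by apply: contD; [exact: cont_cst|apply: cont_norm; exact: cont_id].
by apply: cont_norm; apply: contB; [exact: cont_id|exact: cont_cst].
Qed.

Lemma polar (u v : R) : 0 < u ^+ 2 + v ^+ 2 -> exists th rho, [/\ 0 < rho, u = rho * cos th & v = rho * sin th].
Proof.
move=> h; pose rho := Num.sqrt (u ^+ 2 + v ^+ 2).
have r0 : 0 < rho by rewrite sqrtr_gt0.
have r2 : rho ^+ 2 = u ^+ 2 + v ^+ 2 by rewrite sqr_sqrtr // ltW.
have c1 : -1 <= u / rho <= 1.
  by rewrite -ler_norml normrM normfV (gtr0_norm r0) ler_pdivrMr // mul1r -sqrtr_sqr ler_wsqrtr // lerDl sqr_ge0.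
have e1 : u = rho * cos (acos (u / rho)) by rewrite acosK ?in_itv //= mulrC divfK // gt_eqF.
have e2 : `|v| = rho * sin (acos (u / rho)).
  rewrite sin_acos //; have -> : 1 - (u / rho) ^+ 2 = (v / rho) ^+ 2.
    by rewrite !expr_div_n r2; field; rewrite gt_eqF.
  by rewrite sqrtr_sqr normrM normfV (gtr0_norm r0) mulrC divfK // gt_eqF.
have [v0|v0] := ler0P v.
  exists (- acos (u / rho)), rho; rewrite cosN sinN mulrN -e2 ler0_norm // opprK; split=> //.
by exists (acos (u / rho)), rho; rewrite -e2 gtr0_norm.
Qed.

(** [al] is the oriented angle from (u, v) to (u', v'). The positive scalar product places it in
    (-pi/2, pi/2), where an arctangent computes it continuously. *)
Lemma polar_step (u v u' v' th rho : R) : 0 < rho -> u = rho * cos th -> v = rho * sin th ->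
  0 < u * u' + v * v' ->
  let al := atan ((u * v' - v * u') / (u * u' + v * v')) in
  exists rho', [/\ 0 < rho', u' = rho' * cos (th + al) & v' = rho' * sin (th + al)].
Proof.
move=> r0 eu ev; set dot := u * u' + v * v'; set cr := u * v' - v * u' => d0 al.
have c0 : 0 < cos al by rewrite cos_atan invr_gt0 sqrtr_gt0 ltr_pwDl // sqr_ge0.
have sa : sin al = cr / dot * cos al.
  by have := atanK (cr / dot); rewrite -/al /tan => <-; rewrite divfK // gt_eqF.
pose kk := dot / cos al; have k0 : 0 < kk by rewrite divr_gt0.
have ed : dot = kk * cos al by rewrite divfK // gt_eqF.
have ec : cr = kk * sin al by rewrite sa /kk; field; rewrite !gt_eqF.
have r2 : u ^+ 2 + v ^+ 2 = rho ^+ 2 by rewrite eu ev !exprMn -mulrDr cos2Dsin2 mulr1.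
exists (kk / rho); split; first by rewrite divr_gt0.
  have : rho ^+ 2 * u' = u * dot - v * cr by rewrite -r2 /dot /cr; ring.
  rewrite ed ec eu ev cosD => h.
  apply: (mulfI (_ : rho ^+ 2 != 0)); first by rewrite expf_neq0 // gt_eqF.
  by rewrite h; field; rewrite gt_eqF.
have : rho ^+ 2 * v' = v * dot + u * cr by rewrite -r2 /dot /cr; ring.
rewrite ed ec eu ev sinD => h.
apply: (mulfI (_ : rho ^+ 2 != 0)); first by rewrite expf_neq0 // gt_eqF.
by rewrite h; field; rewrite gt_eqF.
Qed.

Section Lift.
Variables (u v : R * R -> R).
Hypotheses (cu : continuous u) (cv : continuous v) (uv0 : forall z, 0 < u z ^+ 2 + v z ^+ 2).

(** For [a] from 0 to 1 this runs along the segment from the corner (0, 0) to the point z of the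
    square. *)
Let sc (a : R) (z : R * R) : R * R := (a * clamp z.1, a * clamp z.2).
Let dot (z : R * R) a a' := u (sc a z) * u (sc a' z) + v (sc a z) * v (sc a' z).
Let cross (z : R * R) a a' := u (sc a z) * v (sc a' z) - v (sc a z) * u (sc a' z).

Let cont_sc (T : topologicalType) (f : T -> R) (g : T -> R * R) : continuous f -> continuous g ->
  continuous (fun x => sc (f x) (g x)).
Proof.
move=> cf cg; apply: cont_pair; apply: contM => //.
  by apply: (cont_comp cont_clamp); exact: cont_fst.
by apply: (cont_comp cont_clamp); exact: cont_snd.
Qed.

Let cont_dot (T : topologicalType) (f g : T -> R) (h : T -> R * R) : continuous f -> continuous g -> continuous h ->
  continuous (fun x => dot (h x) (f x) (g x)).
Proof.
by move=> cf cg ch; apply: contD; apply: contM; apply: cont_comp => //; exact: cont_sc.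
Qed.

Let cont_cross (T : topologicalType) (f g : T -> R) (h : T -> R * R) : continuous f -> continuous g -> continuous h ->
  continuous (fun x => cross (h x) (f x) (g x)).
Proof.
by move=> cf cg ch; apply: contB; apply: contM; apply: cont_comp => //; exact: cont_sc.
Qed.

Let I01 : set R := `[0, 1]%classic.

(** By compactness, the vector turns by less than a right angle between neighbouring subdivision
    points, uniformly in z. *)
Let subdiv : exists N, (0 < N)%N /\ forall z a a', I01 z.1 -> I01 z.2 -> I01 a -> `|a' - a| <= N%:R^-1 -> 0 < dot z a a'.
Proof.
have cK : compact ((I01 `*` I01) `*` I01) by do 2 (apply: compact_setX; last exact: segment_compact); exact: segment_compact.
pose P (n : nat) (x : (R * R) * R) := forall a', `|a' - x.2| <= n.+1%:R^-1 -> 0 < dot x.1 x.2 a'.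
have [|n0 _ h0] := (compact_near_coveringP ((I01 `*` I01) `*` I01)).1 cK nat \oo P _.
  move=> x _; pose phi (y : ((R * R) * R) * R) := dot y.1.1 y.1.2 y.2.
  have cphi : continuous phi.
    apply: cont_dot.
    - by apply: cont_snd; apply: cont_fst; exact: cont_id.
    - by apply: cont_snd; exact: cont_id.
    - by apply: cont_fst; apply: cont_fst; exact: cont_id.
  have pos : 0 < phi (x, x.2) by rewrite /phi /dot -!expr2 uv0.
  have : nbhs (x, x.2) (phi @^-1` [set r | 0 < r]) by apply: cphi; exact: open_nbhs_nbhs (conj (@open_gt _ 0) pos).
  case=> -[U V] /= [nU nV] UV.
  have [e /= e0 he] := (nbhs_ballP _ _).1 nV.
  have e2 : 0 < e / 2 by rewrite divr_gt0.
  have nW : nbhs x [set x' | U x' /\ `|x'.2 - x.2| < e / 2].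
    apply: filterI => //.
    have c2 : continuous (fun x' : (R * R) * R => x'.2) by apply: cont_snd; exact: cont_id.
    have h2 : nbhs x ((fun x' : (R * R) * R => x'.2) @^-1` ball x.2 (e / 2)) by apply: c2; exact: nbhsx_ballx.
    by apply: filterS h2 => x'; rewrite /preimage /ball /= distrC.
  exists ([set x' | U x' /\ `|x'.2 - x.2| < e / 2], [set n | n.+1%:R^-1 < e / 2]).
    split=> //=; exact: near_infty_natSinv_lt (PosNum e2).
  move=> [x' n] /= [[Ux' h1] h2] a' h3.
  apply: (UV (x', a')); split=> //=; apply: he; rewrite /ball /= distrC.
  rewrite (_ : a' - x.2 = (a' - x'.2) + (x'.2 - x.2)); last by ring.
  apply: (le_lt_trans (ler_normD _ _)); rewrite [e]splitr; apply: ltrD => //.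
  exact: le_lt_trans h3 h2.
exists n0.+1; split=> // z a a' z1 z2 ha h; apply: (h0 n0 (leqnn _) (z, a)) => //.
Qed.

(** The angle at z is that at the corner plus N small turns along the segment to z, each a
    continuous arctangent. *)
Lemma angle : exists th : R * R -> R, continuous th /\
  forall z, I01 z.1 -> I01 z.2 -> exists rho, [/\ 0 < rho, u z = rho * cos (th z) & v z = rho * sin (th z)].
Proof.
have [N [N0 hN]] := subdiv; have [th0 [rho0 [r0 eu0 ev0]]] := polar (uv0 (0, 0)).
have N0' : 0 < N%:R :> R by rewrite ltr0n.
pose ai (i : nat) : R := i%:R / N%:R.
pose al (i : nat) (z : R * R) := atan (cross z (ai i) (ai i.+1) / dot z (ai i) (ai i.+1)).
pose cl (z : R * R) := (clamp z.1, clamp z.2).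
have ccl : continuous cl by apply: cont_pair; apply: (cont_comp cont_clamp); [apply: cont_fst|apply: cont_snd]; exact: cont_id.
have aiI i : (i <= N)%N -> I01 (ai i).
  by move=> iN; rewrite /I01 /= in_itv /= /ai divr_ge0 ?ler0n //= ler_pdivrMr // mul1r ler_nat.
have clI z : I01 (cl z).1 /\ I01 (cl z).2 by rewrite /I01 /= !in_itv /= !clamp_in.
have dpos i z : I01 z.1 -> I01 z.2 -> (i < N)%N -> 0 < dot z (ai i) (ai i.+1).
  move=> h1 h2 iN; apply: hN => //; first by apply: aiI; exact: ltnW.
  by rewrite /ai -mulrBl -natrB // subSnn mul1r gtr0_norm // invr_gt0.
exists (fun z => th0 + \sum_(i < N) al i (cl z)); split.
  apply: contD; first exact: cont_cst.
  apply: cont_sum => i.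
  apply: (@cont_comp _ _ _ (@atan R) (fun z => cross (cl z) (ai i) (ai i.+1) / dot (cl z) (ai i) (ai i.+1))).
    by move=> x; exact: continuous_atan.
  move=> z; apply: cvgM; first by apply: cont_cross => //; exact: cont_cst.
  apply: cvgV; first by rewrite gt_eqF // dpos //; have [] := clI z.
  by apply: cont_dot => //; exact: cont_cst.
move=> z z1 z2; have ez : cl z = z by case: z z1 z2 => a b /=; rewrite /I01 /= !in_itv /= => h1 h2; rewrite /cl /= !clamp_id.
rewrite ez; suff key n : (n <= N)%N -> exists rho, [/\ 0 < rho, u (sc (ai n) z) = rho * cos (th0 + \sum_(i < n) al i z)
    & v (sc (ai n) z) = rho * sin (th0 + \sum_(i < n) al i z)].
  have := key N (leqnn N); rewrite (_ : sc (ai N) z = z) //.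
  by rewrite /sc /ai divff ?gt_eqF // !mul1r -/(cl z) ez.
elim: n => [_|n IH nN].
  by exists rho0; rewrite big_ord0 addr0 /sc /ai !mul0r.
have [rho [rp eu ev]] := IH (ltnW nN).
have := polar_step rp eu ev (dpos n z z1 z2 nN); rewrite -/(cross z _ _) -/(al n z) => -[rho' h].
by exists rho'; rewrite big_ord_recr /= addrA.
Qed.
End Lift.
Lemma IVT_total (f : R -> R) a b y : continuous f -> a <= b -> (f a <= y <= f b) || (f b <= y <= f a) ->
  exists c, a <= c <= b /\ f c = y.
Proof.
move=> cf ab h; have [||c cab <-] := @IVT R f a b y ab _ _.
- exact: continuous_subspaceT.
- by case/orP: h => /andP[h1 h2]; rewrite ge_min le_max h1 h2 ?orbT.
by exists c; move: cab; rewrite in_itv /=.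
Qed.

(** To leave [0, pi], [f] would have to take a value in (-pi, 0) or (pi, 2 pi), where the sine is
    negative. The cut-offs in the choices of [y] keep it inside these intervals. *)
Lemma band (f : R -> R) a b : continuous f -> 0 <= a <= 1 -> 0 <= b <= 1 ->
  (forall t, 0 <= t <= 1 -> 0 <= sin (f t)) -> 0 <= f a <= pi -> 0 <= f b <= pi.
Proof.
move=> cf ha hb hs /andP[fa0 fa1]; have pi0 := pi_gt0 R.
have mid y : (f a <= y <= f b) || (f b <= y <= f a) -> exists c, 0 <= c <= 1 /\ f c = y.
  move=> h; have [ab|/ltW ba] := lerP a b.
    by have [c [hc e]] := IVT_total cf ab h; exists c; split=> //; lra.
  by have [|c [hc e]] := IVT_total (y := y) cf ba; [rewrite orbC|exists c; split=> //; lra].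
apply/andP; split; rewrite leNgt; apply/negP => h.
  pose y := Num.max (f b) (- (pi / 2)).
  have y1 : y < 0 by rewrite gt_max h /=; lra.
  have y2 : - pi < y by rewrite lt_max; apply/orP; right; lra.
  have [|c [hc e]] := mid y; first by rewrite [f b <= y]le_max lexx /= orbC; apply/orP; left; lra.
  have := hs c hc; rewrite e leNgt -[y]opprK sinN oppr_lt0 sin_gt0_pi //; lra.
pose y := Num.min (f b) (pi + pi / 2).
have y1 : pi < y by rewrite lt_min h /=; lra.
have y2 : y < pi *+ 2 by rewrite gt_min mulr2n; apply/orP; right; lra.
have [|c [hc e]] := mid y; first by rewrite ge_min lexx /=; apply/orP; left; rewrite andbT; lra.
have := hs c hc; rewrite e leNgt -[y](subrK pi) sinDpi oppr_lt0 sin_gt0_pi //.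
by rewrite mulr2n in y2; lra.
Qed.

Definition I2 (z : R * R) := 0 <= z.1 <= 1 /\ 0 <= z.2 <= 1.

Section Routes.
Variables (u v : R * R -> R).
Hypotheses (cu : continuous u) (cv : continuous v) (nz : forall z, I2 z -> u z = 0 -> v z = 0 -> False).

Lemma angle0 z0 : I2 z0 -> v z0 = 0 -> 0 < u z0 -> exists th : R * R -> R, [/\ continuous th, th z0 = 0 &
  forall z, I2 z -> exists rho, [/\ 0 < rho, u z = rho * cos (th z) & v z = rho * sin (th z)]].
Proof.
move=> hz0 v0 u0; pose cl (z : R * R) := (clamp z.1, clamp z.2).
have ccl : continuous cl by apply: cont_pair; apply: (cont_comp cont_clamp); [apply: cont_fst|apply: cont_snd]; exact: cont_id.
have clI z : I2 (cl z) by split; exact: clamp_in.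
have clE z : I2 z -> cl z = z by case: z => x y [/= h1 h2]; rewrite /cl /= !clamp_id.
have [||z|th [cth hth]] := @angle (u \o cl) (v \o cl).
- exact: cont_comp.
- exact: cont_comp.
- rewrite lt_neqAle addr_ge0 ?sqr_ge0 // andbT eq_sym paddr_eq0 ?sqr_ge0 // !sqrf_eq0.
  by apply/negP => /andP[/eqP h1 /eqP h2]; exact: (nz (clI z)).
have h z : I2 z -> exists rho, [/\ 0 < rho, u z = rho * cos (th z) & v z = rho * sin (th z)].
  move=> hz; have [|| rho] := hth z; rewrite /= ?in_itv //=; [exact: hz.1|exact: hz.2|].
  by rewrite (clE z hz) => hr; exists rho.
have [r0 [r0p e1 e2]] := h z0 hz0.
have s0 : sin (th z0) = 0.
  by move: e2; rewrite v0 => /esym/eqP; rewrite mulf_eq0 gt_eqF //= => /eqP.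
have c0 : cos (th z0) = 1.
  have : 0 < cos (th z0) by rewrite -(pmulr_rgt0 _ r0p) -e1.
  by have := cos2Dsin2 (th z0); rewrite s0 expr0n addr0 => /eqP; rewrite sqrf_eq1 => /orP[/eqP //|/eqP ->]; lra.
exists (fun z => th z - th z0); split; [by apply: contB => //; exact: cont_cst|by rewrite subrr|].
move=> z /h[rho [rp h1 h2]]; exists rho; rewrite cosB sinB s0 c0 !mulr0 !mulr1 addr0 subr0.
by [].
Qed.

Section Bands.
Variable th : R * R -> R.
Hypotheses (cth : continuous th)
  (hth : forall z, I2 z -> exists rho, [/\ 0 < rho, u z = rho * cos (th z) & v z = rho * sin (th z)]).

Lemma sin_up z : I2 z -> 0 <= v z -> 0 <= sin (th z - 0).
Proof. by move=> /hth[rho [r0 _ ->]]; rewrite subr0 pmulr_rge0. Qed.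
Lemma sin_dn z : I2 z -> v z <= 0 -> 0 <= sin (th z - - pi).
Proof. by move=> /hth[rho [r0 _ ->]]; rewrite opprK sinDpi oppr_ge0 pmulr_rle0. Qed.
Lemma sin_dn' z : I2 z -> v z <= 0 -> 0 <= sin (th z - pi).
Proof. by move=> /hth[rho [r0 _ ->]]; rewrite -[th z - pi]opprK opprB sinN -[pi - _]addrC sinDpi sinN opprK oppr_ge0 pmulr_rle0. Qed.

Lemma band_hor c s a b : 0 <= s <= 1 -> 0 <= a <= 1 -> 0 <= b <= 1 ->
  (forall t, 0 <= t <= 1 -> 0 <= sin (th (s, t) - c)) -> 0 <= th (s, a) - c <= pi -> 0 <= th (s, b) - c <= pi.
Proof.
move=> hs ha hb h; apply: (@band (fun t => th (s, t) - c)) => //.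
apply: contB; last exact: cont_cst.
by apply: (cont_comp cth); apply: cont_pair; [exact: cont_cst|exact: cont_id].
Qed.

Lemma band_ver c t a b : 0 <= t <= 1 -> 0 <= a <= 1 -> 0 <= b <= 1 ->
  (forall s, 0 <= s <= 1 -> 0 <= sin (th (s, t) - c)) -> 0 <= th (a, t) - c <= pi -> 0 <= th (b, t) - c <= pi.
Proof.
move=> hs ha hb h; apply: (@band (fun s => th (s, t) - c)) => //.
apply: contB; last exact: cont_cst.
by apply: (cont_comp cth); apply: cont_pair; [exact: cont_id|exact: cont_cst].
Qed.

Lemma th_axis z : I2 z -> v z = 0 -> 0 <= th z <= pi -> (0 < u z -> th z = 0) /\ (u z < 0 -> th z = pi).
Proof.
move=> /hth[rho [r0 eu ev]] v0 /andP[h0 h1].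
have s0 : sin (th z) = 0 by move: ev; rewrite v0 => /esym/eqP; rewrite mulf_eq0 gt_eqF //= => /eqP.
have [e|n0] := eqVneq (th z) 0.
  by split=> // h; move: h; rewrite eu e cos0 mulr1; lra.
have [e|n1] := eqVneq (th z) pi.
  by split=> // h; move: h; rewrite eu e cospi mulrN1; lra.
have : 0 < sin (th z) by apply: sin_gt0_pi; rewrite !lt_neqAle h0 h1 eq_sym n0 n1.
by rewrite s0 ltxx.
Qed.
End Bands.

Let i0 : 0 <= (0 : R) <= 1. Proof. lra. Qed.
Let i1 : 0 <= (1 : R) <= 1. Proof. lra. Qed.
Let pi0 := pi_gt0 R.

(** The angle is followed from (0, 0) to (1, 1) both ways round: along the sides with v >= 0 it
    stays in [0, pi], along the others in [-pi, 0]. So it ends at 0, against the sign of u at (1,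
    1). *)
Lemma routesA : v (0, 0) = 0 -> 0 < u (0, 0) -> u (1, 1) < 0 ->
  (forall t, 0 <= t <= 1 -> 0 <= v (0, t)) -> (forall t, 0 <= t <= 1 -> 0 <= v (t, 1)) ->
  (forall t, 0 <= t <= 1 -> v (t, 0) <= 0) -> (forall t, 0 <= t <= 1 -> v (1, t) <= 0) -> False.
Proof.
move=> v0 u0 u1 hl ht hb hr; have [//|th [cth t0 hth]] := angle0 (z0 := (0, 0)) _ v0 u0.
have b1 : 0 <= th (0, 1) - 0 <= pi.
  by apply: (band_hor cth i0 i0 i1) => [t ht'|]; [apply: (sin_up hth) => //; exact: hl|rewrite t0 subrr lexx pi_ge0].
have b2 : 0 <= th (1, 1) - 0 <= pi.
  by apply: (band_ver cth i1 i0 i1) => // t ht'; apply: (sin_up hth) => //; exact: ht.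
have b3 : 0 <= th (1, 0) - - pi <= pi.
  by apply: (band_ver cth i0 i0 i1) => [t ht'|]; [apply: (sin_dn hth) => //; exact: hb|rewrite t0; lra].
have b4 : 0 <= th (1, 1) - - pi <= pi.
  by apply: (band_hor cth i1 i0 i1) => // t ht'; apply: (sin_dn hth) => //; exact: hr.
have e : th (1, 1) = 0 by lra.
by have [//|rho [r0 + _]] := hth (1, 1); move: u1 => + eu; rewrite eu e cos0 mulr1; lra.
Qed.

(** Here the two routes from (1, 0) to (1, 1) are the side joining them and the other three
    sides. *)
Lemma routesB : v (1, 0) = 0 -> 0 < u (1, 0) -> u (1, 1) < 0 ->
  (forall t, 0 <= t <= 1 -> 0 <= v (1, t)) -> (forall t, 0 <= t <= 1 -> v (t, 0) <= 0) ->
  (forall t, 0 <= t <= 1 -> v (0, t) <= 0) -> (forall t, 0 <= t <= 1 -> v (t, 1) <= 0) -> False.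
Proof.
move=> v0 u0 u1 hr hb hl ht; have [//|th [cth t0 hth]] := angle0 (z0 := (1, 0)) _ v0 u0.
have b1 : 0 <= th (1, 1) - 0 <= pi.
  by apply: (band_hor cth i1 i0 i1) => [t ht'|]; [apply: (sin_up hth) => //; exact: hr|rewrite t0 subrr lexx pi_ge0].
have b2 : 0 <= th (0, 0) - - pi <= pi.
  by apply: (band_ver cth i0 i1 i0) => [t ht'|]; [apply: (sin_dn hth) => //; exact: hb|rewrite t0; lra].
have b3 : 0 <= th (0, 1) - - pi <= pi.
  by apply: (band_hor cth i0 i0 i1) => // t ht'; apply: (sin_dn hth) => //; exact: hl.
have b4 : 0 <= th (1, 1) - - pi <= pi.
  by apply: (band_ver cth i1 i0 i1) => // t ht'; apply: (sin_dn hth) => //; exact: ht.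
have e : th (1, 1) = 0 by lra.
by have [//|rho [r0 + _]] := hth (1, 1); move: u1 => + eu; rewrite eu e cos0 mulr1; lra.
Qed.

(** All corners lie on the axis v = 0, which fixes the angle at the intermediate ones: pi at (1, 0)
    and 0 at (0, 1). The routes then give [pi, 2 pi] and [0, pi] at (1, 1), hence pi, against the
    sign of u. *)
Lemma routesC : v (0, 0) = 0 -> v (1, 0) = 0 -> v (0, 1) = 0 -> v (1, 1) = 0 ->
  0 < u (0, 0) -> u (1, 0) < 0 -> 0 < u (1, 1) -> 0 < u (0, 1) ->
  (forall t, 0 <= t <= 1 -> v (0, t) <= 0) -> (forall t, 0 <= t <= 1 -> v (1, t) <= 0) ->
  (forall t, 0 <= t <= 1 -> 0 <= v (t, 0)) -> (forall t, 0 <= t <= 1 -> 0 <= v (t, 1)) -> False.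
Proof.
move=> v00 v10 v01 v11 u00 u10 u11 u01 hl hr hb ht.
have [//|th [cth t0 hth]] := angle0 (z0 := (0, 0)) _ v00 u00.
have b1 : 0 <= th (1, 0) - 0 <= pi.
  by apply: (band_ver cth i0 i0 i1) => [t ht'|]; [apply: (sin_up hth) => //; exact: hb|rewrite t0 subrr lexx pi_ge0].
have e1 : th (1, 0) = pi.
  by rewrite subr0 in b1; have [//|_] := th_axis hth (z := (1, 0)) _ v10 b1; apply.
have b2 : 0 <= th (1, 1) - pi <= pi.
  by apply: (band_hor cth i1 i0 i1) => [t ht'|]; [apply: (sin_dn' hth) => //; exact: hr|rewrite e1; lra].
have b3 : 0 <= th (0, 1) - - pi <= pi.
  by apply: (band_hor cth i0 i0 i1) => [t ht'|]; [apply: (sin_dn hth) => //; exact: hl|rewrite t0; lra].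
have e3 : th (0, 1) = 0.
  have [//|rho [r0 eu ev]] := hth (0, 1).
  have s0 : sin (th (0, 1)) = 0 by move: ev; rewrite v01 => /esym/eqP; rewrite mulf_eq0 gt_eqF //= => /eqP.
  have [//|n0] := eqVneq (th (0, 1)) 0.
  have [e|n1] := eqVneq (th (0, 1)) (- pi).
    by move: u01; rewrite eu e cosN cospi mulrN1; lra.
  have : 0 < sin (- th (0, 1)).
    by apply: sin_gt0_pi; rewrite oppr_gt0 ltrNl !lt_neqAle n0 eq_sym n1 /=; lra.
  by rewrite sinN s0 oppr0 ltxx.
have b4 : 0 <= th (1, 1) - 0 <= pi.
  by apply: (band_ver cth i1 i0 i1) => [t ht'|]; [apply: (sin_up hth) => //; exact: ht|rewrite e3; lra].
have e : th (1, 1) = pi by lra.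
by have [//|rho [r0 + _]] := hth (1, 1); move: u11 => + eu; rewrite eu e cospi mulrN1; lra.
Qed.
End Routes.

Definition arcp (X Y : R -> R) (x0 y0 x1 y1 : R) :=
  [/\ continuous X /\ continuous Y, X 0 = x0 /\ Y 0 = y0, X 1 = x1 /\ Y 1 = y1 &
     forall t, 0 < t < 1 -> 0 < Y t < 1].

Definition meet (X Y X' Y' : R -> R) := exists s t, [/\ 0 < s < 1, 0 < t < 1, X s = X' t & Y s = Y' t].

Lemma arcp_bound X Y x0 y0 x1 y1 : arcp X Y x0 y0 x1 y1 -> 0 <= y0 <= 1 -> 0 <= y1 <= 1 ->
  forall t, 0 <= t <= 1 -> 0 <= Y t <= 1.
Proof.
move=> [_ [_ e0] [_ e1] h] h0 h1 t /andP[t0 t1].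
have [->|n0] := eqVneq t 0; first by rewrite e0.
have [->|n1] := eqVneq t 1; first by rewrite e1.
by have := h t; rewrite !lt_neqAle [0 == t]eq_sym n0 n1 t0 t1 => /(_ isT); lra.
Qed.

Section Differences.
Variables (X Y X' Y' : R -> R) (x0 y0 x1 y1 x0' y0' x1' y1' : R).
Hypotheses (h : arcp X Y x0 y0 x1 y1) (h' : arcp X' Y' x0' y0' x1' y1').

Lemma cont_diff (f g : R -> R) : continuous f -> continuous g -> continuous (fun z : R * R => f z.1 - g z.2).
Proof.
by move=> cf cg; apply: contB; [apply: (cont_comp cf); apply: cont_fst|apply: (cont_comp cg); apply: cont_snd]; exact: cont_id.
Qed.

(** On the boundary of the square of parameters a coincidence would identify two ends, or put an
    inner point at height 0 or 1; in the interior it would be a meeting point. *)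
Lemma diff_nz : ~ meet X Y X' Y' -> (y0 = 0 \/ y0 = 1) -> (y1 = 0 \/ y1 = 1) -> (y0' = 0 \/ y0' = 1) -> (y1' = 0 \/ y1' = 1) ->
  ((x0, y0) <> (x0', y0')) -> ((x0, y0) <> (x1', y1')) -> ((x1, y1) <> (x0', y0')) -> ((x1, y1) <> (x1', y1')) ->
  forall z, I2 z -> X z.1 - X' z.2 = 0 -> Y z.1 - Y' z.2 = 0 -> False.
Proof.
move=> nm b0 b1 b0' b1' d1 d2 d3 d4 [s t] [/= /andP[s0 s1] /andP[t0 t1]] /eqP; rewrite subr_eq0 => /eqP eX /eqP; rewrite subr_eq0 => /eqP eY.
have [_ [X0 Y0] [X1 Y1] hi] := h; have [_ [X0' Y0'] [X1' Y1'] hi'] := h'.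
have cs : [\/ s = 0, s = 1 | 0 < s < 1].
  have [->|n0] := eqVneq s 0; first by constructor.
  have [->|n1] := eqVneq s 1; first by constructor.
  by constructor 3; rewrite !lt_neqAle [0 == s]eq_sym n0 n1 s0 s1.
have ct : [\/ t = 0, t = 1 | 0 < t < 1].
  have [->|n0] := eqVneq t 0; first by constructor.
  have [->|n1] := eqVneq t 1; first by constructor.
  by constructor 3; rewrite !lt_neqAle [0 == t]eq_sym n0 n1 t0 t1.
have inb (y : R) : (y = 0 \/ y = 1) -> 0 < y < 1 -> False by move=> [->|->]; lra.
case: cs eX eY => [->|->|hs]; case: ct => [->|->|ht]; rewrite ?X0 ?Y0 ?X1 ?Y1 ?X0' ?Y0' ?X1' ?Y1' => eX eY.
- by apply: d1; rewrite eX eY.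
- by apply: d2; rewrite eX eY.
- by apply: (inb _ b0); rewrite eY; exact: hi'.
- by apply: d3; rewrite eX eY.
- by apply: d4; rewrite eX eY.
- by apply: (inb _ b1); rewrite eY; exact: hi'.
- by apply: (inb _ b0'); rewrite -eY; exact: hi.
- by apply: (inb _ b1'); rewrite -eY; exact: hi.
- by apply: nm; exists s, t.
Qed.
End Differences.

(** If the paths did not meet, their difference would have no zero on the square of parameters; the
    heights of the ends give its signs on the four sides. *)
Lemma crossA X Y X' Y' x0 x1 x0' x1' : arcp X Y x0 0 x1 1 -> arcp X' Y' x0' 0 x1' 1 ->
  x0 < x0' -> x1' < x1 -> meet X Y X' Y'.
Proof.
move=> h h' l0 l1; apply: contrapT => nm.
have bd := arcp_bound h; have bd' := arcp_bound h'.
have [[cX cY] [X0 Y0] [X1 Y1] _] := h; have [[cX' cY'] [X0' Y0'] [X1' Y1'] _] := h'.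
have nz := diff_nz h' h.
apply: (@routesA (fun z => X' z.2 - X z.1) (fun z => Y' z.2 - Y z.1)).
- by apply: contB; [apply: (cont_comp cX'); apply: cont_snd|apply: (cont_comp cX); apply: cont_fst]; exact: cont_id.
- by apply: contB; [apply: (cont_comp cY'); apply: cont_snd|apply: (cont_comp cY); apply: cont_fst]; exact: cont_id.
- move=> [s t] hz /= e1 e2; apply: (nz _ _ _ _ _ _ _ _ _ (t, s)) => //=; try by [left|right|case: hz|case=> ?; lra].
  move=> [s1 [t1 [? ? ? ?]]]; apply: nm; by exists t1, s1.
- by rewrite /= Y0 Y0' subrr.
- by rewrite /= X0 X0'; lra.
- by rewrite /= X1 X1'; lra.
- move=> t ht /=; rewrite Y0 subr0; have := bd' _ _ t ht; lra.
- move=> t ht /=; rewrite Y1'; have := bd _ _ t ht; lra.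
- move=> t ht /=; rewrite Y0'; have := bd _ _ t ht; lra.
- move=> t ht /=; rewrite Y1; have := bd' _ _ t ht; lra.
Qed.

Lemma crossB X Y X' Y' x0 x1 x0' x1' : arcp X Y x0 0 x1 1 -> arcp X' Y' x0' 1 x1' 1 ->
  x0' < x1 -> x1 < x1' -> meet X Y X' Y'.
Proof.
move=> h h' l0 l1; apply: contrapT => nm.
have bd := arcp_bound h; have bd' := arcp_bound h'.
have [[cX cY] [X0 Y0] [X1 Y1] _] := h; have [[cX' cY'] [X0' Y0'] [X1' Y1'] _] := h'.
have nz := diff_nz h h'.
apply: (@routesB (fun z => X z.1 - X' z.2) (fun z => Y z.1 - Y' z.2)).
- exact: cont_diff.
- exact: cont_diff.
- move=> z hz /= e1 e2; apply: (nz _ _ _ _ _ _ _ _ _ z) => //=; by [left|right|case=> ?; lra|case=> ? ?; lra].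
- by rewrite /= Y1 Y0' subrr.
- by rewrite /= X1 X0'; lra.
- by rewrite /= X1 X1'; lra.
- move=> t ht /=; rewrite Y1; have := bd' _ _ t ht; lra.
- move=> t ht /=; rewrite Y0'; have := bd _ _ t ht; lra.
- move=> t ht /=; rewrite Y0; have := bd' _ _ t ht; lra.
- move=> t ht /=; rewrite Y1'; have := bd _ _ t ht; lra.
Qed.

Lemma crossC X Y X' Y' a c a' c' : arcp X Y a 1 c 1 -> arcp X' Y' a' 1 c' 1 ->
  a < a' -> a' < c -> c < c' -> meet X Y X' Y'.
Proof.
move=> h h' l0 l1 l2; apply: contrapT => nm.
have bd := arcp_bound h; have bd' := arcp_bound h'.
have [[cX cY] [X0 Y0] [X1 Y1] _] := h; have [[cX' cY'] [X0' Y0'] [X1' Y1'] _] := h'.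
have nz := diff_nz h' h.
apply: (@routesC (fun z => X' z.2 - X z.1) (fun z => Y' z.2 - Y z.1)).
- by apply: contB; [apply: (cont_comp cX'); apply: cont_snd|apply: (cont_comp cX); apply: cont_fst]; exact: cont_id.
- by apply: contB; [apply: (cont_comp cY'); apply: cont_snd|apply: (cont_comp cY); apply: cont_fst]; exact: cont_id.
- move=> [s t] hz /= e1 e2; apply: (nz _ _ _ _ _ _ _ _ _ (t, s)) => //=; try by [left|right|case: hz|case=> ?; lra].
  move=> [s1 [t1 [? ? ? ?]]]; apply: nm; by exists t1, s1.
all: rewrite /= ?X0 ?X0' ?X1 ?X1' ?Y0 ?Y0' ?Y1 ?Y1' ?subrr //; try lra.
- by move=> t ht; have := bd' _ _ t ht; lra.
- by move=> t ht; have := bd' _ _ t ht; lra.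
- by move=> t ht; have := bd _ _ t ht; lra.
- by move=> t ht; have := bd _ _ t ht; lra.
Qed.

Lemma arcp_flip X Y x0 y0 x1 y1 : arcp X Y x0 y0 x1 y1 -> arcp X (fun t => 1 - Y t) x0 (1 - y0) x1 (1 - y1).
Proof.
move=> [[cX cY] [X0 Y0] [X1 Y1] hi]; split.
- by split=> //; apply: contB => //; exact: cont_cst.
- by rewrite Y0.
- by rewrite Y1.
- by move=> t /hi; lra.
Qed.

Lemma arcp_rev X Y x0 y0 x1 y1 : arcp X Y x0 y0 x1 y1 -> arcp (fun t => X (1 - t)) (fun t => Y (1 - t)) x1 y1 x0 y0.
Proof.
move=> [[cX cY] [X0 Y0] [X1 Y1] hi].
have c1 : continuous (fun t : R => 1 - t) by apply: contB; [exact: cont_cst|exact: cont_id].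
split; rewrite ?subrr ?subr0 //; first by split; apply: cont_comp.
by move=> t ht; apply: hi; lra.
Qed.

(** Turning the strip upside down and reversing the bridging arc exchanges the two boundary
    components. *)
Lemma crossB' X Y X' Y' x0 x1 x0' x1' : arcp X Y x0 0 x1 1 -> arcp X' Y' x0' 0 x1' 0 ->
  x0' < x0 -> x0 < x1' -> meet X Y X' Y'.
Proof.
move=> h h' l0 l1; have := arcp_flip (arcp_rev h); have := arcp_flip h'; rewrite subrr subr0 => k' kk.
have [s [t [hs ht e1 e2]]] := crossB kk k' l0 l1; exists (1 - s), t; split=> //; lra.
Qed.

Lemma crossC' X Y X' Y' a c a' c' : arcp X Y a 0 c 0 -> arcp X' Y' a' 0 c' 0 ->
  a < a' -> a' < c -> c < c' -> meet X Y X' Y'.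
Proof.
move=> h h' l0 l1 l2; have := arcp_flip h; have := arcp_flip h'; rewrite subr0 => k' kk.
have [s [t [hs ht e1 e2]]] := crossC kk k' l0 l1 l2; exists s, t; split=> //; lra.
Qed.
End Angle.

(** * Lifting arcs of the annulus to the strip *)

Section Lifting.
Variable R : realType.
Local Notation I01 := (`[0, 1]%classic : set R).
Local Notation strip := (strip R).
Local Notation annulus := (annulus R).
Local Notation cover := (@Defs.cover R).
Local Notation clamp := (@clamp R).

Lemma clampI r : I01 (clamp r).
Proof. by rewrite /= in_itv /= clamp_in. Qed.

Definition mkI (y : R) : set_type I01 := exist _ (clamp y) (mem_set (clampI y)).

Lemma mkI_val y : set_val (mkI y) = clamp y.
Proof. by rewrite set_valE. Qed.

Lemma cont_mkI : continuous mkI.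
Proof.
apply: continuous_comp_initial; rewrite (_ : _ \o _ = clamp); first exact: cont_clamp.
by apply/funext => y; rewrite /= mkI_val.
Qed.

Definition mkS (x y : R) : strip := (x, mkI y).

Lemma cont_mkS (T : topologicalType) (f g : T -> R) : continuous f -> continuous g -> continuous (fun t => mkS (f t) (g t)).
Proof. by move=> cf cg; apply: cont_pair => //; apply: (cont_comp cont_mkI). Qed.

Lemma cont_x : continuous (fun u : strip => u.1).
Proof. by apply: cont_fst; exact: cont_id. Qed.

Lemma cont_height : continuous (@height R).
Proof.
apply: (@cont_comp _ _ _ (set_val : set_type I01 -> R) snd); last by apply: cont_snd; exact: cont_id.
exact: initial_continuous.
Qed.

Lemma height_in (u : strip) : 0 <= height u <= 1.
Proof. by have := set_valP u.2; rewrite /= in_itv. Qed.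

Lemma mkS_height x y : 0 <= y <= 1 -> height (mkS x y) = y.
Proof. by move=> h; rewrite /height mkI_val clamp_id. Qed.

Lemma mkS_eta (u : strip) : mkS u.1 (height u) = u.
Proof.
case: u => x y; congr (_, _); apply: val_inj => /=.
by rewrite clamp_id ?height_in // /height set_valE.
Qed.

Lemma coverP (u v : strip) : cover u = cover v <-> exists n : int, v.1 = u.1 + n%:~R /\ v.2 = u.2.
Proof.
split=> [e|[n h]].
  have : same_point u v by have /eqquotP := e.
  by move/asboolP.
by apply/eqquotP; apply/asboolP; exists n.
Qed.

Lemma cover_repr (a : annulus) : exists u, a = cover u.
Proof. by exists (repr a); rewrite /cover reprK. Qed.

Let tp : R := pi *+ 2.

Lemma cos_per x (n : int) : cos (tp * (x + n%:~R)) = cos (tp * x) /\ sin (tp * (x + n%:~R)) = sin (tp * x).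
Proof.
have hn (m : nat) y : cos (tp * (y + m%:R)) = cos (tp * y) /\ sin (tp * (y + m%:R)) = sin (tp * y).
  rewrite mulrDr mulr_natr; split; first exact: (periodicn (@cosD2pi R)).
  exact: (periodicn (@sinD2pi R)).
case: n => m; first exact: hn.
have [h1 h2] := hn m.+1 (x + (Negz m)%:~R).
by rewrite NegzE mulrNz -addrA addNr addr0 in h1 h2; rewrite NegzE mulrNz h1 h2.
Qed.

Lemma cos_int x : cos (tp * x) = 1 -> exists n : int, x = n%:~R.
Proof.
move=> h; pose n := Num.floor x; pose r := x - n%:~R.
have r0 : 0 <= r < 1 by rewrite /r; have := floor_le x; have := floorD1_gt x; rewrite -/n intrD; lra.
have hr : cos (tp * r) = 1 by rewrite -h -[x in RHS](subrK n%:~R) -/r (cos_per r n).1.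
have pi0 := pi_gt0 R.
have z (y : R) : 0 <= y <= pi -> cos y = 1 -> y = 0.
  by move=> hy e; apply: cos_inj; rewrite ?in_itv /= ?lexx ?pi_ge0 ?cos0.
exists n; apply/eqP; rewrite -subr_eq0 -/r.
have [l|g] := lerP r (1 / 2).
  have /eqP : (pi + pi) * r = 0 by apply: z => //; nra.
  by rewrite mulf_eq0 gt_eqF //=; lra.
have : tp * (1 - r) = 0.
  apply: z; first by rewrite /tp mulr2n; nra.
  by have := (cos_per (- r) 1).1; rewrite addrC => ->; rewrite mulrN cosN.
by move/eqP; rewrite mulf_eq0 /tp mulr2n gt_eqF /=; [move/eqP; lra|lra].
Qed.

Lemma ang_int x x' : cos (tp * x) = cos (tp * x') -> sin (tp * x) = sin (tp * x') -> exists n : int, x' = x + n%:~R.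
Proof.
move=> h1 h2; have [|n hn] := @cos_int (x' - x).
  by rewrite mulrBr cosB h1 h2 -!expr2 cos2Dsin2.
by exists n; rewrite -hn subrKC.
Qed.

(** [cU], [cV] and [cH] embed the annulus as circle times interval; by periodicity they do not
    depend on the representative. *)
Definition cU (a : annulus) : R := cos (tp * (repr a : strip).1).
Definition cV (a : annulus) : R := sin (tp * (repr a : strip).1).
Definition cH (a : annulus) : R := height (repr a : strip).

Lemma cover_cE (u : strip) : [/\ cU (cover u) = cos (tp * u.1), cV (cover u) = sin (tp * u.1) & cH (cover u) = height u].
Proof.
have [n [h1 h2]] : exists n : int, u.1 = (repr (cover u) : strip).1 + n%:~R /\ u.2 = (repr (cover u) : strip).2.
  by apply/coverP; rewrite /cover reprK.
have [c1 c2] := cos_per (repr (cover u) : strip).1 n.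
by rewrite /cU /cV /cH /height h2 h1 c1 c2.
Qed.

Lemma cont_quot (f : strip -> R) (g : annulus -> R) : continuous f -> (forall u, g (cover u) = f u) -> continuous g.
Proof.
move=> cf h; apply/quotient_continuous; rewrite (_ : _ \o _ = f) //.
by apply/funext => u; exact: h.
Qed.

Lemma cont_cU : continuous cU.
Proof.
apply: (cont_quot (f := fun u => cos (tp * u.1))); last by move=> u; have [] := cover_cE u.
apply: (@cont_comp _ _ _ (@cos R)); first exact: continuous_cos.
by apply: contM; [exact: cont_cst|exact: cont_x].
Qed.
Lemma cont_cV : continuous cV.
Proof.
apply: (cont_quot (f := fun u => sin (tp * u.1))); last by move=> u; have [] := cover_cE u.
apply: (@cont_comp _ _ _ (@sin R)); first exact: continuous_sin.
by apply: contM; [exact: cont_cst|exact: cont_x].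
Qed.
Lemma cont_cH : continuous cH.
Proof. by apply: (cont_quot cont_height) => u; have [] := cover_cE u. Qed.

Lemma cover_mk (a : annulus) x : cU a = cos (tp * x) -> cV a = sin (tp * x) -> a = cover (mkS x (cH a)).
Proof.
have [u ->] := cover_repr a; have [-> -> ->] := cover_cE u => h1 h2.
have [n hn] := ang_int h1 h2; apply/coverP; exists n; split=> //=.
by have := mkS_eta u; case: u {h1 h2 hn} => x1 y1 /= [].
Qed.

Lemma cont_cover : continuous cover.
Proof. exact: pi_continuous. Qed.

Lemma within_comp (T U V : topologicalType) (A : set U) (f : U -> V) (g : T -> U) :
  {within A, continuous f} -> continuous g -> (forall x, A (g x)) -> continuous (fun x => f (g x)).
Proof.
move=> /subspace_continuousP cf cg hA x W hW.
have h : nbhs (g x) [set y | A y -> W (f y)] := cf _ (hA x) W hW.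
change (nbhs x [set t | W (f (g t))]).
have h3 : nbhs x [set t | A (g t) -> W (f (g t))] := cg x _ h.
by apply: filterS h3 => y /=; apply; exact: hA.
Qed.

(** Between two different integers [f] would take the value [y], which lies half a unit above the
    smaller one. *)
Lemma int_const (f : R -> R) : continuous f -> (forall t, 0 <= t <= 1 -> exists n : int, f t = n%:~R) ->
  forall t, 0 <= t <= 1 -> f t = f 0.
Proof.
move=> cf hf t /andP[t0 t1]; have [n hn] := hf t (introT andP (conj t0 t1)).
have [|m hm] := hf 0; first by lra.
have [e|ne] := eqVneq n m; first by rewrite hn hm e.
pose y : R := (Num.min n m)%:~R + 1 / 2.
have [|c [hc ec]] := @IVT_total R f 0 t y cf t0.
  rewrite hn hm /y; have [h|h] : (n + 1 <= m)%R \/ (m + 1 <= n)%R by lia.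
    have -> : Num.min n m = n by lia.
    have h' : (n + 1)%:~R <= m%:~R :> R by rewrite ler_int.
    by rewrite intrD in h'; lra.
  have -> : Num.min n m = m by lia.
  have h' : (m + 1)%:~R <= n%:~R :> R by rewrite ler_int.
  by rewrite intrD in h'; lra.
have [|i hi] := hf c; first by lra.
have h1 : Num.min n m < i by rewrite -(ltr_int R) -hi ec /y; lra.
have h2 : i < Num.min n m + 1 by rewrite -(ltr_int R) intrD -hi ec /y; lra.
lia.
Qed.

(** The circle coordinate of the whole homotopy has a continuous angle on the square by [angle]. At
    s = 0 it differs from the given path by a constant integer [n], and along the fixed ends it is
    constant; so the slice s = 1, shifted by [n], lifts [c] with the right ends. *)
Lemma arc_lift x0 y0 x1 y1 (c : R -> annulus) : arc_class x0 y0 x1 y1 c ->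
  exists X Y, arcp X Y x0 y0 x1 y1 /\ forall t, 0 <= t <= 1 -> c t = cover (mkS (X t) (Y t)).
Proof.
move=> [[wc ic] [d [[wd [d0x d0y] [d1x d1y] di] [H [wH H0 Hs]]]]].
have pi0 := pi_gt0 R; have tp0 : tp != 0 by rewrite /tp mulrn_eq0 /= gt_eqF.
have inI t : 0 <= t <= 1 -> I01 t by rewrite /= in_itv.
pose cl (z : R * R) := (clamp z.1, clamp z.2).
have ccl : continuous cl by apply: cont_pair; apply: (cont_comp (@cont_clamp R)); [apply: cont_fst|apply: cont_snd]; exact: cont_id.
have cHt : continuous (fun z => H (cl z)).
  by apply: (within_comp wH ccl) => z; split; exact: clampI.
have clE z : I2 z -> cl z = z by case: z => x y [/= h1 h2]; rewrite /cl /= !clamp_id.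
have [||z|th [cth hth]] := @angle R (fun z => cU (H (cl z))) (fun z => cV (H (cl z))).
- exact: (cont_comp cont_cU).
- exact: (cont_comp cont_cV).
- by rewrite /cU /cV cos2Dsin2.
have {}hth z : I2 z -> cU (H z) = cos (tp * (th z / tp)) /\ cV (H z) = sin (tp * (th z / tp)).
  move=> hz; have [||rho] := hth z; [exact: (inI _ hz.1)|exact: (inI _ hz.2)|].
  rewrite (clE z hz) [tp * _]mulrC divfK // => -[r0 e1 e2].
  have : rho ^+ 2 = 1.
    have := cos2Dsin2 (tp * (repr (H z) : strip).1); rewrite -/(cU (H z)) -/(cV (H z)) e1 e2 !exprMn -mulrDr cos2Dsin2 mulr1.
    by [].
  move/eqP; rewrite sqrf_eq1 => /orP[|] /eqP er; last by lra.
  by rewrite e1 e2 er !mul1r.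
have i0 : 0 <= (0 : R) <= 1 by lra.
have i1 : 0 <= (1 : R) <= 1 by lra.
have cd : continuous (fun t => (d (clamp t)).1).
  by apply: (cont_comp cont_x); apply: (within_comp wd (@cont_clamp R)); exact: clampI.
have [n hn] : exists n : int, forall t, 0 <= t <= 1 -> th (0, t) / tp - (d t).1 = n%:~R.
  pose g t := th (0, t) / tp - (d (clamp t)).1.
  have hg t : 0 <= t <= 1 -> exists m : int, g t = m%:~R.
    move=> ht; have [e1 e2] := hth (0, t) (conj i0 ht).
    rewrite (H0 t (inI _ ht)).1 in e1 e2; have [f1 f2 _] := cover_cE (d t).
    have [||m hm] := @ang_int (d t).1 (th (0, t) / tp); [by rewrite -f1|by rewrite -f2|].
    by exists m; rewrite /g clamp_id // hm addrAC subrr add0r.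
  have cg : continuous g.
    apply: contB => //; apply: contM; last exact: cont_cst.
    by apply: (cont_comp cth); apply: cont_pair; [exact: cont_cst|exact: cont_id].
  have [m hm] := hg 0 i0; exists m => t ht; rewrite -hm -(int_const cg hg ht).
  by rewrite /g clamp_id.
have const b t0 (h0 : forall s, 0 <= s <= 1 -> H (s, t0) = b) : 0 <= t0 <= 1 -> th (1, t0) / tp = th (0, t0) / tp.
  move=> ht; pose g s := th (s, t0) / tp - th (0, t0) / tp.
  have cg : continuous g.
    apply: contB; last exact: cont_cst.
    apply: contM; last exact: cont_cst.
    by apply: (cont_comp cth); apply: cont_pair; [exact: cont_id|exact: cont_cst].
  have hg s : 0 <= s <= 1 -> exists m : int, g s = m%:~R.
    move=> hs; have [e1 e2] := hth (s, t0) (conj hs ht); have [e3 e4] := hth (0, t0) (conj i0 ht).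
    rewrite h0 // in e1 e2; rewrite h0 // in e3 e4.
    have [||m hm] := @ang_int (th (0, t0) / tp) (th (s, t0) / tp); [by rewrite -e1|by rewrite -e2|].
    by exists m; rewrite /g hm addrAC subrr add0r.
  by have := int_const cg hg i1; rewrite /g subrr => /eqP; rewrite subr_eq0 => /eqP.
pose X t := th (1, t) / tp - n%:~R; pose Y t := cH (H (cl (1, t))).
exists X, Y; have cE t : 0 <= t <= 1 -> c t = H (1, t) by move=> ht; rewrite (H0 t (inI _ ht)).2.
have YE t : 0 <= t <= 1 -> Y t = cH (c t) by move=> ht; rewrite /Y clE // cE.
have c0E : c 0 = cover (d 0) by rewrite cE // (Hs 1 (inI _ i1)).1.
have c1E : c 1 = cover (d 1) by rewrite cE // (Hs 1 (inI _ i1)).2.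
split; last first.
  move=> t ht; have [e1 e2] := hth (1, t) (conj i1 ht).
  rewrite YE // -/(c t) [in LHS]cE //; rewrite [c t]cE //.
  apply: cover_mk; rewrite ?e1 ?e2 /X.
    by rewrite -mulrNz (cos_per _ (- n)).1.
  by rewrite -mulrNz (cos_per _ (- n)).2.
split.
- split.
    apply: contB; last exact: cont_cst.
    apply: contM; last exact: cont_cst.
    by apply: (cont_comp cth); apply: cont_pair; [exact: cont_cst|exact: cont_id].
  apply: (cont_comp cont_cH); apply: (cont_comp cHt).
  by apply: cont_pair; [exact: cont_cst|exact: cont_id].
- split; last by rewrite YE // c0E; have [_ _ ->] := cover_cE (d 0).
  rewrite /X (const (cover (d 0)) 0) //; last by move=> s hs; rewrite (Hs s (inI _ hs)).1.
  by rewrite -(hn 0 i0) subKr.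
- split; last by rewrite YE // c1E; have [_ _ ->] := cover_cE (d 1).
  rewrite /X (const (cover (d 1)) 1) //; last by move=> s hs; rewrite (Hs s (inI _ hs)).2.
  by rewrite -(hn 1 i1) subKr.
- move=> t ht; rewrite YE; last by lra.
  by have [u hu <-] := ic t ht; have [_ _ ->] := cover_cE u.
Qed.

Definition cvr (X Y : R -> R) : R -> annulus := fun t => cover (mkS (X t) (Y t)).

Lemma arcp_class X Y x0 y0 x1 y1 : 0 <= y0 <= 1 -> 0 <= y1 <= 1 -> arcp X Y x0 y0 x1 y1 -> arc_class x0 y0 x1 y1 (cvr X Y).
Proof.
move=> h0 h1 [[cX cY] [X0 Y0] [X1 Y1] hi].
have cd : continuous (fun t => mkS (X t) (Y t)) by exact: cont_mkS.
have cc : continuous (cvr X Y) by exact: (cont_comp cont_cover).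
have hh t : 0 < t < 1 -> 0 < height (mkS (X t) (Y t)) < 1.
  by move=> /hi h; rewrite mkS_height //; lra.
split; first split.
- exact: continuous_subspaceT.
- by move=> t ht; exists (mkS (X t) (Y t)) => //; exact: hh.
exists (fun t => mkS (X t) (Y t)); split; first split=> //.
- exact: continuous_subspaceT.
- by rewrite /= X0 Y0 mkS_height.
- by rewrite /= X1 Y1 mkS_height.
exists (fun z => cvr X Y z.2); split=> //.
by apply: continuous_subspaceT; apply: (cont_comp cc); apply: cont_snd; exact: cont_id.
Qed.

Lemma class_shift (x0 y0 x1 y1 : R) (n : int) : arc_class (x0 + n%:~R) y0 (x1 + n%:~R) y1 = arc_class x0 y0 x1 y1.
Proof.
have sub (a b : R) (m : int) : arc_class a y0 b y1 `<=` arc_class (a + m%:~R) y0 (b + m%:~R) y1.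
  move=> c [hc [d [[wd [d0x d0y] [d1x d1y] di] hH]]]; split=> //.
  exists (fun t => ((d t).1 + m%:~R, (d t).2) : strip); split; first split=> //.
  - apply: (@within_continuous_comp _ _ _ _ d (fun u : strip => (u.1 + m%:~R, u.2) : strip)) => // u _.
    move: u; apply: cont_pair; last by apply: cont_snd; exact: cont_id.
    by apply: contD; [exact: cont_x|exact: cont_cst].
  - by rewrite /= d0x.
  - by rewrite /= d1x.
  rewrite (_ : _ \o _ = cover \o d) //; apply/funext => t /=.
  by apply/coverP; exists (- m); rewrite /= mulrNz addrK.
apply/seteqP; split; last exact: sub.
by move=> c /(sub _ _ (- n)); rewrite mulrNz !addrK.
Qed.

(** Two lifts of one curve differ by an integer that is constant along the curve. *)
Lemma class_ends (x0 y0 x1 y1 x0' y0' x1' y1' : R) c : 0 <= y0 <= 1 -> 0 <= y1 <= 1 -> 0 <= y0' <= 1 -> 0 <= y1' <= 1 -> arc_class x0 y0 x1 y1 c -> arc_class x0' y0' x1' y1' c ->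
  exists n : int, [/\ x0' = x0 + n%:~R, x1' = x1 + n%:~R, y0' = y0 & y1' = y1].
Proof.
move=> h1 h2 h3 h4 /arc_lift[X [Y [[[cX cY] [X0 Y0] [X1 Y1] _] e]]] /arc_lift[X' [Y' [[[cX' cY'] [X0' Y0'] [X1' Y1'] _] e']]].
have hn t : 0 <= t <= 1 -> exists n : int, X' t - X t = n%:~R.
  move=> ht; have /coverP[n [h _]] : cover (mkS (X t) (Y t)) = cover (mkS (X' t) (Y' t)) by rewrite -e // e'.
  by exists n; move: h => /= ->; rewrite addrAC subrr add0r.
have hy t : 0 <= t <= 1 -> clamp (Y' t) = clamp (Y t).
  move=> ht; have /coverP[n [_ h]] : cover (mkS (X t) (Y t)) = cover (mkS (X' t) (Y' t)) by rewrite -e // e'.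
  by have := congr1 set_val h; rewrite !mkI_val.
have cf : continuous (fun t => X' t - X t) by exact: contB.
have i0 : 0 <= (0 : R) <= 1 by lra.
have i1 : 0 <= (1 : R) <= 1 by lra.
have [n en] := hn 0 i0; have e1 := int_const cf hn i1; rewrite en X1 X1' in e1; rewrite X0 X0' in en.
have := hy 0 i0; have := hy 1 i1; rewrite Y0 Y1 Y0' Y1' !clamp_id // => -> ->.
by exists n; split=> //; [rewrite -en|rewrite -e1]; rewrite subrKC.
Qed.
End Lifting.

(** * Straight lines and parabolas as representatives *)

Section Curves.
Variable R : realType.
Implicit Types (X Y : R -> R) (x a c : R) (e : bool).

Lemma cvr_eq X Y X' Y' (s t : R) : 0 <= Y s <= 1 -> 0 <= Y' t <= 1 -> cvr X Y s = cvr X' Y' t ->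
  exists n : int, X' t = X s + n%:~R /\ Y s = Y' t.
Proof.
move=> h h' /coverP[n [/= e1 e2]]; exists n; split=> //.
by have := congr1 set_val e2; rewrite !mkI_val !clamp_id.
Qed.

Lemma not_disjoint (x0 y0 x1 y1 x0' y0' x1' y1' : R) :
  (forall X Y X' Y', arcp X Y x0 y0 x1 y1 -> arcp X' Y' x0' y0' x1' y1' -> meet X Y X' Y') ->
  ~ disjoint_arcs (arc_class x0 y0 x1 y1) (arc_class x0' y0' x1' y1').
Proof.
move=> h [c [c' [/arc_lift[X [Y [a e]]] /arc_lift[X' [Y' [a' e']]] nd]]].
have [s [t [hs ht eX eY]]] := h _ _ _ _ a a'; apply: (nd s t hs ht).
by rewrite e ?e' ?eX ?eY //; lra.
Qed.

(** A common point of a lift and its translate by a nonzero integer is a self-intersection, since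
    the two parameters cannot coincide. *)
Lemma not_simple (x0 y0 x1 y1 : R) (n : int) : n != 0 ->
  (forall X Y X' Y', arcp X Y x0 y0 x1 y1 -> arcp X' Y' (x0 + n%:~R) y0 (x1 + n%:~R) y1 -> meet X Y X' Y') ->
  ~ has_simple_representative (arc_class x0 y0 x1 y1).
Proof.
move=> n0 h [c [/arc_lift[X [Y [[[cX cY] [X0 Y0] [X1 Y1] hi] e]]] inj]].
have [||s [t [hs ht eX eY]]] := h X Y (fun t => X t + n%:~R) Y; first by [].
  split=> //; rewrite ?X0 ?X1 //; split=> //; apply: contD => //; exact: cont_cst.
have b (r : R) : 0 < r < 1 -> 0 <= r <= 1 by lra.
have st : s = t.
  apply: inj => //; rewrite !e ?b //.
  by apply/coverP; exists (- n); rewrite /= eX eY mulrNz addrK.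
move: n0; rewrite -(intr_eq0 R); rewrite st in eX; have -> : n%:~R = 0 :> R by lra.
by rewrite eqxx.
Qed.

Lemma disjointC (C C' : set (R -> annulus R)) : disjoint_arcs C C' -> disjoint_arcs C' C.
Proof. by move=> [c [c' [h h' nd]]]; exists c', c; split=> // s t hs ht /esym; exact: nd. Qed.

Lemma disjoint_mk X Y X' Y' x0 y0 x1 y1 x0' y0' x1' y1' :
  0 <= y0 <= 1 -> 0 <= y1 <= 1 -> 0 <= y0' <= 1 -> 0 <= y1' <= 1 ->
  arcp X Y x0 y0 x1 y1 -> arcp X' Y' x0' y0' x1' y1' ->
  (forall (n : int) (s t : R), 0 < s < 1 -> 0 < t < 1 -> X' t = X s + n%:~R -> Y s = Y' t -> False) ->
  disjoint_arcs (arc_class x0 y0 x1 y1) (arc_class x0' y0' x1' y1').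
Proof.
move=> h0 h1 h2 h3 a a' h; exists (cvr X Y), (cvr X' Y'); split; [exact: arcp_class|exact: arcp_class|].
move=> s t hs ht /cvr_eq[||n [e1 e2]]; last exact: (h n s t).
  by case: a => _ _ _ /(_ s hs); lra.
by case: a' => _ _ _ /(_ t ht); lra.
Qed.

Lemma simple_mk X Y x0 y0 x1 y1 : 0 <= y0 <= 1 -> 0 <= y1 <= 1 -> arcp X Y x0 y0 x1 y1 ->
  (forall (n : int) (s t : R), 0 < s < 1 -> 0 < t < 1 -> X t = X s + n%:~R -> Y s = Y t -> s = t) ->
  has_simple_representative (arc_class x0 y0 x1 y1).
Proof.
move=> h0 h1 a h; exists (cvr X Y); split; first exact: arcp_class.
case: (a) => _ _ _ hi s t hs ht /cvr_eq[||n [e1 e2]]; last exact: (h n s t).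
  by have := hi s hs; lra.
by have := hi t ht; lra.
Qed.

Definition bd e : R := if e then 1 else 0.
Lemma bd01 e : 0 <= bd e <= 1. Proof. by case: e; rewrite /bd; lra. Qed.
Definition bcl (x0 x1 : R) := arc_class x0 0 x1 1.
Definition pcl e (a c : R) := arc_class a (bd e) c (bd e).

Definition seg (x0 x1 t : R) := x0 + (x1 - x0) * t.
(* In terms of x = seg a c t the height above the boundary is d (x - a) (c - x). *)
Definition bump d e (a c t : R) := let h := d * ((c - a) ^+ 2 * (t * (1 - t))) in if e then 1 - h else h.

Lemma cont_seg x0 x1 : continuous (seg x0 x1).
Proof.
apply: contD; first exact: cont_cst.
by apply: contM; [exact: cont_cst|exact: cont_id].
Qed.

Lemma br_arcp x0 x1 : arcp (seg x0 x1) id x0 0 x1 1.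
Proof.
split=> //; first by split; [exact: cont_seg|exact: cont_id].
  by rewrite /seg mulr0 addr0.
by rewrite /seg mulr1 subrKC.
Qed.

Lemma bump_quarter (t : R) : t * (1 - t) <= 1 / 4.
Proof. by have := sqr_ge0 (t - 1 / 2); nra. Qed.

Lemma bump_arcp d e a c : a < c -> 0 < d -> d * (c - a) ^+ 2 <= 1 -> arcp (seg a c) (bump d e a c) a (bd e) c (bd e).
Proof.
move=> ac d0 d1; split; first split; first exact: cont_seg.
- have h : continuous (fun t : R => d * ((c - a) ^+ 2 * (t * (1 - t)))).
    apply: contM; first exact: cont_cst.
    apply: contM; first exact: cont_cst.
    apply: contM; first exact: cont_id.
    by apply: contB; [exact: cont_cst|exact: cont_id].
  by rewrite /bump; case: e => //; apply: contB => //; exact: cont_cst.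
- by rewrite /seg /bump /bd mulr0 addr0 mul0r !mulr0 subr0; case: e.
- by rewrite /seg /bump /bd subrr mulr1 !mulr0 subr0 subrKC; case: e.
move=> t ht; rewrite /bump mulrA; set K := d * (c - a) ^+ 2 in d1 *.
have K0 : 0 < K by rewrite /K mulr_gt0 // exprn_gt0 // subr_gt0.
have h4 := bump_quarter t; have h5 : 0 < t * (1 - t) by apply: mulr_gt0; lra.
have h : 0 < K * (t * (1 - t)) < 1 by rewrite mulr_gt0 //=; nra.
by case: e; lra.
Qed.

Lemma bumpE d e a c t : bump d e a c t =
  if e then 1 - d * (seg a c t - a) * (c - seg a c t) else d * (seg a c t - a) * (c - seg a c t).
Proof. by rewrite /bump /seg; case: e; ring. Qed.

Lemma seg_in a c t : a < c -> 0 < t < 1 -> a < seg a c t < c.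
Proof. by rewrite /seg => ac /andP[t0 t1]; nra. Qed.

Lemma bb_cross x0 x1 x0' x1' (n : int) : (x0 + n%:~R - x0') * (x1 + n%:~R - x1') < 0 ->
  ~ disjoint_arcs (bcl x0 x1) (bcl x0' x1').
Proof.
move=> h; rewrite /bcl -(class_shift x0 0 x1 1 n).
have u0 : x0 + n%:~R - x0' != 0 by apply: contraTneq h => ->; rewrite mul0r ltxx.
rewrite subr_eq0 in u0; have [l|l|l] := ltrgtP (x0 + n%:~R) x0'; last by rewrite l eqxx in u0.
  by apply: not_disjoint => X Y X' Y' a a'; apply: (crossA a a') => //; nra.
move=> /disjointC; apply: not_disjoint => X Y X' Y' a a'; apply: (crossA a a'); nra.
Qed.

Lemma bb_disjoint x0 x1 x0' x1' : (forall n : int, 0 <= (x0 + n%:~R - x0') * (x1 + n%:~R - x1')) ->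
  (forall n : int, x0 + n%:~R = x0' -> x1 + n%:~R = x1' -> False) ->
  disjoint_arcs (bcl x0 x1) (bcl x0' x1').
Proof.
move=> h hn; apply: (disjoint_mk _ _ _ _ (br_arcp x0 x1) (br_arcp x0' x1')); try lra.
move=> n s t hs ht e; rewrite /seg in e; move=> /= st; subst t.
have := h n; set u := x0 + n%:~R - x0'; set v := x1 + n%:~R - x1' => uv.
(* At a common height the lines meet where a convex combination of the differences of their ends
   vanishes; as these do not have opposite signs, both vanish. *)
have huv : (1 - s) * u + s * v = 0 by rewrite /u /v; lra.
have u0 : u = 0.
  have e1 : (1 - s) * u ^+ 2 + s * (u * v) = 0 by rewrite -[RHS](mulr0 u) -huv; ring.
  have u2 := sqr_ge0 u; apply/eqP; rewrite -sqrf_eq0 eq_le u2 andbT.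
  have : 0 <= s * (u * v) by apply: mulr_ge0 => //; lra.
  nra.
have v0 : v = 0 by move: huv; rewrite u0 mulr0 add0r => /eqP; rewrite mulf_eq0 => /orP[|] /eqP; lra.
by apply: (hn n); rewrite /u in u0; rewrite /v in v0; lra.
Qed.

Lemma bp_cross e x0 x1 a c (n : int) : a < (if e then x1 else x0) + n%:~R < c ->
  ~ disjoint_arcs (bcl x0 x1) (pcl e a c).
Proof.
rewrite /bcl -(class_shift x0 0 x1 1 n) => /andP[h h'].
by apply: not_disjoint => X Y X' Y' u u'; case: e h h' u' => h h' u'; [exact: (crossB u u')|exact: (crossB' u u')].
Qed.

(** The integer tested is the largest n with x + n < c. *)
Lemma gap_le1 x a c : (forall n : int, ~ a < x + n%:~R < c) -> c - a <= 1.
Proof.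
move=> h; have /andP[] := ceil_itv (c - x); rewrite intrB => h1 h2.
have := h (Num.ceil (c - x) - 1); rewrite intrB => h3.
rewrite leNgt; apply/negP => h4; apply: h3; lra.
Qed.

Lemma damp (K u v : R) : -1 < K < 1 -> 0 < u < 1 -> 0 < v < 1 -> - u < K * (u * v) < v.
Proof.
move=> hK hu hv; have h1 : -1 < K * v by nra.
have h2 : K * u < 1 by nra.
by apply/andP; split; [rewrite mulrCA mulrC|rewrite mulrA]; nra.
Qed.

(** The parabola is flat in proportion to the slope of the line: at a common abscissa x, the end of
    the line would differ from x by [K * ((x - a) * (c - x))] with |K| < 1, and so would lie in (a,
    c). *)
Lemma bp_disjoint e x0 x1 a c : a < c -> (forall n : int, ~ a < (if e then x1 else x0) + n%:~R < c) ->
  disjoint_arcs (bcl x0 x1) (pcl e a c).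
Proof.
move=> ac h; have ca := gap_le1 h; pose d := (1 + `|x1 - x0|)^-1.
have d0 : 0 < d by rewrite invr_gt0 ltr_wpDr.
have hd : d + d * `|x1 - x0| = 1 by rewrite -{1}[d]mulr1 -mulrDr mulVf // gt_eqF // ltr_wpDr.
have hk : -1 < d * (x1 - x0) < 1.
  have [k0|k0] := lerP 0 (x1 - x0).
    by rewrite ger0_norm // in hd; nra.
  by rewrite ltr0_norm // in hd; nra.
have d1 : d * (c - a) ^+ 2 <= 1.
  have : 0 <= d * `|x1 - x0| by rewrite mulr_ge0 // ltW.
  have : (c - a) ^+ 2 <= 1 by nra.
  by have : 0 <= (c - a) ^+ 2; [exact: sqr_ge0|nra].
apply: (disjoint_mk _ _ _ _ (br_arcp x0 x1) (bump_arcp e ac d0 d1)) => //; try lra; try exact: bd01.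
move=> n s t hs ht; rewrite bumpE; have := seg_in ac ht; set x := seg a c t => hx e1 e2.
set K := d * (x1 - x0) in hk *; have hu : 0 < x - a < 1 by lra.
have hv : 0 < c - x < 1 by lra.
case: e h e2 => h /= e2; apply: (h n).
  have -> : x1 + n%:~R = x + K * ((x - a) * (c - x)).
    have eP : d * (x - a) * (c - x) = 1 - s by rewrite e2 subKr.
    rewrite (_ : K * _ = (x1 - x0) * (d * (x - a) * (c - x))); last by rewrite /K; ring.
    by rewrite eP e1 /seg; ring.
  by have := damp hk hu hv; lra.
have -> : x0 + n%:~R = x - K * ((x - a) * (c - x)).
  rewrite (_ : K * _ = (x1 - x0) * (d * (x - a) * (c - x))); last by rewrite /K; ring.
  by rewrite -e2 e1 /seg; ring.
by have := damp (_ : -1 < - K < 1) hu hv; rewrite mulNr => /(_ ltac:(lra)); lra.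
Qed.

Lemma pp_cross e a c a' c' (n : int) : a < a' + n%:~R -> a' + n%:~R < c -> c < c' + n%:~R ->
  ~ disjoint_arcs (pcl e a c) (pcl e a' c').
Proof.
rewrite /pcl -(class_shift a' (bd e) c' _ n) => h1 h2 h3.
by apply: not_disjoint => X Y X' Y' u u'; case: e u u' => u u'; [exact: (crossC u u')|exact: (crossC' u u')].
Qed.

Lemma nested_eq a c a' c' x : a <= a' -> c' <= c -> a' < x < c' ->
  (x - a) * (c - x) = (x - a') * (c' - x) -> a = a' /\ c = c'.
Proof.
move=> h1 h2 /andP[h3 h4] e.
have k1 : 0 <= (x - a') * (c - c') by apply: mulr_ge0; lra.
have k2 : 0 <= (a' - a) * (c - x) by apply: mulr_ge0; lra.
have e1 : (x - a') * (c - c') = 0 by lra.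
have e2 : (a' - a) * (c - x) = 0 by lra.
move/eqP: e1; rewrite mulf_eq0 => /orP[|] /eqP; move/eqP: e2; rewrite mulf_eq0 => /orP[|] /eqP; by split; lra.
Qed.

(** With one coefficient [d] for both, parabolas over nested intervals are nested; [d] is small
    enough for both to stay inside the strip. *)
Lemma pp_disjoint e a c a' c' : a < c -> a' < c' ->
  (forall n : int, ~ [/\ a < a' + n%:~R, a' + n%:~R < c & c < c' + n%:~R]) ->
  (forall n : int, ~ [/\ a' + n%:~R < a, a < c' + n%:~R & c' + n%:~R < c]) ->
  (forall n : int, a' + n%:~R = a -> c' + n%:~R = c -> False) ->
  disjoint_arcs (pcl e a c) (pcl e a' c').
Proof.
move=> ac ac' h1 h2 h3; pose K := (c - a) ^+ 2 + (c' - a') ^+ 2; pose d := K^-1.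
have k1 : 0 < (c - a) ^+ 2 by rewrite exprn_gt0 // subr_gt0.
have k2 : 0 < (c' - a') ^+ 2 by rewrite exprn_gt0 // subr_gt0.
have K0 : 0 < K by rewrite addr_gt0.
have d0 : 0 < d by rewrite invr_gt0.
have dK : d * K = 1 by rewrite mulVf // gt_eqF.
have d1 : d * (c - a) ^+ 2 <= 1 by rewrite /K in dK; nra.
have d2 : d * (c' - a') ^+ 2 <= 1 by rewrite /K in dK; nra.
apply: (disjoint_mk _ _ _ _ (bump_arcp e ac d0 d1) (bump_arcp e ac' d0 d2)); try exact: bd01.
move=> n s t hs ht; rewrite !bumpE; have := seg_in ac hs; have := seg_in ac' ht.
set x' := seg a' c' t; set x := seg a c s => hx' hx e1 e2.
have {}e2 : (x - a) * (c - x) = (x' - a') * (c' - x').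
  by apply: (mulfI (lt0r_neq0 d0)); case: e e2 => e2; lra.
have := h1 (- n); have := h2 (- n); have := h3 (- n); rewrite !mulrNz.
set N := n%:~R in e1 *; move=> k3 k4 k5.
have {}hx' : a' - N < x < c' - N by lra.
have {}e2 : (x - a) * (c - x) = (x - (a' - N)) * (c' - N - x) by rewrite e2 e1; ring.
have [l|l] := lerP a (a' - N).
  have l' : c' - N <= c.
    rewrite leNgt; apply/negP => l'; have [l2|l2] := ltrP a (a' - N); first by apply: k5; split; lra.
    have ea : a = a' - N by lra.
    have e3 : (x - a) * (c - x) = (x - a) * (c' - N - x) by rewrite e2 ea.
    have : x - a != 0 by rewrite gt_eqF //; lra.
    by move/mulfI => /(_ _ _ e3); lra.
  by have [|ea ec] := nested_eq l l' _ e2; [lra|apply: k3; lra].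
have l' : c <= c' - N by rewrite leNgt; apply/negP => l'; apply: k4; split; lra.
  by nra.
Qed.

Lemma inv_sqr a c : a < c -> 0 < ((c - a) ^+ 2)^-1 /\ ((c - a) ^+ 2)^-1 * (c - a) ^+ 2 = 1.
Proof.
move=> ac; have k1 : 0 < (c - a) ^+ 2 by rewrite exprn_gt0 // subr_gt0.
by rewrite invr_gt0 k1 mulVf ?gt_eqF.
Qed.

(** Normalised to height at most 1/4, the two parabolas stay near opposite sides of the strip. *)
Lemma pp_opposite e a c a' c' : a < c -> a' < c' -> disjoint_arcs (pcl e a c) (pcl (~~ e) a' c').
Proof.
move=> ac ac'; have [d0 d1] := inv_sqr ac; have [d0' d1'] := inv_sqr ac'.
apply: (disjoint_mk _ _ _ _ (bump_arcp e ac d0 _) (bump_arcp (~~ e) ac' d0' _)); try exact: bd01; rewrite ?d1 ?d1' //.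
move=> n s t hs ht _; rewrite /bump (mulrA ((c - a) ^- 2) ((c - a) ^+ 2)) (mulrA ((c' - a') ^- 2) ((c' - a') ^+ 2)) d1 d1' !mul1r; have := bump_quarter s; have := bump_quarter t.
by case: e => /=; lra.
Qed.

Lemma br_simple x0 x1 : has_simple_representative (bcl x0 x1).
Proof. by apply: (simple_mk _ _ (br_arcp x0 x1)) => //; lra. Qed.

Lemma pe_simple e a c : a < c -> c - a <= 1 -> has_simple_representative (pcl e a c).
Proof.
move=> ac ca; have [d0 d1] := inv_sqr ac.
apply: (simple_mk _ _ (bump_arcp e ac d0 _)); try exact: bd01; rewrite ?d1 // => n s t hs ht e1 _.
have hn : n%:~R = seg a c t - seg a c s by rewrite e1 addrAC subrr add0r.
have := seg_in ac hs; have := seg_in ac ht => hxt hxs.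
have l1 : n < 1 by rewrite -(ltrz1 R) hn; lra.
have l2 : -1 < n by rewrite -(ltr_int R) hn rmorphN1; lra.
have n0 : n = 0 by move: l1 l2; clear; lia.
have ca0 : c - a != 0 by rewrite subr_eq0 gt_eqF.
by move: e1; rewrite n0 addr0 /seg => /addrI /(mulfI ca0).
Qed.

Lemma pe_not_simple e a c : 1 < c - a -> ~ has_simple_representative (pcl e a c).
Proof.
move=> ca; apply: (@not_simple _ _ _ _ 1) => // X Y X' Y' u u'.
by case: e u u' => u u'; [apply: (crossC u u')|apply: (crossC' u u')]; lra.
Qed.

Lemma bcl_ne x0 x1 : exists f, bcl x0 x1 f.
Proof. by eexists; apply: (arcp_class _ _ (br_arcp x0 x1)); lra. Qed.

Lemma pcl_ne e a c : a < c -> exists f, pcl e a c f.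
Proof.
move=> ac; have [d0 d1] := inv_sqr ac; eexists; apply: (arcp_class _ _ (bump_arcp e ac d0 _)); try exact: bd01.
by rewrite d1.
Qed.
End Curves.

(* Br m1 m2 stands for the bridging arc corresponding to O(m1 x_1 + m2 x_2), and
   Pe b a c for the peripheral arc over the interval (a, c) on the boundary
   component b, in coordinates for which b = 1 is reversed. *)
Inductive arcd := Br of int & int | Pe of 'I_2 & int & int.

HB.instance Definition _ := gen_eqMixin arcd.
HB.instance Definition _ := gen_choiceMixin arcd.

Definition valid (x : arcd) := if x is Pe b a c then a + 2 <= c else true.

(** * Arcs of the annulus *)

Section ArcData.
Variable (R : realType) (p q : nat).
Hypotheses (p_gt0 : (0 < p)%N) (q_gt0 : (0 < q)%N).
Local Notation w b := ((wt p q b)%:Z).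
Local Notation bridging := (@bridging R p q).
Local Notation inner_peripheral := (@inner_peripheral R p).
Local Notation outer_peripheral := (@outer_peripheral R q).
Local Notation is_arc := (@is_arc R p q).

Definition cls (x : arcd) : set (R -> annulus R) := match x with
  | Br m1 m2 => bridging m1 (- m2)
  | Pe b a c => if b == 0 then inner_peripheral a c else outer_peripheral (- c) (- a)
  end.

(** [t] ranges over the translations of the strip, so that some pair of lifts is compared. In
    [cross x x] only a nonzero [t] can occur. *)
Definition cross (x y : arcd) : Prop := match x, y with
  | Br m1 m2, Br n1 n2 => exists t : int, 0 < (m1 - n1 - t * p%:Z) * (m2 - n2 + t * q%:Z)
  | Br m1 m2, Pe b a c => exists t : int, a < co b m1 m2 + t * w b < c
  | Pe b a c, Br m1 m2 => exists t : int, a < co b m1 m2 + t * w b < c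
  | Pe b a c, Pe b' a' c' => b = b' /\ exists t : int, let s := t * w b in
      [/\ a < a' + s, a' + s < c & c < c' + s] \/ [/\ a' + s < a, a < c' + s & c' + s < c]
  end.

Definition shifted (x y : arcd) : Prop := match x, y with
  | Br m1 m2, Br n1 n2 => exists t : int, n1 = m1 + t * p%:Z /\ n2 = m2 - t * q%:Z
  | Pe b a c, Pe b' a' c' => b = b' /\ exists t : int, a' = a + t * w b /\ c' = c + t * w b
  | _, _ => False
  end.

Let w_gt0 b : (0 < wt p q b)%N. Proof. by rewrite /wt; case: ifP. Qed.

Lemma frac_shift (w : nat) (m n : int) : (0 < w)%N -> m%:~R / w%:R + n%:~R = (m + n * w%:Z)%:~R / w%:R :> R.
Proof. by move=> w0; rewrite intrD intrM mulrDl mulfK // pnatr_eq0 -lt0n. Qed.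

Lemma frac_lt (w : nat) (m n : int) : (0 < w)%N -> (m%:~R / w%:R < n%:~R / w%:R :> R) = (m < n).
Proof. by move=> w0; rewrite ltr_pM2r ?ltr_int // invr_gt0 ltr0n. Qed.

Lemma frac_eq (w : nat) (m n : int) : (0 < w)%N -> m%:~R / w%:R = n%:~R / w%:R :> R -> m = n.
Proof. by move=> w0 /mulIf h; apply/eqP; rewrite -(eqr_int R); apply/eqP/h; rewrite invr_neq0 // pnatr_eq0 -lt0n. Qed.

(* The real coordinates of an integer point on the boundary component b. *)
Definition pt (b : 'I_2) (m : int) : R := (if b == 0 then m else - m)%:~R / (wt p q b)%:R.

Lemma ptD b m n : pt b m + n%:~R = pt b (m + (if b == 0 then n else - n) * w b).
Proof. by rewrite /pt frac_shift //; case: ifP => // _; rewrite mulNr opprD opprK. Qed.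

Lemma pt_lt b m n : (pt b m < pt b n) = if b == 0 then m < n else n < m.
Proof. by rewrite /pt frac_lt //; case: ifP => // _; rewrite ltrN2. Qed.

Lemma pt_inj b m n : pt b m = pt b n -> m = n.
Proof. by move=> /(frac_eq (w_gt0 b)); case: ifP => // _ /oppr_inj. Qed.

Definition side (b : 'I_2) := b == 0.
(** Reversing coordinates on the side b = 1 exchanges the left and right ends. *)
Definition lo (b : 'I_2) (a c : int) := if b == 0 then a else c.
Definition hi (b : 'I_2) (a c : int) := if b == 0 then c else a.

Lemma clsBr m1 m2 : cls (Br m1 m2) = bcl (pt 1 m2) (pt 0 m1).
Proof. by []. Qed.

Lemma clsPe b a c : cls (Pe b a c) = pcl (side b) (pt b (lo b a c)) (pt b (hi b a c)).
Proof. by elim/I2P: b. Qed.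

Lemma pt_lohi b a c : a + 2 <= c -> pt b (lo b a c) < pt b (hi b a c).
Proof. by rewrite pt_lt /lo /hi; case: (b == 0) => h; lia. Qed.

Lemma cls_ne x : valid x -> exists f, cls x f.
Proof.
case: x => [m1 m2|b a c] h; first by rewrite clsBr; exact: bcl_ne.
by rewrite clsPe; apply/pcl_ne/pt_lohi.
Qed.

Lemma cls_common x y f : cls x f -> cls y f -> shifted x y.
Proof.
have z : 0 <= (0 : R) <= 1 by lra.
have o : 0 <= (1 : R) <= 1 by lra.
have n01 : 0 <> 1 :> R by move/eqP; rewrite eq_sym oner_eq0.
case: x y => [m1 m2|b a c] [n1 n2|b' a' c']; rewrite ?clsBr ?clsPe => h h'.
- have [n [e1 e2 _ _]] := class_ends z o z o h h'; move: e1 e2.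
  by rewrite !ptD /wt /= => /pt_inj -> /pt_inj ->; exists n; rewrite mulNr.
- by have [n [_ _]] := class_ends z o (bd01 _ _) (bd01 _ _) h h'; rewrite /bd; case: ifP => _ e e'; lra.
- by have [n [_ _]] := class_ends (bd01 _ _) (bd01 _ _) z o h h'; rewrite /bd; case: ifP => _ e e'; lra.
have [n [e1 e2 e3 _]] := class_ends (bd01 _ _) (bd01 _ _) (bd01 _ _) (bd01 _ _) h h'.
have eb : b = b' by move: e3; rewrite /bd /side {h h' e1 e2}; elim/I2P: b; elim/I2P: b' => //= e; case: n01.
rewrite -eb in h' e1 e2 *; split=> //; move: e1 e2; rewrite !ptD => /pt_inj + /pt_inj; rewrite /lo /hi.
by case: ifP => _ e1 e2; [exists n|exists (- n)].
Qed.

Lemma cls_shifted x y : shifted x y -> cls x = cls y.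
Proof.
case: x y => [m1 m2|b a c] [n1 n2|b' a' c'] //=.
- move=> [t [-> ->]]; rewrite -!/(cls (Br _ _)) !clsBr /bcl -(class_shift (pt 1 m2) 0 (pt 0 m1) 1 t) !ptD /=.
  by rewrite mulNr.
move=> [<- [t [-> ->]]]; rewrite -!/(cls (Pe _ _ _)) !clsPe /pcl.
rewrite -(class_shift (pt b (lo b a c)) _ _ _ (if b == 0 then t else - t)) !ptD /lo /hi.
by case: ifP => _; rewrite ?opprK.
Qed.

Lemma cls_eq x y : valid x -> cls x = cls y -> shifted x y.
Proof. by move=> /cls_ne[f hf] e; apply: (cls_common hf); rewrite -e. Qed.

Lemma cross_shift x y z : shifted x y -> cross x z -> cross y z.
Proof.
case: x y z => [m1 m2|b a c] [n1 n2|b' a' c'] // [l1 l2|d e f] /=.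
- by move=> [t [-> ->]] [s h]; exists (s + t); congr (0 < _): h; ring.
- by move=> [t [-> ->]] [s h]; elim/I2P: d h => /= h; [exists (s - t)|exists (s + t)]; rewrite /co /wt /= in h *; lia.
- by move=> [<- [t [-> ->]]] [s h]; exists (s + t); rewrite mulrDl; lia.
move=> [<- [t [-> ->]]] [<- [s h]]; split=> //; exists (s + t); rewrite mulrDl.
by case: h => -[h1 h2 h3]; [left|right]; split; lia.
Qed.

Lemma cross_sym x y : cross x y -> cross y x.
Proof.
case: x y => [m1 m2|b a c] [n1 n2|b' a' c'] //=.
- by move=> [t h]; exists (- t); congr (0 < _): h; ring.
move=> [<- [t h]]; split=> //; exists (- t); rewrite mulNr.
by case: h => -[h1 h2 h3]; [right|left]; split; lia.
Qed.

Lemma cls_crossing x y : cross x y -> ~ disjoint_arcs (cls x) (cls y).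
Proof.
have bp m1 m2 b a c : cross (Br m1 m2) (Pe b a c) -> ~ disjoint_arcs (cls (Br m1 m2)) (cls (Pe b a c)).
  move=> [t h]; rewrite clsBr clsPe; apply: (@bp_cross _ _ _ _ _ _ (if b == 0 then t else - t)).
  by elim/I2P: b h => h; rewrite /side /= ptD !pt_lt /= /lo /hi /=; rewrite /co /= in h; lia.
case: x y => [m1 m2|b a c] [n1 n2|b' a' c']; first last.
- move=> [<- [t h]]; rewrite !clsPe; pose n := if b == 0 then t else - t.
  have hn : (if b == 0 then n else - n) * w b = t * w b by rewrite /n; case: (b == 0) => //; rewrite opprK.
  case: h => -[h1 h2 h3].
    have [b0|b1] := boolP (b == 0).
      by apply: (@pp_cross _ _ _ _ _ _ n); rewrite ptD hn pt_lt /lo /hi b0.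
    move=> /disjointC; apply: (@pp_cross _ _ _ _ _ _ (- n)); rewrite ptD pt_lt /lo /hi (negbTE b1); rewrite (negbTE b1) in hn; rewrite ?mulNr; lia.
  have [b0|b1] := boolP (b == 0).
    by move=> /disjointC; apply: (@pp_cross _ _ _ _ _ _ (- n)); rewrite ptD pt_lt /lo /hi b0; rewrite b0 in hn; lia.
  by apply: (@pp_cross _ _ _ _ _ _ n); rewrite ptD hn pt_lt /lo /hi (negbTE b1).
- by move=> /cross_sym /bp h /disjointC.
- exact: bp.
move=> [t h]; rewrite !clsBr; apply: (@bb_cross _ _ _ _ _ (- t)); rewrite !ptD /=.
have [h1|h1|h1] := ltrgtP (m2 - n2 + t * q%:Z) 0; last by rewrite h1 mulr0 ltxx in h.
  rewrite nmulr_lgt0 // in h; rewrite pmulr_rlt0 ?subr_lt0 ?subr_gt0 pt_lt /wt /=; lia.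
by rewrite pmulr_lgt0 // in h; rewrite nmulr_rlt0 ?subr_gt0 ?subr_lt0 pt_lt /wt /=; lia.
Qed.

Lemma cls_disjoint x y : valid x -> valid y -> ~ shifted x y -> ~ cross x y -> disjoint_arcs (cls x) (cls y).
Proof.
have bp m1 m2 b a c : a + 2 <= c -> ~ cross (Br m1 m2) (Pe b a c) -> disjoint_arcs (cls (Br m1 m2)) (cls (Pe b a c)).
  move=> ac nc; rewrite clsBr clsPe; apply: bp_disjoint; first exact: pt_lohi.
  move=> n h; apply: nc; exists (if b == 0 then n else - n).
  by elim/I2P: b ac h => ac; rewrite /side /= ptD !pt_lt /= /lo /hi /= /co /=; lia.
case: x y => [m1 m2|b a c] [n1 n2|b' a' c'] vx vy ns nc; first last.
- have [eb|nb] := eqVneq b b'; last first.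
    rewrite !clsPe (_ : side b' = ~~ side b); first by apply: pp_opposite; exact: pt_lohi.
    by rewrite /side; elim/I2P: b nb {ns nc vx}; elim/I2P: b' {vy}.
  rewrite -{}eb in ns nc *; rewrite !clsPe; apply: pp_disjoint; try exact: pt_lohi.
  + move=> n [h1 h2 h3]; apply: nc; split=> //; exists (if b == 0 then n else - n); move: h1 h2 h3.
    by rewrite !ptD !pt_lt /lo /hi; case: (b == 0) => h1 h2 h3; [left|right].
  + move=> n [h1 h2 h3]; apply: nc; split=> //; exists (if b == 0 then n else - n); move: h1 h2 h3.
    by rewrite !ptD !pt_lt /lo /hi; case: (b == 0) => h1 h2 h3; [right|left].
  + move=> n; rewrite !ptD => /pt_inj + /pt_inj h2 => h1; apply: ns; split=> //; exists (- (if b == 0 then n else - n)).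
    by move: h1 h2; rewrite /lo /hi mulNr; case: (b == 0) => h1 h2; lia.
- by apply/disjointC/bp => //; move=> h; apply: nc; exact: cross_sym.
- exact: bp.
rewrite !clsBr; apply: bb_disjoint => n; rewrite !ptD /=.
  rewrite leNgt; apply/negP => h; apply: nc; exists (- n).
  have [h1|h1|h1] := ltrgtP (m2 + - n * q%:Z) n2; last by rewrite h1 subrr mul0r ltxx in h.
    rewrite pmulr_rlt0 ?subr_gt0 ?pt_lt // subr_lt0 pt_lt /wt /= in h.
    by rewrite nmulr_lgt0; lia.
  rewrite nmulr_rlt0 ?subr_lt0 ?pt_lt // subr_gt0 pt_lt /wt /= in h.
  by rewrite pmulr_lgt0; lia.
by rewrite /wt /= mulNr => /pt_inj h1 /pt_inj h2; apply: ns; exists n; rewrite -h1 -h2.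
Qed.

(** For a peripheral arc both conditions say that its length is at most [w b]; a bridging arc never
    crosses its translates. *)
Lemma cls_simple x : valid x -> has_simple_representative (cls x) <-> ~ cross x x.
Proof.
case: x => [m1 m2|b a c] vx.
  rewrite clsBr; split=> _; last exact: br_simple.
  by move=> [t]; rewrite !subrr sub0r add0r mulNr mulrACA oppr_gt0 ltNge mulr_ge0 // -?expr2 ?sqr_ge0.
have lh := pt_lohi b vx; rewrite clsPe; have [h|h] := lerP (c - a) (w b).
  split=> _; last first.
    apply: pe_simple => //; rewrite lerBlDl (ptD _ _ 1) leNgt pt_lt /lo /hi.
    by case: (b == 0); rewrite ?mulN1r ?mul1r; lia.
  have w0 := w_gt0 b; move=> [_ [t]] /= [] [h1 h2 h3].
    have : 0 < t by rewrite -(pmulr_lgt0 t (_ : 0 < w b)) //; lia.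
    by move=> t0; have : w b <= t * w b; [rewrite ler_peMl; lia|lia].
  have : t < 0 by rewrite -(pmulr_llt0 t (_ : 0 < w b)) //; lia.
  by move=> t0; have : w b <= - t * w b; [rewrite ler_peMl; lia|rewrite mulNr; lia].
have nc : cross (Pe b a c) (Pe b a c).
  by split=> //; exists 1; rewrite /= mul1r; left; have := w_gt0 b; split; lia.
split=> // /pe_not_simple; case; rewrite ltrBrDl (ptD _ _ 1) pt_lt /lo /hi.
by case: (b == 0); rewrite ?mulN1r ?mul1r; lia.
Qed.

Lemma is_arcP C : is_arc C <-> exists x, [/\ valid x, ~ cross x x & C = cls x].
Proof.
split=> [[h hs]|[x [vx nx ->]]].
  have [x vx ex] : exists2 x, valid x & C = cls x.
    case: h => [[i [j e]]|[i [j [ij e]]]|[i [j [ij e]]]].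
    - by exists (Br i (- j)) => //=; rewrite opprK.
    - by exists (Pe 0 i j) => //=; lia.
    - by exists (Pe 1 (- j) (- i)) => /=; rewrite ?opprK //; lia.
  by exists x; split=> //; apply/cls_simple => //; rewrite -ex.
split; last exact/cls_simple.
case: x vx {nx} => [m1 m2|b a c] /= h; first by constructor 1; exists m1, (- m2).
by elim/I2P: b => /=; [constructor 2; exists a, c|constructor 3; exists (- c), (- a)]; split=> //; lia.
Qed.
End ArcData.

(** * Tilting sheaves and triangulations *)

Section Dictionary.
Variables (k : closedFieldType) (p q : nat).
Hypotheses (p_gt0 : (0 < p)%N) (q_gt0 : (0 < q)%N).
Local Notation vx := (@vx p q).
Local Notation grmod := (grmod k p q).
Local Notation Qm := (@Qm k p q).
Implicit Types A B M N P X : grmod.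
Local Notation retract := (@retract k p q).
Notation Qx b l y := (Qm (prm_xx k p_gt0 q_gt0 b) l y).
Local Notation w b := ((wt p q b)%:Z).
Local Notation Oc := (@Oc k p q).
Local Notation Pc := (@Pc k p q p_gt0 q_gt0).
Local Notation iso_refl := (iso_refl p_gt0 q_gt0).
Local Notation cross := (@cross p q).
Local Notation shifted := (@shifted p q).

Definition obj (x : arcd) : grmod := match x with Br m1 m2 => Oc m1 m2 | Pe b a c => Pc b a c end.

Lemma obj_indec x : valid x -> indecomposable (obj x).
Proof. by case: x => [m1 m2|b a c] h; [exact: Oc_indec|exact: Pc_indec]. Qed.

Lemma obj_shift x y : shifted x y -> isomorphic (obj x) (obj y).
Proof.
case: x y => [m1 m2|b a c] [n1 n2|b' a' c'] //=.
  move=> [t [e1 e2]]; rewrite (@Oc_iso k p q m1 m2 n1 n2 (- t)); first exact: iso_refl.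
    by rewrite e1 mulNr addrK.
  by rewrite e2 mulNr opprK subrK.
by move=> [<- [t [-> ->]]]; exact: Pc_iso.
Qed.

Lemma obj_ext x y : valid x -> valid y ->
  (Ext1_zero (obj x) (obj y) /\ Ext1_zero (obj y) (obj x)) <-> ~ cross x y.
Proof.
have op m1 m2 b a c : a + 2 <= c -> (Ext1_zero (Oc m1 m2) (Pc b a c) /\ Ext1_zero (Pc b a c) (Oc m1 m2)) <->
    ~ cross (Br m1 m2) (Pe b a c).
  by move=> ac; split=> [[_ /Ext_PO]|h]; [exact|split; [exact: Ext_OP|exact/Ext_PO]].
case: x y => [m1 m2|b a c] [n1 n2|b' a' c'] vx vy; first last.
- have [eb|nb] := eqVneq b b'; last first.
    by split=> [_ [eb]|_]; [rewrite eb eqxx in nb|split; apply: Ext_PP_ne; rewrite // eq_sym].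
  subst b'; rewrite /obj; split=> [[/Ext_PP h1 /Ext_PP h2] [_ [t [h|[h3 h4 h5]]]]|h].
  + by apply: h2 => //; exists t.
  + by apply: h1 => //; exists (- t); rewrite /= mulNr; split; lia.
  split; apply/Ext_PP => // -[t /= h1]; apply: h; split=> //; last by exists t; left.
  by exists (- t); right; case: h1; rewrite mulNr => h1 h2 h3; split; lia.
- by rewrite and_comm; exact: op.
- exact: op.
rewrite /obj; split=> [[/Ext_OO h1 /Ext_OO h2] [t h]|h].
  set X := m1 - n1 - t * p%:Z in h; set Y := m2 - n2 + t * q%:Z in h.
  have [[x0 y0]|[x0 y0]] : (0 < X /\ 0 < Y) \/ (X < 0 /\ Y < 0).
    have [x0|x0|x0] := ltrgtP 0 X; last by rewrite -x0 mul0r ltxx in h.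
      by left; split=> //; rewrite pmulr_rgt0 in h.
    by right; split=> //; rewrite nmulr_rgt0 in h.
    by apply: h1 => //; exists (- t); rewrite !mulNr /X /Y in x0 y0 *; split; lia.
  by apply: h2 => //; exists t; rewrite /X /Y in x0 y0 *; split; lia.
split; apply/Ext_OO => // -[t [h1 h2]]; apply: h; [exists (- t)|exists t].
  by apply: mulr_gt0; rewrite mulNr; lia.
by rewrite -mulrNN; apply: mulr_gt0; lia.
Qed.

(** Nonzero morphisms in both directions identify the degrees of two line bundles. Peripheral arcs
    without self-crossing have length at most [w b], and then residues determine both ends up to
    translation. *)
Lemma obj_iso x y : valid x -> valid y -> ~ cross x x -> ~ cross y y -> isomorphic (obj x) (obj y) -> shifted x y.
Proof.
have op m1 m2 b a c : a + 2 <= c -> isomorphic (Pc b a c) (Oc m1 m2) -> False.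
  move=> ac h; have [nz _] := Pc_indec k p_gt0 q_gt0 b ac.
  by apply: (iso_retract_ne p_gt0 q_gt0 h nz); exact: Hom_PO.
have short b a c : a + 2 <= c -> ~ cross (Pe b a c) (Pe b a c) -> c - a <= w b.
  move=> ac h; rewrite leNgt; apply/negP => h'; apply: h; split=> //; exists 1; left; rewrite /= mul1r.
  by have : 0 < w b; [rewrite /wt; case: ifP|split; lia].
case: x y => [m1 m2|b a c] [n1 n2|b' a' c'] vx vy nx ny; rewrite /obj => e.
- have [nz _] := Oc_indec k p_gt0 q_gt0 m1 m2; have [nz' _] := Oc_indec k p_gt0 q_gt0 n1 n2.
  have [t [h1 h2]] : exists t : int, m1 + t * p%:Z <= n1 /\ m2 - t * q%:Z <= n2.
    by apply: contrapT => h; apply: (iso_retract_ne p_gt0 q_gt0 e nz); exact/Hom_OO.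
  have [s [h3 h4]] : exists t : int, n1 + t * p%:Z <= m1 /\ n2 - t * q%:Z <= m2.
    by apply: contrapT => h; apply: (iso_retract_ne p_gt0 q_gt0 (iso_sym e) nz'); exact/Hom_OO.
  have st : s = - t.
    have h5 : (s + t) * p%:Z <= 0 by lia.
    have h6 : 0 <= (s + t) * q%:Z by lia.
    have h7 : s + t <= 0 by nia.
    have h8 : 0 <= s + t by nia.
    lia.
  by exists t; move: h3 h4; rewrite st !mulNr => h3 h4; split; lia.
- by case: (op m1 m2 b' a' c' vy (iso_sym e)).
- by case: (op n1 n2 b a c vx e).
have [nz _] := Pc_indec k p_gt0 q_gt0 b vx.
have [eb|nb] := eqVneq b b'; last first.
  by case: (iso_retract_ne p_gt0 q_gt0 e nz); exact: Hom_PP_ne.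
subst b'; split=> //; have l := short _ _ _ vx nx; have l' := short _ _ _ vy ny; have v1 : a + 2 <= c := vx; have v2 : a' + 2 <= c' := vy.
have [r1 r2] := iso_retract e.
(* The residues of the twists m with Hom(O(m), Pc b a c) <> 0 determine the arc. *)
have key (m : int) : (exists t : int, a + 1 < m + t * w b <= c) <-> exists t : int, a' + 1 < m + t * w b <= c'.
  have tr A B : retract A B -> forall X, Hom_zero X B -> Hom_zero X A.
    by move=> r X; apply: (Hom_ret p_gt0 q_gt0 _ r); exact: retract_refl.
  pose m1 := if b == 0 then m else 0; pose m2 := if b == 0 then 0 else m.
  have hm : co b m1 m2 = m := co_if b m.
  split=> h; apply: contrapT => h'.
    have /(tr _ _ r1) : Hom_zero (Oc m1 m2) (Pc b a' c') by apply/Hom_OP; rewrite ?hm.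
    by move/Hom_OP; rewrite hm; apply.
  have /(tr _ _ r2) : Hom_zero (Oc m1 m2) (Pc b a c) by apply/Hom_OP; rewrite ?hm.
  by move/Hom_OP; rewrite hm; apply.
have w0 : 0 < w b by rewrite /wt; case: ifP.
(* A window of residues this short misses its neighbours [u + 1] and [v + 1]; these will pin down
   the ends. *)
have out (u v m : int) : v - u <= w b -> (m = u + 1 \/ m = v + 1) -> ~ exists t : int, u + 1 < m + t * w b <= v.
  move=> uv hm [t ht]; have [t0|t0] := lerP t 0.
    have : t * w b <= 0 by nia.
    move=> h; have t1 : t <> 0 by move=> et; rewrite et mul0r in ht; lia.
    have : t * w b <= - w b by nia.
    lia.
  have : w b <= t * w b by nia.
  lia.
have [t ht] : exists t : int, a' + 1 < c + t * w b <= c' by apply/key; exists 0; lia.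
have [s hs] : exists t : int, a' + 1 < a + 2 + t * w b <= c' by apply/key; exists 0; lia.
have ec : c + t * w b = c'.
  apply: contrapT => ne; apply: (out a c (c + 1) l); first by right.
  by apply/key; exists t; lia.
have ea : a + s * w b = a'.
  apply: contrapT => ne; apply: (out a c (a + 1) l); first by left.
  by apply/key; exists s; lia.
exists t; split; last by rewrite ec.
have : s = t by apply: contrapT => ne; have : (t - s) * w b < w b by [lia]; have : (s - t) * w b < w b by [lia]; nia.
by move=> <-.
Qed.

Lemma Qx_exc_res b (i i' : int) j : (0 < j)%N -> res b (vx b *~ i - vx b *~ i') 0 ->
  is_exc_uniserial b i j (Qx b j (vx b *~ i')).
Proof.
move=> j0 h; split; [exact: Q_uniserial|exact: Q_has_length|].
exists (Qx b 1 (vx b *~ i)); first exact: Qx_exc_simple.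
apply: (top_iso p_gt0 q_gt0 (res_iso k p_gt0 q_gt0 j h)); exact: Q_is_top.
Qed.

Section Phi.
Variable R : realType.
Local Notation bridging := (@bridging R p q).
Local Notation inner_peripheral := (@inner_peripheral R p).
Local Notation outer_peripheral := (@outer_peripheral R q).
Local Notation cls := (@cls R p q).
Local Notation is_phi := (@is_phi R p q k).

Lemma cls_inner a c : inner_peripheral a c = cls (Pe 0 a c). Proof. by []. Qed.
Lemma cls_outer (i : int) (j : nat) : outer_peripheral (- i) (j%:Z - i + 1) = cls (Pe 1 (i - j%:Z - 1) i).
Proof. by rewrite /cls /= opprB; congr outer_peripheral; ring. Qed.
Lemma cls_bridging i j : bridging i j = cls (Br i (- j)).
Proof. by rewrite /cls opprK. Qed.

(** Each class is sent to the object of one chosen code; any other code is a translate, which leads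
    to an isomorphic object. *)
Lemma phi_exists : exists phi, is_phi phi.
Proof.
pose rep C := xget (Br 0 0) [set x | valid x /\ cls x = C].
have hrep x : valid x -> shifted x (rep (cls x)).
  move=> vx; have [vy e] : [set z | valid z /\ cls z = cls x] (rep (cls x)) by apply: xgetPex; exists x.
  by apply: (cls_eq p_gt0 q_gt0 vx (esym e)).
have hper b (i : int) j : (1 <= j)%N -> is_exc_uniserial b i j (obj (rep (cls (Pe b (i - j%:Z - 1) i)))).
  move=> j0; have /hrep : valid (Pe b (i - j%:Z - 1) i) by rewrite /=; lia.
  case: (rep _) => // b' a' c' [<- [t [-> ->]]] /=.
  rewrite /Pc (_ : absz _ = j); last by lia.
  apply: Qx_exc_res => //; rewrite -mulrzBr vx_co; apply/res_co => //; exists (- t); rewrite co_if mulNr; lia.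
exists (fun C => obj (rep C)); split=> [i j|i j hj|i j hj].
- rewrite cls_bridging; have /obj_shift/iso_sym := hrep (Br i (- j)) isT; rewrite /= /Oc.
  by rewrite mulrNz.
- by rewrite cls_inner; exact: hper.
- by rewrite cls_outer; exact: hper.
Qed.

Lemma phi_obj phi x : is_phi phi -> valid x -> isomorphic (phi (cls x)) (obj x).
Proof.
move=> [h1 h2 h3]; case: x => [m1 m2|b a c] vx.
  by have := h1 m1 (- m2); rewrite mulrNz opprK cls_bridging opprK.
have [j [j0 ea]] : exists j : nat, (0 < j)%N /\ a = c - j%:Z - 1.
  by exists (absz (c - a - 1)%R); move: vx; rewrite /=; lia.
rewrite ea /obj (Pc_exc k p_gt0 q_gt0) //; apply: exc_uniserial_iso => //.
elim/I2P: b {vx}; first by rewrite -cls_inner; exact: h2.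
by rewrite -cls_outer; exact: h3.
Qed.
End Phi.
End Dictionary.

(** * Maximal and generating collections of arcs *)

Section Bijection.
Variables (k : closedFieldType) (p q : nat).
Hypotheses (p_gt0 : (0 < p)%N) (q_gt0 : (0 < q)%N).
Local Notation xx := (@xx k).
Local Notation vx := (@vx p q).
Local Notation grmod := (grmod k p q).
Local Notation Qm := (@Qm k p q).
Implicit Types A B M N P X : grmod.
Local Notation retract := (@retract k p q).
Local Notation w b := ((wt p q b)%:Z).
Local Notation cross := (@cross p q).
Local Notation shifted := (@shifted p q).
Local Notation obj := (@obj k p q p_gt0 q_gt0).

Section Collection.
Variable D : arcd -> Prop.
Hypothesis Dv : forall x, D x -> valid x.
Hypothesis Dsh : forall x y, shifted x y -> D x -> D y.
Hypothesis Dnc : forall x y, D x -> D y -> ~ cross x y.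
Let B m1 m2 := D (Br m1 m2).
Let I b a c := D (Pe b a c).

Let w_gt0 b : 0 < w b. Proof. by rewrite /wt; case: ifP. Qed.

Lemma Bper m1 m2 (t : int) : B m1 m2 -> B (m1 + t * p%:Z) (m2 - t * q%:Z).
Proof. by apply: Dsh; exists t. Qed.
Lemma Iper b a c (t : int) : I b a c -> I b (a + t * w b) (c + t * w b).
Proof. by apply: Dsh; split=> //; exists t. Qed.
Lemma Ilen b a c : I b a c -> a + 2 <= c.
Proof. exact: Dv. Qed.
Lemma nBB m1 m2 n1 n2 : B m1 m2 -> B n1 n2 -> (m1 - n1) * (m2 - n2) <= 0.
Proof.
move=> h h'; rewrite leNgt; apply/negP => h2; apply: (Dnc h h'); exists 0.
by rewrite !mul0r subr0 addr0.
Qed.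
Lemma nBI m1 m2 b a c : B m1 m2 -> I b a c -> ~ (a < co b m1 m2 < c).
Proof. by move=> h h' h2; apply: (Dnc h h'); exists 0; rewrite mul0r addr0. Qed.
Lemma nII b a c a' c' : I b a c -> I b a' c' -> ~ [/\ a < a', a' < c & c < c'].
Proof. by move=> h h' [h1 h2 h3]; apply: (Dnc h h'); split=> //; exists 0; left; rewrite /= mul0r !addr0. Qed.

Definition maximal := forall x, valid x -> ~ cross x x -> (forall y, D y -> ~ cross x y) -> D x.
Definition generating := forall X, ~ is_zero X -> exists x, D x /\ ~ (Hom_zero (obj x) X /\ Ext1_zero (obj x) X).

Section FromMaximal.
Hypothesis DM : maximal.

Lemma MB n1 n2 : (forall m1 m2, B m1 m2 -> (m1 - n1) * (m2 - n2) <= 0) ->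
  (forall b a c, I b a c -> ~ (a < co b n1 n2 < c)) -> B n1 n2.
Proof.
move=> hB hI; apply: DM => //.
  move=> [t]; rewrite !subrr sub0r add0r => h.
  by have [t0|t0] := lerP 0 t; nia.
move=> [m1 m2|b a c] hy [t h].
  have := hB _ _ (Bper t hy); rewrite leNgt; case/negP; rewrite -mulrNN.
  by congr (0 < _): h; ring.
by apply: (hI _ _ _ (Iper (- t) hy)); rewrite mulNr; lia.
Qed.

Lemma MI b x y : x + 2 <= y -> y - x <= w b -> (forall m1 m2, B m1 m2 -> ~ (x < co b m1 m2 < y)) ->
  (forall a c, I b a c -> ~ [/\ a < x, x < c & c < y] /\ ~ [/\ x < a, a < y & y < c]) -> I b x y.
Proof.
move=> xy yx hB hI; have w0 := w_gt0 b; apply: DM => //.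
  move=> [_ [t /= h]]; have [t0|t0] := lerP t 0.
    have [e|ne] := eqVneq t 0; first by rewrite e mul0r in h; case: h => -[*]; lia.
    have : t * w b <= - w b by nia.
    by move=> h'; case: h => -[*]; lia.
  have : w b <= t * w b by nia.
  by move=> h'; case: h => -[*]; lia.
move=> [m1 m2|b' a c] hy.
  move=> [t h]; apply: (hB _ _ (Bper (if b == 0 then t else - t) hy)).
  by move: h; rewrite /co /wt; case: (b == 0); rewrite ?mulNr ?opprK.
by move=> [eb [t h]]; subst b'; have [h1 h2] := hI _ _ (Iper t hy); case: h.
Qed.

Let h2 : consec_cond B I. Proof. exact: (max_consec p_gt0 q_gt0 Bper nBI MI). Qed.
Let h3 : split_cond I. Proof. exact: (max_split p_gt0 q_gt0 Iper Ilen nBI nII MI). Qed.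

Lemma maximal_bridging : exists m1 m2, B m1 m2.
Proof. exact: (max_bridging p_gt0 q_gt0 Iper Ilen nII MB). Qed.

(** By [nonzero_co] a nonzero sheaf has a summand of one of three kinds. They are detected by
    [max_genO], by [gen_peripheral] and, at ordinary points, by any bridging arc. *)
Lemma maximal_generating : generating.
Proof.
have HR A Y X : retract A X -> ~ Hom_zero Y A -> ~ Hom_zero Y X.
  by move=> r h h'; apply: h; apply: Hom_ret h' => //; exact: retract_refl.
have ER A Y X : retract A X -> ~ Ext1_zero Y A -> ~ Ext1_zero Y X.
  by move=> r h h'; apply: h; apply: Ext_ret_r h'.
move=> X /(nonzero_co p_gt0 q_gt0)[[n1 [n2 r]]|[b [a [c [ac r]]]]|[f [d [b [hf [l [y [fo l0 r]]]]]]]].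
- have [[m1 [m2 [hm m1n m2n]]]|[m1 [m2 [hm m1n m2n]]]|[b [a [c [hI hc]]]]] := max_genO p_gt0 q_gt0 MB n1 n2.
  + exists (Br m1 m2); split=> // -[h _]; move: h; apply: (HR _ _ _ r) => /Hom_OO; apply=> //.
    by exists 0; rewrite !mul0r addr0 subr0.
  + exists (Br m1 m2); split=> // -[_ h]; move: h; apply: (ER _ _ _ r) => /Ext_OO; apply=> //.
    by exists 0; rewrite !mul0r addr0 subr0.
  exists (Pe b a c); split=> // -[_ h]; move: h; apply: (ER _ _ _ r) => /Ext_PO; apply=> //; first exact: Dv hI.
  by exists 0; rewrite mul0r addr0.
- have [[m1 [m2 [hm h]]]|[a' [c' [hI h4 h5 h6]]]|[a' [c' [hI h4 h5 h6]]]] := gen_peripheral p_gt0 q_gt0 Bper Ilen maximal_bridging h2 h3 b ac.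
  + exists (Br m1 m2); split=> // -[h' _]; move: h'; apply: (HR _ _ _ r) => /Hom_OP; apply=> //.
    by exists 0; rewrite mul0r addr0.
  + exists (Pe b a' c'); split=> // -[h' _]; move: h'; apply: (HR _ _ _ r) => /Hom_PP; apply=> //; first exact: Dv hI.
    by exists 0; rewrite /= mul0r !addr0.
  exists (Pe b a' c'); split=> // -[_ h']; move: h'; apply: (ER _ _ _ r) => /Ext_PP; apply=> //; first exact: Dv hI.
  by exists 0; rewrite /= mul0r !addr0.
have [m1 [m2 hm]] := maximal_bridging; exists (Br m1 m2); split=> // -[h _]; move: h.
by apply: (HR _ _ _ r); exact: ordinary_HomO.
Qed.
End FromMaximal.

Lemma generating_maximal : generating -> maximal.
Proof.
move=> gen.
(* The sheaf at the ordinary point with parameter 1 is orthogonal to all exceptional torsion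
   sheaves, so only a bridging arc can detect it. *)
have B0 : exists m1 m2, B m1 m2.
  have fo := ordinary_ff k p_gt0 q_gt0; set hf := prm_ff p_gt0 q_gt0 (oner_neq0 k).
  have [|[m1 m2|b a c] [hx h]] := gen (Qm hf 1 0); first by have [] := Q_indec p_gt0 q_gt0 hf 0 (ltn0Sn 0).
    by exists m1, m2.
  have cop : mprim (xx b) (ff p q (1 : k)) by case: fo => h1 h2'; elim/I2P: (b); exact: mprimC.
  by case: h; split; [exact: HomQQ_cop|exact: ExtQQ_cop].
have nz X Y : ~ (Hom_zero X Y /\ Ext1_zero X Y) -> ~ Hom_zero X Y \/ ~ Ext1_zero X Y.
  by move=> h; have [h1|h1] := pselect (Hom_zero X Y); [right=> h1'; exact: h|left].
have gO n1 n2 : [\/ exists m1 m2, [/\ B m1 m2, m1 <= n1 & m2 <= n2],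
    exists m1 m2, [/\ B m1 m2, n1 < m1 & n2 < m2] |
    exists b a c, I b a c /\ a < co b n1 n2 < c].
  have [zO _] := Oc_indec k p_gt0 q_gt0 n1 n2.
  have [[m1 m2|b a c] [hx /nz h]] := gen _ zO.
    case: h => h.
      have [t [h1 h2]] : exists t : int, m1 + t * p%:Z <= n1 /\ m2 - t * q%:Z <= n2.
        by apply: contrapT => h'; apply: h; exact/Hom_OO.
      by constructor 1; exists (m1 + t * p%:Z), (m2 - t * q%:Z); split=> //; exact: Bper.
    have [t [h1 h2]] : exists t : int, n1 < m1 + t * p%:Z /\ n2 < m2 - t * q%:Z.
      by apply: contrapT => h'; apply: h; exact/Ext_OO.
    by constructor 2; exists (m1 + t * p%:Z), (m2 - t * q%:Z); split=> //; exact: Bper.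
  case: h => h; first by case: h; exact: Hom_PO.
  have [t ht] : exists t : int, a < co b n1 n2 + t * w b < c.
    by apply: contrapT => h'; apply: h; apply/Ext_PO => //; exact: Dv hx.
  constructor 3; exists b, (a + (- t) * w b), (c + (- t) * w b); split; first exact: Iper.
  by rewrite mulNr; lia.
have gS b a c : a + 2 <= c ->
    [\/ exists m1 m2, B m1 m2 /\ a + 1 < co b m1 m2 <= c,
      exists a' c', [/\ I b a' c', a' <= a, a + 1 < c' & c' <= c] |
      exists a' c', [/\ I b a' c', a < a', a' < c & c < c']].
  move=> ac; have [zP _] := Pc_indec k p_gt0 q_gt0 b ac.
  have [[m1 m2|b' a' c'] [hx /nz h]] := gen _ zP.
    case: h => h; last by case: h; exact: Ext_OP.
    have [t ht] : exists t : int, a + 1 < co b m1 m2 + t * w b <= c.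
      by apply: contrapT => h'; apply: h; exact/Hom_OP.
    pose s := if b == 0 then t else - t.
    constructor 1; exists (m1 + s * p%:Z), (m2 - s * q%:Z); split; first exact: Bper.
    by move: ht; rewrite /s /co /wt; case: (b == 0); rewrite ?mulNr ?opprK.
  have [eb|nb] := eqVneq b' b; last by case: h => -[]; [exact: Hom_PP_ne|exact: Ext_PP_ne].
  subst b'; have vx := Dv hx; case: h => h.
    have [t [h1 h2 h3]] : exists t : int, let s := t * w b in [/\ a' + s <= a, a + 1 < c' + s & c' + s <= c].
      by apply: contrapT => h'; apply: h; exact/Hom_PP.
    by constructor 2; exists (a' + t * w b), (c' + t * w b); split=> //; exact: Iper.
  have [t [h1 h2 h3]] : exists t : int, let s := t * w b in [/\ a < a' + s, a' + s < c & c < c' + s].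
    by apply: contrapT => h'; apply: h; exact/Ext_PP.
  by constructor 3; exists (a' + t * w b), (c' + t * w b); split=> //; exact: Iper.
have h2 : consec_cond B I := gen_consec p_gt0 q_gt0 Ilen nBI nII gS.
have h3 : split_cond I := gen_split p_gt0 q_gt0 Ilen nBI nII gS.
move=> [n1 n2|b x y] vx _ hc.
  apply: (gen_maxB p_gt0 q_gt0 Bper Ilen nBB nBI nII B0 gO gS).
    move=> m1 m2 hm; rewrite leNgt; apply/negP => h; apply: (hc _ hm); exists 0.
    by congr (0 < _): h; ring.
  by move=> b a c hI h; apply: (hc _ hI); exists 0; rewrite mul0r addr0.
apply: (max_peripheral p_gt0 q_gt0 Bper Ilen B0 h2 h3) => //.
  by move=> m1 m2 hm h; apply: (hc _ hm); exists 0; rewrite mul0r addr0.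
move=> a c hI; split=> -[h4 h5 h6]; apply: (hc _ hI); split=> //; exists 0; rewrite /= mul0r !addr0; [right|left]; split; lia.
Qed.
End Collection.

Section Triangulations.
Variable R : realType.
Local Notation K := (set (R -> annulus R)).
Local Notation cls := (@cls R p q).
Local Notation noncrossing := (@noncrossing R p q).
Local Notation triangulation := (@triangulation R p q).
Implicit Type G : set K.

(** All codes of each arc are kept, which gives the periodicity required by the combinatorial
    lemmas. *)
Definition arcs_of G (x : arcd) : Prop := valid x /\ G (cls x).

Lemma arcs_ofP G C : noncrossing G -> G C -> exists2 x, arcs_of G x & C = cls x.
Proof. by move=> [ha _] hC; have /(is_arcP p_gt0 q_gt0)[x [vx _ e]] := ha _ hC; exists x; rewrite /arcs_of -?e. Qed.

Lemma valid_shift x y : shifted x y -> valid x -> valid y.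
Proof. by case: x y => [m1 m2|b a c] [n1 n2|b' a' c'] //= [_ [t [-> ->]]]; lia. Qed.

Lemma arcs_of_shift G x y : shifted x y -> arcs_of G x -> arcs_of G y.
Proof. by move=> h [vx hx]; split; [exact: valid_shift h vx|rewrite -(cls_shifted R p_gt0 q_gt0 h)]. Qed.

Lemma arcs_of_nc G x y : noncrossing G -> arcs_of G x -> arcs_of G y -> ~ cross x y.
Proof.
move=> [ha hn] [vx hx] [vy hy] h; have [e|ne] := pselect (cls x = cls y).
  have [_ /(cls_simple R p_gt0 q_gt0 vy)] := ha _ hy; apply.
  exact: (cross_shift p_gt0 q_gt0 (cls_eq p_gt0 q_gt0 vx e) h).
exact: (cls_crossing p_gt0 q_gt0 h) (hn _ _ hx hy ne).
Qed.

Lemma triangulation_maximal G : triangulation G -> maximal (arcs_of G).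
Proof.
move=> [nG mG] x vx nx hx; split=> //; suff <- : G `|` [set cls x] = G by right.
apply: mG; last by move=> C; left.
have [ha hn] := nG; split.
  by move=> C [/ha//|->]; apply/(is_arcP p_gt0 q_gt0); exists x.
have aux C : G C -> C <> cls x -> disjoint_arcs C (cls x).
  move=> hC; have [y hy eC] := arcs_ofP nG hC; rewrite eC => ne.
  apply: (cls_disjoint R p_gt0 q_gt0) => //; first exact: hy.1.
    by move/(cls_shifted R p_gt0 q_gt0).
  by move/(cross_sym p_gt0 q_gt0); exact: hx.
move=> C C' [hC|->] [hC'|->] // ne; first exact: hn.
  exact: aux.
by apply: disjointC; apply: aux => // e; apply: ne.
Qed.

Lemma maximal_triangulation G : noncrossing G -> maximal (arcs_of G) -> triangulation G.
Proof.
move=> nG mG; split=> // G' nG' sG; apply/seteqP; split=> // C hC.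
have [x hx eC] := arcs_ofP nG' hC; rewrite eC; suff [] : arcs_of G x by [].
apply: mG; [exact: hx.1|exact: (arcs_of_nc nG' hx hx)|].
by move=> y [vy hy]; apply: (arcs_of_nc nG' hx); split=> //; exact: sG.
Qed.

(** Up to translation a peripheral arc has finitely many positions and lengths. Bridging arcs are
    indexed by m1 - m2 modulo p + q: for two with the same m1 - m2 the product that tests crossing
    is a square, so they coincide. *)
Lemma noncrossing_finite G : noncrossing G -> finite_set G.
Proof.
move=> nG; have nc x y := @arcs_of_nc G x y nG.
pose br (n : nat) := cls (xget (Br 0 0) [set x | arcs_of G x /\ exists m1 m2 : int, x = Br m1 m2 /\ m1 - m2 = n]).
pose pe b (z : nat * nat) := cls (Pe b z.1%:Z (z.1%:Z + z.2%:Z)).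
pose P b := `I_(wt p q b) `*` `I_(wt p q b).+1.
apply: (@sub_finite_set _ _ (br @` `I_(p + q) `|` (pe 0 @` P 0 `|` pe 1 @` P 1))); last first.
  by rewrite !finite_setU; split; [|split]; apply: finite_image; rewrite /P; try apply: finite_setX; exact: finite_II.
have hpe b a c : arcs_of G (Pe b a c) -> (pe b @` P b) (cls (Pe b a c)).
  move=> h; have w0 : 0 < w b by rewrite /wt; case: ifP.
  pose t := (a %/ w b)%Z; have et : a = (a %/ w b)%Z * w b + (a %% w b)%Z := divz_eq _ _.
  have r1 : (0 <= (a %% w b)%Z) by apply: modz_ge0; lia.
  have r2 : ((a %% w b)%Z < w b) by apply: ltz_pmod.
  have l1 : c - a <= w b.
    rewrite leNgt; apply/negP => l; apply: (nc _ _ h h); split=> //; exists 1; left; rewrite /= mul1r.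
    by have := h.1; rewrite /=; split; lia.
  have l2 : a + 2 <= c := h.1.
  exists (absz (a %% w b)%Z, absz (c - a)%R); first by split=> /=; lia.
  rewrite /pe; apply: esym; apply: (cls_shifted R p_gt0 q_gt0); split=> //; exists (- t).
  have a0 : `|(a %% w b)%Z|%N = (a %% w b)%Z :> int by rewrite gez0_abs.
  have c0 : `|(c - a)%R|%N = c - a :> int by rewrite gez0_abs //; lia.
  by rewrite /fst /snd a0 c0 mulNr /t; split; lia.
move=> C hC; have [[m1 m2|b a c] hx ->] := arcs_ofP nG hC; last first.
  by right; elim/I2P: b hx => /hpe; [left|right].
left; have pq0 : (0 : int) < (p + q)%N by lia.
pose t := ((m1 - m2) %/ (p + q)%N)%Z; have et : m1 - m2 = t * (p + q)%N + ((m1 - m2) %% (p + q)%N)%Z := divz_eq _ _.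
have r1 : (0 <= ((m1 - m2) %% (p + q)%N)%Z) by apply: modz_ge0; lia.
have r2 : (((m1 - m2) %% (p + q)%N)%Z < (p + q)%N) by apply: ltz_pmod.
set r := ((m1 - m2) %% _)%Z in et r1 r2.
have sh : shifted (Br m1 m2) (Br (m1 - t * p%:Z) (m2 + t * q%:Z)).
  by exists (- t); rewrite !mulNr opprK.
exists (absz r); first by rewrite /=; lia.
have [hg [n1 [n2 [eg hn]]]] : [set x | arcs_of G x /\ exists m1 m2 : int, x = Br m1 m2 /\ m1 - m2 = absz r]
    (xget (Br 0 0) [set x | arcs_of G x /\ exists m1 m2 : int, x = Br m1 m2 /\ m1 - m2 = absz r]).
  apply: xgetPex; exists (Br (m1 - t * p%:Z) (m2 + t * q%:Z)); split; first exact: arcs_of_shift hx.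
  by exists (m1 - t * p%:Z), (m2 + t * q%:Z); split=> //; rewrite PoszD mulrDr in et; lia.
rewrite (cls_shifted R p_gt0 q_gt0 sh) /br eg.
have := arcs_of_shift sh hx; set u := m1 - _; set v := m2 + _ => huv.
have e : u - v = n1 - n2 by rewrite hn /u /v; rewrite PoszD mulrDr in et; lia.
have := nc _ _ hg huv; rewrite eg => nc'.
have d0 : n1 = u.
  apply: contrapT => ne; apply: nc'; exists 0; rewrite !mul0r subr0 addr0.
  have -> : n2 - v = n1 - u by lia.
  by rewrite -expr2 lt_def sqrf_eq0 subr_eq0 sqr_ge0 andbT; apply/eqP.
by congr (cls (Br _ _)); lia.
Qed.

End Triangulations.
End Bijection.

(** * The bijection between triangulations and tilting sheaves *)

Section Correspondence.
Variables (k : closedFieldType) (p q : nat).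
Hypotheses (p_gt0 : (0 < p)%N) (q_gt0 : (0 < q)%N).
Local Notation vx := (@vx p q).
Local Notation grmod := (grmod k p q).
Implicit Types A B M N P X : grmod.
Local Notation retract := (@retract k p q).
Local Notation iso_trans := (iso_trans p_gt0 q_gt0).
Local Notation iso_refl := (iso_refl p_gt0 q_gt0).
Local Notation cross := (@cross p q).
Local Notation obj := (@obj k p q p_gt0 q_gt0).
Local Notation generating := (@generating k p q p_gt0 q_gt0).
Local Notation maximal := (@maximal p q).

Variable R : realType.
Local Notation K := (set (R -> annulus R)).
Local Notation cls := (@cls R p q).
Local Notation arcs_of := (@arcs_of p q R).
Local Notation noncrossing := (@noncrossing R p q).
Local Notation triangulation := (@triangulation R p q).
Implicit Type G : set K.

Lemma indec_iso A B : isomorphic A B -> indecomposable A -> indecomposable B.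
Proof.
move=> e [nz h]; split; first by move=> zB; apply: nz; exact: (is_zero_iso p_gt0 q_gt0 (iso_sym e)).
by move=> A' B' e'; apply: h; exact: iso_trans e e'.
Qed.

Lemma arcs_of_gen G : noncrossing G -> maximal (arcs_of G) -> generating (arcs_of G).
Proof.
move=> nG mG; apply: maximal_generating => //; first by move=> x [].
  by move=> x y; exact: arcs_of_shift.
by move=> x y; exact: arcs_of_nc.
Qed.

Lemma gen_arcs_of G : noncrossing G -> generating (arcs_of G) -> maximal (arcs_of G).
Proof.
move=> nG; apply: generating_maximal => //; first by move=> x [].
  by move=> x y; exact: arcs_of_shift.
by move=> x y; exact: arcs_of_nc.
Qed.

Lemma enum_fsetP G C : finite_set G -> (C \in finmap.enum_fset (fset_set G)) <-> G C.
Proof. by move=> fG; split=> [|h]; [rewrite in_fset_set // => /set_mem|rewrite in_fset_set //; exact: mem_set]. Qed.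

Section Phi.
Variable phi : K -> grmod.
Hypothesis hphi : is_phi phi.
Let phiE x : valid x -> isomorphic (phi (cls x)) (obj x) := phi_obj p_gt0 q_gt0 hphi.

Lemma phi_ret G C : finite_set G -> G C -> retract (phi C) (phi_sum phi G).
Proof. by move=> fG /(enum_fsetP _ fG); exact: nth_dsum. Qed.

Lemma obj_ret G x : finite_set G -> arcs_of G x -> retract (obj x) (phi_sum phi G).
Proof.
move=> fG [vx hx]; apply: (retract_trans p_gt0 q_gt0) (phi_ret fG hx); exact: (iso_retract (phiE vx)).2.
Qed.

Lemma ext_transport A A' B B' : isomorphic A A' -> isomorphic B B' -> Ext1_zero A' B' -> Ext1_zero A B.
Proof.
move=> e e' h; apply: (Ext_ret_l p_gt0 q_gt0 (iso_retract e).1).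
exact: (Ext_ret_r p_gt0 q_gt0 (iso_retract e').1 h).
Qed.

Lemma phi_sum_tilting G : triangulation G -> tilting (phi_sum phi G).
Proof.
move=> tG; have nG := tG.1; have fG := noncrossing_finite p_gt0 q_gt0 nG; split.
  apply: Ext_dsum_seq_l => // C /(enum_fsetP _ fG) hC; apply: Ext_dsum_seq_r => // C' /(enum_fsetP _ fG) hC'.
  have [x hx ->] := arcs_ofP p_gt0 q_gt0 nG hC; have [y hy ->] := arcs_ofP p_gt0 q_gt0 nG hC'.
  apply: ext_transport (phiE hx.1) (phiE hy.1) _.
  by have [] := (obj_ext k p_gt0 q_gt0 hx.1 hy.1).2 (arcs_of_nc p_gt0 q_gt0 nG hx hy).
move=> X hX eX; apply: contrapT => nX.
have [x [hx h]] := arcs_of_gen nG (triangulation_maximal p_gt0 q_gt0 tG) nX.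
have r := obj_ret fG hx; apply: h; split; last exact: Ext_ret_l r eX.
by apply: (Hom_ret p_gt0 q_gt0 r _ hX); exact: retract_refl.
Qed.

Lemma phi_sum_mf G : noncrossing G -> multiplicity_free (phi_sum phi G).
Proof.
move=> nG; have fG := noncrossing_finite p_gt0 q_gt0 nG; set s := finmap.enum_fset (fset_set G).
have us : uniq s by exact: finmap.fset_uniq.
exists (map phi s); rewrite size_map; split; last exact: iso_refl.
  move=> i hi; rewrite (nth_map set0) //.
  have /(enum_fsetP _ fG) hC := mem_nth set0 hi; have [x hx ->] := arcs_ofP p_gt0 q_gt0 nG hC.
  by apply: indec_iso (iso_sym (phiE hx.1)) _; apply: obj_indec; exact: hx.1.
move=> i j /andP[ij hj]; have hi := ltn_trans ij hj; rewrite !(nth_map set0) // => e.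
have /(enum_fsetP _ fG) hC := mem_nth set0 hi; have /(enum_fsetP _ fG) hC' := mem_nth set0 hj.
have [x hx ex] := arcs_ofP p_gt0 q_gt0 nG hC; have [y hy ey] := arcs_ofP p_gt0 q_gt0 nG hC'.
suff : nth set0 s i == nth set0 s j by rewrite nth_uniq // (ltn_eqF ij).
rewrite ex ey; apply/eqP/(cls_shifted R p_gt0 q_gt0).
apply: (obj_iso (k := k) (p_gt0 := p_gt0) (q_gt0 := q_gt0) hx.1 hy.1); [exact: (arcs_of_nc p_gt0 q_gt0 nG hx hx)|exact: (arcs_of_nc p_gt0 q_gt0 nG hy hy)|].
apply: iso_trans (iso_sym (phiE hx.1)) _; apply: iso_trans (phiE hy.1).
by rewrite -ex -ey.
Qed.

(** As the sums are isomorphic, Ext^1 vanishes both ways between the sheaf of an arc of one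
    triangulation and those of the other. So the arc crosses nothing there, and it belongs to the
    other triangulation by maximality. *)
Lemma phi_sum_inj G G' : triangulation G -> triangulation G' ->
  isomorphic (phi_sum phi G) (phi_sum phi G') -> G = G'.
Proof.
have sub G1 G2 : triangulation G1 -> triangulation G2 -> isomorphic (phi_sum phi G1) (phi_sum phi G2) -> G2 `<=` G1.
  move=> t1 t2 e C hC; have f1 := noncrossing_finite p_gt0 q_gt0 t1.1; have f2 := noncrossing_finite p_gt0 q_gt0 t2.1.
  have [y hy ->] := arcs_ofP p_gt0 q_gt0 t2.1 hC; have [eT _] := phi_sum_tilting t1.
  suff [] : arcs_of G1 y by [].
  apply: (triangulation_maximal p_gt0 q_gt0 t1); [exact: hy.1|exact: (arcs_of_nc p_gt0 q_gt0 t2.1 hy hy)|].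
  move=> x hx; apply/(obj_ext k p_gt0 q_gt0 hy.1 hx.1).
  have r1 := obj_ret f1 hx; have r2 := retract_trans p_gt0 q_gt0 (obj_ret f2 hy) (iso_retract e).2.
  by split; apply: Ext_ret_l => //; [exact: r2|apply: Ext_ret_r r1 eT|exact: r1|apply: Ext_ret_r r2 eT].
by move=> t1 t2 e; apply/seteqP; split; apply: sub => //; exact: iso_sym.
Qed.

(** The summands are rigid and indecomposable, hence sheaves of arcs. Vanishing of Ext^1 between
    them makes the arcs noncrossing, multiplicity-freeness makes them distinct, and the second
    tilting condition is generation, which yields maximality. *)
Lemma tilting_phi_sum T : tilting T -> multiplicity_free T -> exists2 G, triangulation G & isomorphic T (phi_sum phi G).
Proof.
move=> tT [s [si sn eT]]; pose F := nth (gzero k p q) s; pose ix := iota 0 (size s).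
have es : s = map F ix by rewrite -[LHS](mkseq_nth (gzero k p q)).
have [rT gT] : tilting (dsum_seq (map F ix)) by rewrite -es; exact: (tilting_iso p_gt0 q_gt0 eT tT).
have ixP i : i \in ix = (i < size s)%N by rewrite mem_iota.
have rF i : (i < size s)%N -> retract (F i) (dsum_seq (map F ix)).
  by move=> hi; apply: nth_dsum => //; rewrite ixP.
have ext i j : (i < size s)%N -> (j < size s)%N -> Ext1_zero (F i) (F j).
  by move=> hi hj; apply: Ext_ret_l (rF i hi) (Ext_ret_r _ _ (rF j hj) rT).
have /choice[x hx] (i : nat) : exists y, (i < size s)%N -> valid y /\ isomorphic (F i) (obj y).
  have [hi|hi] := ltnP i (size s); last by exists (Br 0 0).
  have [[m1 [m2 e]]|[b [a [c [ac e]]]]] := rigid_co p_gt0 q_gt0 (si i hi) (ext i i hi hi).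
    by exists (Br m1 m2).
  by exists (Pe b a c).
have nc i j : (i < size s)%N -> (j < size s)%N -> ~ cross (x i) (x j).
  move=> hi hj; have [vi ei] := hx i hi; have [vj ej] := hx j hj.
  apply/(obj_ext k p_gt0 q_gt0 vi vj); split.
    exact: (ext_transport (iso_sym ei) (iso_sym ej) (ext i j hi hj)).
  exact: (ext_transport (iso_sym ej) (iso_sym ei) (ext j i hj hi)).
pose G : set K := [set C | exists2 i, (i < size s)%N & C = cls (x i)].
have nG : noncrossing G.
  split=> [C [i hi ->]|C C' [i hi ->] [j hj ->] ne].
    by apply/(is_arcP p_gt0 q_gt0); exists (x i); split=> //; [exact: (hx i hi).1|exact: nc].
  apply: (cls_disjoint R p_gt0 q_gt0); [exact: (hx i hi).1|exact: (hx j hj).1| |exact: nc].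
  by move/(cls_shifted R p_gt0 q_gt0).
have fG := noncrossing_finite p_gt0 q_gt0 nG.
have inj i j : (i < size s)%N -> (j < size s)%N -> cls (x i) = cls (x j) -> i = j.
  move=> hi hj e; have e' : isomorphic (F i) (F j).
    apply: iso_trans (hx i hi).2 _; apply: iso_trans (iso_sym (hx j hj).2).
    by apply: obj_shift; apply: (cls_eq p_gt0 q_gt0 (hx i hi).1 e).
  have [ij|ij|//] := ltngtP i j; first by case: (sn i j); rewrite ?ij.
  by case: (sn j i); rewrite ?ij //; exact: iso_sym.
exists G.
  apply: (maximal_triangulation p_gt0 q_gt0 nG); apply: gen_arcs_of => // X nX.
  apply: contrapT => h; apply: nX; apply: gT.
    apply: Hom_dsum_seq_l => // i; rewrite ixP => hi; have [vi ei] := hx i hi.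
    apply: (Hom_ret p_gt0 q_gt0 (iso_retract ei).1 (retract_refl p_gt0 q_gt0 X)).
    apply: contrapT => h'; apply: h; exists (x i); split; last by case.
    by split=> //; exists i.
  apply: Ext_dsum_seq_l => // i; rewrite ixP => hi; have [vi ei] := hx i hi.
  apply: (Ext_ret_l p_gt0 q_gt0 (iso_retract ei).1).
  apply: contrapT => h'; apply: h; exists (x i); split; last by case.
  by split=> //; exists i.
apply: iso_trans eT _; rewrite es /phi_sum.
set s' := finmap.enum_fset (fset_set G); have us' : uniq s' by exact: finmap.fset_uniq.
apply: (dsum_seq_iso p_gt0 q_gt0 (R := fun i C => (i < size s)%N /\ C = cls (x i))) => //.
- have pe : perm_eq s' (map (fun i => cls (x i)) ix).
    apply: uniq_perm => //; first rewrite map_inj_in_uniq ?iota_uniq //.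
      by move=> i j; rewrite !ixP; exact: inj.
    move=> C; apply/idP/mapP => [/(enum_fsetP _ fG)[i hi ->]|[i]]; first by exists i; rewrite ?ixP.
    by rewrite ixP => hi ->; apply/(enum_fsetP _ fG); exists i.
  by rewrite (perm_size pe) size_map.
- by move=> i; rewrite ixP => hi; exists (cls (x i)) => //; apply/(enum_fsetP _ fG); exists i.
- by move=> i j C [hi ->] [hj]; exact: inj.
- exact: iota_uniq.
- by move=> i C [hi ->]; apply: iso_trans (hx i hi).2 (iso_sym (phiE (hx i hi).1)).
Qed.
End Phi.
End Correspondence.

Theorem theorem4p3 (k : closedFieldType) (R : realType) (p q : nat)
    (hp : (1 <= p)%N) (hpq : (p <= q)%N) :
  (exists phi : set (R -> annulus R) -> grmod k p q, is_phi phi) /\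
  (forall phi : set (R -> annulus R) -> grmod k p q, is_phi phi ->
     [/\ forall G, triangulation p q G ->
           [/\ finite_set G, tilting (phi_sum phi G)
             & multiplicity_free (phi_sum phi G)],
         forall G G', triangulation p q G -> triangulation p q G' ->
           isomorphic (phi_sum phi G) (phi_sum phi G') -> G = G'
       & forall T : grmod k p q, tilting T -> multiplicity_free T ->
           exists2 G, triangulation p q G & isomorphic T (phi_sum phi G)]).
Proof.
have q_gt0 : (1 <= q)%N := leq_trans hp hpq.
split=> [|phi hphi]; first exact: phi_exists.
split=> [G tG|G G'|T].
- by split; [exact: noncrossing_finite tG.1|exact: phi_sum_tilting|exact: phi_sum_mf tG.1].
- exact: phi_sum_inj.
- exact: tilting_phi_sum.
Qed.
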